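(* Assume that $\mu(\tau>t)=\ell(t)t^{-\beta}$ where $\beta\in(0,1)$, and that hypotheses (H) and (S)(ii) (stated in the context) hold. Let $A,B\subset Y$ be measurable with $1_A\in\mathcal{B}$. Then for any $h>0$, $$\liminf_{t\to\infty}m(t)\big(U_{A,B}(t+h)-U_{A,B}(t)\big)=d_{\beta}\,\mu(A)\mu(B)\,h .$$
   Context: $(Y,\mu)$ is a probability space, $F:Y\to Y$ is an ergodic and mixing measure-preserving transformation, and $\tau:Y\to\mathbb{R}^+$ is a measurable nonintegrable function with $\operatorname{ess\,inf}\tau>1$. The function $\ell:[0,\infty)\to[0,\infty)$ is measurable and slowly varying, i.e. $\lim_{t\to\infty}\ell(\lambda t)/\ell(t)=1$ for all $\lambda>0$. Write $\tau_n=\sum_{j=0}^{n-1}\tau\circ F^j$. For measurable $A,B\subset Y$ define the renewal measure $U_{A,B}(I)=\sum_{n=0}^\infty\mu(y\in A\cap F^{-n}B:\tau_n(y)\in I)$ for intervals $I\subset\mathbb{R}$, and $U_{A,B}(x)=U_{A,B}([0,x])$ for $x>0$. Constants: $d_\beta=\frac1\pi\sin\beta\pi$ and $m(t)=\ell(t)t^{1-\beta}$ (for $\beta\in(0,1)$). Operators: $\overline{\mathbb{H}}=\{s\in\mathbb{C}:\operatorname{Re}s\ge0\}$; for $\delta,L>0$, $\mathbb{H}_{\delta,L}=(\overline{\mathbb{H}}\cap B_\delta(0))\cup\{ib:|b|\le L\}$. $R:L^1(Y)\to L^1(Y)$ is the transfer operator of $F$: $\int_Y Rv\,w\,d\mu=\int_Y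 v\,w\circ F\,d\mu$ for $v\in L^1(Y)$, $w\in L^\infty(Y)$. For $s\in\overline{\mathbb{H}}$, $\hat R(s):L^1(Y)\to L^1(Y)$, $\hat R(s)v=R(e^{-s\tau}v)$. $|\cdot|_p$ is the $L^p(Y,\mu)$ norm. Hypothesis (H): there exists $p_0\ge1$, and for each $p\in(p_0,\infty)$, $\gamma\in(0,\beta)$ and $L>0$ there exists a Banach space $\mathcal{B}=\mathcal{B}(Y)$ containing constant functions, with norm $\|\cdot\|_{\mathcal{B}}$, and constants $\delta\in(0,L)$, $\alpha_0\in(0,1)$, $C>0$ such that (i) $\mathcal{B}$ is compactly embedded in $L^p$; (ii) $\|\hat R(s)^nv\|_{\mathcal{B}}\le C(|v|_p+\alpha_0^n\|v\|_{\mathcal{B}})$ for all $s\in\mathbb{H}_{\delta,L}$, $v\in\mathcal{B}$, $n\ge1$; (iii) $|R(\tau^\gamma v)|_p\le C\|v\|_{\mathcal{B}}$ for all $v\in\mathcal{B}$. Hypothesis (S)(ii): for all $b\in[-L,L]$, $b\ne0$, the spectral radius of $\hat R(ib):\mathcal{B}\to\mathcal{B}$ is less than $1$. Here (S)(ii) and the condition $1_A\in\mathcal{B}$ are understood for each of the spaces $\mathcal{B}=\mathcal{B}_{p,\gamma,L}$ in (H). *)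

(* Defs.v *)
From HB Require Import structures.
From mathcomp Require Import all_boot all_order all_algebra.
From mathcomp Require Import all_classical all_reals all_analysis.
From mathcomp Require Import complex.

Set Implicit Arguments.
Unset Strict Implicit.
Unset Printing Implicit Defensive.
Import Order.TTheory GRing.Theory Num.Theory.
Import numFieldNormedType.Exports.
Import Normc.

Local Open Scope classical_set_scope.
Local Open Scope ring_scope.
Local Open Scope complex_scope.

Section regular_variation.
Context {R : realType}.
Implicit Types (ell : R -> R) (beta t : R).

(* [ell] stands for a function [0, oo) -> [0, oo): its values at negative
   arguments are irrelevant. *)
Definition slowly_varying ell :=
  [/\ measurable_fun (`[0, +oo[%classic : set R) ell,
      forall t, 0 <= t -> 0 <= ell t &
      forall lambda, 0 < lambda ->
        (ell (lambda * t) / ell t) @[t --> +oo] --> (1 : R)].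

Definition d_const beta : R := sin (beta * pi) / pi.

Definition m_fun ell beta t : R := ell t * t `^ (1 - beta).

End regular_variation.

Section dynamics.
Context d (Y : measurableType d) (R : realType) (mu : probability Y R).
Implicit Types (F : Y -> Y) (tau : Y -> R) (A B : set Y).
Local Open Scope ereal_scope.

Definition measure_preserving F :=
  measurable_fun setT F /\
  forall A, measurable A -> mu (F @^-1` A) = mu A.

Definition ergodic F :=
  forall A, measurable A -> F @^-1` A = A -> mu A = 0 \/ mu A = 1.

Definition mixing F :=
  forall A B, measurable A -> measurable B ->
    mu (A `&` iter n F @^-1` B) @[n --> \oo] --> mu A * mu B.

Definition birkhoff_sum F tau (n : nat) (y : Y) : R :=
  (\sum_(j < n) tau (iter j F y))%R.

Definition renewal_measure F tau A B (I : interval R) : \bar R :=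
  \sum_(0 <= n <oo)
    mu (A `&` iter n F @^-1` B `&` [set y | birkhoff_sum F tau n y \in I]).

Definition renewal_function F tau A B (x : R) : \bar R :=
  renewal_measure F tau A B `[0%R, x].

End dynamics.

(* Complex-valued functions on Y; an element of L^p is represented by any of
   its versions. *)
Section complex_Lp.
Context d (Y : measurableType d) (R : realType) (mu : probability Y R).
Implicit Types (v w : Y -> R[i]) (p : \bar R).

Definition cmeasurable v :=
  measurable_fun setT (fun y => complex.Re (v y)) /\
  measurable_fun setT (fun y => complex.Im (v y)).

Definition cLnorm p v : \bar R := Lnorm mu p (fun y => (normc (v y))%:E).

Definition in_Lp p v := cmeasurable v /\ (cLnorm p v < +oo)%E.

Definition cintegral v : R[i] :=
  (\int[mu]_y complex.Re (v y)) +i* (\int[mu]_y complex.Im (v y)).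

Definition cexp (z : R[i]) : R[i] :=
  (expR (complex.Re z) * cos (complex.Im z)) +i*
  (expR (complex.Re z) * sin (complex.Im z)).

(* This determines P on L^1 up to a.e. equality; nothing is said about the
   values of P outside L^1. *)
Definition transfer_operator (F : Y -> Y) (P : (Y -> R[i]) -> (Y -> R[i])) :=
  forall v, in_Lp 1%E v ->
    in_Lp 1%E (P v) /\
    forall w, in_Lp +oo%E w ->
      cintegral (fun y => P v y * w y) = cintegral (fun y => v y * w (F y)).

Definition Rhat (P : (Y -> R[i]) -> (Y -> R[i])) (tau : Y -> R) (s : R[i]) v :
    Y -> R[i] :=
  P (fun y => cexp (- (s * (tau y)%:C)) * v y).

End complex_Lp.

Definition halfdisc_segment (R : realType) (delta L : R) : set R[i] :=
  [set s | 0 <= complex.Re s /\ normc s < delta] `|`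
  [set s | complex.Re s = 0 /\ `|complex.Im s| <= L].

Section spectral_radius.
Context (R : realType) (V : normedModType R[i]).

(* The library norm of V takes its values in R[i]. *)
Definition rnorm (v : V) : R := complex.Re `|v|.

Definition spectrum (T : V -> V) : set R[i] :=
  [set lambda | ~ exists S : V -> V,
    [/\ continuous S,
        cancel (fun v => lambda *: v - T v) S &
        cancel S (fun v => lambda *: v - T v)]].

Definition spectral_radius (T : V -> V) : \bar R :=
  ereal_sup [set (normc lambda)%:E | lambda in spectrum T].

End spectral_radius.

(* A complex Banach space of (classes modulo a.e. equality of) functions on Y:
   [bfun v] is a version of the function represented by v. *)
Record banach_fun_space d (Y : measurableType d) (R : realType)
    (mu : probability Y R) := BanachFunSpace {
  bsort :> completeNormedModType R[i] ;
  bfun : bsort -> Y -> R[i] ;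
  bfun_linear : forall (a : R[i]) (u v : bsort),
    bfun (a *: u + v) = (fun y => a * bfun u y + bfun v y) %[ae mu] ;
  bfun_inj : forall v : bsort, bfun v = (fun=> 0) %[ae mu] -> v = 0 }.

Section hypotheses.
Context d (Y : measurableType d) (R : realType) (mu : probability Y R).
Implicit Types (BB : banach_fun_space mu) (f : Y -> R[i]).

Definition in_space BB f := exists v : BB, bfun v = f %[ae mu].

Definition compactly_embedded BB (p : \bar R) :=
  (forall v : BB, in_Lp mu p (bfun v)) /\
  forall u : nat -> BB, (exists M : R, forall k, rnorm (u k) <= M) ->
    exists phi : nat -> nat, {homo phi : i j / (i < j)%N} /\
    exists f, in_Lp mu p f /\
      cLnorm mu p (fun y => bfun (u (phi k)) y - f y) @[k --> \oo] --> 0%E.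

(* T is the operator on BB given by P; it is unique by [bfun_inj]. *)
Definition induces BB (P : (Y -> R[i]) -> (Y -> R[i])) (T : BB -> BB) :=
  forall v : BB, bfun (T v) = P (bfun v) %[ae mu].

Definition hypothesis_H (P : (Y -> R[i]) -> (Y -> R[i])) (tau : Y -> R)
    (p gamma L : R) BB :=
  (forall c : R[i], in_space BB (fun=> c)) /\
  exists delta alpha0 C : R,
  [/\ 0 < delta < L, 0 < alpha0 < 1 & 0 < C] /\
  [/\ compactly_embedded BB p%:E,
      forall s, halfdisc_segment delta L s ->
        exists T : BB -> BB, induces (Rhat P tau s) T /\
        forall (v : BB) (n : nat), (1 <= n)%N ->
          rnorm (iter n T v) <=
            C * (fine (cLnorm mu p%:E (bfun v)) + alpha0 ^+ n * rnorm v) &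
      forall v : BB,
        let tau_v := fun y => (tau y `^ gamma)%:C * bfun v y in
        in_Lp mu 1%E tau_v /\
        in_Lp mu p%:E (P tau_v) /\
        (cLnorm mu p%:E (P tau_v) <= (C * rnorm v)%:E)%E].

Definition hypothesis_Sii (P : (Y -> R[i]) -> (Y -> R[i])) (tau : Y -> R)
    (L : R) BB :=
  forall b : R, - L <= b <= L -> b != 0 ->
    exists T : BB -> BB, induces (Rhat P tau (0 +i* b)) T /\
      (spectral_radius T < 1)%E.

End hypotheses.

(* Main.v *)
(** Transfer operators write the Fourier-Laplace transform of [tau_n] on
[A `&` F^-n B] as [R(s)^n 1_A]. By (H) and (S)(ii) it decays off [0], and near [0]
its leading eigenvalue is [1 - \int (1 - e^(- s tau))] up to lower order. Damped renewal
sums are thus bounded and equicontinuous at scale [t], with explicit Laplace limits,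
so they converge. Removing the damping and using
[\int y^(beta - 1) / (1 + y) = pi / sin (pi beta)] gives both bounds. *)
Require Import Defs.
From HB Require Import structures.
From mathcomp Require Import all_boot all_order all_algebra.
From mathcomp Require Import all_classical all_reals all_analysis.
From mathcomp Require Import measurable_realfun ess_sup_inf complex.
From mathcomp Require Import ring lra.
Set Implicit Arguments.
Unset Strict Implicit.
Unset Printing Implicit Defensive.
Import Order.TTheory GRing.Theory Num.Theory.
Import numFieldNormedType.Exports.
Local Open Scope classical_set_scope.
Local Open Scope ring_scope.
Import Normc.

(** Write [H t] for the tail of [tau], so that about [1 / H t] steps lead to level [t]. When
    [beta <= 1/2] the scaled increments of the renewal function need not converge: terms with [n]
    far below [1 / H t] can be large for exceptional [t]. The two bounds on the liminf therefore use
    different weights. From below, the terms carry [(1 - e^(- z n H t))^k e^(- e n H t)], which is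
    at most 1 and suppresses both extremes of [n]. With [k] large in terms of [1 / beta] the
    weighted Fourier transform at small [b >= 1 / t] is [O(t (t b)^-4)], with a first moment of
    order [1 / t]; the limits [z -> oo], [e -> 0] are taken in the Laplace transform only. From
    above the weight is 1, and Fatou's lemma tolerates exceptional [t]. A second obstacle is that
    (H) gives no norm continuity of [R(s)] on [B]: the weights are continuous in L^1 only.
    Perturbation theory is replaced by compactness along sequences of parameters, and the
    second-order error of the eigenvalue is controlled by (H)(iii), which limits how often two large
    values of [tau] occur together. *)

Local Notation mfunT := (measurable_fun setT) (only parsing).

(** * Arithmetic of real and complex norms *)

Section real_lemmas.
Context {R : realType}.
Implicit Types x y : R.

Lemma expRN_le1 x : (expR (- x) <= 1) = (0 <= x).
Proof. by rewrite -[leRHS]expR0 ler_expR oppr_le0. Qed.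

Lemma eq_ler disp (T : porderType disp) (u v : T) : u = v -> (u <= v)%O.
Proof. by move=> ->. Qed.

Lemma measurable_EFinS d (T : measurableType d) (D : set T) (f : T -> R) :
 mfunT f -> measurable_fun D (fun z => (f z)%:E).
Proof. by move=> mf; apply/measurable_EFinP; exact: measurable_funTS. Qed.

End real_lemmas.

Section rnorm_theory.
Context (R : realType) (V : normedModType R[i]).
Implicit Types u v : V.

Lemma rnormE v : `|v| = (rnorm v)%:C%C.
Proof. by rewrite /rnorm RRe_real// normr_real. Qed.

Lemma rnorm_ge0 v : 0 <= rnorm v.
Proof. by rewrite -ler0c -rnormE. Qed.

Lemma rnormD u v : rnorm (u + v) <= rnorm u + rnorm v.
Proof. by rewrite -lecR rmorphD/= -!rnormE ler_normD. Qed.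

Lemma normcEC (a : R[i]) : `|a| = (normc a)%:C%C.
Proof. by case: a. Qed.

Lemma rnormZ a v : rnorm (a *: v) = normc a * rnorm v.
Proof. by apply: complexI; rewrite rmorphM/= -!rnormE -normcEC normrZ. Qed.

Lemma rnormN v : rnorm (- v) = rnorm v.
Proof. by apply: complexI; rewrite -!rnormE normrN. Qed.

Lemma rnormB u v : rnorm (u - v) <= rnorm u + rnorm v.
Proof. by rewrite (le_trans (rnormD _ _))// rnormN. Qed.

Lemma rnorm_eq0 v : rnorm v = 0 -> v = 0.
Proof. by move=> v0; apply/normr0_eq0; rewrite rnormE v0. Qed.

Lemma rnorm0 : rnorm (0 : V) = 0.
Proof. by apply: complexI; rewrite -rnormE normr0. Qed.

End rnorm_theory.

Section normc_theory.
Context {R : rcfType}.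
Implicit Types z w : R[i].

Lemma normc_ge0 z : 0 <= normc z.
Proof. by case: z => a b /=; rewrite sqrtr_ge0. Qed.

Lemma normcB z w : normc (z - w) <= normc z + normc w.
Proof. by rewrite (le_trans (le_normcD _ _))// normcN. Qed.

Lemma normc_dist z w : normc z <= normc w + normc (z - w).
Proof. by rewrite -{1}(subrK w z) addrC le_normcD. Qed.

Lemma normc_distC z w : normc (z - w) = normc (w - z).
Proof. by rewrite -normcN opprB. Qed.

Lemma normc_real (a : R) : normc (a%:C)%C = `|a|.
Proof. by rewrite /= expr0n/= addr0 sqrtr_sqr. Qed.

Lemma normcX z n : normc (z ^+ n) = normc z ^+ n.
Proof.
elim: n => [|n IH]; first by rewrite !expr0 normc1.
by rewrite !exprS normcM IH.
Qed.

Lemma le_Re_normc z : `|complex.Re z| <= normc z.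
Proof.
case: z => a b /=; rewrite -sqrtr_sqr ler_sqrt ?addr_ge0 ?sqr_ge0//.
by rewrite lerDl sqr_ge0.
Qed.

Lemma le_Im_normc z : `|complex.Im z| <= normc z.
Proof.
case: z => a b /=; rewrite -sqrtr_sqr ler_sqrt ?addr_ge0 ?sqr_ge0//.
by rewrite lerDr sqr_ge0.
Qed.

Lemma le_normc_ReIm z : normc z <= `|complex.Re z| + `|complex.Im z|.
Proof.
rewrite -(@ler_pXn2r _ 2)// ?nnegrE ?normc_ge0//.
case: z => a b /=; rewrite sqr_sqrtr ?addr_ge0 ?sqr_ge0// sqrrD !real_normK ?num_real//.
by rewrite addrAC lerDl mulrn_wge0// mulr_ge0.
Qed.

Lemma ReD z w : complex.Re (z + w) = complex.Re z + complex.Re w.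
Proof. by case: z; case: w. Qed.

Lemma ImD z w : complex.Im (z + w) = complex.Im z + complex.Im w.
Proof. by case: z; case: w. Qed.

Lemma ReN z : complex.Re (- z) = - complex.Re z.
Proof. by case: z. Qed.

Lemma ImN z : complex.Im (- z) = - complex.Im z.
Proof. by case: z. Qed.

Lemma ReM z w : complex.Re (z * w) =
 complex.Re z * complex.Re w - complex.Im z * complex.Im w.
Proof. by case: z; case: w. Qed.

Lemma ImM z w : complex.Im (z * w) =
 complex.Re z * complex.Im w + complex.Im z * complex.Re w.
Proof. by case: z; case: w => a b c d /=. Qed.

End normc_theory.

Section cexp_theory.
Context {R : realType}.
Implicit Types z w : R[i].

Lemma normc_cexp z : normc (cexp z) = expR (complex.Re z).
Proof.
rewrite /= !exprMn -mulrDr cos2Dsin2 mulr1 sqrtr_sqr ger0_norm//.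
Qed.

Lemma cexp0 : cexp (0 : R[i]) = 1.
Proof. by rewrite /cexp /= expR0 cos0 sin0 mulr1 mulr0. Qed.

Lemma cexpD z w : cexp (z + w) = cexp z * cexp w.
Proof.
apply/eqP; rewrite eq_complex /cexp; apply/andP; split; apply/eqP.
 by rewrite ReM /= ReD ImD expRD cosD; ring.
by rewrite ImM /= ReD ImD expRD sinD; ring.
Qed.

End cexp_theory.

(** * Integration of complex-valued functions *)

Section complex_integral.
Context d (Y : measurableType d) (R : realType) (mu : probability Y R).
Implicit Types (f g : Y -> R) (v w : Y -> R[i]).

Definition rintegrable f := mu.-integrable setT (EFin \o f).

Lemma rintegrable_le f g : mfunT f -> rintegrable g ->
 (forall y, `|f y| <= `|g y|) -> rintegrable f.
Proof.
move=> mf ig fg; apply: (le_integrable measurableT _ _ ig).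
 exact/measurable_EFinP.
by move=> y _ /=; rewrite lee_fin.
Qed.

Lemma rintegrable_cst (c : R) : rintegrable (fun=> c).
Proof. exact: finite_measure_integrable_cst. Qed.

Lemma rintegrable_bounded f (M : R) : mfunT f ->
 (forall y, `|f y| <= M) -> rintegrable f.
Proof.
move=> mf fM; apply: (rintegrable_le mf (rintegrable_cst M)) => y.
by rewrite (le_trans (fM y))// ler_norm.
Qed.

Lemma rintegrable_measurable f : rintegrable f -> mfunT f.
Proof. by move=> /integrableP[/measurable_EFinP]. Qed.

Lemma rintegrableD f g : rintegrable f -> rintegrable g ->
 rintegrable (fun y => f y + g y).
Proof. by move=> fi gi; exact: (integrableD measurableT fi gi). Qed.

Lemma rintegrableZ a f : rintegrable f -> rintegrable (fun y => a * f y).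
Proof.
move=> fi; have := @integrableZl _ _ _ mu setT measurableT a _ fi.
by apply: eq_integrable => // y _ /=; rewrite EFinM.
Qed.

Lemma rintegrableN f : rintegrable f -> rintegrable (fun y => - f y).
Proof.
move=> /(rintegrableZ (-1)); rewrite /rintegrable.
by under eq_fun do rewrite mulN1r.
Qed.

Lemma rintegrableB f g : rintegrable f -> rintegrable g ->
 rintegrable (fun y => f y - g y).
Proof. by move=> fi /rintegrableN; exact: rintegrableD. Qed.

Lemma rintegrable_norm f : rintegrable f -> rintegrable (fun y => `|f y|).
Proof.
move=> fi; apply: (rintegrable_le _ fi) => [|y]; last by rewrite normr_id.
exact: (measurableT_comp _ (rintegrable_measurable fi)).
Qed.

Lemma Rintegral_le f g : rintegrable f -> rintegrable g ->
 (forall y, f y <= g y) -> \int[mu]_y f y <= \int[mu]_y g y.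
Proof. by move=> fi gi fg; apply: le_Rintegral => //. Qed.

Lemma Rintegral_cst1 (c : R) : \int[mu]_y c = c.
Proof. by rewrite Rintegral_cst//= probability_setT mulr1. Qed.

Definition cintegrable v := rintegrable (fun y => complex.Re (v y)) /\
 rintegrable (fun y => complex.Im (v y)).

Lemma measurable_normc v : cmeasurable v -> mfunT (fun y => normc (v y)).
Proof.
move=> [mR mI].
rewrite (_ : (fun _ => _) = (fun y => Num.sqrt
  (complex.Re (v y) ^+ 2 + complex.Im (v y) ^+ 2))); last first.
 by apply/funext => y; case: (v y).
apply: (measurableT_comp (f := @Num.sqrt R)).
 exact: (continuous_measurable_fun (@sqrt_continuous R)).
by apply: measurable_funD; apply: measurable_funX.
Qed.

Lemma cintegrableP v :
 cintegrable v <-> cmeasurable v /\ rintegrable (fun y => normc (v y)).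
Proof.
split=> [[iR iI]|[[mR mI] iv]].
 have mv : cmeasurable v by split; exact: rintegrable_measurable.
 split=> //; have iRI := rintegrableD (rintegrable_norm iR) (rintegrable_norm iI).
 apply: (rintegrable_le _ iRI) => [|y]; first exact: measurable_normc.
 rewrite ger0_norm ?normc_ge0// ger0_norm//.
 exact: le_normc_ReIm.
by split; apply: (rintegrable_le _ iv) => // y;
 rewrite [leRHS]ger0_norm ?normc_ge0// ?le_Re_normc ?le_Im_normc.
Qed.

Lemma cintegrable_cmeasurable v : cintegrable v -> cmeasurable v.
Proof. by move/cintegrableP => []. Qed.

Lemma cintegrable_normc v : cintegrable v -> rintegrable (fun y => normc (v y)).
Proof. by move/cintegrableP => []. Qed.

Lemma cmeasurableM v w : cmeasurable v -> cmeasurable w ->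
 cmeasurable (fun y => v y * w y).
Proof.
move=> [v1 v2] [w1 w2]; split.
 under eq_fun do rewrite ReM.
 by apply: measurable_funB; apply: measurable_funM.
under eq_fun do rewrite ImM.
by apply: measurable_funD; apply: measurable_funM.
Qed.

Lemma cmeasurableD v w : cmeasurable v -> cmeasurable w ->
 cmeasurable (fun y => v y + w y).
Proof.
move=> [v1 v2] [w1 w2]; split.
 by under eq_fun do rewrite ReD; apply: measurable_funD.
by under eq_fun do rewrite ImD; apply: measurable_funD.
Qed.

Lemma cmeasurableN v : cmeasurable v -> cmeasurable (fun y => - v y).
Proof.
move=> [v1 v2]; split.
 by under eq_fun do rewrite ReN; apply: measurableT_comp.
by under eq_fun do rewrite ImN; apply: measurableT_comp.
Qed.

Lemma cmeasurableB v w : cmeasurable v -> cmeasurable w ->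
 cmeasurable (fun y => v y - w y).
Proof. by move=> mv mw; apply: cmeasurableD => //; exact: cmeasurableN. Qed.

Lemma cmeasurable_cst (c : R[i]) : cmeasurable (fun _ : Y => c).
Proof. by split; exact: measurable_cst. Qed.

Lemma cmeasurable_real f : mfunT f ->
 cmeasurable (fun y => (f y)%:C%C).
Proof. by move=> mf; split => //=; exact: measurable_cst. Qed.

Lemma cmeasurable_comp (F : Y -> Y) v : mfunT F ->
 cmeasurable v -> cmeasurable (fun y => v (F y)).
Proof.
by move=> mF [v1 v2]; split; [exact: (measurableT_comp v1)|exact: (measurableT_comp v2)].
Qed.

Lemma cmeasurable_cexp v : cmeasurable v -> cmeasurable (fun y => cexp (v y)).
Proof.
move=> [v1 v2]; split => /=; apply: measurable_funM.
- exact: (measurableT_comp (@measurable_expR R)).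
- apply: (measurableT_comp (f := @cos R)) => //.
 exact: (continuous_measurable_fun (@continuous_cos R)).
- exact: (measurableT_comp (@measurable_expR R)).
- apply: (measurableT_comp (f := @sin R)) => //.
 exact: (continuous_measurable_fun (@continuous_sin R)).
Qed.

Lemma cintegrableM_bounded v w (M : R) : cintegrable v -> cmeasurable w ->
 (forall y, normc (w y) <= M) -> cintegrable (fun y => v y * w y).
Proof.
move=> /cintegrableP[mv iv] mw wM; apply/cintegrableP; split.
 exact: cmeasurableM.
have iMv := rintegrableZ M iv.
apply: (rintegrable_le _ iMv).
 exact/measurable_normc/cmeasurableM.
move=> y; rewrite normcM ger0_norm ?mulr_ge0 ?normc_ge0//.
rewrite mulrC (le_trans _ (ler_norm _))// ler_wpM2r// ?normc_ge0//.
Qed.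

Lemma cintegrable_cst (c : R[i]) : cintegrable (fun _ : Y => c).
Proof. by split; exact: rintegrable_cst. Qed.

Lemma cintegrableZ a v : cintegrable v -> cintegrable (fun y => a * v y).
Proof.
move=> iv; under eq_fun do rewrite mulrC.
by apply: (cintegrableM_bounded iv (cmeasurable_cst a) (M := normc a)).
Qed.

Lemma cintegrableN v : cintegrable v -> cintegrable (fun y => - v y).
Proof. by move=> /(cintegrableZ (-1)); under eq_fun do rewrite mulN1r. Qed.

Lemma cintegrable_bounded v (M : R) : cmeasurable v ->
 (forall y, normc (v y) <= M) -> cintegrable v.
Proof.
move=> mv vM; have := cintegrableM_bounded (cintegrable_cst 1) mv vM.
by under eq_fun do rewrite mul1r.
Qed.

Lemma cintegralD v w : cintegrable v -> cintegrable w ->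
 cintegral mu (fun y => v y + w y) = cintegral mu v + cintegral mu w.
Proof.
move=> [v1 v2] [w1 w2]; rewrite /cintegral; congr Complex.
 by under eq_Rintegral do rewrite ReD; rewrite RintegralD.
by under eq_Rintegral do rewrite ImD; rewrite RintegralD.
Qed.

Lemma cintegralZ a v : cintegrable v ->
 cintegral mu (fun y => a * v y) = a * cintegral mu v.
Proof.
move=> [v1 v2]; apply/eqP; rewrite eq_complex; apply/andP; split; apply/eqP.
 rewrite ReM /=; under eq_Rintegral do rewrite ReM.
 rewrite RintegralB//; [|exact: rintegrableZ..].
 by rewrite !RintegralZl.
rewrite ImM /=; under eq_Rintegral do rewrite ImM.
rewrite RintegralD//; [|exact: rintegrableZ..].
by rewrite !RintegralZl.
Qed.

Lemma cintegralN v : cintegrable v ->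
 cintegral mu (fun y => - v y) = - cintegral mu v.
Proof.
move=> iv; under [X in cintegral _ X]eq_fun do rewrite -mulN1r.
by rewrite cintegralZ// mulN1r.
Qed.

Lemma cintegralB v w : cintegrable v -> cintegrable w ->
 cintegral mu (fun y => v y - w y) = cintegral mu v - cintegral mu w.
Proof.
by move=> iv iw; rewrite cintegralD//; [rewrite cintegralN|exact: cintegrableN].
Qed.

Lemma cintegral_cst (c : R[i]) : cintegral mu (fun=> c) = c.
Proof. by rewrite /cintegral !Rintegral_cst1; case: c. Qed.

(** Real and imaginary parts are bounded separately, which costs the factor 2 and avoids rotating
    the integral; only orders of magnitude matter later. *)
Lemma normc_cintegral v : cintegrable v ->
 normc (cintegral mu v) <= 2 * \int[mu]_y normc (v y).
Proof.
move=> iv; have [iR iI] := iv; have iN := cintegrable_normc iv.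
rewrite (le_trans (le_normc_ReIm _))//= mulr2n mulrDl mul1r.
by apply: lerD; (apply: (le_trans (le_normr_Rintegral _ _)) => //);
 apply: Rintegral_le => // [|y]; rewrite ?le_Re_normc ?le_Im_normc//;
 exact: rintegrable_norm.
Qed.

Lemma cintegral_ae v w : cmeasurable v -> cmeasurable w ->
 v = w %[ae mu] -> cintegral mu v = cintegral mu w.
Proof.
move=> [v1 v2] [w1 w2] vw; rewrite /cintegral /Rintegral; congr (fine _ +i* fine _)%C;
 apply: ae_eq_integral => //; try exact/measurable_EFinP;
 by apply: filterS vw => y /= vwy yT; rewrite vwy.
Qed.

Lemma cintegrable_ae v w : cmeasurable w -> v = w %[ae mu] -> cintegrable v ->
 cintegrable w.
Proof.
move=> mw vw /cintegrableP[mv iv]; apply/cintegrableP; split=> //.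
have mnw := measurable_normc mw.
apply/integrableP; split; first exact/measurable_EFinP.
have /integrableP[_] := iv; apply: le_lt_trans; rewrite le_eqVlt; apply/orP; left.
apply/eqP; apply: ae_eq_integral => //.
- by apply/measurableT_comp => //; exact/measurable_EFinP.
- by apply/measurableT_comp => //; exact/measurable_EFinP/measurable_normc.
- by apply: filterS vw => y /= vwy yT; rewrite vwy.
Qed.

Lemma cintegral_eq0_ae v : cintegrable v ->
 (forall E, measurable E -> cintegral mu (fun y => v y * (\1_E y : R)%:C%C) = 0) ->
 v = (fun=> 0) %[ae mu].
Proof.
move=> [v1 v2] v0.
have key f : rintegrable f -> (forall E, measurable E ->
  \int[mu]_y (f y * \1_E y) = 0) -> f = (fun=> 0) %[ae mu].
 move=> fi f0.
 have : ae_eq mu setT (EFin \o f) (cst 0%E).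
  apply: integral_ae_eq => // E _ mE; rewrite integral0.
  have := f0 E mE; rewrite /Rintegral.
  have -> : (\int[mu]_y (f y * \1_E y)%:E = \int[mu]_(y in E) (EFin \o f) y)%E.
   rewrite [RHS]integral_mkcond; apply: eq_integral => y _.
   by rewrite patchE indicE; case: (y \in E); rewrite ?mulr1 ?mulr0.
  move=> /eqP; rewrite fine_eq0 => [/eqP//|].
  exact/(integrable_fin_num mE)/(integrableS measurableT _ _ fi).
 by apply: filterS => y /= /(_ I)[].
have hR : (fun y => complex.Re (v y)) = (fun=> 0) %[ae mu].
 apply: key => // E mE; have [+ _] := v0 E mE; apply: etrans.
 by apply: eq_Rintegral => y _; rewrite ReM/= mulr0 subr0.
have hI : (fun y => complex.Im (v y)) = (fun=> 0) %[ae mu].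
 apply: key => // E mE; have [_ +] := v0 E mE; apply: etrans.
 by apply: eq_Rintegral => y _; rewrite ImM/= mulr0 add0r.
apply: filterS2 hR hI => y /= + + _ => /(_ I) h1 /(_ I) h2.
by case: (v y) h1 h2 => a b /= -> ->.
Qed.

End complex_integral.

(** * Hölder estimates in L^p *)

Section Lp.
Context d (Y : measurableType d) (R : realType) (mu : probability Y R).
Implicit Types (f g : Y -> R) (v w : Y -> R[i]).

Lemma in_L1P v : in_Lp mu 1%E v <-> cintegrable mu v.
Proof.
rewrite /in_Lp /cLnorm Lnorm1; split=> [[mv fv]|/cintegrableP[mv iv]].
 apply/cintegrableP; split => //; apply/integrableP; split => //.
 exact/measurable_EFinP/measurable_normc.
by split => //; have /integrableP[] := iv.
Qed.

Lemma in_Loo_bounded w (M : R) : cmeasurable w -> (forall y, normc (w y) <= M) ->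
 in_Lp mu +oo%E w.
Proof.
move=> mw wM; split=> //; rewrite /cLnorm unlock.
case: ifPn => // _; rewrite (@le_lt_trans _ _ M%:E) ?ltry//.
apply: (@ess_sup_ler _ _ _ mu (fun y => `|normc (w y)|)) => y.
by rewrite lee_fin ger0_norm ?normc_ge0.
Qed.

Lemma cLnorm_ae p v w : cmeasurable v -> cmeasurable w -> v = w %[ae mu] ->
 cLnorm mu p%:E v = cLnorm mu p%:E w.
Proof.
move=> mv mw vw; rewrite /cLnorm unlock; apply: (congr1 (fun x => x `^ _)%E).
apply: ae_eq_integral => //.
- apply: (@measurableT_comp _ _ _ _ _ _ (fun x : \bar R => x `^ p)%E).
  exact: measurable_poweR.
 by apply/measurableT_comp => //; exact/measurable_EFinP/measurable_normc.
- apply: (@measurableT_comp _ _ _ _ _ _ (fun x : \bar R => x `^ p)%E).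
  exact: measurable_poweR.
 by apply/measurableT_comp => //; exact/measurable_EFinP/measurable_normc.
- by apply: filterS vw => y /= vwy yT; rewrite vwy.
Qed.

(** Hölder with exponents [p] and [1 / (1 - p^-1)]: since [0 <= f <= 1], the conjugate power of [f]
    is at most [f], so the dual norm is at most a power of [\int f]. This is the source of the
    exponent [1 - p^-1] in all later estimates; it tends to 1 as [p] grows. *)
Lemma hoelder_unit (p : R) v f : 1 < p -> in_Lp mu p%:E v ->
 mfunT f -> (forall y, 0 <= f y <= 1) ->
 rintegrable mu (fun y => normc (v y) * f y) /\
 \int[mu]_y (normc (v y) * f y) <=
  fine (cLnorm mu p%:E v) * (\int[mu]_y f y) `^ (1 - p^-1).
Proof.
move=> p1 [mv fv] mf f01.
have p0 : 0 < p by rewrite (lt_trans _ p1).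
have q0 : 0 < 1 - p^-1 by rewrite subr_gt0 invf_lt1.
have mnv := measurable_normc mv.
have ifi : rintegrable mu f.
 apply: (rintegrable_bounded mu mf (M := 1)) => y.
 by have /andP[f0 f1] := f01 y; rewrite ger0_norm.
have := @hoelder _ _ _ mu _ f p (1 - p^-1)^-1 mnv mf p0.
rewrite invr_gt0 q0 invrK addrCA subrr addr0 => /(_ isT erefl).
set N := (X in (_ <= _ * X)%E).
have NE : (N <= ((\int[mu]_y f y) `^ (1 - p^-1))%:E)%E.
 rewrite /N unlock invrK.
 have If : (\int[mu]_y (f y)%:E = (\int[mu]_y f y)%:E)%E.
  by rewrite fineK//; apply: (integrable_fin_num measurableT ifi).
 rewrite -poweR_EFin -If; apply: gt0_ler_poweR.
 - exact: ltW.
 - by rewrite in_itv/= leey andbT; apply: integral_ge0 => y _; rewrite lee_fin powR_ge0.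
 - rewrite in_itv/= leey andbT; apply: integral_ge0 => y _.
  by rewrite lee_fin; case/andP: (f01 y).
 apply: ge0_le_integral => //.
 - by move=> y _; exact: poweR_ge0.
 - apply: (@measurableT_comp _ _ _ _ _ _ (fun x : \bar R => x `^ _)%E).
   exact: measurable_poweR.
  by apply/measurableT_comp => //; exact/measurable_EFinP.
 - exact/measurable_EFinP.
 - move=> y _ /=; have /andP[f0 f1] := f01 y.
  rewrite ger0_norm// lee_fin -[leRHS]powRr1//.
  move: f0; rewrite le_eqVlt => /predU1P[<-|f0].
   by rewrite powRr1// powR0// invr_eq0 gt_eqF.
  apply: ger_powR; first by rewrite f0.
  by rewrite invf_ge1// lerBlDr lerDl invr_ge0 ltW.
rewrite Lnorm1 => H.
have fNp : cLnorm mu p%:E v \is a fin_num.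
 by rewrite ge0_fin_numE ?Lnorm_ge0.
have {}H : (\int[mu]_x `|(normc (v x) * f x)%:E| <=
  (fine (cLnorm mu p%:E v) * (\int[mu]_y f y) `^ (1 - p^-1))%:E)%E.
 rewrite EFinM fineK//; apply: (le_trans H).
 by apply: lee_wpmul2l => //; exact: Lnorm_ge0.
have irt : rintegrable mu (fun y => normc (v y) * f y).
 apply/integrableP; split; first exact/measurable_EFinP/measurable_funM.
 by apply: (le_lt_trans H); exact: ltry.
split => //; rewrite -lee_fin fineK; last exact: (integrable_fin_num measurableT irt).
apply: le_trans H; apply: ge0_le_integral => //.
- move=> y _; rewrite lee_fin mulr_ge0 ?normc_ge0//.
 by case/andP: (f01 y).
- exact/measurable_EFinP/measurable_funM.
- apply/measurableT_comp => //; exact/measurable_EFinP/measurable_funM.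
- by move=> y _; rewrite lee_fin ler_norm.
Qed.

Lemma in_Lp_cintegrable (p : R) v : 1 < p -> in_Lp mu p%:E v ->
 cintegrable mu v /\ \int[mu]_y normc (v y) <= fine (cLnorm mu p%:E v).
Proof.
move=> p1 Lv; have [] := @hoelder_unit p v (fun=> 1) p1 Lv (measurable_cst _).
 by move=> y; rewrite ler01 lexx.
rewrite Rintegral_cst1 powR1 mulr1.
rewrite (_ : (fun y => normc (v y) * 1) = (fun y => normc (v y))); last first.
 by apply/funext => y; rewrite mulr1.
by move=> iv le; split => //; apply/cintegrableP; split => //; case: Lv.
Qed.

End Lp.

(** * Invariance, and mixing for integrable functions *)

Section dynamics_theory.
Import HBSimple.
Context d (Y : measurableType d) (R : realType) (mu : probability Y R).
Variables (F : Y -> Y) (tau : Y -> R).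
Hypothesis F_mp : measure_preserving mu F.
Hypothesis tau_meas : mfunT tau.
Implicit Types (f g : Y -> R) (v w : Y -> R[i]).

Lemma measurable_iter n : mfunT (iter n F).
Proof.
by elim: n => [|n IH]; [exact: measurable_id|apply: measurableT_comp => //; case: F_mp].
Qed.

Lemma measure_iter n E : measurable E -> mu (iter n F @^-1` E) = mu E.
Proof.
elim: n E => // n IH E mE.
rewrite (_ : _ @^-1` _ = iter n F @^-1` (F @^-1` E))// IH; last first.
 by rewrite -[X in measurable X]setTI; case: F_mp => mF _; exact: mF.
by case: F_mp => _; exact.
Qed.

Lemma measurable_birkhoff n : mfunT (birkhoff_sum F tau n).
Proof.
apply: measurable_sum => j; apply: measurableT_comp => //.
exact: measurable_iter.
Qed.

Lemma birkhoff0 y : birkhoff_sum F tau 0 y = 0.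
Proof. by rewrite /birkhoff_sum big_ord0. Qed.

Lemma birkhoffS n y :
 birkhoff_sum F tau n.+1 y = birkhoff_sum F tau n y + tau (iter n F y).
Proof. by rewrite /birkhoff_sum big_ord_recr. Qed.

Lemma rintegrable_iter n f : rintegrable mu f -> rintegrable mu (f \o iter n F).
Proof.
move=> fi; have mf := rintegrable_measurable fi.
apply/integrableP; split.
 by apply/measurable_EFinP/measurableT_comp => //; exact: measurable_iter.
have /integrableP[_] := fi; apply: le_lt_trans.
apply: eq_ler.
have mn := measurable_iter n.
rewrite -[LHS](ge0_integral_pushforward mn mu
 (D := setT) (f := fun y => `|(f y)%:E|%E))//=.
 by apply: eq_measure_integral => E mE _; exact: measure_iter.
by apply/measurable_EFinP; exact: measurableT_comp.
Qed.

Lemma Rintegral_iter n f : rintegrable mu f ->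
 \int[mu]_y f (iter n F y) = \int[mu]_y f y.
Proof.
move=> fi; rewrite /Rintegral; congr fine.
have mn := measurable_iter n.
rewrite -[LHS](integral_pushforward mn (D := setT) (f := EFin \o f))//=.
- by apply: eq_measure_integral => E mE _; exact: measure_iter.
- exact/measurable_EFinP/(rintegrable_measurable fi).
- exact: rintegrable_iter.
Qed.

Lemma cintegral_iter n v : cintegrable mu v ->
 cintegral mu (v \o iter n F) = cintegral mu v.
Proof.
move=> [v1 v2]; rewrite /cintegral; congr Complex.
 exact: (@Rintegral_iter n (fun y => complex.Re (v y))).
exact: (@Rintegral_iter n (fun y => complex.Im (v y))).
Qed.

Hypothesis F_mixing : mixing mu F.

Lemma rintegrableM_indic n f E : measurable E -> rintegrable mu f ->
 rintegrable mu (fun y => f y * \1_E (iter n F y)).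
Proof.
move=> mE fi; apply: (rintegrable_le _ fi) => [|y].
 apply: measurable_funM; first exact: (rintegrable_measurable fi).
 apply: (measurableT_comp (f := \1_E : Y -> R)) => //.
 exact: measurable_iter.
by rewrite normrM ler_piMr// indicE; case: (_ \in _); rewrite ?normr1 ?normr0.
Qed.

(** The class [Q] contains indicators by mixing, is stable under linear combinations, hence contains
    simple functions, and these approximate [f] in L^1. The integral against an indicator composed
    with [F^n] is bounded by the L^1 norm uniformly in [n], so the approximation survives the
    limit. *)
Lemma mixing_rintegrable f E : measurable E -> rintegrable mu f ->
 \int[mu]_y (f y * \1_E (iter n F y)) @[n --> \oo] -->
  \int[mu]_y f y * fine (mu E).
Proof.
move=> mE fi.
pose Q f := rintegrable mu f /\ \int[mu]_y (f y * \1_E (iter n F y)) @[n --> \oo] -->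
  \int[mu]_y f y * fine (mu E).
have Q1 A : measurable A -> Q (\1_A).
 move=> mA; split.
  apply: (rintegrable_bounded mu _ (M := 1)) => // y.
  by rewrite indicE; case: (_ \in _); rewrite ?normr1 ?normr0.
 have -> : \int[mu]_y (\1_A y : R) = fine (mu A).
  by rewrite /Rintegral integral_indic// setIT.
 have -> : (fun n => \int[mu]_y ((\1_A y : R) * \1_E (iter n F y))) =
   (fun n => fine (mu (A `&` iter n F @^-1` E))).
  apply/funext => n; rewrite /Rintegral -[in RHS](setIT (A `&` _)) -integral_indic//.
   congr fine; apply: eq_integral => y _; rewrite !indicE in_setI.
   by case: (y \in A); rewrite ?mul1r ?mul0r.
  apply: measurableI => //; rewrite -[X in measurable X]setTI.
  exact: measurable_iter.
 rewrite -fineM ?fin_num_measure//.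
 by apply: fine_cvg; rewrite fineK ?fin_numM ?fin_num_measure//; exact: F_mixing.
have QZD a g1 g2 : Q g1 -> Q g2 -> Q (fun y => a * g1 y + g2 y).
 move=> [i1 c1] [i2 c2]; split.
  by apply: rintegrableD => //; exact: rintegrableZ.
 rewrite RintegralD// ?RintegralZl//; last exact: rintegrableZ.
 rewrite mulrDl -mulrA.
 have cc := cvgD (cvgM (cvg_cst a) c1) c2.
 rewrite (_ : (fun n => \int[mu]_y _) = (fun n => a * \int[mu]_y (g1 y * \1_E (iter n F y)) +
  \int[mu]_y (g2 y * \1_E (iter n F y)))); first exact: cc.
 apply/funext => n; rewrite -[RHS]/(a * \int[mu]_y (g1 y * \1_E (iter n F y)) +
  \int[mu]_y (g2 y * \1_E (iter n F y))).
 rewrite -RintegralZl//; last exact: rintegrableM_indic.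
 rewrite -RintegralD//; first by apply: eq_Rintegral => y _; rewrite mulrDl mulrA.
 - by apply: rintegrableZ; exact: rintegrableM_indic.
 - exact: rintegrableM_indic.
have Q0 : Q (fun=> 0).
 split; first exact: rintegrable_cst.
 rewrite Rintegral_cst1 mul0r; apply: cvg_near_cst; near=> n.
 by rewrite -[RHS](Rintegral_cst1 mu); apply: eq_Rintegral => y _; rewrite mul0r.
have Qs (g : {sfun Y >-> R}) : Q g.
 have gE : (g : Y -> R) = (fun y => \sum_(r <- finmap.enum_fset (fset_set (range g)))
   (r * \1_(g @^-1` [set r]) y + 0)).
  apply/funext => y; rewrite fimfunE fsbig_finite//=.
  by apply: eq_bigr => r _; rewrite addr0.
 rewrite gE; elim: (finmap.enum_fset _) => [|r s IH].
  by under eq_fun do rewrite big_nil.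
 under eq_fun do rewrite big_cons addr0.
 by apply: QZD => //; apply: Q1; exact: measurable_funPTI.
have [g_ [gi _ g_f]] := approximation_sfun_integrable measurableT fi.
apply/cvgrPdist_le => e e0.
have e3 : 0 < e / 3 by rewrite divr_gt0.
have : \forall n \near \oo, (\int[mu]_z `|(f z)%:E - (g_ n z)%:E| <= (e/3)%:E)%E.
 have /fine_cvgP[fin /cvgrPdist_le/(_ _ e3)] := g_f.
 apply: filterS2 fin => n fn.
 by rewrite sub0r normrN/= => h; rewrite -[leLHS]fineK// lee_fin (le_trans (ler_norm _)).
move=> [N _ /(_ N (leqnn N))/= gN].
have [_ /cvgrPdist_le/(_ _ e3) cg] := Qs (g_ N).
have giN := gi N.
have dg : \int[mu]_z `|f z - g_ N z| <= e / 3.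
 rewrite -lee_fin fineK//.
 by apply: (integrable_fin_num measurableT); apply: rintegrable_norm; exact: rintegrableB.
near=> n.
have ib h1 : rintegrable mu h1 ->
  `|\int[mu]_y (h1 y * \1_E (iter n F y))| <= \int[mu]_y `|h1 y|.
 move=> h1i; rewrite (le_trans (le_normr_Rintegral _ _))//; first exact: rintegrableM_indic.
 apply: Rintegral_le => //.
 - by apply: rintegrable_norm; exact: rintegrableM_indic.
 - exact: rintegrable_norm.
 - move=> y; rewrite normrM ler_piMr// indicE.
  by case: (_ \in _); rewrite ?normr1 ?normr0.
have bi : rintegrable mu (fun y => f y - g_ N y) by exact: rintegrableB.
(* Three errors of size [e / 3]: replacing [f] by [g_ N] in the limit, mixing for [g_ N], and
   replacing [g_ N] by [f] before the limit. *)
rewrite (_ : _ - _ = (\int[mu]_y (f y - g_ N y)) * fine (mu E) +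
 (\int[mu]_y g_ N y * fine (mu E) - \int[mu]_y (g_ N y * \1_E (iter n F y)))
 - \int[mu]_y ((f y - g_ N y) * \1_E (iter n F y))); last first.
 under [X in _ = _ - X]eq_Rintegral do rewrite mulrBl.
 rewrite RintegralB// RintegralB//; [|exact: rintegrableM_indic..].
 by ring.
rewrite (_ : e = e / 3 + e / 3 + e / 3); last by field.
rewrite (le_trans (ler_normB _ _))// lerD ?(le_trans (ib _ bi))//.
rewrite (le_trans (ler_normD _ _))// lerD//; last by near: n; exact: cg.
rewrite normrM (le_trans (ler_piMr _ _))//.
 rewrite ger0_norm// -lee_fin fineK ?fin_num_measure//.
 exact: probability_le1.
by rewrite (le_trans (le_normr_Rintegral _ _)).
Unshelve. all: end_near. Qed.

Lemma mixing_cintegrable v E : measurable E -> cintegrable mu v ->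
 cintegral mu v = 0 ->
 normc (cintegral mu (fun y => v y * (\1_E (iter n F y) : R)%:C%C)) @[n --> \oo] --> (0 : R).
Proof.
move=> mE [v1 v2] [I1 I2].
have h1 := mixing_rintegrable mE v1; have h2 := mixing_rintegrable mE v2.
have : `|\int[mu]_y (complex.Re (v y) * \1_E (iter n F y))| +
  `|\int[mu]_y (complex.Im (v y) * \1_E (iter n F y))| @[n --> \oo] --> (0 : R).
 rewrite -[0 in X in _ --> X]addr0; apply: cvgD.
  rewrite -[0](normr0 R) -(mul0r (fine (mu E))); apply: cvg_norm.
  by rewrite -I1.
 rewrite -[0](normr0 R) -(mul0r (fine (mu E))); apply: cvg_norm.
 by rewrite -I2.
apply: squeeze_cvgr; last exact: cvg_cst.
near=> n; apply/andP; split; first exact: normc_ge0.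
rewrite (le_trans (le_normc_ReIm _))//= lerD//.
 by under eq_Rintegral do rewrite ReM/= mulr0 subr0.
by under eq_Rintegral do rewrite ImM/= mulr0 add0r.
Unshelve. all: end_near. Qed.

End dynamics_theory.

(** * Subsequences *)

Section sequences_lemmas.
Context {R : realType}.

Lemma infinitely_often_subseq (Q : nat -> Prop) :
 (forall N, exists2 n, (N <= n)%N & Q n) ->
 exists g : nat -> nat, {homo g : i j / (i < j)%N} /\ forall k, Q (g k).
Proof.
move=> HQ; have /choice[f fP] : forall N, exists n, (N <= n)%N /\ Q n.
 by move=> N; have [n] := HQ N; exists n.
pose g := fix g k := if k is j.+1 then f (g j).+1 else f 0%N.
exists g; split=> [|[|k]]; [|exact: (fP _).2..].
apply: homo_ltn => [i j k|i]; first exact: ltn_trans.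
exact: (fP _).1.
Qed.

Lemma not_cvg0_subseq (a : nat -> R) : (forall n, 0 <= a n) ->
 ~ (a n @[n --> \oo] --> (0 : R)) ->
 exists2 e, 0 < e & exists g : nat -> nat,
  {homo g : i j / (i < j)%N} /\ forall k, e < a (g k).
Proof.
move=> a0 na; apply: contrapT => H; apply: na; apply/cvgrPdist_le => e e0.
apply: contrapT => nae; apply: H; exists e => //.
apply: (@infinitely_often_subseq (fun n => e < a n)) => N; apply: contrapT => HN.
apply: nae; exists N => // n /= Nn; rewrite sub0r normrN ger0_norm//.
by rewrite leNgt; apply/negP => en; apply: HN; exists n.
Qed.

Lemma subseq_cvgnP (g : nat -> nat) : {homo g : i j / (i < j)%N} ->
 g k @[k --> \oo] --> \oo.
Proof.
move=> hg; have gk k : (k <= g k)%N.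
 by elim: k => // k; move/leq_ltn_trans; apply; exact: hg.
apply/cvgnyPge => A; exists A => // n /= An; exact: leq_trans (gk n).
Qed.

Lemma cvg_subseq (a : nat -> R) (l : R) (g : nat -> nat) :
 {homo g : i j / (i < j)%N} -> a n @[n --> \oo] --> l -> a (g n) @[n --> \oo] --> l.
Proof. by move=> /subseq_cvgnP hg al; exact: (cvg_comp _ _ hg al). Qed.

End sequences_lemmas.

(** * Homogeneity and Minkowski's inequality for [cLnorm] *)

Section Lp_more.
Context d (Y : measurableType d) (R : realType) (mu : probability Y R).
Implicit Types (v w : Y -> R[i]).

Lemma cLnormZ (p : R) (a : R[i]) v : 1 < p -> in_Lp mu p%:E v ->
 fine (cLnorm mu p%:E (fun y => a * v y)) = normc a * fine (cLnorm mu p%:E v).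
Proof.
move=> p1 [mv fv]; have p0 : 0 < p by rewrite (lt_trans _ p1).
have mn := measurable_normc mv.
suff -> : cLnorm mu p%:E (fun y => a * v y) = ((normc a)%:E * cLnorm mu p%:E v)%E.
 by rewrite fineM// ge0_fin_numE ?Lnorm_ge0.
rewrite /cLnorm unlock.
have -> : (\int[mu]_x `|(normc (a * v x))%:E| `^ p =
  (normc a `^ p)%:E * \int[mu]_x `|(normc (v x))%:E| `^ p)%E.
 rewrite -ge0_integralZl//.
 - apply: eq_integral => y _.
  rewrite normcM EFinM abseM poweRM//.
  by rewrite -poweR_EFin/= ger0_norm ?normc_ge0.
 - apply: (@measurableT_comp _ _ _ _ _ _ (fun x : \bar R => x `^ p)%E).
   exact: measurable_poweR.
  by apply/measurableT_comp => //; exact/measurable_EFinP.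
 - by move=> y _; exact: poweR_ge0.
 - by rewrite lee_fin powR_ge0.
rewrite poweRM ?lee_fin ?powR_ge0//; last first.
 by apply: integral_ge0 => y _; exact: poweR_ge0.
congr (_ * _)%E; rewrite poweR_EFin -powRrM mulfV ?gt_eqF// powRr1 ?normc_ge0//.
Qed.

Lemma cLnormD (p : R) v w : 1 < p -> cmeasurable v -> cmeasurable w ->
 (cLnorm mu p%:E (fun y => v y + w y)%R <= cLnorm mu p%:E v + cLnorm mu p%:E w)%E.
Proof.
move=> p1 mv mw; have p0 : 0 < p by rewrite (lt_trans _ p1).
have mnv := measurable_normc mv; have mnw := measurable_normc mw.
have mnvw := measurable_normc (cmeasurableD mv mw).
have := minkowski_EFin (p := p) mu mnv mnw (ltW p1).
apply: le_trans; rewrite /cLnorm unlock.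
have mP (g : Y -> R) : mfunT g ->
  mfunT (fun y => `|(g y)%:E| `^ p)%E.
 move=> mg; apply: (@measurableT_comp _ _ _ _ _ _ (fun x : \bar R => x `^ p)%E).
  exact: measurable_poweR.
 by apply/measurableT_comp => //; exact/measurable_EFinP.
apply: gt0_ler_poweR; rewrite ?invr_ge0 ?(ltW p0)//.
- by rewrite in_itv/= leey andbT; apply: integral_ge0 => y _; rewrite lee_fin powR_ge0.
- by rewrite in_itv/= leey andbT; apply: integral_ge0 => y _; rewrite lee_fin powR_ge0.
apply: ge0_le_integral => //.
- by move=> y _; exact: poweR_ge0.
- exact: mP.
- by apply: mP; exact: measurable_funD.
- move=> y _; apply: gt0_ler_poweR; rewrite ?(ltW p0) ?in_itv/= ?leey ?andbT ?lee_fin//.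
 by rewrite !ger0_norm ?addr_ge0 ?normc_ge0// le_normcD.
Qed.

End Lp_more.

(** * Lipschitz bounds for the exponential on the half-plane *)

Section cexp_lipschitz.
Context {R : realType}.
Implicit Types z w : R[i].

(** For [z = a + ib] the modulus is at most [(1 - e^-a) + e^-a (|1 - cos b| + |sin b|)], hence at
    most [a + 2 |b|]; the constant 3 is crude. *)
Lemma normc_1Bcexp z : 0 <= complex.Re z ->
 normc (1 - cexp (- z)) <= 3 * normc z.
Proof.
move=> z0; rewrite (le_trans (le_normc_ReIm _))//.
have hR := le_Re_normc z; have hI := le_Im_normc z.
move: z0 hR hI; case: z => a b /=; set r := Num.sqrt _ => a0 hR hI.
rewrite cosN sinN sub0r.
have e1 : expR (- a) <= 1 by rewrite expRN_le1.
have e0 : 0 < expR (- a) by exact: expR_gt0.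
have ea : 1 - expR (- a) <= a.
 by rewrite lerBlDr addrC -lerBlDr; have := expR_ge1Dx (- a).
have sb x : `|sin x| <= `|x| :> R.
 have key (y : R) : 0 <= y -> `|sin y| <= y.
  move=> y0; have [->|yn] := eqVneq y 0; first by rewrite sin0 normr0.
  have yp : 0 < y by rewrite lt_neqAle eq_sym yn.
  have cs : {within `[0, y], continuous (@sin R)}.
   by apply: continuous_subspaceT => ?; exact: continuous_sin.
  have [c _] := MVT_segment y0 (fun x _ => is_derive_sin x) cs.
  rewrite sin0 !subr0 => ->.
  by rewrite normrM [`|y|]ger0_norm// ler_piMl// cos_max.
 have [x0|x0] := leP 0 x; first by rewrite [leRHS]ger0_norm// key.
 by have := key (- x); rewrite sinN normrN [`|x|]ltr0_norm// oppr_ge0 => -> //; exact: ltW.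
have cb : `|1 - cos b| <= `|b|.
 have -> : 1 - cos b = 2 * sin (b / 2) ^+ 2.
  have {1}-> : b = b / 2 *+ 2 by rewrite mulr2n -splitr.
  by rewrite cos_mulr2n cos2sin2; ring.
 rewrite normrM normrX ger0_norm//.
 have h1 := sb (b / 2); have h2 : `|sin (b / 2)| <= 1 by exact: sin_max.
 have h3 : `|b / 2| = `|b| / 2 by rewrite normrM (@ger0_norm _ 2^-1) ?invr_ge0.
 have h4 : `|sin (b / 2)| ^+ 2 <= `|sin (b / 2)| by rewrite expr2 ler_piMl.
 by rewrite h3 in h1; lra.
rewrite (_ : 1 - _ = (1 - expR (- a)) + expR (- a) * (1 - cos b)); last by ring.
have t1 : `|1 - expR (- a)| <= `|a|.
 by rewrite ger0_norm ?subr_ge0// ger0_norm.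
have t2 : `|expR (- a) * (1 - cos b)| <= `|b|.
 by rewrite normrM gtr0_norm// (le_trans _ cb)// ler_piMl.
have t3 : `|- (expR (- a) * - sin b)| <= `|b|.
 by rewrite mulrN opprK normrM gtr0_norm// (le_trans _ (sb b))// ler_piMl.
have := ler_normD (1 - expR (- a)) (expR (- a) * (1 - cos b)).
move: t1 t2 t3 hR hI; move: (`|_|) => A1; lra.
Qed.

Lemma cexp_le1 z : 0 <= complex.Re z -> normc (cexp (- z)) <= 1.
Proof. by move=> z0; rewrite normc_cexp ReN expRN_le1. Qed.

(** The exponential whose exponent has the smaller real part is factored out, so that the difference
    of exponents stays in the half-plane; this is what the [wlog] arranges. *)
Lemma normc_cexpB z w : 0 <= complex.Re z -> 0 <= complex.Re w ->
 normc (cexp (- z) - cexp (- w)) <= 3 * normc (z - w).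
Proof.
wlog zw : z w / complex.Re z <= complex.Re w.
 move=> H z0 w0; have [|/ltW] := leP (complex.Re z) (complex.Re w).
  by move=> ?; exact: H.
 by move=> ?; rewrite -normc_distC -(normc_distC w z); exact: H.
move=> z0 w0.
have -> : cexp (- z) - cexp (- w) = cexp (- z) * (1 - cexp (- (w - z))).
 by rewrite mulrBr mulr1 -cexpD; congr (_ - cexp _); ring.
rewrite normcM (le_trans (ler_piMl _ (cexp_le1 z0))) ?normc_ge0//.
rewrite (normc_distC z w) normc_1Bcexp// ReD ReN subr_ge0//.
Qed.

End cexp_lipschitz.

(** * Scalar inequalities behind the error exponents *)

Lemma geometric_arith (R : realType) (x : R) k : 0 <= x <= 1 -> x ^+ k * (1 + k%:R * (1 - x)) <= 1.
Proof.
case/andP=> x0 x1; elim: k => [|k IH]; first by rewrite expr0 mul0r addr0 mulr1.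
have xk : 0 <= x ^+ k <= 1 by rewrite exprn_ge0// exprn_ile1.
rewrite exprS -natr1; set z := x ^+ k in IH xk *.
have -> : x * z * (1 + (k%:R + 1) * (1 - x)) = x * (z * (1 + k%:R * (1 - x)) + z * (1 - x)) by ring.
have h : z * (1 - x) <= 1 - x by case/andP: xk => ? ?; rewrite ler_piMl// subr_ge0.
(* Here [x (2 - x) = 1 - (1 - x)^2 <= 1]. The lemma serves to bound [k x^k] by [1 / (1 - x)]
   uniformly in [k]. *)
rewrite (le_trans (_ : _ <= x * (1 + (1 - x))))//; first by rewrite ler_wpM2l// lerD.
have := sqr_ge0 (1 - x); rewrite expr2; lra.
Qed.

(* Choosing [n] of order [ln (1 / H)], the first power of [t] below [H]. *)
Lemma log_choice (R : realType) (t : R) : 0 < t < 1 -> exists2 K, 0 < K &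
 forall H : R, 0 < H <= 1 -> exists n, t ^+ n <= H /\ n%:R * H `^ 8^-1 <= K.
Proof.
case/andP=> t0 t1; pose x := t `^ 8^-1.
have e1 : 1 `^ 8^-1 = 1 :> R by rewrite powR1.
have x1 : x < 1.
 by rewrite /x -[ltRHS]e1; apply: gt0_ltr_powR; rewrite ?nnegrE ?invr_gt0// ltW.
have x0 : 0 < x by exact: powR_gt0.
exists (1 + (1 - x)^-1); first by rewrite addr_gt0// invr_gt0 subr_gt0.
move=> H /andP[H0 H1].
have ex : exists n, t ^+ n <= H.
 have : t ^+ n @[n --> \oo] --> (0 : R) by apply: cvg_expr; rewrite ger0_norm// ltW.
 move=> /cvgrPdist_le/(_ _ H0) [n _ /(_ n (leqnn n))/=].
 by rewrite sub0r normrN ger0_norm ?exprn_ge0 ?(ltW t0)// => h; exists n.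
case: (ex_minnP ex) => -[|n] hn mn; [exists 0%N|exists n.+1]; split => //.
 by rewrite mul0r addr_ge0// invr_ge0 subr_ge0 ltW.
have Hn : H <= t ^+ n by rewrite leNgt; apply/negP => /ltW /mn; rewrite ltnn.
have p1 : H `^ 8^-1 <= 1.
 by rewrite -[leRHS]e1; apply: ge0_ler_powR; rewrite ?nnegrE ?invr_ge0// ltW.
have p2 : H `^ 8^-1 <= x ^+ n.
 rewrite /x -powR_mulrn ?powR_ge0// -powRrM mulrC powRrM powR_mulrn ?(ltW t0)//.
 by apply: ge0_ler_powR; rewrite ?nnegrE ?invr_ge0 ?exprn_ge0// ltW.
have := @geometric_arith R x n; rewrite (ltW x0) (ltW x1) => /(_ isT) g.
rewrite -natr1 mulrDl mul1r addrC; apply: lerD => //.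
rewrite (le_trans (_ : _ <= n%:R * x ^+ n))//; first by rewrite ler_wpM2l.
rewrite -[leRHS]mul1r ler_pdivlMr ?subr_gt0//.
have xn := exprn_ge0 n (ltW x0).
move: xn g; nra.
Qed.

Lemma powR_le_const (R : realType) (c x y a b : R) : 1 <= c -> 0 <= x <= c * y -> 0 <= y <= 1 ->
 0 < b <= a -> a <= 1 -> x `^ a <= c * y `^ b.
Proof.
move=> c1 /andP[x0 xc] /andP[y0 y1] /andP[b0 ba] a1.
have c0 : 0 <= c by rewrite (le_trans ler01).
have a0 : 0 < a by exact: lt_le_trans ba.
rewrite (le_trans (_ : _ <= (c * y) `^ a))//.
 by apply: ge0_ler_powR; rewrite ?nnegrE ?(ltW a0)// mulr_ge0.
rewrite powRM//; apply: ler_pM; rewrite ?powR_ge0//.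
 by rewrite -[leRHS](powRr1 c0); apply: ler_powR.
have [->|yn] := eqVneq y 0; first by rewrite !powR0 ?gt_eqF.
by apply: ger_powR => //; rewrite y1 lt_neqAle eq_sym yn y0.
Qed.

(** Here [m] stands for the mass of the defect, of order [H], and [x] for [|s|^gamma], of order
    [H^(1/2)]. With [a >= 7/8] the quadratic terms are of order [H^(14/8)] and
    [H^((1/2 + 7/8) 7/8) = H^(77/64)]; the choice of [n] costs a factor [H^(-1/8)], and [t^n m^a] is
    of order at most [H^(15/8)]. All are [O(H^(65/64))], and what matters is that this exponent
    exceeds 1. *)
Lemma error_choice (R : realType) (B t C0 a : R) : 0 < B -> 0 < t < 1 -> 1 <= C0 ->
 7 / 8 <= a < 1 -> exists2 C1, 0 < C1 & forall H m x : R, 0 < H <= 1 -> 0 <= m <= C0 * H ->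
 0 <= x <= C0 * H `^ 2^-1 -> exists n,
  B * (n%:R * m `^ a + t ^+ n) <= C1 * H `^ 2^-1 /\
  B * (n%:R * (m `^ a * m `^ a) + n%:R * (x * m `^ a) `^ a + t ^+ n * m `^ a) <=
   C1 * H `^ (65 / 64).
Proof.
move=> B0 t01 C1 /andP[a7 a1]; have C00 : 0 < C0 by rewrite (lt_le_trans ltr01).
have [K K0 hK] := log_choice t01.
exists (B * (K * C0 * C0 * 3 + 1 + C0)); first by rewrite mulr_gt0// !addr_gt0// !mulr_gt0.
move=> H m x H01 m0 x0; have [n [tn nH]] := hK _ H01; exists n.
have /andP[H0 H1] := H01.
have HH : 0 <= H <= 1 by rewrite ltW.
have ma : m `^ a <= C0 * H `^ (7 / 8).
 by apply: powR_le_const => //; lra.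
have ma0 : 0 <= m `^ a by exact: powR_ge0.
have mono u v : 0 <= u -> u <= v -> H `^ v <= H `^ u by move=> u0 uv; apply: ger_powR.
have HD u v : H `^ (u + v) = H `^ u * H `^ v by rewrite powRD// (gt_eqF H0) implybT.
have xm : (x * m `^ a) `^ a <= (C0 * C0) * H `^ (77 / 64).
 have -> : H `^ (77 / 64) = (H `^ (11 / 8)) `^ (7 / 8).
  by rewrite -powRrM; congr (_ `^ _); field.
 case/andP: x0 => x0 x1.
 apply: powR_le_const; rewrite ?mulr_ege1 ?mulr_ge0 ?powR_ge0 ?(ltW a1)//=.
 - rewrite (_ : 11 / 8 = 2^-1 + 7 / 8); last by field.
  by rewrite HD mulrACA; apply: ler_pM.
 - by rewrite -[leRHS](powRr0 H); apply: mono => //; lra.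
 - by apply/andP; split => //; lra.
have nK u v : 0 <= u -> v = 8^-1 + u -> n%:R * H `^ v <= K * H `^ u.
 by move=> u0 ->; rewrite HD mulrA ler_wpM2r// powR_ge0.
have H12 : 0 <= H `^ 2^-1 by exact: powR_ge0.
have H65 : 0 <= H `^ (65 / 64) by exact: powR_ge0.
have tH : t ^+ n <= H `^ 2^-1.
 by rewrite (le_trans tn)// -[leLHS](powRr1 (ltW H0)); apply: mono => //; lra.
have t0 : 0 <= t ^+ n by case/andP: t01 => ? _; rewrite exprn_ge0// ltW.
have CC : 0 <= K * C0 * C0 by rewrite !mulr_ge0// ltW.
have KC : K * C0 <= K * C0 * C0 by rewrite ler_peMr// mulr_ge0// ltW.
split; rewrite -[leRHS]mulrA ler_wpM2l ?(ltW B0)//.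
- have h1 : n%:R * m `^ a <= K * C0 * H `^ 2^-1.
  rewrite (le_trans (ler_wpM2l _ ma))// mulrCA -mulrA [leRHS]mulrCA ler_wpM2l ?(ltW C00)//.
  rewrite (le_trans (nK (3 / 4) (7 / 8) ltac:(lra) ltac:(lra)))//.
  by rewrite ler_wpM2l ?(ltW K0)//; apply: mono => //; lra.
 have h2 : K * C0 * H `^ 2^-1 <= K * C0 * C0 * H `^ 2^-1 by rewrite ler_wpM2r.
 have h3 : 0 <= (K * C0 * C0 * 2 + C0) * H `^ 2^-1 by rewrite mulr_ge0// addr_ge0 ?mulr_ge0// ltW.
 lra.
have h1 : n%:R * (m `^ a * m `^ a) <= K * C0 * C0 * H `^ (65 / 64).
 rewrite (le_trans (_ : _ <= n%:R * (C0 * C0 * H `^ (14 / 8))))//.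
  rewrite ler_wpM2l// (_ : 14 / 8 = 7 / 8 + 7 / 8); last by field.
  by rewrite HD mulrACA; apply: ler_pM.
 rewrite mulrCA (_ : K * C0 * C0 * _ = C0 * C0 * (K * H `^ (65 / 64))); last by ring.
 rewrite ler_wpM2l ?mulr_ge0 ?(ltW C00)// (le_trans (nK (13 / 8) (14 / 8) ltac:(lra) ltac:(lra)))//.
 by rewrite ler_wpM2l ?(ltW K0)//; apply: mono => //; lra.
have h2 : n%:R * (x * m `^ a) `^ a <= K * C0 * C0 * H `^ (65 / 64).
 rewrite (le_trans (ler_wpM2l _ xm))// mulrCA (_ : K * C0 * C0 * _ = C0 * C0 * (K * H `^ (65 / 64))).
  2: by ring.
 rewrite ler_wpM2l ?mulr_ge0 ?(ltW C00)//.
 rewrite (le_trans (nK (69 / 64) (77 / 64) ltac:(lra) ltac:(lra)))//.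
 by rewrite ler_wpM2l ?(ltW K0)//; apply: mono => //; lra.
have h3 : t ^+ n * m `^ a <= C0 * H `^ (65 / 64).
 rewrite (le_trans (_ : _ <= H * (C0 * H `^ (7 / 8))))//; first by apply: ler_pM.
 rewrite mulrCA ler_wpM2l ?(ltW C00)// -{1}(powRr1 (ltW H0)) -HD; apply: mono => //; lra.
have h4 := mulr_ge0 CC H65.
lra.
Qed.

(** [|1 - g|^2 = 1 - 2 Re g + |g|^2] and [|g|^2 <= c0 h] for small [h], so
    [|1 - g| <= 1 - c0 h / 2]; the distance from [lam] to [1 - g] spends at most half of the
    gain. *)
Lemma normc_contraction (R : realType) (g lam : R[i]) (c0 C0 C1 h : R) : 0 < c0 -> 0 <= h -> c0 * h <= 1 ->
 4 * (C0 * C0) * h <= c0 -> C1 <= c0 / 4 ->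
 c0 * h <= complex.Re g -> normc g <= 2 * (C0 * h) -> normc (1 - lam - g) <= C1 * h ->
 normc lam <= expR (- (c0 / 4) * h).
Proof.
move=> c00 h0 ch Ch hC1 hg gC err.
have g0 := normc_ge0 g.
have g2 : normc g ^+ 2 = complex.Re g ^+ 2 + complex.Im g ^+ 2.
 by case: g {hg gC err g0} => x y /=; rewrite /normc/= sqr_sqrtr// addr_ge0// sqr_ge0.
have n1 : normc (1 - g) <= 1 - c0 * h / 2.
 have p0 : 0 <= 1 - c0 * h / 2 by lra.
 rewrite -(@ler_pXn2r _ 2)// ?nnegrE ?normc_ge0//.
 have -> : normc (1 - g) ^+ 2 = 1 - 2 * complex.Re g + normc g ^+ 2.
  rewrite g2; case: g {hg gC err g0 g2} => x y /=.
  by rewrite /normc/= sqr_sqrtr ?addr_ge0 ?sqr_ge0// !expr2; ring.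
 have : normc g ^+ 2 <= (2 * (C0 * h)) ^+ 2 by rewrite ler_pXn2r ?nnegrE//; exact: le_trans gC.
 have : (2 * (C0 * h)) ^+ 2 <= c0 * h.
  rewrite (_ : (2 * (C0 * h)) ^+ 2 = (4 * (C0 * C0) * h) * h); last by ring.
  by rewrite ler_wpM2r.
 have := sqr_ge0 (c0 * h / 2); rewrite (_ : (1 - c0 * h / 2) ^+ 2 = 1 - c0 * h + (c0 * h / 2) ^+ 2); last by field.
 lra.
have -> : lam = (1 - g) - (1 - lam - g) by ring.
rewrite (le_trans (normcB _ _))// (le_trans _ (expR_ge1Dx _))//.
have : C1 * h <= c0 / 4 * h by rewrite ler_wpM2r.
lra.
Qed.

Arguments Normc.normc : simpl never.
Arguments cexp : simpl never.

(** * Uniformity over compact ranges of parameters *)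

Section uniformity.
Context {R : realType}.

(** The bound [M] is treated as a second variable tending to [+oo], so that near-covering
    compactness yields one bound on the whole segment without handling a finite subcover. *)
Lemma segment_uniform (a b : R) (Q : R -> R -> Prop) :
 (forall x M M', M <= M' -> Q x M -> Q x M') ->
 (forall x, a <= x <= b -> exists M r, 0 < r /\
   forall y, a <= y <= b -> `|y - x| < r -> Q y M) ->
 exists M, forall y, a <= y <= b -> Q y M.
Proof.
move=> Qmono HQ.
have /compact_near_coveringP/(_ R +oo%R (fun M y => a <= y <= b -> Q y M) _) := @segment_compact R a b.
case.
 move=> x; rewrite /= in_itv/= => xab.
 have [M [r [r0 hr]]] := HQ x xab.
 exists ([set y | `|y - x| < r], [set M' | M <= M']).
  split; last exact: (nbhs_pinfty_ge (num_real M)).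
  exists r => //= y /=; rewrite distrC; exact.
 by move=> [y M'] [/= yx MM'] yab; apply: Qmono MM' (hr _ yab yx).
move=> M [_ hM]; exists (M + 1) => y yab; apply: (hM (M + 1)) => //.
 by rewrite ltrDl.
Qed.

(** The rate [2^(-1/N)] serves every halving period [n <= N] at once. Contractions whose period
    depends on the parameter thus acquire a common geometric rate. *)
Lemma geometric_rate (N : nat) : (1 <= N)%N -> exists2 t : R, 0 < t < 1 &
 forall (f : nat -> R) B, (forall j, 0 <= f j) -> (forall j, f j <= B) ->
 forall n, (1 <= n <= N)%N -> (forall j, f (n + j)%N <= f j / 2) ->
 forall j, f j <= 2 * B * t ^+ j.
Proof.
move=> N1; pose t : R := 2^-1 `^ (N%:R^-1).
have t0 : 0 < t by rewrite powR_gt0// invr_gt0.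
have tN : t ^+ N = 2^-1.
 by rewrite -powR_mulrn ?(ltW t0)// -powRrM mulVf ?powRr1// pnatr_eq0 -lt0n.
have t1 : t < 1.
 rewrite ltNge; apply/negP => t1; have := exprn_ege1 N t1.
 by rewrite tN leNgt invf_lt1 ?ltr1n.
have tn n : (n <= N)%N -> 2^-1 <= t ^+ n.
 by move=> nN; rewrite -tN; apply: ler_wiXn2l; rewrite ?ltW.
exists t; first by rewrite t0.
move=> f B f0 fB n /andP[n1 nN] fn j.
have B0 : 0 <= B by rewrite (le_trans (f0 0%N)).
elim/ltn_ind: j => j IH; have [jn|nj] := ltnP j n.
 rewrite (le_trans (fB j))// mulrAC ler_peMl//.
 have := tn j (leq_trans (ltnW jn) nN).
 by lra.
rewrite -(subnKC nj) (le_trans (fn _))//.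
have jj : (j - n < j)%N by rewrite ltn_subrL n1 (leq_trans n1).
have := IH _ jj => h; rewrite exprD.
have tt : 0 <= 2 * B * t ^+ (j - n) by rewrite !mulr_ge0// exprn_ge0// ltW.
have h2 : 1 <= 2 * t ^+ n by have := tn n nN; lra.
have := ler_wpM2r tt h2; rewrite mul1r => h3.
rewrite (_ : 2 * B * (t ^+ n * t ^+ (j - n)) = t ^+ n * (2 * B * t ^+ (j - n))); last by ring.
lra.
Qed.

End uniformity.

(** * From the spectral radius to a contracting power *)

Section spectral_radius_theory.
Context (R : realType) (V : normedModType R[i]) (T : V -> V) (M : R).
Hypothesis T_lin : forall a u v, T (a *: u + v) = a *: T u + T v.
Hypothesis M_ge1 : 1 <= M.
Hypothesis T_bounded : forall n v, rnorm (iter n T v) <= M * rnorm v.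
Hypothesis T_spec : (spectral_radius T < 1)%E.
Implicit Types (u v w : V) (z : R[i]).

Let e (x : R) : R[i] := cexp (0 +i* x)%C.

Let e_norm x : normc (e x) = 1.
Proof. by rewrite normc_cexp/= expR0. Qed.

Let e_lip x y : normc (e x - e y) <= 3 * `|x - y|.
Proof.
have h := @normc_cexpB R (0 +i* (- x))%C (0 +i* (- y))%C (lexx _) (lexx _).
have E a : - (0 +i* (- a))%C = (0 +i* a)%C :> R[i].
 by apply/eqP; rewrite eq_complex/= oppr0 opprK !eqxx.
rewrite !E in h; rewrite (le_trans h)// ler_wpM2l//.
rewrite (le_trans (le_normc_ReIm _))// ReD ImD/= addr0 normr0 add0r.
by rewrite -normrN opprD opprK.
Qed.

Let eD x y : e (x + y) = e x * e y.
Proof.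
by rewrite /e -cexpD; congr cexp; apply/eqP; rewrite eq_complex/= addr0 !eqxx.
Qed.

Let e_pi x : e (x + pi) = - e x.
Proof.
rewrite /e; apply/eqP; rewrite eq_complex/= !expR0 !mul1r.
by rewrite cosDpi sinDpi !eqxx.
Qed.

Let e0 : e 0 = 1.
Proof. by rewrite /e; apply/eqP; rewrite eq_complex/= expR0 cos0 sin0 mulr1 mulr0 !eqxx. Qed.

Let T0 : T 0 = 0.
Proof.
have := T_lin 1 0 0; rewrite scaler0 addr0 scale1r.
by move/(congr1 (fun x => x - T 0)); rewrite subrr addrK.
Qed.

Let iter_lin n a u v : iter n T (a *: u + v) = a *: iter n T u + iter n T v.
Proof. by elim: n => // n IH; rewrite !iterS IH T_lin. Qed.

Let iterD_ n u v : iter n T (u + v) = iter n T u + iter n T v.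
Proof. by have := iter_lin n 1 u v; rewrite !scale1r. Qed.

Let iter0_ n : iter n T 0 = 0.
Proof. by elim: n => // n IH; rewrite iterS IH T0. Qed.

Let iterZ_ n a u : iter n T (a *: u) = a *: iter n T u.
Proof. by rewrite -[a *: u]addr0 iter_lin iter0_ addr0. Qed.

Let iterN_ n u : iter n T (- u) = - iter n T u.
Proof. by rewrite -scaleN1r iterZ_ scaleN1r. Qed.

(** [1 / z] has modulus at least 1 and so lies off the spectrum. The inverse is only given as a
    continuous map; it is homogeneous as the inverse of a linear bijection, and continuity at 0 then
    bounds it. *)
Lemma resolvent z : normc z <= 1 -> z != 0 -> exists2 B, 0 < B &
 (forall u, rnorm u <= B * rnorm (u - z *: T u)) /\
 (forall v, exists u, u - z *: T u = v).
Proof.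
move=> z1 z0.
have zn0 : 0 < normc z.
 rewrite lt_neqAle normc_ge0 andbT eq_sym; apply: contra z0 => /eqP/eq0_normc ->//.
have : ~ spectrum T z^-1.
 move=> sz; have : ((normc z^-1)%:E <= spectral_radius T)%E.
  by apply: ereal_sup_ubound; exists z^-1.
 move=> /le_lt_trans/(_ T_spec); rewrite lte_fin normcV.
 by rewrite invf_lt1// ltNge z1.
move/contrapT => [S [cS S1 S2]].
have Sz v : S v - z *: T (S v) = z *: v.
 by rewrite -{3}(S2 v) scalerBr scalerA mulfV// scale1r.
have SK u : S (z^-1 *: (u - z *: T u)) = u.
 by rewrite scalerBr scalerA mulVf// scale1r S1.
have S0 : S 0 = 0 by have := S1 0; rewrite T0 scaler0 subr0.
have SZ a v : S (a *: v) = a *: S v.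
 rewrite -[RHS]S1; congr S; have := S2 v => <-; rewrite [S (_ - _)]S1.
 by have := iterZ_ 1 a (S v) => /= ->; rewrite scalerBr !scalerA mulrC.
have [r r0 hr] : exists2 r : R, 0 < r & forall v, rnorm v < r -> rnorm (S v) <= 1.
 have /cvgrPdist_le/(_ 1 ltr01) := cS 0.
 rewrite S0 => /nbhs_normP[r /= r0 hr].
 have rE : r = (complex.Re r)%:C%C.
  by move: r0; rewrite ltcE/= => /andP[/eqP ri _]; case: (r) ri => a b /= ->.
 exists (complex.Re r); first by move: r0; rewrite ltcE => /andP[].
 move=> v vr; have := hr v; rewrite /= !sub0r !normrN.
 rewrite !rnormE rE ltcR => /(_ vr).
 by rewrite -(lecR _ 1).
have Sb v : rnorm (S v) <= 2 / r * rnorm v.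
 have [v0|v0] := eqVneq (rnorm v) 0.
  by rewrite (rnorm_eq0 v0) S0 rnorm0 mulr0.
 have vp : 0 < rnorm v by rewrite lt_neqAle eq_sym v0 rnorm_ge0.
 have := hr ((r / 2 / rnorm v)%:C%C *: v).
 rewrite SZ !rnormZ normc_real gtr0_norm ?divr_gt0//.
 rewrite divfK// ltr_pdivrMr// ltr_pMr// ltr1n => /(_ isT) h.
 rewrite -ler_pdivrMr// mulrC -(ler_pM2l (_ : 0 < r / 2)) ?divr_gt0//.
 rewrite mulrA (le_trans h)// mulrA divfK ?gt_eqF// mulfV ?gt_eqF//.
exists (2 / r * (normc z)^-1); first by rewrite mulr_gt0 ?divr_gt0// invr_gt0.
split=> [u|v].
 by rewrite -{1}(SK u) (le_trans (Sb _))// rnormZ normcV mulrA.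
by exists (S (z^-1 *: v)); rewrite Sz scalerA mulfV// scale1r.
Qed.

(** The bound [B] at one point survives, doubled, on a neighbourhood of radius [1 / (6 B M)]: the
    function [e] has Lipschitz constant 3, so the perturbation absorbs at most half of [u].
    Compactness of the circle does the rest. *)
Lemma circle_resolvent : exists2 B, 0 < B & forall x, 0 <= x <= 2 * pi ->
 forall u, rnorm u <= B * rnorm (u - e x *: T u).
Proof.
have [] := @segment_uniform R 0 (2 * pi)
  (fun x B => forall u, rnorm u <= B * rnorm (u - e x *: T u)).
- by move=> x B B' BB H u; rewrite (le_trans (H u))// ler_wpM2r ?rnorm_ge0.
- move=> x _; have e1 : normc (e x) <= 1 by rewrite e_norm.
 have en0 : e x != 0.
  by apply/eqP => h; have := e_norm x; rewrite h normc0 => /eqP; rewrite eq_sym oner_eq0.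
 have [B B0 [HB _]] := resolvent e1 en0.
 have BM : 0 < B * M by rewrite mulr_gt0// (lt_le_trans ltr01).
 exists (2 * B), (6 * (B * M))^-1; split; first by rewrite invr_gt0 mulr_gt0.
 move=> y _ yx u.
 have h1 := HB u.
 have h2 : rnorm (u - e x *: T u) <= rnorm (u - e y *: T u) + (2 * B)^-1 * rnorm u.
  rewrite (_ : u - e x *: T u = (u - e y *: T u) + (e y - e x) *: T u); last first.
   by rewrite scalerBl addrA subrK.
  rewrite (le_trans (rnormD _ _))// lerD2l rnormZ.
  rewrite (le_trans (_ : _ <= (3 * `|y - x|) * (M * rnorm u)))//.
   by rewrite ler_pM ?normc_ge0 ?rnorm_ge0//; exact: (T_bounded 1).
  rewrite mulrA ler_wpM2r ?rnorm_ge0//.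
  rewrite (le_trans (_ : _ <= 3 * (6 * (B * M))^-1 * M))//.
   rewrite ler_wpM2r ?(le_trans ler01)// ler_wpM2l//; exact: ltW.
  apply: eq_ler.
  have : M != 0 by rewrite gt_eqF// (lt_le_trans ltr01).
  by move: B0; move/lt0r_neq0 => Bn Mn; field; rewrite Bn Mn.
 have h3 : B * ((2 * B)^-1 * rnorm u) = rnorm u / 2.
  by field; rewrite gt_eqF.
 have := ler_wpM2l (ltW B0) h2; rewrite mulrDr h3 -mulrA => h4.
 lra.
- move=> B HB; exists (`|B| + 1); first by rewrite ltr_wpDl.
 move=> x xx u; rewrite (le_trans (HB x xx u))// ler_wpM2r ?rnorm_ge0//.
 by rewrite (le_trans (ler_norm _))// lerDl.
Qed.

Let half (x : R) : 0 <= x <= 2 * pi -> 0 <= x / 2 <= 2 * pi /\ 0 <= x / 2 + pi <= 2 * pi.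
Proof. by move=> /andP[h1 h2]; have := pi_ge0 R; split; lra. Qed.

Let e_half x : e (x / 2) * e (x / 2) = e x.
Proof. by rewrite -eD -splitr. Qed.

Let pow2S k u : iter (2 ^ k.+1) T u = iter (2 ^ k) T (iter (2 ^ k) T u).
Proof. by rewrite expnS mul2n -addnn iterD. Qed.

(* [(1 - w^2 S^2) = (1 - w S)(1 + w S)], so bounds and surjectivity pass from
  [S = T^(2^k)] to its square. *)
Let factor k (c : R[i]) u :
 u - (c * c) *: iter (2 ^ k.+1) T u =
 (u + c *: iter (2 ^ k) T u) - c *: iter (2 ^ k) T (u + c *: iter (2 ^ k) T u).
Proof.
rewrite pow2S iterD_ iterZ_ scalerDr scalerA opprD addrA.
by rewrite addrK.
Qed.

Let factor' k (c : R[i]) u :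
 u - (c * c) *: iter (2 ^ k.+1) T u =
 (u - c *: iter (2 ^ k) T u) + c *: iter (2 ^ k) T (u - c *: iter (2 ^ k) T u).
Proof.
have := factor k (- c) u; rewrite mulrNN => ->.
by rewrite !scaleNr opprK.
Qed.

(** The angles [x / 2] and [x / 2 + pi] give the two square roots [w] and [- w]. As [2 u] is the sum
    of [u + w S u] and [u - w S u], each controlled by the same right-hand side, the constant [B] is
    kept for every [k]. *)
Lemma doubled_bound (c : R) B :
 (forall x, 0 <= x <= 2 * pi -> forall u, rnorm u <= B * rnorm (u - (c%:C * e x)%C *: T u)) ->
 forall k x, 0 <= x <= 2 * pi -> forall u,
  rnorm u <= B * rnorm (u - ((c ^+ (2 ^ k))%:C * e x)%C *: iter (2 ^ k) T u).
Proof.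
move=> H; elim=> [|k IH] x xx u; first by rewrite expn0 expr1; exact: H.
have [x1 x2] := half xx.
pose w := ((c ^+ (2 ^ k))%:C * e (x / 2))%C.
have wE : ((c ^+ (2 ^ k.+1))%:C * e x)%C = w * w.
 rewrite /w expnS mul2n -addnn exprD rmorphM/= -(e_half x); ring.
have w2 : ((c ^+ (2 ^ k))%:C * e (x / 2 + pi))%C = - w by rewrite e_pi mulrN.
have h1 := IH _ x1 (u + w *: iter (2 ^ k) T u).
have h2 := IH _ x2 (u - w *: iter (2 ^ k) T u).
rewrite w2 scaleNr opprK -factor' in h2; rewrite -/w -factor in h1.
rewrite wE.
have h3 : 2 * rnorm u <= rnorm (u + w *: iter (2 ^ k) T u) + rnorm (u - w *: iter (2 ^ k) T u).
 have -> : 2 * rnorm u = rnorm (2%:C%C *: u) by rewrite rnormZ normc_real ger0_norm.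
 rewrite (_ : 2%:C%C *: u = (u + w *: iter (2 ^ k) T u) + (u - w *: iter (2 ^ k) T u)).
  exact: rnormD.
 rewrite addrACA subrr addr0.
 by rewrite (_ : 2%:C%C = 1 + 1 :> R[i]) ?scalerDl ?scale1r//; apply/eqP; rewrite eq_complex/= addr0 !eqxx.
lra.
Qed.

(** The equation is solved with the root [w] first and then with [- w]. *)
Lemma doubled_surj (c : R) :
 (forall x, 0 <= x <= 2 * pi -> forall v, exists u, u - (c%:C * e x)%C *: T u = v) ->
 forall k x, 0 <= x <= 2 * pi -> forall v, exists u,
  u - ((c ^+ (2 ^ k))%:C * e x)%C *: iter (2 ^ k) T u = v.
Proof.
move=> H; elim=> [|k IH] x xx v; first by rewrite expn0 expr1; exact: H.
have [x1 x2] := half xx.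
pose w := ((c ^+ (2 ^ k))%:C * e (x / 2))%C.
have wE : ((c ^+ (2 ^ k.+1))%:C * e x)%C = w * w.
 rewrite /w expnS mul2n -addnn exprD rmorphM/= -(e_half x); ring.
have w2 : ((c ^+ (2 ^ k))%:C * e (x / 2 + pi))%C = - w by rewrite e_pi mulrN.
have [a ha] := IH _ x1 v; have [u hu] := IH _ x2 a.
exists u; rewrite wE factor -ha -/w; rewrite w2 scaleNr opprK in hu.
by rewrite hu.
Qed.

(** Doubling expresses the inverse of [1 - T^(2^k)] as an average of the inverses of [1 - w T] over
    the [2^k]-th roots of unity [w]. Replacing [w] by [c w] with [c] slightly below 1 changes this
    average little, uniformly in [k], whereas [c^(2^k) T^(2^k)] tends to 0, so that the changed
    average is nearly the identity. Hence [1 - T^(2^k)] is nearly the identity too, and [T^(2^k)] is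
    small. *)
Lemma power_contraction : exists2 n, (1 <= n)%N &
 forall u, rnorm (iter n T u) <= rnorm u / 2.
Proof.
have [B B0 hB] := circle_resolvent.
have M0 : 0 < M by rewrite (lt_le_trans ltr01).
(* The size of [1 - c] ensures [B d M <= 1/2], for the bound at radius [c], and
   [2 e1 (1 + M) <= 1/2] with [e1 = 2 B^2 d M], for the final comparison. *)
pose d := Num.min (2^-1) (16 * (B + 1) ^+ 2 * M * (1 + M))^-1.
have P0 : 0 < 16 * (B + 1) ^+ 2 * M * (1 + M).
 by rewrite !mulr_gt0// ?exprn_gt0// ?addr_gt0.
have d0 : 0 < d by rewrite lt_min invr_gt0 ltr0n/= invr_gt0.
have d2 : d <= 2^-1 by rewrite ge_min lexx.
have dP : d * (16 * (B + 1) ^+ 2 * M * (1 + M)) <= 1.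
 by rewrite -ler_pdivlMr// mul1r ge_min lexx orbT.
pose c := 1 - d.
have c0 : 0 < c by rewrite /c; lra.
have c1 : c < 1 by rewrite /c; lra.
have h1 k x : 0 <= x <= 2 * pi -> forall u,
  rnorm u <= B * rnorm (u - e x *: iter (2 ^ k) T u).
 move=> xx u; have := @doubled_bound 1 B _ k x xx u; rewrite expr1n mul1r; apply.
 by move=> y yy w; rewrite mul1r; exact: hB.
pose B2 := 2 * B.
have hc x : 0 <= x <= 2 * pi -> forall u, rnorm u <= B2 * rnorm (u - (c%:C * e x)%C *: T u).
 move=> xx u; have h2 := hB _ xx u.
 have h3 : rnorm (u - e x *: T u) <= rnorm (u - (c%:C * e x)%C *: T u) + d * (M * rnorm u).
  rewrite (_ : u - e x *: T u = (u - (c%:C * e x)%C *: T u) + (((- d)%:C * e x)%C *: T u)).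
   rewrite (le_trans (rnormD _ _))// lerD2l rnormZ normcM e_norm mulr1 normc_real.
   rewrite normrN ger0_norm ?(ltW d0)// ler_wpM2l ?(ltW d0)//; exact: (T_bounded 1).
  rewrite -addrA; congr (_ + _); rewrite -!scaleNr -scalerDl; congr (_ *: _).
  rewrite /c rmorphB rmorphN/=; ring.
 have h4 : B * (d * (M * rnorm u)) <= rnorm u / 2.
  rewrite !mulrA [leRHS]mulrC ler_wpM2r ?rnorm_ge0//.
  have : 0 <= d * M * (1 + M) * B by rewrite !mulr_ge0// ?addr_ge0// ltW.
  have : 0 <= d * M * B * M by rewrite !mulr_ge0// ltW.
  have : 0 <= d * M * (1 + M) * (B * B) by rewrite !mulr_ge0// ?addr_ge0// ltW.
  have : 0 <= d * M * (1 + M) by rewrite !mulr_ge0// ?addr_ge0// ltW.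
  move: dP; rewrite !expr2; nra.
 have := ler_wpM2l (ltW B0) h3; rewrite mulrDr => h5.
 by rewrite /B2 -mulrA; lra.
have hck k x : 0 <= x <= 2 * pi -> forall u,
  rnorm u <= B2 * rnorm (u - ((c ^+ (2 ^ k))%:C * e x)%C *: iter (2 ^ k) T u).
 exact: doubled_bound hc k x.
have hs x : 0 <= x <= 2 * pi -> forall v, exists u, u - (c%:C * e x)%C *: T u = v.
 move=> xx; have [|//|_ _ [_ h]] := @resolvent (c%:C * e x)%C; last exact: h.
 - by rewrite normcM e_norm mulr1 normc_real ger0_norm ltW.
 - apply/eqP => h; have : normc (c%:C * e x)%C = 0 by rewrite h normc0.
  by rewrite normcM e_norm mulr1 normc_real => /eqP; rewrite normr_eq0 gt_eqF.
pose e1 := B * d * M * B2.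
have e1E : 2 * e1 * (1 + M) <= 2^-1.
 rewrite /e1 /B2; move: dP; rewrite !expr2.
 have : 0 <= d * M * (1 + M) * B by rewrite !mulr_ge0// ?addr_ge0// ltW.
 have : 0 <= d * M * (1 + M) by rewrite !mulr_ge0// ?addr_ge0// ltW.
 nra.
have e10 : 0 < e1 by rewrite /e1 /B2 !mulr_gt0.
(* The distance of the two solutions does not grow with [k]: at each doubling it is at most the
   average of two distances with the same right-hand side. *)
have cmp k : forall x, 0 <= x <= 2 * pi -> forall v u u',
  u - e x *: iter (2 ^ k) T u = v ->
  u' - ((c ^+ (2 ^ k))%:C * e x)%C *: iter (2 ^ k) T u' = v ->
  rnorm (u - u') <= e1 * rnorm v.
 elim: k => [|k IH] x xx v u u'.
  rewrite expn0 expr1/= => hu hu'.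
  have := hB _ xx (u - u'); have -> : (u - u') - e x *: T (u - u') = (d%:C * e x)%C *: T u'.
   have -> : T (u - u') = T u - T u' by have := iterD_ 1 u (- u'); rewrite (iterN_ 1).
   transitivity ((u - e x *: T u) - (u' - e x *: T u')).
    by rewrite scalerBr !opprB [LHS]addrACA [RHS]addrACA [- u' - _]addrC.
   rewrite hu -hu' opprB addrC addrA subrK -scalerBl; congr (_ *: _).
   by rewrite /c rmorphB/=; ring.
  rewrite rnormZ normcM e_norm mulr1 normc_real (ger0_norm (ltW d0)) => h.
  have h6 := hc _ xx u'; rewrite hu' in h6.
  have h7 := T_bounded 1 u'; rewrite /= in h7.
  apply: (le_trans h); rewrite /e1 -!mulrA ler_wpM2l ?(ltW B0)// ler_wpM2l ?(ltW d0)//.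
  by rewrite (le_trans h7)// ler_wpM2l ?(ltW M0)// mulrA.
 have [x1 x2] := half xx.
 pose S := iter (2 ^ k) T.
 pose w := e (x / 2); pose w' := ((c ^+ (2 ^ k))%:C * e (x / 2))%C.
 have w'E : ((c ^+ (2 ^ k.+1))%:C * e x)%C = w' * w'.
  rewrite /w' expnS mul2n -addnn exprD rmorphM/= -(e_half x); ring.
 rewrite w'E -(e_half x) -/w => hu hu'.
 have a1 := IH _ x1 v (u + w *: S u) (u' + w' *: S u').
 have a2 := IH _ x2 v (u - w *: S u) (u' - w' *: S u').
 rewrite -/w -/w' -!factor hu hu' in a1.
 rewrite e_pi mulrN -/w -/w' !scaleNr !opprK -!factor' hu hu' in a2.
 have {}a1 := a1 erefl erefl; have {}a2 := a2 erefl erefl.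
 have h3 : 2 * rnorm (u - u') <=
   rnorm (u + w *: S u - (u' + w' *: S u')) + rnorm (u - w *: S u - (u' - w' *: S u')).
  have -> : 2 * rnorm (u - u') = rnorm (2%:C%C *: (u - u')) by rewrite rnormZ normc_real ger0_norm.
  rewrite (_ : 2%:C%C *: (u - u') = (u + w *: S u - (u' + w' *: S u')) + (u - w *: S u - (u' - w' *: S u'))).
   exact: rnormD.
  rewrite (_ : 2%:C%C = 1 + 1 :> R[i]) ?scalerDl ?scale1r//; last first.
   by apply/eqP; rewrite eq_complex/= addr0 !eqxx.
  rewrite !opprD !opprK (addrACA u (w *: S u)) (addrACA u (- (w *: S u))).
  by rewrite [RHS]addrACA (addrACA (w *: S u)) subrr addNr !addr0.
 lra.
have : c ^+ k * (M * B2) @[k --> \oo] --> (0 : R).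
 rewrite -[X in _ --> X](mul0r (M * B2)); apply: cvgM; last exact: cvg_cst.
 by apply: cvg_expr; rewrite ger0_norm// ltW.
move=> /cvgrPdist_le/(_ _ e10)[k _ hk].
have {}hk : c ^+ (2 ^ k) * (M * B2) <= e1.
 have := hk (2 ^ k)%N (ltnW (ltn_expl k _)); rewrite sub0r normrN => /(_ isT).
 exact/le_trans/ler_norm.
have x0 : 0 <= (0 : R) <= 2 * pi by rewrite lexx mulr_ge0// pi_ge0.
exists (2 ^ k)%N => [|u]; first by rewrite expn_gt0.
pose v := u - iter (2 ^ k) T u.
have [u' hu'] := doubled_surj hs k x0 v.
have hv : u - e 0 *: iter (2 ^ k) T u = v by rewrite e0 scale1r.
have b1 := @cmp k 0 x0 v u u' hv hu'.
have b2 := hck k 0 x0 u'; rewrite hu' in b2.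
have b3 : rnorm (u' - v) <= e1 * rnorm v.
 have -> : u' - v = ((c ^+ (2 ^ k))%:C * e 0)%C *: iter (2 ^ k) T u'.
  by rewrite -hu' opprB addrC subrK.
 rewrite rnormZ normcM e_norm mulr1 normc_real ger0_norm ?exprn_ge0 ?(ltW c0)//.
 rewrite (le_trans (_ : _ <= c ^+ (2 ^ k) * (M * (B2 * rnorm v))))//.
  rewrite ler_wpM2l ?exprn_ge0 ?(ltW c0)// (le_trans (T_bounded _ _))//.
  by rewrite ler_wpM2l// ltW.
 by rewrite (mulrA M) (mulrA (c ^+ _)) ler_wpM2r ?rnorm_ge0.
(* Both differences are at most [e1] times the norm of [v], itself at most [1 + M] times that of
   [u]. *)
have -> : iter (2 ^ k) T u = (u - u') + (u' - v).
 by rewrite addrA subrK /v opprB addrC subrK.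
have b4 : rnorm v <= (1 + M) * rnorm u.
 by rewrite /v (le_trans (rnormB _ _))// mulrDl mul1r lerD2l.
rewrite (le_trans (rnormD _ _))// (le_trans (lerD b1 b3))//.
have e2 : 0 <= 2 * e1 by rewrite mulr_ge0// ltW.
have b5 := ler_wpM2l e2 b4; have b6 := ler_wpM2r (rnorm_ge0 u) e1E.
lra.
Qed.

End spectral_radius_theory.

(** Banach's fixed point theorem with ratio 1/2 on a closed subset. Closedness is phrased by
    approximation, which is directly checkable for a ball of mean-zero functions. *)
Lemma halving_fixpoint (R : realType) (V : completeNormedModType R[i]) (f : V -> V)
  (S : V -> Prop) (x0 : V) : S x0 -> (forall x, S x -> S (f x)) ->
 (forall x y, S x -> S y -> rnorm (f x - f y) <= rnorm (x - y) / 2) ->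
 (forall x, (forall e, 0 < e -> exists y, S y /\ rnorm (x - y) <= e) -> S x) ->
 exists x, S x /\ f x = x.
Proof.
move=> S0 Sf fl Scl; pose x k := iter k f x0; pose d := rnorm (f x0 - x0).
have d0 : 0 <= d by exact: rnorm_ge0.
have Sx k : S (x k) by elim: k => // k IH; exact: Sf.
have x1 k : rnorm (x k.+1 - x k) <= d * 2^-1 ^+ k.
 elim: k => [|k IH]; first by rewrite expr0 mulr1.
 apply: (le_trans (fl (x k.+1) (x k) (Sx _) (Sx _))).
 by rewrite exprSr mulrA ler_wpM2r.
have xm k m : rnorm (x (k + m)%N - x k) <= d * 2^-1 ^+ k * (2 - 2 * 2^-1 ^+ m).
 elim: m => [|m IH]; first by rewrite addn0 subrr rnorm0 expr0 mulr1 subrr mulr0.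
 rewrite addnS (_ : _ - _ = (x (k + m).+1 - x (k + m)%N) + (x (k + m)%N - x k)); last first.
  by rewrite addrA subrK.
 rewrite (le_trans (rnormD _ _))// (le_trans (lerD (x1 _) IH))//.
 by rewrite exprD exprS; apply: eq_ler; field.
have h0 m : 0 <= 2^-1 ^+ m :> R by rewrite exprn_ge0.
have xm2 k m : (k <= m)%N -> rnorm (x m - x k) <= 2 * d * 2^-1 ^+ k.
 move=> km; rewrite -(subnKC km) (le_trans (xm _ _))//.
 rewrite mulrC mulrA ler_wpM2r// ler_wpM2r// lerBlDr lerDl mulr_ge0//.
have small e : 0 < e -> exists k, 2 * d * 2^-1 ^+ k < e.
 move=> e0; have : 2 * d * 2^-1 ^+ k @[k --> \oo] --> (0 : R).
  rewrite -[X in _ --> X](mulr0 (2 * d)); apply: cvgM; first exact: cvg_cst.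
  by apply: cvg_expr; rewrite ger0_norm// invf_lt1// ltr1n.
 move=> /cvgrPdist_lt/(_ _ e0)[k _ /(_ k (leqnn k))/=].
 by rewrite sub0r normrN => /(le_lt_trans (ler_norm _)) h; exists k.
have Rpos (e : R[i]) : 0 < e -> e = (complex.Re e)%:C%C /\ 0 < complex.Re e.
 by case: e => a b; rewrite ltcE/= => /andP[/eqP -> ->].
have : cvgn x.
 apply: cauchy_cvg; apply: cauchy_exP => e /Rpos[-> e0].
 have [k hk] := small _ e0; exists (x k); exists k => // m /= km.
 by rewrite -ball_normE /= distrC rnormE ltcR (le_lt_trans (xm2 _ _ km)).
move=> /cvg_ex[l xl].
have xl' e : 0 < e -> exists k, forall m, (k <= m)%N -> rnorm (l - x m) <= e.
 move=> e0; have eC : 0 < e%:C%C by rewrite ltcR.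
 have /cvgrPdist_le/(_ _ eC)[k _ hk] := xl.
 by exists k => m km; have := hk m km; rewrite /= rnormE lecR.
have Sl : S l.
 by apply: Scl => e /xl'[k /(_ k (leqnn k)) h]; exists (x k).
exists l; split => //; apply/subr0_eq/rnorm_eq0/eqP.
rewrite eq_le rnorm_ge0 andbT leNgt; apply/negP => h.
have h2 : 0 < rnorm (f l - l) / 2 by rewrite divr_gt0.
have [k hk] := xl' _ h2.
have := rnormB (f l - f (x k)) (l - x k.+1); rewrite opprB addrA subrK.
have a1 := fl _ _ Sl (Sx k); have a2 := hk k (leqnn k); have a3 := hk k.+1 (leqW (leqnn k)).
lra.
Qed.

(** * Twisted transfer operators: decay, leading eigenvalue, expansion of powers *)

Section operator.
Context d (Y : measurableType d) (R : realType) (mu : probability Y R).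
Variables (F : Y -> Y) (tau : Y -> R) (P : (Y -> R[i]) -> (Y -> R[i])).
Hypothesis F_mp : measure_preserving mu F.
Hypothesis tau_meas : mfunT tau.
Hypothesis tau_pos : forall y, 0 < tau y.
Hypothesis F_mixing : mixing mu F.
Hypothesis P_transfer : transfer_operator mu F P.
Variables (BB : banach_fun_space mu) (p delta L alpha C : R).
Hypothesis p_gt1 : 1 < p.
Hypothesis delta_gt0 : 0 < delta.
Hypothesis alpha01 : 0 < alpha < 1.
Hypothesis C_gt0 : 0 < C.
Hypothesis Hcst : forall c : R[i], in_space BB (fun=> c).
Hypothesis Hcomp : compactly_embedded BB p%:E.
Variable T : R[i] -> BB -> BB.
Local Notation D := (halfdisc_segment delta L).
Local Notation Np v := (fine (cLnorm mu p%:E (bfun v))).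
Hypothesis T_induced : forall s, D s -> induces (Rhat P tau s) (T s).
Hypothesis T_LY : forall s, D s -> forall v n, (1 <= n)%N ->
 rnorm (iter n (T s) v) <= C * (Np v + alpha ^+ n * rnorm v).
Implicit Types (u v : BB) (w : Y -> R[i]) (s : R[i]).

(** A bilinear pairing, without conjugation. Identities in [BB] are tested through it, since
    elements of [BB] and values of [P] are determined only up to null sets. *)
Definition cpair v w : R[i] := cintegral mu (fun y => bfun v y * w y).

Definition laplace_weight s n y : R[i] :=
 cexp (- (s * (birkhoff_sum F tau n y)%:C%C)).
Local Notation es := laplace_weight.

Definition btest w := cmeasurable w /\ exists M, forall y, normc (w y) <= M.

Lemma btestM w1 w2 : btest w1 -> btest w2 -> btest (fun y => w1 y * w2 y).
Proof.
move=> [m1 [M1 b1]] [m2 [M2 b2]]; split; first exact: cmeasurableM.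
exists (M1 * M2) => y; rewrite normcM ler_pM ?normc_ge0//.
Qed.

Lemma btest_iter n w : btest w -> btest (w \o iter n F).
Proof.
move=> [m1 [M b]]; split; last by exists M => y; exact: b.
exact: (cmeasurable_comp (measurable_iter F_mp n)).
Qed.

Lemma btest_cst c : btest (fun=> c).
Proof. by split; [exact: cmeasurable_cst|exists (normc c)]. Qed.

Lemma normc_indic E (y : Y) : normc ((\1_E y : R)%:C%C) <= 1.
Proof. by rewrite normc_real indicE; case: (_ \in _); rewrite ?normr1 ?normr0. Qed.

Lemma btest_indic E : measurable E -> btest (fun y => (\1_E y : R)%:C%C).
Proof.
move=> mE; split; last by exists 1 => y; exact: normc_indic.
by apply: cmeasurable_real.
Qed.

Lemma birkhoff_ge0 n y : 0 <= birkhoff_sum F tau n y.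
Proof. by apply: sumr_ge0 => j _; exact: ltW. Qed.

Lemma D_Re s : D s -> 0 <= complex.Re s.
Proof. by case=> [[]|[->]]. Qed.

Lemma normc_es s n y : 0 <= complex.Re s -> normc (es s n y) <= 1.
Proof.
move=> s0; apply: cexp_le1; rewrite ReM/= mulr0 subr0 mulr_ge0//.
exact: birkhoff_ge0.
Qed.

Lemma cmeasurable_es s n : cmeasurable (es s n).
Proof.
apply/cmeasurable_cexp/cmeasurableN/cmeasurableM; first exact: cmeasurable_cst.
by apply: cmeasurable_real; apply: measurable_birkhoff F_mp tau_meas n.
Qed.

Lemma btest_es s n : 0 <= complex.Re s -> btest (es s n).
Proof.
by move=> s0; split; [exact: cmeasurable_es|exists 1 => y; exact: normc_es].
Qed.

Lemma es0 n y : es 0 n y = 1.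
Proof. by rewrite /laplace_weight mul0r oppr0 cexp0. Qed.

Lemma bfun_Lp v : in_Lp mu p%:E (bfun v).
Proof. by have [] := Hcomp. Qed.

Lemma bfun_cintegrable v : cintegrable mu (bfun v).
Proof. by have [] := in_Lp_cintegrable p_gt1 (bfun_Lp v). Qed.

Lemma bfun_cmeasurable v : cmeasurable (bfun v).
Proof. exact: (cintegrable_cmeasurable (bfun_cintegrable v)). Qed.

Lemma cintegrable_test (f : Y -> R[i]) w : cintegrable mu f -> btest w ->
 cintegrable mu (fun y => f y * w y).
Proof. by move=> fi [mw [M wM]]; exact: (cintegrableM_bounded fi mw wM). Qed.

Lemma cpair_integrable v w : btest w -> cintegrable mu (fun y => bfun v y * w y).
Proof. exact/cintegrable_test/bfun_cintegrable. Qed.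

Lemma cpairD a u v w : btest w -> cpair (a *: u + v) w = a * cpair u w + cpair v w.
Proof.
move=> bw; have [mw _] := bw.
rewrite /cpair -cintegralZ; last exact: cpair_integrable.
rewrite -cintegralD; [|apply: cintegrableZ; exact: cpair_integrable|exact: cpair_integrable].
apply: cintegral_ae.
- by apply: cmeasurableM => //; exact: bfun_cmeasurable.
- apply: cmeasurableD; last by apply: cmeasurableM => //; exact: bfun_cmeasurable.
 apply: cmeasurableM; first exact: cmeasurable_cst.
 by apply: cmeasurableM => //; exact: bfun_cmeasurable.
- by have := bfun_linear a u v; apply: filterS => y h yT; rewrite h//; ring.
Qed.

Lemma cpair0 w : btest w -> cpair 0 w = 0.
Proof.
move=> bw; have := cpairD 1 0 0 bw; rewrite scaler0 addr0 mul1r.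
by move/(congr1 (fun x => x - cpair 0 w)); rewrite subrr addrK.
Qed.

Lemma cpairZ a v w : btest w -> cpair (a *: v) w = a * cpair v w.
Proof. by move=> bw; rewrite -[a *: v]addr0 cpairD// cpair0// addr0. Qed.

Lemma cpairB u v w : btest w -> cpair (u - v) w = cpair u w - cpair v w.
Proof. by move=> bw; rewrite addrC -scaleN1r cpairD// mulN1r addrC. Qed.

Lemma cpair_ae v (f w : Y -> R[i]) : btest w -> cmeasurable f ->
 bfun v = f %[ae mu] -> cpair v w = cintegral mu (fun y => f y * w y).
Proof.
move=> [mw _] mf vf; apply: cintegral_ae.
- by apply: cmeasurableM => //; exact: bfun_cmeasurable.
- exact: cmeasurableM.
- by apply: filterS vf => y h yT; rewrite h.
Qed.

Lemma bfun_ext v : (forall E, measurable E ->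
 cpair v (fun y => (\1_E y : R)%:C%C) = 0) -> v = 0.
Proof.
move=> h; apply: bfun_inj; apply: cintegral_eq0_ae => //.
exact: bfun_cintegrable.
Qed.

Lemma cpair_bound v w M : cmeasurable w -> (forall y, normc (w y) <= M) ->
 normc (cpair v w) <= 2 * M * Np v.
Proof.
move=> mw wM.
have [iv ivN] := in_Lp_cintegrable p_gt1 (bfun_Lp v).
have iw := cintegrableM_bounded iv mw wM.
apply: (le_trans (normc_cintegral iw)); rewrite -mulrA ler_wpM2l//.
have M0 : 0 <= M.
 have [[y _]|h] := pselect (exists y : Y, True).
  by rewrite (le_trans _ (wM y))// normc_ge0.
 have : mu setT = 0.
  rewrite (_ : setT = set0) ?measure0//.
  by rewrite -subset0 => y _; apply: h; exists y.
 by rewrite probability_setT => /eqP; rewrite eqe oner_eq0.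
rewrite (le_trans (_ : _ <= \int[mu]_y (M * normc (bfun v y)))) //.
 apply: Rintegral_le; first exact: cintegrable_normc.
  by apply: rintegrableZ; exact: cintegrable_normc.
 by move=> y; rewrite normcM mulrC ler_wpM2r ?normc_ge0.
by rewrite RintegralZl//; [rewrite ler_wpM2l|exact: cintegrable_normc].
Qed.

Lemma cpair_weight v (g w : Y -> R[i]) : cmeasurable w -> (forall y, normc (w y) <= 1) ->
 cmeasurable g -> (forall y, normc (g y) <= 1) ->
 normc (cpair v (fun y => g y * w y)) <=
  2 * Np v * (\int[mu]_y normc (g y)) `^ (1 - p^-1).
Proof.
move=> mw w1 mg g1.
have gw1 y : normc (g y * w y) <= 1.
 by rewrite normcM mulr_ile1 ?normc_ge0.
have iw := cintegrableM_bounded (bfun_cintegrable v) (cmeasurableM mg mw) gw1.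
apply: (le_trans (normc_cintegral iw)); rewrite -mulrA ler_wpM2l//.
have [] := hoelder_unit p_gt1 (bfun_Lp v) (measurable_normc mg).
 by move=> y; rewrite normc_ge0 g1.
move=> ig; apply: le_trans; apply: Rintegral_le => //; first exact: cintegrable_normc.
by move=> y; rewrite !normcM ler_wpM2l ?normc_ge0// ler_piMr ?normc_ge0.
Qed.

Lemma P_pair (g w : Y -> R[i]) : cintegrable mu g -> btest w ->
 cintegrable mu (P g) /\
 cintegral mu (fun y => P g y * w y) = cintegral mu (fun y => g y * w (F y)).
Proof.
move=> gi [mw [M wM]]; have [h1 h2] := P_transfer ((in_L1P mu g).2 gi).
split; first exact/in_L1P.
exact: (h2 _ (in_Loo_bounded mu mw wM)).
Qed.

Lemma es1E s y : es s 1 y = cexp (- (s * (tau y)%:C%C)).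
Proof. by rewrite /laplace_weight birkhoffS birkhoff0 add0r. Qed.

Lemma esS s n y : es s n.+1 y = es s n y * es s 1 (iter n F y).
Proof.
rewrite es1E /laplace_weight birkhoffS -cexpD; congr cexp.
by rewrite rmorphD/=; ring.
Qed.

Lemma T_pair s v w : D s -> btest w ->
 cpair (T s v) w = cpair v (fun y => es s 1 y * w (F y)).
Proof.
move=> Ds bw; have s0 := D_Re Ds.
have gi : cintegrable mu (fun y => es s 1 y * bfun v y).
 under eq_fun do rewrite mulrC.
 exact/cpair_integrable/btest_es.
have [iP PE] := P_pair gi bw.
rewrite (@cpair_ae _ (P (fun y => es s 1 y * bfun v y)))//.
- by rewrite PE; congr cintegral; apply/funext => y; ring.
- exact: (cintegrable_cmeasurable iP).
- have := T_induced Ds v; rewrite /Rhat.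
 by under [X in P X]eq_fun do rewrite -es1E.
Qed.

(** Iterated duality: each application of [T s] multiplies by [e^(- s tau)] and composes the test
    function with [F], and the weights accumulate along the orbit. This is the link between powers
    of [T s] and Birkhoff sums. *)
Lemma iterT_pair s n v w : D s -> btest w ->
 cpair (iter n (T s) v) w = cpair v (fun y => es s n y * w (iter n F y)).
Proof.
move=> Ds; elim: n w => [|n IH] w bw.
 congr cintegral; apply/funext => y.
 by rewrite /laplace_weight birkhoff0 rmorph0 mulr0 oppr0 cexp0 mul1r.
rewrite iterS T_pair// IH; last first.
 apply: btestM; first exact: btest_es (D_Re Ds).
 exact: (btest_iter 1 bw).
congr cintegral; apply/funext => y.
by rewrite [in RHS]esS [in RHS]iterS -!mulrA.
Qed.

(** Linearity is not part of the data; it is recovered by duality, testing on indicators. *)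
Lemma T_linear s a u v : D s -> T s (a *: u + v) = a *: T s u + T s v.
Proof.
move=> Ds; apply/subr0_eq; apply: bfun_ext => E mE.
have bE := btest_indic mE.
have bE' : btest (fun y => es s 1 y * (\1_E (F y) : R)%:C%C).
 apply: btestM; first exact/btest_es/D_Re.
 exact: (btest_iter 1 bE).
rewrite cpairB// cpairD// !T_pair// cpairD//.
by rewrite subrr.
Qed.

Lemma T0 s : D s -> T s 0 = 0.
Proof.
move=> Ds; have := T_linear 1 0 0 Ds; rewrite scaler0 addr0 scale1r.
by move/(congr1 (fun x => x - T s 0)); rewrite subrr addrK.
Qed.

Lemma iterT_linear s n a u v : D s ->
 iter n (T s) (a *: u + v) = a *: iter n (T s) u + iter n (T s) v.
Proof.
by move=> Ds; elim: n => // n IH; rewrite !iterS IH T_linear.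
Qed.

Lemma iterT0 s n : D s -> iter n (T s) 0 = 0.
Proof. by move=> Ds; elim: n => // n IH; rewrite iterS IH T0. Qed.

Lemma iterTZ s n a v : D s -> iter n (T s) (a *: v) = a *: iter n (T s) v.
Proof. by move=> Ds; rewrite -[a *: v]addr0 iterT_linear// iterT0// addr0. Qed.

Lemma iterTB s n u v : D s ->
 iter n (T s) (u - v) = iter n (T s) u - iter n (T s) v.
Proof. by move=> Ds; rewrite addrC -scaleN1r iterT_linear// scaleN1r addrC. Qed.

Lemma Np_ge0 v : 0 <= Np v.
Proof. exact/fine_ge0/Lnorm_ge0. Qed.

Lemma NpZ a v : Np (a *: v) = normc a * Np v.
Proof.
rewrite -(cLnormZ _ p_gt1 (bfun_Lp v)); congr fine; apply: cLnorm_ae.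
- exact: bfun_cmeasurable.
- by apply: cmeasurableM; [exact: cmeasurable_cst|exact: bfun_cmeasurable].
- have := bfun_linear a v 0; rewrite addr0.
 have := bfun_linear 1 (0 : BB) 0; rewrite scaler0 addr0.
 apply: filterS2 => y h0 h yT; rewrite h//.
 have := h0 yT; rewrite mul1r.
 by move=> /eqP; rewrite -subr_eq subrr => /eqP <-; rewrite addr0.
Qed.

(** Compactness implies boundedness: otherwise elements of the unit ball have L^p norms above every
    [k], yet some L^p-convergent subsequence of them is bounded. *)
Lemma embedding_bounded : exists2 K, 0 < K & forall v, Np v <= K * rnorm v.
Proof.
apply: contrapT => nK.
have H (k : nat) : exists v, rnorm v <= 1 /\ k%:R < Np v.
 apply: contrapT => Hk; apply: nK; exists k.+1%:R => // v.
 rewrite leNgt; apply/negP => kv.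
 have [v0|v0] := eqVneq (rnorm v) 0.
  move: kv; rewrite v0 mulr0 (rnorm_eq0 v0).
  by have := NpZ 0 (0 : BB); rewrite scale0r normc0 mul0r => ->; rewrite ltxx.
 have vp : 0 < rnorm v by rewrite lt_neqAle eq_sym v0 rnorm_ge0.
 apply: Hk; exists (((rnorm v)^-1)%:C%C *: v).
 rewrite rnormZ NpZ normc_real gtr0_norm ?invr_gt0// mulVf//; split => //.
 rewrite mulrC ltr_pdivlMr// (le_lt_trans _ kv)// ler_wpM2r ?rnorm_ge0//.
 by rewrite ler_nat.
have /choice[u uP] := H.
have [_ /(_ u)] := Hcomp; case.
 by exists 1 => k; have [] := uP k.
move=> phi [hphi [f [Lf /fine_cvgP[fin cf]]]].
have mf := Lf.1.
have : \forall k \near \oo, Np (u (phi k)) <= 1 + fine (cLnorm mu p%:E f).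
 have /cvgrPdist_le/(_ 1 ltr01) := cf.
 apply: filterS2 fin => k fk; rewrite sub0r normrN/= => h.
 have := @cLnormD _ _ _ mu p (fun y => bfun (u (phi k)) y - f y) f p_gt1.
 move=> /(_ (cmeasurableB (bfun_cmeasurable _) mf) mf).
 under [X in (cLnorm _ _ X <= _)%E]eq_fun do rewrite subrK.
 move=> h2.
 have ff : cLnorm mu p%:E f \is a fin_num by rewrite ge0_fin_numE ?Lnorm_ge0//; case: Lf.
 have uf : cLnorm mu p%:E (bfun (u (phi k))) \is a fin_num.
  by rewrite ge0_fin_numE ?Lnorm_ge0//; case: (bfun_Lp (u (phi k))).
 have {h2}:= fine_le uf _ h2; rewrite fin_numD fk ff fineD// => /(_ isT).
 move/le_trans; apply; rewrite lerD2r (le_trans (ler_norm _))//.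
move=> [N _ /(_ _ _)] hN.
have [m hm] : exists m : nat, 1 + fine (cLnorm mu p%:E f) <= m%:R.
 by exists (Num.bound (1 + fine (cLnorm mu p%:E f))); apply/ltW/archi_boundP; rewrite addr_ge0// fine_ge0// Lnorm_ge0.
pose k := maxn N m.
have gk j : (j <= phi j)%N.
 by elim: j => // j; move/leq_ltn_trans; apply; exact: hphi.
have := hN k (leq_maxl _ _); apply/negP; rewrite -ltNge.
apply: (le_lt_trans hm); apply: le_lt_trans (uP (phi k)).2.
by rewrite ler_nat (leq_trans _ (gk k))// leq_maxr.
Qed.

Lemma cvg_fineP (f : nat -> \bar R) : f n @[n --> \oo] --> 0%E ->
 fine (f n) @[n --> \oo] --> (0 : R).
Proof. by move/fine_cvgP => []. Qed.

Lemma Lp_dist (v : BB) f w : in_Lp mu p%:E f -> cmeasurable w ->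
 (forall y, normc (w y) <= 1) ->
 (cLnorm mu p%:E (fun y => (bfun v y - f y)%R) < +oo)%E ->
 normc (cpair v w - cintegral mu (fun y => f y * w y)) <=
  2 * fine (cLnorm mu p%:E (fun y => bfun v y - f y)).
Proof.
move=> Lf mw w1 fin.
have [fi _] := in_Lp_cintegrable p_gt1 Lf.
have Ld : in_Lp mu p%:E (fun y => bfun v y - f y).
 by split=> //; apply: cmeasurableB; [exact: bfun_cmeasurable|case: Lf].
have bw : btest w by split => //; exists 1.
rewrite /cpair -cintegralB; [|exact: cpair_integrable|exact: cintegrable_test].
under [X in cintegral _ X]eq_fun do rewrite -mulrBl.
have [di dN] := in_Lp_cintegrable p_gt1 Ld.
apply: (le_trans (normc_cintegral (cintegrable_test di bw))).
rewrite ler_wpM2l// (le_trans _ dN)//; apply: Rintegral_le.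
- exact/cintegrable_normc/cintegrable_test.
- exact: cintegrable_normc.
- by move=> y; rewrite normcM ler_piMr ?normc_ge0.
Qed.

(** Compactness in the form used below: the extracted indices stay inside a prescribed subsequence,
    and pairings converge uniformly over test functions of modulus at most 1, so that the test
    function may depend on the index. The last clause holds only eventually, because [fine] sends an
    infinite norm to 0. *)
Lemma bounded_extract (u : nat -> BB) (g : nat -> nat) M :
 (forall n, rnorm (u n) <= M) -> {homo g : i j / (i < j)%N} ->
 exists h : nat -> nat, {homo h : i j / (i < j)%N} /\ exists f, [/\ in_Lp mu p%:E f,
  fine (cLnorm mu p%:E (fun y => bfun (u (h k)) y - f y)) @[k --> \oo] --> (0 : R),
  (exists r : nat -> nat, {homo r : i j / (i < j)%N} /\ forall k, h k = g (r k)) &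
  \forall k \near \oo, forall w, cmeasurable w -> (forall y, normc (w y) <= 1) ->
   normc (cpair (u (h k)) w - cintegral mu (fun y => f y * w y)) <=
  2 * fine (cLnorm mu p%:E (fun y => bfun (u (h k)) y - f y))].
Proof.
move=> uM hg; have [_ /(_ (u \o g))] := Hcomp; case; first by exists M => k; exact: uM.
move=> phi [hphi [f [Lf cf]]].
exists (g \o phi); split; first by move=> i j ij; exact/hg/hphi.
exists f; split => //.
- exact: (cvg_fineP cf).
- by exists phi.
- have /fine_cvgP[fin _] := cf.
 apply: filterS fin => k fk w mw w1; apply: Lp_dist => //.
 by move: fk; rewrite ge0_fin_numE// Lnorm_ge0.
Qed.

(** An L^p limit of a subsequence pairs to 0 with all indicators and is therefore null; by
    compactness the whole sequence tends to 0 in L^p. *)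
Lemma weakly_null_Lp (u : nat -> BB) M : (forall n, rnorm (u n) <= M) ->
 (forall E, measurable E ->
  normc (cpair (u n) (fun y => (\1_E y : R)%:C%C)) @[n --> \oo] --> (0 : R)) ->
 Np (u n) @[n --> \oo] --> (0 : R).
Proof.
move=> uM u0; apply: contrapT => nu.
have [e e0 [g [hg ge]]] := not_cvg0_subseq (fun n => Np_ge0 (u n)) nu.
have [h [hh [f [Lf cf [r [hr hE]] cw]]]] := bounded_extract uM hg.
have [fi _] := in_Lp_cintegrable p_gt1 Lf.
have f0 : f = (fun=> 0) %[ae mu].
 apply: (cintegral_eq0_ae fi) => E mE; apply: eq0_normc.
 have mI : cmeasurable (fun y => (\1_E y : R)%:C%C) by case: (btest_indic mE).
 have cz : normc (cpair (u (h n)) (fun y => (\1_E y : R)%:C%C)) +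
   2 * fine (cLnorm mu p%:E (fun y => bfun (u (h n)) y - f y)) @[n --> \oo] --> (0 : R).
  rewrite -[0 in X in _ --> X]addr0 -[X in _ --> _ + X](mulr0 2); apply: cvgD.
   exact: (cvg_subseq hh (u0 _ mE)).
  by apply: cvgM; [exact: cvg_cst|exact: cf].
 apply/eqP; rewrite eq_le normc_ge0 andbT.
 apply: (ler_cvg_to (cvg_cst _) cz).
 apply: filterS cw => k /(_ _ mI (normc_indic E)) hk.
 rewrite (le_trans (normc_dist _ (cpair (u (h k)) (fun y => (\1_E y : R)%:C%C))))//.
 by rewrite lerD2l normc_distC.
have cu : Np (u (h n)) @[n --> \oo] --> (0 : R).
 suff -> : (fun n => Np (u (h n))) =
  (fun n => fine (cLnorm mu p%:E (fun y => bfun (u (h n)) y - f y))) by exact: cf.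
 apply/funext => k; congr fine; apply/esym/cLnorm_ae.
 - by apply: cmeasurableB; [exact: bfun_cmeasurable|case: Lf].
 - exact: bfun_cmeasurable.
 - by apply: filterS f0 => y fy yT; rewrite fy// subr0.
have : e <= 0.
 apply: (ler_cvg_to (cvg_cst _) cu); near=> k; rewrite hE ltW//.
by rewrite leNgt e0.
Unshelve. all: end_near. Qed.

(** Mixing concerns a fixed function, whereas [v n] varies. Along a subsequence [v n] is close in
    L^p to a fixed [f], also of mean 0, and mixing is applied to [f]. *)
Lemma mixing_weak_decay (v : nat -> BB) M : (forall n, rnorm (v n) <= M) ->
 (forall n, cpair (v n) (fun=> 1) = 0) -> forall E, measurable E ->
 normc (cpair (v n) (fun y => (\1_E (iter n F y) : R)%:C%C)) @[n --> \oo] --> (0 : R).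
Proof.
move=> vM v0 E mE; apply: contrapT => nu.
have [e e0 [g [hg ge]]] := not_cvg0_subseq (fun n => normc_ge0 _) nu.
have [h [hh [f [Lf cf [r [hr hE]] cw]]]] := bounded_extract vM hg.
have [fi _] := in_Lp_cintegrable p_gt1 Lf.
have c2 : 2 * fine (cLnorm mu p%:E (fun y => bfun (v (h n)) y - f y)) @[n --> \oo] --> (0 : R).
 by rewrite -[0 in X in _ --> X](mulr0 2); apply: cvgM; [exact: cvg_cst|exact: cf].
have If : cintegral mu f = 0.
 apply: eq0_normc; apply/eqP; rewrite eq_le normc_ge0 andbT.
 apply: (ler_cvg_to (cvg_cst _) c2).
 apply: filterS cw => k /(_ (fun=> 1) (@cmeasurable_cst _ Y R 1)).
 rewrite v0 sub0r normcN; under [X in cintegral _ X]eq_fun do rewrite mulr1.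
 by apply => y; rewrite normc1.
have mf := mixing_cintegrable F_mp F_mixing mE fi If.
have : e <= 0.
 have cm : normc (cintegral mu (fun y => f y * (\1_E (iter (h n) F y) : R)%:C%C)) +
   2 * fine (cLnorm mu p%:E (fun y => bfun (v (h n)) y - f y)) @[n --> \oo] --> (0 : R).
  rewrite -[X in _ --> X](addr0 (0 : R)); apply: cvgD; last by [].
  exact: (cvg_subseq hh mf).
 apply: (ler_cvg_to (cvg_cst _) cm).
 apply: filterS cw => k cwk.
 have := ge (r k); rewrite -hE => /ltW/le_trans; apply.
 have bE := btest_iter (h k) (btest_indic mE).
 rewrite (le_trans (normc_dist _ (cintegral mu (fun y => f y * (\1_E (iter (h k) F y) : R)%:C%C))))//.
 by rewrite lerD2l; apply: cwk => [|y]; [case: bE|exact: normc_indic].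
by rewrite leNgt e0.
Qed.

Lemma weight_dist n s s0 y : 0 <= complex.Re s -> 0 <= complex.Re s0 ->
 normc (es s n y - es s0 n y) <=
  Num.min 2 (3 * normc (s - s0) * birkhoff_sum F tau n y).
Proof.
move=> hs hs0; rewrite le_min; apply/andP; split.
 by rewrite (le_trans (normcB _ _))// lerD// normc_es.
have b0 := birkhoff_ge0 n y.
have Re_ge0 t : 0 <= complex.Re t -> 0 <= complex.Re (t * (birkhoff_sum F tau n y)%:C%C).
 by move=> t0; rewrite ReM/= mulr0 subr0 mulr_ge0.
rewrite (le_trans (normc_cexpB (Re_ge0 _ hs) (Re_ge0 _ hs0)))//.
by rewrite -mulrBl normcM normc_real (ger0_norm b0) mulrA.
Qed.

(** The difference of weights is at most the minimum of 2 and a multiple of [|s - s0| tau_n]; the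
    truncation makes dominated convergence applicable whatever the tail of [tau_n]. *)
Lemma weight_continuous n e : 0 < e -> exists2 r, 0 < r &
 forall s s0, 0 <= complex.Re s -> 0 <= complex.Re s0 -> normc (s - s0) < r ->
 \int[mu]_y normc (es s n y - es s0 n y) <= e.
Proof.
move=> e0; have mS := measurable_birkhoff F_mp tau_meas n.
pose f (k : nat) y : R := Num.min 2 (3 * k.+1%:R^-1 * birkhoff_sum F tau n y).
have mf k : mfunT (f k).
 by apply: measurable_minr => //; apply: measurable_funM.
have f0 k y : 0 <= f k y.
 by rewrite le_min ler0n/= !mulr_ge0// birkhoff_ge0.
have f2 k y : f k y <= 2 by rewrite ge_min lexx.
have if_ k : rintegrable mu (f k).
 by apply: (rintegrable_bounded mu (mf k) (M := 2)) => y; rewrite ger0_norm.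
have cf y : f k y @[k --> \oo] --> (0 : R).
 have : 3 * k.+1%:R^-1 * birkhoff_sum F tau n y @[k --> \oo] --> (0 : R).
  rewrite -[X in _ --> X](mul0r (birkhoff_sum F tau n y)).
  apply: cvgM; last exact: cvg_cst.
  rewrite -[X in _ --> X](mulr0 3); apply: cvgM; first exact: cvg_cst.
  exact: cvg_harmonic.
 apply: squeeze_cvgr; last exact: cvg_cst.
 by near=> k; rewrite f0 ge_min lexx orbT.
have : (\int[mu]_y (f k y)%:E)%E @[k --> \oo] --> (\int[mu]_y 0%E)%E.
 apply: (@dominated_cvg _ _ _ mu setT measurableT (fun k => EFin \o f k) _ (fun=> 2%:E)).
 - by move=> k; exact/measurable_EFinP.
 - by move=> y _; apply: cvg_EFin; [near=> k|exact: cf].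
 - by [].
 - exact: rintegrable_cst.
 - by move=> k y _ /=; rewrite lee_fin ger0_norm.
rewrite integral0 => /cvg_fineP /cvgrPdist_le /(_ _ e0) [k _ /(_ k (leqnn k))/=].
rewrite sub0r normrN => hk.
exists k.+1%:R^-1; first by rewrite invr_gt0.
move=> s s0 hs hs0 ss0.
have ig : rintegrable mu (fun y => normc (es s n y - es s0 n y)).
 apply: cintegrable_normc; apply: (cintegrable_bounded mu (M := 2)).
  by apply: cmeasurableB; exact: cmeasurable_es.
 by move=> y; rewrite (le_trans (normcB _ _))// lerD// normc_es.
rewrite (le_trans _ (le_trans (ler_norm _) hk))//.
apply: (Rintegral_le ig (if_ k)) => y.
rewrite (le_trans (weight_dist n y hs hs0))// le_min; apply/andP; split.
 by rewrite ge_min lexx.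
rewrite ge_min; apply/orP; right.
rewrite ler_wpM2r ?birkhoff_ge0// ler_wpM2l//; exact: ltW.
Unshelve. all: end_near. Qed.

Lemma power_bounded : exists2 M, 1 <= M & forall s, D s -> forall n v,
 rnorm (iter n (T s) v) <= M * rnorm v.
Proof.
have [K K0 hK] := embedding_bounded.
exists (Num.max 1 (C * (K + 1))); first by rewrite le_max lexx.
move=> s Ds [|n] v; first by rewrite ler_peMl ?rnorm_ge0// le_max lexx.
rewrite (le_trans (T_LY Ds v (isT : (1 <= n.+1)%N)))//.
rewrite (le_trans (_ : _ <= C * (K + 1) * rnorm v))//; last first.
 by rewrite ler_wpM2r ?rnorm_ge0// le_max lexx orbT.
rewrite -mulrA ler_wpM2l ?(ltW C_gt0)// mulrDl lerD// ler_wpM2r ?rnorm_ge0//.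
by case/andP: alpha01 => a0 a1; rewrite exprn_ile1 ?ltW.
Qed.

Lemma alpha_small B e : 0 < e -> exists2 m, (1 <= m)%N & alpha ^+ m * B <= e.
Proof.
move=> e0; case/andP: alpha01 => a0 a1.
have : alpha ^+ m * B @[m --> \oo] --> (0 : R).
 rewrite -[X in _ --> X](mul0r B); apply: cvgM; last exact: cvg_cst.
 by apply: cvg_expr; rewrite ger0_norm// ltW.
move=> /cvgrPdist_le/(_ _ e0) [m _ /(_ (maxn 1 m) (leq_maxr _ _))/=].
rewrite sub0r normrN => h; exists (maxn 1 m); first exact: leq_maxl.
exact: le_trans (ler_norm _) h.
Qed.

(** Weak decay at the single parameter [s0] becomes contraction of one power, uniformly near [s0].
    If smallness failed in L^p, parameters [s_n] could be chosen so close to [s0] that replacing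
    [e^(- s_n tau_n)] by [e^(- s0 tau_n)] costs only [O(1/n)]; the images would be weakly null,
    hence null in L^p by compactness. The Lasota-Yorke inequality over [m] more steps turns
    smallness in L^p into smallness in [BB]. The set [Z] is the whole space away from 0 and the
    mean-zero subspace at 0. *)
Lemma perturbed_decay s0 (Z : BB -> Prop) : D s0 -> Z 0 ->
 (forall a v, Z v -> Z (a *: v)) ->
 (forall v : nat -> BB, (forall n, Z (v n)) -> (forall n, rnorm (v n) <= 1) ->
  forall E, measurable E ->
  normc (cpair (v n) (fun y => es s0 n y * (\1_E (iter n F y) : R)%:C%C))
   @[n --> \oo] --> (0 : R)) ->
 forall e, 0 < e -> exists2 n, (1 <= n)%N & exists2 r, 0 < r &
  forall s, D s -> normc (s - s0) < r -> forall v, Z v ->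
   rnorm (iter n (T s) v) <= e * rnorm v.
Proof.
move=> Ds0 Z0 ZZ HW e e0.
have [K K0 hK] := embedding_bounded.
have [M M1 hM] := power_bounded.
have q0 : 0 < 1 - p^-1 by rewrite subr_gt0 invf_lt1// (lt_trans _ p_gt1).
(* The exponent [(1 - p^-1)^-1] undoes the power [1 - p^-1] coming from Hölder's inequality. *)
have /choice[rr rP] : forall n, exists r, 0 < r /\
 forall s s0, 0 <= complex.Re s -> 0 <= complex.Re s0 -> normc (s - s0) < r ->
 \int[mu]_y normc (es s n y - es s0 n y) <= (n.+1%:R^-1) `^ (1 - p^-1)^-1.
 move=> n; have n0 : 0 < n.+1%:R^-1 :> R by rewrite invr_gt0.
 by have [r r0 hr] := weight_continuous n (powR_gt0 (1 - p^-1)^-1 n0); exists r.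
(* Half of [e] goes to the L^p term of the Lasota-Yorke inequality, the other half to its
   [alpha ^+ m] term. *)
pose e' := e / (2 * C).
have e'0 : 0 < e' by rewrite divr_gt0// mulr_gt0.
have [n [n1 Qn]] : exists n, (1 <= n)%N /\ forall s, D s -> normc (s - s0) < rr n ->
  forall v, Z v -> rnorm v <= 1 -> Np (iter n (T s) v) <= e'.
 apply: contrapT => nQ.
 have /choice[sv svP] : forall n, exists sv : R[i] * BB, [/\ D sv.1,
   normc (sv.1 - s0) < rr n, Z sv.2, rnorm sv.2 <= 1 &
   (1 <= n)%N -> e' < Np (iter n (T sv.1) sv.2)].
  (* The pair at index 0 is a dummy, hence the guard [1 <= n] in the last clause. *)
  case=> [|n].
   exists (s0, 0); split => //=; first by rewrite subrr normc0; case: (rP 0%N).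
   by rewrite rnorm0.
  apply: contrapT => H; apply: nQ; exists n.+1; split => // s Ds ss v Zv v1.
  rewrite leNgt; apply/negP => h; apply: H; exists (s, v); split => //.
 pose u n := iter n (T (sv n).1) (sv n).2.
 have uM k : rnorm (u k) <= M.
  have [Ds _ _ v1 _] := svP k.
  by rewrite (le_trans (hM _ Ds _ _))// ler_piMr// (le_trans _ M1).
 have u0 E : measurable E ->
   normc (cpair (u k) (fun y => (\1_E y : R)%:C%C)) @[k --> \oo] --> (0 : R).
  move=> mE.
  have c1 : normc (cpair (sv k).2 (fun y => es s0 k y * (\1_E (iter k F y) : R)%:C%C)) +
    8 * K * k.+1%:R^-1 @[k --> \oo] --> (0 : R).
   rewrite -[0 in X in _ --> X]addr0; apply: cvgD.
    by apply: HW => // k; have [] := svP k.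
   rewrite -[X in _ --> X](mulr0 (8 * K)); apply: cvgM; first exact: cvg_cst.
   exact: cvg_harmonic.
  apply: squeeze_cvgr c1; last exact: cvg_cst.
  near=> k; rewrite normc_ge0/=.
  have [Ds ss Zv v1 _] := svP k.
  have hs := D_Re Ds; have hs0 := D_Re Ds0.
  have bE := btest_indic mE; have bEk := btest_iter k bE.
  rewrite /u iterT_pair//.
  apply: (le_trans (normc_dist _
    (cpair (sv k).2 (fun y => es s0 k y * (\1_E (iter k F y) : R)%:C%C)))).
  rewrite lerD2l.
  (* Halving the difference of two weights brings it into the unit disc, as [cpair_weight]
     requires. *)
  have mD : cmeasurable (fun y => (2^-1)%:C%C * (es (sv k).1 k y - es s0 k y)).
   apply: cmeasurableM; first exact: cmeasurable_cst.
   by apply: cmeasurableB; exact: cmeasurable_es.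
  have nD y : normc ((2^-1)%:C%C * (es (sv k).1 k y - es s0 k y)) =
    2^-1 * normc (es (sv k).1 k y - es s0 k y).
   by rewrite normcM normc_real ger0_norm.
  have -> : cpair (sv k).2 (fun y => es (sv k).1 k y * (\1_E (iter k F y) : R)%:C%C) -
    cpair (sv k).2 (fun y => es s0 k y * (\1_E (iter k F y) : R)%:C%C) =
    2%:C%C * cpair (sv k).2 (fun y => (2^-1)%:C%C * (es (sv k).1 k y - es s0 k y) *
     (\1_E (iter k F y) : R)%:C%C).
   rewrite /cpair -cintegralB; [|apply: cpair_integrable; apply: btestM => //; exact: btest_es..].
   rewrite -cintegralZ; last first.
    apply: cpair_integrable; apply: btestM => //; apply: btestM; first exact: btest_cst.
    split; first by apply: cmeasurableB; exact: cmeasurable_es.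
    by exists 2 => y; rewrite (le_trans (normcB _ _))// lerD// normc_es.
   congr cintegral; apply/funext => y.
   have h2 : (2%:C * (2^-1)%:C = 1 :> R[i])%C by rewrite -rmorphM/= mulfV.
   transitivity ((2%:C * (2^-1)%:C)%C * (bfun (sv k).2 y *
    ((es (sv k).1 k y - es s0 k y) * (\1_E (iter k F y) : R)%:C%C))); last by ring.
   by rewrite h2; ring.
  rewrite normcM normc_real ger0_norm//.
  have := @cpair_weight (sv k).2 _ _ bEk.1 (fun y => normc_indic E (iter k F y)) mD.
  have nD1 y : normc ((2^-1)%:C%C * (es (sv k).1 k y - es s0 k y)) <= 1.
   by rewrite nD ler_pdivrMl// mulr1 (le_trans (normcB _ _))// lerD// normc_es.
  move=> /(_ nD1); under eq_Rintegral do rewrite nD.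
  have ig : rintegrable mu (fun y => normc (es (sv k).1 k y - es s0 k y)).
   apply: cintegrable_normc; apply: (cintegrable_bounded mu (M := 2)).
    by apply: cmeasurableB; exact: cmeasurable_es.
   by move=> y; rewrite (le_trans (normcB _ _))// lerD// normc_es.
  rewrite RintegralZl// => h.
  have Ige0 : 0 <= \int[mu]_y normc (es (sv k).1 k y - es s0 k y).
   by apply: Rintegral_ge0 => y _; exact: normc_ge0.
  have h3 : (2^-1 * \int[mu]_x normc (es (sv k).1 k x - es s0 k x)) `^ (1 - p^-1) <= k.+1%:R^-1.
   rewrite (le_trans (_ : _ <= ((k.+1%:R^-1 : R) `^ (1 - p^-1)^-1) `^ (1 - p^-1)))//; last first.
    by rewrite -powRrM mulVf ?gt_eqF// powRr1// invr_ge0.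
   apply: ge0_ler_powR; rewrite ?(ltW q0) ?nnegrE ?mulr_ge0 ?powR_ge0//.
   have [_ /(_ _ _ hs hs0 ss) hr] := rP k.
   by apply: le_trans hr; rewrite ler_piMl// invf_le1// ler1n.
  have hN : Np (sv k).2 <= K.
   by rewrite (le_trans (hK _))// ler_piMr// ltW.
  rewrite (le_trans (_ : _ <= 2 * (2 * K * k.+1%:R^-1)))//.
   rewrite ler_wpM2l// (le_trans h)// ler_pM ?mulr_ge0 ?powR_ge0 ?Np_ge0//.
   by rewrite ler_wpM2l.
  rewrite !mulrA ler_wpM2r ?invr_ge0// ler_wpM2r ?(ltW K0)//; lra.
 have /cvgrPdist_lt/(_ _ e'0)[N _ HN] := weakly_null_Lp uM u0.
 have := HN N.+1 (leqW (leqnn N)); rewrite /= sub0r normrN ger0_norm ?Np_ge0//.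
 by have [_ _ _ _ /(_ isT)] := svP N.+1; rewrite /u => /lt_trans h /h; rewrite ltxx.
have e2 : 0 < e / 2 by rewrite divr_gt0.
have [m m1 hm] := alpha_small (C * M) e2.
exists (m + n)%N; first by rewrite (leq_trans m1)// leq_addr.
exists (rr n); first by case: (rP n).
move=> s Ds ss v Zv.
have unit u : Z u -> rnorm u <= 1 -> rnorm (iter (m + n) (T s) u) <= e.
 move=> Zu u1; rewrite iterD (le_trans (T_LY Ds _ m1))//.
 have h1 := Qn _ Ds ss _ Zu u1.
 have h2 : rnorm (iter n (T s) u) <= M.
  by rewrite (le_trans (hM _ Ds _ _))// ler_piMr// (le_trans _ M1).
 rewrite mulrDr [leRHS](splitr e) lerD//.
  rewrite (le_trans (_ : _ <= C * e'))// ?ler_wpM2l ?(ltW C_gt0)//.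
  apply: eq_ler; rewrite /e'.
  by field; rewrite gt_eqF.
 rewrite (le_trans _ hm)// mulrCA ler_wpM2l ?exprn_ge0//.
  by case/andP: alpha01 => /ltW.
 by rewrite ler_wpM2l// ltW.
have [v0|v0] := eqVneq (rnorm v) 0.
 by rewrite (rnorm_eq0 v0) iterT0// rnorm0 mulr0.
have vp : 0 < rnorm v by rewrite lt_neqAle eq_sym v0 rnorm_ge0.
have := unit (((rnorm v)^-1)%:C%C *: v) (ZZ _ _ Zv).
rewrite iterTZ// !rnormZ normc_real gtr0_norm ?invr_gt0// mulVf//.
by move=> /(_ (lexx _)); rewrite ler_pdivrMl// mulrC.
Unshelve. all: end_near. Qed.

(** At each [b] the spectral radius gives geometric decay, hence weak decay; [perturbed_decay]
    spreads a halving of the norm to a neighbourhood, and compactness together with a common rate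
    for all periods makes it uniform. *)
Lemma decay_off_zero (d' : R) : 0 < d' ->
 (forall b : R, d' <= b <= L -> (spectral_radius (T (0%R +i* b)%C) < 1)%E) ->
 exists M t, 0 < t < 1 /\ forall b : R, d' <= b <= L -> forall v n,
  rnorm (iter n (T (0 +i* b)%C) v) <= M * t ^+ n * rnorm v.
Proof.
move=> d'0 Hs.
have [K K0 hK] := embedding_bounded.
have [M M1 hM] := power_bounded.
have Db (b : R) : d' <= b <= L -> D (0 +i* b)%C.
 move=> /andP[b1 b2]; right; split => //=; rewrite ger0_norm//.
 by rewrite (le_trans _ b1)// ltW.
have [] := @segment_uniform R d' L (fun b B => exists n, [/\ (1 <= n)%N, n%:R <= B &
  forall v, rnorm (iter n (T (0 +i* b)%C) v) <= rnorm v / 2]).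
- move=> b B B' lBB [n [n1 nB h]]; exists n; split => //; exact: le_trans lBB.
- move=> b bL; have Dsb := Db _ bL.
 have [n n1 hn] := power_contraction (fun a u v => T_linear a u v Dsb) M1 (hM _ Dsb) (Hs b bL).
 have [t /andP[t0 t1] ht] := @geometric_rate R n n1.
 have h20 : 0 < 2^-1 :> R by rewrite invr_gt0.
 have HW (v : nat -> BB) : (forall n : nat, True) -> (forall n, rnorm (v n) <= 1) ->
  forall E, measurable E ->
  normc (cpair (v j) (fun y => es (0 +i* b)%C j y * (\1_E (iter j F y) : R)%:C%C))
   @[j --> \oo] --> (0 : R).
  move=> _ v1 E mE.
  have ct : 4 * K * M * t ^+ j @[j --> \oo] --> (0 : R).
   rewrite -[X in _ --> X](mulr0 (4 * K * M)); apply: cvgM; first exact: cvg_cst.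
   by apply: cvg_expr; rewrite ger0_norm// ltW.
  apply: squeeze_cvgr ct; last exact: cvg_cst.
  near=> j; rewrite normc_ge0/=.
  rewrite -(iterT_pair _ _ Dsb (btest_indic mE)).
  rewrite (le_trans (cpair_bound _ (btest_indic mE).1 (normc_indic E)))//.
  have h1 := hK (iter j (T (0 +i* b)%C) (v j)).
  have h2 : rnorm (iter j (T (0 +i* b)%C) (v j)) <= 2 * M * t ^+ j.
   apply: (ht (fun i => rnorm (iter i (T (0 +i* b)%C) (v j))) M _ _ n).
   - by move=> i; exact: rnorm_ge0.
   - move=> i; rewrite (le_trans (hM _ Dsb _ _))// ler_piMr//.
    by rewrite (le_trans ler01).
   - by rewrite n1 leqnn.
   - by move=> i; rewrite iterD.
  have h3 := ler_wpM2l (ltW K0) h2; lra.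
 have [m m1 [r r0 hr]] := @perturbed_decay (0 +i* b)%C (fun=> True) Dsb I (fun _ _ _ => I) HW _ h20.
  exists m%:R, r; split=> // y yL yb.
  exists m; split => // v; have := hr (0 +i* y)%C (Db _ yL) _ v I.
  rewrite mulrC; apply; rewrite (_ : _ - _ = (0 +i* (y - b))%C); last first.
   by apply/eqP; rewrite eq_complex/= subrr !eqxx.
  by rewrite (le_lt_trans (le_normc_ReIm _))//= normr0 add0r.
- move=> B hB.
 pose N := (Num.bound B).+1.
 have [t t01 ht] := @geometric_rate R N isT.
 exists (2 * M), t; split => // b bL v n; have [m [m1 mB hm]] := hB b bL.
 rewrite -[leRHS]mulrA [t ^+ n * _]mulrC mulrA -[2 * M * _]mulrA.
 apply: (ht (fun i => rnorm (iter i (T (0 +i* b)%C) v)) _ _ _ m).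
 + by move=> i; exact: rnorm_ge0.
 + by move=> i; exact: hM (Db _ bL) _ _.
 + rewrite m1 /N ltnW// ltnS -(ler_nat R) (le_trans mB)// ltW// archi_boundP//.
  by rewrite (le_trans _ mB).
 + by move=> i; rewrite iterD.
Unshelve. all: end_near. Qed.

Lemma D0 : D 0.
Proof. by left; split => //=; rewrite normc0. Qed.

Lemma mean_T s v : D s ->
 cpair (T s v) (fun=> 1) = cpair v (es s 1).
Proof.
move=> Ds; rewrite T_pair//; last exact: btest_cst.
by congr cintegral; apply/funext => y; rewrite mulr1.
Qed.

Lemma mean_iterT0 v n : cpair (iter n (T 0) v) (fun=> 1) = cpair v (fun=> 1).
Proof.
rewrite iterT_pair//; [|exact: D0|exact: btest_cst].
by congr cintegral; apply/funext => y; rewrite es0 mulr1.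
Qed.

(** At [s = 0] the weight is 1 and mixing supplies the weak decay. Mean zero need not be preserved
    by [T s] for other [s], so one fixed power is contracted rather than all of them. *)
Lemma mean_zero_decay e : 0 < e -> exists2 n, (1 <= n)%N & exists2 r, 0 < r &
 forall s, D s -> normc s < r -> forall v, cpair v (fun=> 1) = 0 ->
  rnorm (iter n (T s) v) <= e * rnorm v.
Proof.
move=> e0.
have b1 : btest (fun _ : Y => 1) by exact: btest_cst.
have h1 a v : cpair v (fun=> 1) = 0 -> cpair (a *: v) (fun=> 1) = 0.
 by move=> h; rewrite cpairZ// h mulr0.
have h2 (v : nat -> BB) : (forall n, cpair (v n) (fun=> 1) = 0) ->
  (forall n, rnorm (v n) <= 1) -> forall E, measurable E ->
  normc (cpair (v n) (fun y => es 0 n y * (\1_E (iter n F y) : R)%:C%C)) @[n --> \oo] --> (0 : R).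
 move=> Zv v1 E mE.
 suff -> : (fun n => normc (cpair (v n) (fun y => es 0 n y * (\1_E (iter n F y) : R)%:C%C))) =
   (fun n => normc (cpair (v n) (fun y => (\1_E (iter n F y) : R)%:C%C))).
  exact: (mixing_weak_decay v1 Zv mE).
 by apply/funext => n; congr (normc (cintegral _ _)); apply/funext => y; rewrite es0 mul1r.
have [n n1 [r r0 hr]] := perturbed_decay D0 (cpair0 b1) h1 h2 e0.
exists n => //; exists r => // s Ds sr v Zv; apply: hr => //.
by rewrite subr0.
Qed.

(** At [s = 0] the mean is preserved, so the contraction can be iterated. *)
Lemma mean_zero_decay0 : exists M t, 0 < t < 1 /\ forall v, cpair v (fun=> 1) = 0 ->
 forall n, rnorm (iter n (T 0) v) <= M * t ^+ n * rnorm v.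
Proof.
have [M M1 hM] := power_bounded.
have h20 : 0 < 2^-1 :> R by rewrite invr_gt0.
have [n n1 [r r0 hr]] := mean_zero_decay h20.
have [t t01 ht] := @geometric_rate R n n1.
exists (2 * M), t; split => // v Zv m.
rewrite -[leRHS]mulrA [t ^+ m * _]mulrC mulrA -[2 * M * _]mulrA.
apply: (ht (fun i => rnorm (iter i (T 0) v)) _ _ _ n).
- by move=> i; exact: rnorm_ge0.
- by move=> i; exact: hM D0 _ _.
- by rewrite n1 leqnn.
- move=> i; rewrite iterD mulrC; apply: hr; [exact: D0|by rewrite normc0|].
 by rewrite mean_iterT0.
Qed.

(** The difference of means is the integral of [v (e^(- s tau_n) - 1)], small by Hölder since the
    weight is continuous at 0 in L^1. *)
Lemma mean_perturbation n e : 0 < e -> exists2 r, 0 < r &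
 forall s, D s -> normc s < r -> forall v,
  normc (cpair (iter n (T s) v) (fun=> 1) - cpair v (fun=> 1)) <= e * rnorm v.
Proof.
move=> e0; have [K K0 hK] := embedding_bounded.
have q0 : 0 < 1 - p^-1 by rewrite subr_gt0 invf_lt1// (lt_trans _ p_gt1).
pose e' := (e / (4 * K)) `^ (1 - p^-1)^-1.
have e'0 : 0 < e' by rewrite powR_gt0// divr_gt0// mulr_gt0.
have [r r0 hr] := weight_continuous n e'0.
exists r => // s Ds sr v; have s0 := D_Re Ds.
have b1 : btest (fun _ : Y => 1) by exact: btest_cst.
have bs := btest_es n s0.
have bd : btest (fun y => (2^-1)%:C%C * (es s n y - 1)).
 split; first apply: cmeasurableM.
 - exact: cmeasurable_cst.
 - by apply: cmeasurableB; [exact: cmeasurable_es|exact: cmeasurable_cst].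
 - exists 1 => y; rewrite normcM normc_real ger0_norm// ler_pdivrMl// mulr1.
  by rewrite (le_trans (normcB _ _))// normc1 lerD// normc_es.
have -> : cpair (iter n (T s) v) (fun=> 1) - cpair v (fun=> 1) =
  2%:C%C * cpair v (fun y => (2^-1)%:C%C * (es s n y - 1) * 1).
 rewrite iterT_pair// /cpair -cintegralB; [|apply: cpair_integrable|exact: cpair_integrable]; last first.
  exact: btestM.
 rewrite -cintegralZ; last by apply: cpair_integrable; exact: btestM.
 congr cintegral; apply/funext => y.
 have h2 : (2%:C * (2^-1)%:C = 1 :> R[i])%C by rewrite -rmorphM/= mulfV.
 transitivity ((2%:C * (2^-1)%:C)%C * (bfun v y * (es s n y - 1))); last by ring.
 by rewrite h2; ring.
rewrite normcM normc_real ger0_norm//.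
have n1 (y : Y) : normc (1 : R[i]) <= 1 by rewrite normc1.
have h := @cpair_weight v _ _ b1.1 n1 bd.1.
have hd y : normc ((2^-1)%:C%C * (es s n y - 1)) = 2^-1 * normc (es s n y - es 0 n y).
 by rewrite normcM normc_real ger0_norm// es0.
have hd1 y : normc ((2^-1)%:C%C * (es s n y - 1)) <= 1.
 rewrite normcM normc_real ger0_norm// ler_pdivrMl// mulr1.
 by rewrite (le_trans (normcB _ _))// normc1 lerD// normc_es.
have hI : \int[mu]_y normc ((2^-1)%:C%C * (es s n y - 1)) =
  \int[mu]_y (2^-1 * normc (es s n y - es 0 n y)).
 by apply: eq_Rintegral => y _; exact: hd.
have {}h := h hd1; rewrite hI in h.
have ig : rintegrable mu (fun y => normc (es s n y - es 0 n y)).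
 apply: cintegrable_normc; apply: (cintegrable_bounded mu (M := 2)).
  by apply: cmeasurableB; exact: cmeasurable_es.
 by move=> y; rewrite (le_trans (normcB _ _))// lerD// normc_es.
rewrite RintegralZl// in h.
have I0 : 0 <= \int[mu]_y normc (es s n y - es 0 n y).
 by apply: Rintegral_ge0 => y _; exact: normc_ge0.
have hi : \int[mu]_y normc (es s n y - es 0 n y) <= e'.
 by apply: hr => //; rewrite ?subr0.
have h3 : (2^-1 * \int[mu]_x normc (es s n x - es 0 n x)) `^ (1 - p^-1) <= e / (4 * K).
 have -> : e / (4 * K) = e' `^ (1 - p^-1).
  by rewrite /e' -powRrM mulVf ?gt_eqF// powRr1// divr_ge0 ?(ltW e0)// mulr_ge0// ltW.
 apply: ge0_ler_powR; rewrite ?(ltW q0) ?nnegrE ?mulr_ge0 ?(ltW e'0)//.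
 by apply: le_trans hi; rewrite ler_piMl// invf_le1// ler1n.
have h4 : 2 * Np v * (2^-1 * \int[mu]_x normc (es s n x - es 0 n x)) `^ (1 - p^-1) <=
  2 * (K * rnorm v) * (e / (4 * K)).
 by rewrite ler_pM ?mulr_ge0 ?powR_ge0 ?Np_ge0// ler_wpM2l.
have h5 : 2 * (2 * (K * rnorm v) * (e / (4 * K))) = e * rnorm v.
 by field; rewrite gt_eqF.
by rewrite -h5 ler_wpM2l// (le_trans h).
Qed.

Lemma mean_bound : exists2 k, 0 < k & forall v, normc (cpair v (fun=> 1)) <= k * rnorm v.
Proof.
have [K K0 hK] := embedding_bounded.
exists (2 * K) => [|v]; first by rewrite mulr_gt0.
have b1 : btest (fun _ : Y => 1) by exact: btest_cst.
have n1 (y : Y) : normc (1 : R[i]) <= 1 by rewrite normc1.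
by rewrite (le_trans (cpair_bound v b1.1 n1))// mulr1 -mulrA ler_wpM2l.
Qed.

Lemma meanB u v : cpair (u - v) (fun=> 1) = cpair u (fun=> 1) - cpair v (fun=> 1).
Proof. by rewrite cpairB//; exact: btest_cst. Qed.

Lemma meanZ a v : cpair (a *: v) (fun=> 1) = a * cpair v (fun=> 1).
Proof. by rewrite cpairZ//; exact: btest_cst. Qed.

Lemma meanD u v : cpair (u + v) (fun=> 1) = cpair u (fun=> 1) + cpair v (fun=> 1).
Proof. by rewrite -[u]scale1r cpairD ?scale1r ?mul1r//; exact: btest_cst. Qed.

(* For [s] near [0] the normalized map [v |-> T_s^N v / mean (T_s^N v)] contracts
  the affine space of functions of mean [1]; its fixed point is the leading
  eigenvector. *)
Lemma leading_eigenvector (one : BB) : cpair one (fun=> 1) = 1 ->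
 exists (rho eta : R) (N : nat), [/\ 0 < rho, 0 < eta, eta * (1 + rho) <= 4^-1 & (1 <= N)%N] /\
 exists2 r : R, 0 < r & forall s, D s -> normc s < r ->
 exists v lam, [/\ cpair v (fun=> 1) = 1, rnorm v <= rho, T s v = lam *: v &
  2^-1 <= normc (lam ^+ N)] /\
  forall f : BB, cpair f (fun=> 1) = 0 -> rnorm (iter N (T s) f) <= eta * rnorm f /\
   normc (cpair (iter N (T s) f) (fun=> 1)) <= eta * rnorm f.
Proof.
move=> one1; have [M M1 hM] := power_bounded.
have M0 : 0 < M by rewrite (lt_le_trans ltr01).
pose om := rnorm one; have om0 : 0 <= om by exact: rnorm_ge0.
(* Radius of the mean-zero ball in which the fixed point is sought: it must exceed
   [2 (M om + eta rw) + om], where [eta rw <= 1/16]. *)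
pose rw := 2 * M * om + 1 + om.
have rw0 : 0 < rw by rewrite /rw ltr_wpDr// ltr_wpDl// !mulr_ge0// ltW.
pose rho := om + rw; have rho0 : 0 < rho by rewrite ltr_wpDl.
(* With [eta = 1 / q] each of [eta], [eta M], [eta rho] and [eta M rho] is at most 1/16. *)
pose q := 16 * (M + 1) * (1 + rho).
have q0 : 0 < q by rewrite !mulr_gt0// addr_gt0.
pose eta := q^-1; have eta0 : 0 < eta by rewrite invr_gt0.
have etaq : eta * q = 1 by rewrite mulVf// gt_eqF.
have Mr0 : 0 <= eta * (M * rho) by rewrite !mulr_ge0// ltW.
have eM0 : 0 <= eta * M by rewrite !mulr_ge0// ltW.
have er0 : 0 <= eta * rho by rewrite !mulr_ge0// ltW.
have etaqE : 16 * (eta * (M * rho)) + 16 * (eta * M) + 16 * (eta * rho) + 16 * eta = 1.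
 by transitivity (eta * q); [rewrite /q; ring|].
have e4 : eta * (1 + rho) <= 4^-1 by move: eta0; lra.
have [N N1 [r r0 hr]] := mean_zero_decay eta0.
have [r' r'0 hr'] := mean_perturbation N eta0.
exists rho, eta, N; split => //; exists (Num.min r r'); first by rewrite lt_min r0.
move=> s Ds; rewrite lt_min => /andP[sr sr'].
pose S := iter N (T s).
have SD u v : S (u + v) = S u + S v by rewrite /S -[u]scale1r iterT_linear// !scale1r.
have SB u v : S (u - v) = S u - S v by exact: iterTB.
have mS v : normc (cpair (S v) (fun=> 1) - cpair v (fun=> 1)) <= eta * rnorm v by exact: hr'.
have mzS (f : BB) : cpair f (fun=> 1) = 0 -> rnorm (S f) <= eta * rnorm f /\
  normc (cpair (S f) (fun=> 1)) <= eta * rnorm f.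
 by move=> w0; split; [exact: hr|have := mS f; rewrite w0 subr0].
pose mu' f := cpair (S (one + f)) (fun=> 1).
pose Phi f := (mu' f)^-1 *: S (one + f) - one.
pose Z f := cpair f (fun=> 1) = 0 /\ rnorm f <= rw.
have Zn f : Z f -> rnorm (one + f) <= rho.
 by move=> [_ h]; rewrite (le_trans (rnormD _ _))// lerD2l.
have Zm f : Z f -> normc (mu' f - 1) <= 16^-1.
 move=> Zw; have := mS (one + f); rewrite meanD one1 (proj1 Zw) addr0 => h.
 have h2 := ler_wpM2l (ltW eta0) (Zn _ Zw).
 apply: (le_trans h); apply: (le_trans h2); move: (ltW eta0); lra.
have Zm2 f : Z f -> 2^-1 <= normc (mu' f).
 move=> /Zm h; have := normc_dist 1 (mu' f); rewrite normc_distC normc1.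
 by move: h; lra.
have Zm0 f : Z f -> mu' f != 0.
 move=> /Zm2 h; apply/eqP => h0; move: h; rewrite h0 normc0.
 by rewrite leNgt invr_gt0 ltr0n.
have Zi f : Z f -> normc (mu' f)^-1 <= 2.
 by move=> /Zm2 h; rewrite normcV -[leRHS]invrK lef_pV2// ?posrE ?invr_gt0// (lt_le_trans _ h)// invr_gt0.
have ZPhi f : Z f -> Z (Phi f).
 move=> Zw; split.
  by rewrite meanB meanZ mulVf ?one1 ?subrr// Zm0.
 rewrite (le_trans (rnormB _ _))// rnormZ.
 have h1 : rnorm (S (one + f)) <= M * om + eta * rw.
  rewrite SD (le_trans (rnormD _ _))// lerD ?hM//.
  have [+ _] := mzS _ (proj1 Zw); move/le_trans; apply.
  by rewrite ler_wpM2l ?(ltW eta0)//; case: Zw.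
 have h2 : normc (mu' f)^-1 * rnorm (S (one + f)) <= 2 * (M * om + eta * rw).
  by rewrite ler_pM ?normc_ge0 ?rnorm_ge0// Zi.
 have h3 : eta * rw <= 16^-1.
  rewrite (le_trans (_ : _ <= eta * rho))// ?ler_wpM2l ?(ltW eta0)// ?lerDr//.
  by move: (ltW eta0); lra.
 rewrite -/om /rw in h2 h3 *; move: h2 h3; lra.
have Phic f f' : Z f -> Z f' -> rnorm (Phi f - Phi f') <= rnorm (f - f') / 2.
 move=> Zw Zw'.
 have dz : cpair (f - f') (fun=> 1) = 0.
  by rewrite meanB (proj1 Zw) (proj1 Zw') subrr.
 have [d1 d2] := mzS _ dz.
 have Sd : S (one + f) - S (one + f') = S (f - f').
  by rewrite -SB opprD addrACA subrr add0r.
 have md : mu' f - mu' f' = cpair (S (f - f')) (fun=> 1) by rewrite -Sd meanB.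
 have -> : Phi f - Phi f' = (mu' f)^-1 *: S (f - f') +
   ((mu' f)^-1 - (mu' f')^-1) *: S (one + f').
  rewrite /Phi opprB addrA subrK -Sd scalerBr scalerBl addrA subrK//.
 rewrite (le_trans (rnormD _ _))// !rnormZ.
 have -> : (mu' f)^-1 - (mu' f')^-1 = - ((mu' f)^-1 * (mu' f')^-1 * (mu' f - mu' f')).
  by have a1 := Zm0 _ Zw; have a2 := Zm0 _ Zw'; field; rewrite a1 a2.
 rewrite normcN !normcM md.
 have b1 : normc (mu' f)^-1 * rnorm (S (f - f')) <= 2 * (eta * rnorm (f - f')).
  by rewrite ler_pM ?normc_ge0 ?rnorm_ge0// Zi.
 have b2 : normc (mu' f)^-1 * normc (mu' f')^-1 * normc (cpair (S (f - f')) (fun=> 1)) *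
   rnorm (S (one + f')) <= 2 * 2 * (eta * rnorm (f - f')) * (M * rho).
  rewrite ler_pM ?mulr_ge0 ?normc_ge0 ?rnorm_ge0//.
   by rewrite ler_pM ?mulr_ge0 ?normc_ge0//; rewrite ler_pM ?normc_ge0// Zi.
  by rewrite (le_trans (hM _ Ds _ _))// ler_wpM2l ?(ltW M0)// Zn.
 have c1 := rnorm_ge0 (f - f').
 have c2 : (2 * eta + 4 * (eta * (M * rho))) * rnorm (f - f') <= 2^-1 * rnorm (f - f').
  by rewrite ler_wpM2r//; move: (ltW eta0); lra.
 move: b1 b2 c2; lra.
have [k k0 hk] := mean_bound.
have [f [Zw wfix]] : exists f, Z f /\ Phi f = f.
 apply: (halving_fixpoint _ ZPhi Phic (x0 := 0)).
  by split; [apply: cpair0; exact: btest_cst|rewrite rnorm0 ltW].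
 move=> x hx; split.
  apply: eq0_normc; apply/eqP; rewrite eq_le normc_ge0 andbT.
  apply/ler_addgt0Pr => e e0; rewrite add0r.
  have [y [[y0 _] xy]] := hx _ (divr_gt0 e0 k0).
  rewrite -[x](subrK y) meanD y0 addr0 (le_trans (hk _))// mulrC -ler_pdivlMr//.
 apply/ler_addgt0Pr => e e0; have [y [[_ yr] xy]] := hx _ e0.
 by rewrite -[x](subrK y) (le_trans (rnormD _ _))// addrC lerD.
pose v := one + f.
have v1 : cpair v (fun=> 1) = 1 by rewrite meanD one1 (proj1 Zw) addr0.
have Sv : S v = mu' f *: v.
 have : (mu' f)^-1 *: S v = v.
  by rewrite -(subrK one ((mu' f)^-1 *: S v)) [X in X + _]wfix addrC.
 by move/(congr1 (fun z => mu' f *: z)); rewrite scalerA mulfV ?Zm0// scale1r.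
(* So far [v] is an eigenvector of the [N]-th power only. The mean-zero vector [T s v - lam v] has
   the same eigenvalue, of modulus at least 1/2, under a power that contracts mean-zero vectors by
   [eta <= 1/4]; so it vanishes. *)
pose lam := cpair (T s v) (fun=> 1).
have Tv : T s v = lam *: v.
 apply/subr0_eq; set z := _ - _; apply: rnorm_eq0.
 have z0 : cpair z (fun=> 1) = 0 by rewrite meanB meanZ v1 mulr1 subrr.
 have Sz : S z = mu' f *: z.
  rewrite SB scalerBr /S -iterSr iterS -/S Sv.
  have -> : T s (mu' f *: v) = mu' f *: T s v by exact: (iterTZ 1).
  by rewrite /S iterTZ// -/S Sv !scalerA [lam * _]mulrC.
 have [h _] := mzS _ z0; rewrite Sz rnormZ in h.
 have h2 := ler_wpM2r (rnorm_ge0 z) (Zm2 _ Zw).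
 have h3 : eta * rnorm z <= 4^-1 * rnorm z.
  rewrite ler_wpM2r ?rnorm_ge0//; move: e4 (er0); lra.
 by have := rnorm_ge0 z; move: h h2 h3; lra.
have iv n : iter n (T s) v = lam ^+ n *: v.
 elim: n => [|n IH]; first by rewrite expr0 scale1r.
 rewrite iterS IH; have -> : T s (lam ^+ n *: v) = lam ^+ n *: T s v by exact: (iterTZ 1).
 by rewrite Tv scalerA -exprSr.
have lamN : lam ^+ N = mu' f.
 by have := Sv; rewrite /S iv => /(congr1 (fun z => cpair z (fun=> 1))); rewrite !meanZ v1 !mulr1.
exists v, lam; split; last exact: mzS.
by split => //; [exact: Zn|rewrite lamN; exact: Zm2].
Qed.

Lemma iterT_eigen s v lam n : D s -> T s v = lam *: v -> iter n (T s) v = lam ^+ n *: v.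
Proof.
move=> Ds Tv; elim: n => [|n IH]; first by rewrite expr0 scale1r.
rewrite iterS IH; have -> : T s (lam ^+ n *: v) = lam ^+ n *: T s v by exact: (iterTZ 1).
by rewrite Tv scalerA -exprSr.
Qed.

(** After each block of [N] steps the mean-zero part yields a small multiple of [v] and a mean-zero
    remainder contracted by 1/4. As [|lam^N| >= 1/2], the multiples injected at successive blocks
    form a series dominated by [|lam|^n]. The bound [e] on the injected means is kept apart from
    [eta], since it can be made arbitrarily small near [s = 0]. *)
Lemma eigen_expansion (rho eta : R) (N : nat) :
 0 < rho -> 0 < eta -> eta * (1 + rho) <= 4^-1 -> (1 <= N)%N ->
 exists B t : R, [/\ 0 < B, 0 < t < 1 & forall s v lam (e : R),
  D s -> cpair v (fun=> 1) = 1 -> rnorm v <= rho -> T s v = lam *: v ->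
  2^-1 <= normc (lam ^+ N) -> 0 <= e <= eta ->
  (forall f : BB, cpair f (fun=> 1) = 0 -> rnorm (iter N (T s) f) <= eta * rnorm f /\
   normc (cpair (iter N (T s) f) (fun=> 1)) <= e * rnorm f) ->
  forall u n, exists c,
   rnorm (iter n (T s) u - c *: v) <= B * t ^+ n * rnorm u /\
   normc (c - cpair u (fun=> 1) * lam ^+ n) <= B * e * normc lam ^+ n * rnorm u].
Proof.
move=> rho0 eta0 e4 N1.
have [M M1 hM] := power_bounded; have M0 : 0 < M by rewrite (lt_le_trans ltr01).
have [k k0 hk] := mean_bound.
have [t t01 ht] := @geometric_rate R N N1.
have htk n : 2^-1 ^+ (n %/ N)%N <= 2 * t ^+ n.
 have := ht (fun j => 2^-1 ^+ (j %/ N)%N) 1 _ _ N; rewrite mulr1; apply.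
 - by move=> j; rewrite exprn_ge0.
 - by move=> j; rewrite exprn_ile1// invf_le1// ler1n.
 - by rewrite N1 leqnn.
 - by move=> j; rewrite divnDl ?dvdnn// divnn N1 add1n exprSr.
pose A := 1 + k * rho.
have A0 : 0 < A by rewrite ltr_wpDr// mulr_ge0// ltW.
exists (4 * A + 2 * M * A), t; split => //.
 by rewrite addr_gt0// ?mulr_gt0// mulr_gt0.
move=> s v lam e Ds v1 vr Tv lN /andP[e0 ee] HS u n.
pose m := cpair u (fun=> 1); pose u0 := u - m *: v.
have u00 : cpair u0 (fun=> 1) = 0 by rewrite meanB meanZ v1 mulr1 subrr.
have u0n : rnorm u0 <= A * rnorm u.
 rewrite (le_trans (rnormB _ _))// mulrDl mul1r lerD2l rnormZ.
 rewrite [leRHS]mulrAC; apply: ler_pM; rewrite ?normc_ge0 ?rnorm_ge0//; exact: hk.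
(* Subtracting [4^-1 ^+ j] closes the induction: the mean injected at block [j] is at most [e 4^-j]
   times the norm of [u0], and it is absorbed because [4 (x - 1/4) >= 1] for
   [x = |lam^N| >= 1/2]. *)
have step j : exists dw : R[i] * BB, [/\ iter (j * N) (T s) u0 = dw.1 *: v + dw.2,
  cpair dw.2 (fun=> 1) = 0, rnorm dw.2 <= 4^-1 ^+ j * rnorm u0 &
  normc dw.1 <= 4 * e * rnorm u0 * (normc (lam ^+ N) ^+ j - 4^-1 ^+ j)].
 elim: j => [|j [[g f] /= [E w0 wn dn]]].
  exists (0, u0); split => //=.
  - by rewrite scale0r add0r.
  - by rewrite expr0 mul1r.
  - by rewrite normc0 !expr0 subrr mulr0.
 have [h1 h2] := HS _ w0.
 pose b := cpair (iter N (T s) f) (fun=> 1).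
 exists (g * lam ^+ N + b, iter N (T s) f - b *: v); split => /=.
 - rewrite mulSn iterD E iterT_linear// (iterT_eigen _ Ds Tv) scalerA.
  by rewrite scalerDl -addrA (addrC (b *: v)) subrK.
 - by rewrite meanB meanZ v1 mulr1 subrr.
 - rewrite (le_trans (rnormB _ _))// rnormZ.
  have h3 : normc b * rnorm v <= eta * rnorm f * rho.
   rewrite ler_pM ?normc_ge0 ?rnorm_ge0// (le_trans h2)// ler_wpM2r ?rnorm_ge0//.
  have h4 := ler_wpM2r (rnorm_ge0 f) e4.
  rewrite exprS -mulrA; have h5 := ler_wpM2l (_ : 0 <= 4^-1) wn.
  have {}h5 : 4^-1 * rnorm f <= 4^-1 * (4^-1 ^+ j * rnorm u0) by rewrite ler_wpM2l.
  by move: h1 h3 h4 h5; lra.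
 - rewrite (le_trans (le_normcD _ _))// normcM exprS [4^-1 ^+ j.+1]exprS.
  set x := normc (lam ^+ N) in lN dn *.
  have x0 : 0 <= x by exact: normc_ge0.
  have h3 : normc b <= e * (4^-1 ^+ j * rnorm u0) by rewrite (le_trans h2)// ler_wpM2l.
  have h4 : normc g * x <= 4 * e * rnorm u0 * (x ^+ j - 4^-1 ^+ j) * x by rewrite ler_wpM2r.
  have h5 : 0 <= e * (4^-1 ^+ j * rnorm u0) by rewrite !mulr_ge0 ?rnorm_ge0// exprn_ge0.
  have h6 := ler_wpM2l h5 lN.
  rewrite -/b; lra.
have [[g f] /= [E w0 wn dn]] := step (n %/ N)%N.
have iE : iter n (T s) u0 = (g * lam ^+ (n %% N)%N) *: v + iter (n %% N)%N (T s) f.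
 rewrite {1}(divn_eq n N) addnC iterD E iterT_linear// (iterT_eigen _ Ds Tv) scalerA//.
exists (m * lam ^+ n + g * lam ^+ (n %% N)%N); split.
 have -> : iter n (T s) u - (m * lam ^+ n + g * lam ^+ (n %% N)%N) *: v =
   iter (n %% N)%N (T s) f.
  have uE : u = m *: v + u0 by rewrite addrC subrK.
  rewrite uE iterT_linear// (iterT_eigen _ Ds Tv) scalerA iE scalerDl.
  by rewrite addrA [X in X - _]addrC addrK.
 rewrite (le_trans (hM _ Ds _ _))// (le_trans (ler_wpM2l (ltW M0) wn))//.
 have p4 : 4^-1 ^+ (n %/ N) <= 2 * t ^+ n :> R.
  by rewrite (le_trans _ (htk n))// lerXn2r// ?nnegrE// lef_pV2 ?posrE// ler_nat.
 have p5 : 4^-1 ^+ (n %/ N) * rnorm u0 <= 2 * t ^+ n * (A * rnorm u).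
  by rewrite ler_pM ?rnorm_ge0// exprn_ge0.
 have p6 := ler_wpM2l (ltW M0) p5.
 have p7 : 0 <= 4 * A * (t ^+ n * rnorm u).
  case/andP: t01 => t0 t1.
  by rewrite !mulr_ge0 ?rnorm_ge0 ?exprn_ge0 ?(ltW A0) ?(ltW t0).
 move: p6 p7; lra.
rewrite addrC addKr normcM normcX.
have l0 : 0 <= normc lam by exact: normc_ge0.
have p1 : normc g <= 4 * e * rnorm u0 * normc lam ^+ (n %/ N * N)%N.
 apply: (le_trans dn); rewrite ler_wpM2l ?mulr_ge0 ?rnorm_ge0//.
 by rewrite normcX -exprM mulnC lerBlDr lerDl exprn_ge0.
have p2 : normc g * normc lam ^+ (n %% N)%N <= 4 * e * rnorm u0 * normc lam ^+ n.
 rewrite {2}(divn_eq n N) exprD mulrA ler_wpM2r ?exprn_ge0//.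
have p3 : 4 * e * rnorm u0 * normc lam ^+ n <= 4 * e * (A * rnorm u) * normc lam ^+ n.
 by rewrite ler_wpM2r ?exprn_ge0// ler_wpM2l// mulr_ge0.
have p4 : 0 <= 2 * M * A * (e * normc lam ^+ n * rnorm u).
 by rewrite !mulr_ge0 ?rnorm_ge0 ?exprn_ge0 ?(ltW A0) ?(ltW M0).
by move: p2 p3 p4; lra.
Qed.

Lemma cpair_weightM v (g w : Y -> R[i]) (M : R) : 1 <= M -> cmeasurable w ->
 (forall y, normc (w y) <= 1) -> cmeasurable g -> (forall y, normc (g y) <= M) ->
 normc (cpair v (fun y => g y * w y)) <=
  2 * M * Np v * (\int[mu]_y normc (g y)) `^ (1 - p^-1).
Proof.
move=> M1 mw w1 mg gM; have M0 : 0 < M by rewrite (lt_le_trans ltr01).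
have q0 : 0 < 1 - p^-1 by rewrite subr_gt0 invf_lt1// (lt_trans _ p_gt1).
pose h y := (M^-1)%:C%C * g y.
have nh y : normc (h y) = M^-1 * normc (g y).
 by rewrite normcM normc_real ger0_norm// invr_ge0 ltW.
have mh : cmeasurable h by apply: cmeasurableM => //; exact: cmeasurable_cst.
have h1 y : normc (h y) <= 1 by rewrite nh ler_pdivrMl// mulr1.
have ig : rintegrable mu (fun y => normc (g y)).
 by apply: cintegrable_normc; exact: (cintegrable_bounded mu mg gM).
have -> : cpair v (fun y => g y * w y) = (M%:C)%C * cpair v (fun y => h y * w y).
 rewrite /cpair -cintegralZ; last first.
  apply: cpair_integrable; apply: btestM; split => //; by exists 1.
 congr cintegral; apply/funext => y; rewrite /h.
 have MM : (M%:C * (M^-1)%:C = 1 :> R[i])%C by rewrite -rmorphM/= mulfV// gt_eqF.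
 by rewrite -[LHS]mul1r -MM; ring.
rewrite normcM normc_real (ger0_norm (ltW M0)) [2 * M]mulrC -!mulrA ler_wpM2l ?(ltW M0)//.
have := cpair_weight v mw w1 mh h1.
have -> : \int[mu]_y normc (h y) = M^-1 * \int[mu]_y normc (g y).
 by rewrite -RintegralZl//; apply: eq_Rintegral => y _; exact: nh.
move=> /le_trans; apply; rewrite -mulrA ler_wpM2l// ler_wpM2l ?Np_ge0//.
have I0 : 0 <= \int[mu]_y normc (g y) by apply: Rintegral_ge0 => y _; exact: normc_ge0.
apply: ge0_ler_powR; rewrite ?(ltW q0) ?nnegrE ?mulr_ge0 ?invr_ge0 ?(ltW M0)//.
by rewrite ler_piMl// invf_le1.
Qed.

Variables (one : BB) (gamma : R).
Hypothesis one_fun : bfun one = (fun=> 1) %[ae mu].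
Hypothesis gamma01 : 0 < gamma <= 1.
Let tau_one := fun y => (tau y `^ gamma)%:C%C * bfun one y.
Hypothesis tau_one_L1 : in_Lp mu 1%E tau_one.
Hypothesis tau_one_Lp : in_Lp mu p%:E (P tau_one).

Definition defect s y : R[i] := 1 - es s 1 y.
Definition defect_mass s : R := \int[mu]_y normc (defect s y).
Local Notation a := (1 - p^-1).

Lemma cmeasurable_defect s : cmeasurable (defect s).
Proof. by apply: cmeasurableB; [exact: cmeasurable_cst|exact: cmeasurable_es]. Qed.

Lemma defect_le2 s y : 0 <= complex.Re s -> normc (defect s y) <= 2.
Proof. by move=> s0; rewrite (le_trans (normcB _ _))// normc1 lerD// normc_es. Qed.

Lemma defect_le s y : 0 <= complex.Re s -> normc (defect s y) <= 3 * normc s * tau y.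
Proof.
move=> s0; rewrite /defect es1E (le_trans (normc_1Bcexp _))//.
 by rewrite ReM/= mulr0 subr0 mulr_ge0// ltW.
by rewrite normcM normc_real (gtr0_norm (tau_pos y)) mulrA.
Qed.

Lemma btest_defect s : 0 <= complex.Re s -> btest (defect s).
Proof.
by move=> s0; split; [exact: cmeasurable_defect|exists 2 => y; exact: defect_le2].
Qed.

Lemma rintegrable_defect s : 0 <= complex.Re s -> rintegrable mu (fun y => normc (defect s y)).
Proof.
move=> s0; apply: cintegrable_normc; apply: (cintegrable_bounded mu (M := 2)).
 exact: cmeasurable_defect.
by move=> y; exact: defect_le2.
Qed.

Lemma defect_mass_ge0 s : 0 <= defect_mass s.
Proof. by apply: Rintegral_ge0 => y _; exact: normc_ge0. Qed.

(** Interpolation between the bounds 2 and [3 |s| tau]: with [x = |s| tau], the minimum of 1 and [x]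
    is at most [x^gamma]. *)
Lemma defect_power s y : 0 <= complex.Re s ->
 normc (defect s y) <= 3 * (normc s `^ gamma * tau y `^ gamma).
Proof.
move=> s0; have t0 := tau_pos y; have n0 := normc_ge0 s; case/andP: gamma01 => g0 g1.
rewrite -powRM ?(ltW t0)//.
have [h|h] := leP (normc s * tau y) 1; last first.
 rewrite (le_trans (defect_le2 y s0))// (le_trans (_ : _ <= 3 * 1))//; first by lra.
 rewrite ler_wpM2l// -[leLHS](powRr0 (normc s * tau y)) ler_powR// ltW//.
rewrite (le_trans (defect_le y s0))// -mulrA ler_wpM2l//.
have : 0 <= normc s * tau y by rewrite mulr_ge0// ltW.
rewrite le_eqVlt => /predU1P[<-|h0]; first exact: powR_ge0.
rewrite -[leLHS]powRr1 ?(ltW h0)//; apply: ger_powR => //.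
by rewrite h0.
Qed.

Lemma one_pair w : btest w -> cpair one w = cintegral mu w.
Proof.
move=> bw; rewrite (cpair_ae bw (@cmeasurable_cst _ Y R 1) one_fun).
by congr cintegral; apply/funext => y; rewrite mul1r.
Qed.

Lemma cintegral_comp n w : btest w -> cintegral mu (w \o iter n F) = cintegral mu w.
Proof. by move=> [mw [M wM]]; apply: (cintegral_iter F_mp); exact: (cintegrable_bounded mu mw wM). Qed.

Lemma T0_one : T 0 one = one.
Proof.
apply/subr0_eq; apply: bfun_ext => E mE; have bE := btest_indic mE.
rewrite cpairB// T_pair//; last exact: D0.
have -> : (fun y => es 0 1 y * (\1_E (F y) : R)%:C%C) = (fun y => (\1_E y : R)%:C%C) \o iter 1 F.
 by apply/funext => y /=; rewrite es0 mul1r.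
rewrite one_pair; last exact: btest_iter.
by rewrite one_pair// cintegral_comp// subrr.
Qed.

(** Clause (iii) of (H) at the function 1 places [P (tau^gamma)] in L^p, and duality with Hölder
    bounds the integral of [tau^gamma] times [g \o F]. A large value of [tau] and an event of small
    probability one step later therefore seldom coincide, which mixing alone does not quantify. *)
Lemma tau_gamma_pair : exists2 B, 0 < B & forall (g : Y -> R), mfunT g ->
 (forall y, 0 <= g y <= 2) ->
 rintegrable mu (fun y => tau y `^ gamma * g (F y)) /\
 \int[mu]_y (tau y `^ gamma * g (F y)) <= B * (\int[mu]_y g y) `^ a.
Proof.
have [iP _] := in_Lp_cintegrable p_gt1 tau_one_Lp.
have it : cintegrable mu tau_one by exact/in_L1P.
pose N := fine (cLnorm mu p%:E (P tau_one)).
have N0 : 0 <= N by exact/fine_ge0/Lnorm_ge0.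
exists (4 * N + 1); first by rewrite ltr_wpDl// mulr_ge0.
move=> g mg g02.
have q0 : 0 < a by rewrite subr_gt0 invf_lt1// (lt_trans _ p_gt1).
pose w y := (g y)%:C%C.
have mw : cmeasurable w by exact: cmeasurable_real.
have bw : btest w.
 split => //; exists 2 => y; rewrite normc_real.
 by have /andP[? ?] := g02 y; rewrite ger0_norm.
have mF : mfunT F by case: F_mp.
pose f y := tau y `^ gamma * g (F y).
have mf : mfunT f.
 apply: measurable_funM; last exact: measurableT_comp.
 by apply: (measurableT_comp (f := fun x : R => x `^ gamma)) => //; exact: measurable_powR.
have fE : (fun y => tau_one y * w (F y)) = (fun y => (f y)%:C%C) %[ae mu].
 apply: filterS one_fun => y h yT; rewrite /tau_one h// mulr1 /w /f.
 by rewrite -rmorphM.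
have iff : cintegrable mu (fun y => (f y)%:C%C).
 apply: (cintegrable_ae _ fE); first exact: cmeasurable_real.
 exact: cintegrable_test it (btest_iter 1 bw).
have [rif _] := iff; split; first exact: rif.
have [_ PE] := P_pair it bw.
have E2 : cintegral mu (fun y => tau_one y * w (F y)) = (\int[mu]_y f y)%:C%C.
 rewrite (cintegral_ae _ _ fE).
 - by rewrite /cintegral/= Rintegral_cst1.
 - by apply: (cintegrable_cmeasurable (cintegrable_test it (btest_iter 1 bw))).
 - exact: cmeasurable_real.
have f0 y : 0 <= f y by rewrite mulr_ge0 ?powR_ge0//; case/andP: (g02 (F y)).
have -> : \int[mu]_y (tau y `^ gamma * g (F y)) = normc (cintegral mu (fun y => P tau_one y * w y)).
 rewrite PE E2 normc_real ger0_norm//.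
 by apply: Rintegral_ge0 => y _; exact: f0.
rewrite (le_trans (normc_cintegral (cintegrable_test iP bw)))//.
pose g2 y := g y / 2.
have g201 y : 0 <= g2 y <= 1.
 by have /andP[? ?] := g02 y; rewrite /g2; apply/andP; split; lra.
have mg2 : mfunT g2 by exact: measurable_funM.
have [ih hh] := hoelder_unit p_gt1 tau_one_Lp mg2 g201.
have -> : \int[mu]_y normc (P tau_one y * w y) = 2 * \int[mu]_y (normc (P tau_one y) * g2 y).
 rewrite -RintegralZl//; apply: eq_Rintegral => y _.
 rewrite normcM normc_real ger0_norm; last by case/andP: (g02 y).
 by rewrite /g2; field.
have ig : rintegrable mu g.
 by apply: (rintegrable_bounded mu mg (M := 2)) => y; have /andP[? ?] := g02 y; rewrite ger0_norm.
have I0 : 0 <= \int[mu]_y g y by apply: Rintegral_ge0 => y _; case/andP: (g02 y).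
have h3 : (\int[mu]_y g2 y) `^ a <= (\int[mu]_y g y) `^ a.
 apply: ge0_ler_powR; rewrite ?(ltW q0) ?nnegrE ?I0//.
  by apply: Rintegral_ge0 => y _; case/andP: (g201 y).
 apply: Rintegral_le => //.
  by apply: (rintegrable_bounded mu mg2 (M := 1)) => y; have /andP[? ?] := g201 y; rewrite ger0_norm.
 by move=> y; have /andP[? ?] := g02 y; rewrite /g2; lra.
have h4 := ler_wpM2l N0 h3.
have h5 : 0 <= (\int[mu]_y g y) `^ a by exact: powR_ge0.
rewrite -/N in hh.
have h6 : \int[mu]_y (normc (P tau_one y) * g2 y) <= N * (\int[mu]_y g y) `^ a.
 exact: le_trans h4.
apply: (@le_trans _ _ (4 * N * (\int[mu]_y g y) `^ a)); last first.
 by rewrite [leRHS]mulrDl mul1r lerDl.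
rewrite (_ : 4 * N * (\int[mu]_y g y) `^ a = 2 * (2 * (N * (\int[mu]_y g y) `^ a))); last by ring.
by rewrite !ler_wpM2l.
Qed.

Lemma telescope x w n : btest w ->
 cpair x w = \sum_(j < n) cpair (iter j (T 0) (x - T 0 x)) w + cpair (iter n (T 0) x) w.
Proof.
move=> bw; elim: n => [|n ->]; first by rewrite big_ord0 add0r.
rewrite big_ord_recr/= -addrA; congr (_ + _).
rewrite iterTB ?cpairB//; last exact: D0.
by rewrite -iterSr iterS subrK.
Qed.

Lemma normc_sum (I : Type) (r : seq I) (f : I -> R[i]) :
 normc (\sum_(j <- r) f j) <= \sum_(j <- r) normc (f j).
Proof.
elim: r => [|i r IH]; first by rewrite !big_nil normc0.
by rewrite !big_cons (le_trans (le_normcD _ _))// lerD2l.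
Qed.

(** The mean-zero vector [z = v - 1] satisfies [z - T 0 z = (1 - lam) v + (T s - T 0) v].
    Telescoping along [T 0] and pairing with [w] leaves [n] terms of order [m^a] and a remainder of
    order [t^n]. For the eigenvalue, [1 - lam - \int defect] is the pairing of [z] with the defect
    itself, so the terms become products of two small quantities; a product of defects at different
    times is bounded by [tau_gamma_pair]. The free integer [n] is fixed later by [error_choice]. *)
Lemma eigen_asymptotics (rho : R) : 0 < rho ->
 exists (B t : R), [/\ 0 < B, 0 < t < 1 & forall s v lam,
  D s -> cpair v (fun=> 1) = 1 -> rnorm v <= rho -> T s v = lam *: v ->
  let m := defect_mass s in
  (forall n w, cmeasurable w -> (forall y, normc (w y) <= 1) ->
    normc (cpair v w - cintegral mu w) <= B * (n%:R * m `^ a + t ^+ n)) /\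
  forall n, normc (1 - lam - cintegral mu (defect s)) <=
   B * (n%:R * (m `^ a * m `^ a) + n%:R * (normc s `^ gamma * m `^ a) `^ a + t ^+ n * m `^ a)].
Proof.
move=> rho0; have [K K0 hK] := embedding_bounded.
have [M M1 hM] := power_bounded; have M0 : 0 < M by rewrite (lt_le_trans ltr01).
have [M' [t [t01 hM']]] := mean_zero_decay0.
have [B0 B00 hB0] := tau_gamma_pair.
have q0 : 0 < a by rewrite subr_gt0 invf_lt1// (lt_trans _ p_gt1).
have b1 : btest (fun _ : Y => 1) by exact: btest_cst.
have [V V0 VE] : exists2 V, 0 < V & V = K * M * rho by eexists; last reflexivity; rewrite !mulr_gt0.
have [X X0 XE] : exists2 X, 0 <= X & X = K * (`|M'| * (rho + rnorm one)).
 by eexists; last reflexivity; rewrite !mulr_ge0 ?addr_ge0 ?rnorm_ge0// ltW.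
have [A A0 AE] : exists2 A, 0 <= A & A = (3 * B0) `^ a.
 by eexists; last reflexivity; exact: powR_ge0.
have VV : 0 < V * V by rewrite mulr_gt0.
have VA : 0 <= V * A by rewrite mulr_ge0// ltW.
exists (16 * (V * V) + 8 * (V * A) + 4 * V + 4 * X), t; split => //; first by lra.
move=> s v lam Ds v1 vr Tv m; have s0 := D_Re Ds.
have m0 : 0 <= m by exact: defect_mass_ge0.
have ma0 : 0 <= m `^ a by exact: powR_ge0.
have bd := btest_defect s0; have md := cmeasurable_defect s.
have d2 y : normc (defect s y) <= 2 by exact: defect_le2.
pose z := v - one.
have z0 : cpair z (fun=> 1) = 0 by rewrite meanB v1 one_pair// cintegral_cst subrr.
have zE w : btest w -> cpair z w = cpair v w - cintegral mu w.
 by move=> bw; rewrite cpairB// one_pair.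
have NpRv j : Np (iter j (T 0) v) <= V.
 rewrite (le_trans (hK _))// VE -mulrA ler_wpM2l ?(ltW K0)//.
 by rewrite (le_trans (hM _ D0 _ _))// ler_wpM2l// ltW.
have NpRz n : Np (iter n (T 0) z) <= X * t ^+ n.
 rewrite (le_trans (hK _))// XE -mulrA ler_wpM2l ?(ltW K0)//.
 rewrite (le_trans (hM' _ z0 n))//.
 have tn : 0 <= t ^+ n by case/andP: t01 => t0 _; rewrite exprn_ge0// ltW.
 have hz : rnorm z <= rho + rnorm one by rewrite (le_trans (rnormB _ _))// lerD2r.
 rewrite mulrAC ler_wpM2r// (le_trans (_ : _ <= `|M'| * rnorm z))//.
  by rewrite ler_wpM2r ?rnorm_ge0// ler_norm.
 by rewrite ler_wpM2l.
have pR j u w : btest w -> cpair (iter j (T 0) u) w = cpair u (w \o iter j F).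
 move=> bw; rewrite iterT_pair//; last exact: D0.
 by congr cintegral; apply/funext => y; rewrite es0 mul1r.
(* Means are taken in [v - T s v = (1 - lam) v]. *)
have lamE : 1 - lam = cpair v (defect s).
 have <- : cpair (v - T s v) (fun=> 1) = 1 - lam by rewrite meanB v1 Tv meanZ v1 mulr1.
 rewrite meanB mean_T// /cpair -cintegralB; [|exact: cpair_integrable|apply: cpair_integrable; exact: btest_es].
 by congr cintegral; apply/funext => y; rewrite /defect; ring.
have cvd w : cmeasurable w -> (forall y, normc (w y) <= 1) -> forall u,
  normc (cpair u (fun y => defect s y * w y)) <= 4 * Np u * m `^ a.
 move=> mw w1 u; have := @cpair_weightM u _ _ 2 _ mw w1 md d2.
 by rewrite ler1n => /(_ isT); rewrite -/m (_ : 2 * 2 = 4 :> R)//; lra.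
have m1 : cmeasurable (fun _ : Y => 1 : R[i]) by case: b1.
have n1 : forall y : Y, normc (1 : R[i]) <= 1 by move=> _; rewrite normc1.
have cvd1 u : normc (cpair u (defect s)) <= 4 * Np u * m `^ a.
 have := cvd _ m1 n1 u; rewrite (_ : (fun y => _ * 1) = defect s)//.
 by apply/funext => y; rewrite mulr1.
clear n1.
have lam_small : normc (1 - lam) <= 4 * V * m `^ a.
 rewrite lamE (le_trans (cvd1 v))// ler_wpM2r// ler_wpM2l//; exact: (NpRv 0%N).
have RzE : z - T 0 z = (1 - lam) *: v + (T s v - T 0 v).
 have -> : T 0 z = T 0 v - one by have := iterTB 1 v one D0; rewrite /= T0_one.
 by rewrite /z Tv scalerBl scale1r opprB addrA subrK addrA subrK.
have pdiff j w : btest w -> cpair (iter j (T 0) (T s v - T 0 v)) w =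
  - cpair v (fun y => defect s y * w (iter j.+1 F y)).
 move=> bw; have bwj := btest_iter j bw; have bwj1 := btest_iter j.+1 bw.
 rewrite pR// cpairB// !T_pair//; last exact: D0.
 rewrite /cpair -cintegralB; last 2 first.
 - by apply: cpair_integrable; apply: btestM; [exact: btest_es|exact: (btest_iter 1 bwj)].
 - by apply: cpair_integrable; apply: btestM; [exact: btest_es|exact: (btest_iter 1 bwj)].
 rewrite -cintegralN; last by apply: cpair_integrable; exact: btestM.
 congr cintegral; apply/funext => y; rewrite /= -iterSr iterS es0 /defect; ring.
have step w n : btest w -> normc (cpair z w) <=
  \sum_(j < n) (normc (1 - lam) * normc (cpair (iter j (T 0) v) w) +
   normc (cpair v (fun y => defect s y * w (iter j.+1 F y)))) +
  normc (cpair (iter n (T 0) z) w).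
 move=> bw; rewrite (telescope z n bw) (le_trans (le_normcD _ _))// lerD2r.
 rewrite (le_trans (normc_sum _ _))//; apply: ler_sum => j _.
 rewrite RzE iterT_linear; last exact: D0.
 rewrite cpairD// pdiff// (le_trans (normcB _ _))// lerD2r normcM//.
split.
 move=> n w mw w1; have bw : btest w by split => //; exists 1.
 rewrite -zE// (le_trans (step w n bw))//.
 rewrite (le_trans (_ : _ <= \sum_(j < n) ((8 * (V * V) + 4 * V) * m `^ a) + 2 * X * t ^+ n))//.
  apply: lerD; last first.
   by rewrite (le_trans (cpair_bound _ mw w1))// mulr1 -mulrA ler_wpM2l.
  apply: ler_sum => j _.
  have h1 : normc (cpair (iter j (T 0) v) w) <= 2 * V.
   by rewrite (le_trans (cpair_bound _ mw w1))// mulr1 ler_wpM2l.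
  have h2 : normc (cpair v (fun y => defect s y * w (iter j.+1 F y))) <= 4 * V * m `^ a.
   have [mwj _] := btest_iter j.+1 bw.
   rewrite (le_trans (cvd _ mwj (fun y => w1 _) v))// ler_wpM2r// ler_wpM2l//; exact: (NpRv 0%N).
  have h3 : normc (1 - lam) * normc (cpair (iter j (T 0) v) w) <= 4 * V * m `^ a * (2 * V).
   by rewrite ler_pM ?normc_ge0.
  lra.
 rewrite sumr_const card_ord -mulr_natl.
 have tn : 0 <= t ^+ n by case/andP: t01 => t0 _; rewrite exprn_ge0// ltW.
 have nm : 0 <= n%:R * m `^ a by rewrite mulr_ge0.
 have e1 : 0 <= (8 * (V * V) + 8 * (V * A) + 4 * X) * (n%:R * m `^ a).
  by apply: mulr_ge0 => //; rewrite !addr_ge0 ?mulr_ge0 ?(ltW V0)//.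
 have e2 : 0 <= (16 * (V * V) + 8 * (V * A) + 4 * V + 2 * X) * t ^+ n.
  by apply: mulr_ge0 => //; rewrite !addr_ge0 ?mulr_ge0 ?(ltW V0)//.
 lra.
move=> n; rewrite lamE -zE// (le_trans (step _ n bd))//.
pose sg := normc s `^ gamma; have sg0 : 0 <= sg by exact: powR_ge0.
rewrite (le_trans (_ : _ <= \sum_(j < n) (16 * (V * V) * (m `^ a * m `^ a) +
  8 * (V * A) * (sg * m `^ a) `^ a) + 4 * X * (t ^+ n * m `^ a)))//.
 apply: lerD; last first.
  rewrite (_ : 4 * X * (t ^+ n * m `^ a) = 4 * (X * t ^+ n) * m `^ a); last by ring.
  by rewrite (le_trans (cvd1 _))// ler_wpM2r// ler_wpM2l.
 apply: ler_sum => j _; apply: lerD.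
  have h1 : normc (cpair (iter j (T 0) v) (defect s)) <= 4 * V * m `^ a.
   by rewrite (le_trans (cvd1 _))// ler_wpM2r// ler_wpM2l.
  have h3 : normc (1 - lam) * normc (cpair (iter j (T 0) v) (defect s)) <=
    4 * V * m `^ a * (4 * V * m `^ a) by rewrite ler_pM ?normc_ge0.
  by rewrite (le_trans h3)//; apply: eq_ler; ring.
 pose g y := defect s y * defect s (iter j.+1 F y).
 have [mdj _] := btest_iter j.+1 bd.
 have mg : cmeasurable g by exact: cmeasurableM.
 have g4 y : normc (g y) <= 4.
  rewrite normcM (le_trans (_ : _ <= 2 * 2))//; first by rewrite ler_pM ?normc_ge0.
  by lra.
 have n1 : forall y : Y, normc (1 : R[i]) <= 1 by move=> _; rewrite normc1.
 have := @cpair_weightM v _ _ 4 _ m1 n1 mg g4.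
 clear n1.
 rewrite ler1n => /(_ isT).
 rewrite (_ : (fun y => g y * 1) = g); last by apply/funext => y; rewrite mulr1.
 move=> /le_trans; apply.
 (* One defect is bounded by [3 |s|^gamma tau^gamma]; the other, at time [j + 1], is a function of
    [F y], to which [tau_gamma_pair] applies, and invariance brings its mass back to time 0. *)
 have gI : \int[mu]_y normc (g y) <= 3 * B0 * (sg * m `^ a).
  pose gj y := normc (defect s (iter j F y)).
  have [mdj' _] := btest_iter j bd.
  have mgj : mfunT gj by exact: measurable_normc mdj'.
  have gj2 y : 0 <= gj y <= 2 by rewrite normc_ge0 d2.
  have [igj hgj] := hB0 _ mgj gj2.
  have ig : rintegrable mu (fun y => normc (g y)).
   by apply: cintegrable_normc; exact: (cintegrable_bounded mu mg g4).
  have ir : rintegrable mu (fun y => 3 * sg * (tau y `^ gamma * gj (F y))) by exact: rintegrableZ.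
  have Em : \int[mu]_y gj y = m.
   by rewrite (Rintegral_iter F_mp j (rintegrable_defect s0)).
  rewrite Em in hgj.
  rewrite (le_trans (Rintegral_le ig ir _))//.
   move=> y; rewrite /g normcM /gj -iterSr [leRHS]mulrA ler_wpM2r ?normc_ge0//.
   by rewrite -mulrA (le_trans (defect_power _ s0)).
  rewrite RintegralZl// (_ : 3 * B0 * (sg * m `^ a) = 3 * sg * (B0 * m `^ a)); last by ring.
  by rewrite ler_wpM2l// mulr_ge0.
 have I0 : 0 <= \int[mu]_y normc (g y) by apply: Rintegral_ge0 => y _; exact: normc_ge0.
 have h5 : (\int[mu]_y normc (g y)) `^ a <= A * (sg * m `^ a) `^ a.
  rewrite AE -powRM ?mulr_ge0 ?(ltW B00)//.
  by apply: ge0_ler_powR; rewrite ?(ltW q0) ?nnegrE ?mulr_ge0 ?(ltW B00).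
 have h6 : Np v <= V by exact: (NpRv 0%N).
 rewrite (_ : 2 * 4 = 8 :> R); last by rewrite -natrM.
 rewrite (_ : 8 * (V * A) * (sg * m `^ a) `^ a = 8 * V * (A * (sg * m `^ a) `^ a)); last by ring.
 have aux (x y x' y' : R) : 0 <= x -> x <= x' -> 0 <= y -> y <= y' -> 8 * x * y <= 8 * x' * y'.
  by move=> *; apply: ler_pM => //; [rewrite mulr_ge0|rewrite ler_wpM2l].
 exact: (aux _ _ _ _ (Np_ge0 v) h6 (powR_ge0 _ _) h5).
rewrite sumr_const card_ord -[_ *+ n]mulr_natl.
have tn : 0 <= t ^+ n * m `^ a by case/andP: t01 => t0 _; rewrite mulr_ge0 ?exprn_ge0// ltW.
have y1 : 0 <= n%:R * (m `^ a * m `^ a) by rewrite !mulr_ge0.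
have y2 : 0 <= n%:R * (sg * m `^ a) `^ a by rewrite mulr_ge0// powR_ge0.
have e1 : 0 <= (8 * (V * A) + 4 * V + 4 * X) * (n%:R * (m `^ a * m `^ a)).
 by apply: mulr_ge0 => //; rewrite !addr_ge0 ?mulr_ge0 ?(ltW V0)//.
have e2 : 0 <= (16 * (V * V) + 4 * V + 4 * X) * (n%:R * (sg * m `^ a) `^ a).
 by apply: mulr_ge0 => //; rewrite !addr_ge0 ?mulr_ge0 ?(ltW V0)//.
have e3 : 0 <= (16 * (V * V) + 8 * (V * A) + 4 * V) * (t ^+ n * m `^ a).
 by apply: mulr_ge0 tn; rewrite !addr_ge0 ?mulr_ge0 ?(ltW V0)//.
rewrite -/sg; lra.
Qed.

(** The scale [h] will be the tail of [tau] at [1 / |s|]. The predicate [Q] selects directions,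
    later the two axes, along which the real part of the integrated defect is at least of order [h];
    this forces [|lam| <= e^(- c h)]. The relative error [e] is as small as desired, while [C1], [c]
    and [t] do not depend on it. *)
Lemma spectral_expansion (h : R -> R) (b0 C0 c0 : R) (Q : R[i] -> Prop) u w :
 8 <= p -> 0 < b0 -> 0 < c0 -> 1 <= C0 ->
 (forall b, 0 < b <= b0 -> 0 < h b <= 1) ->
 (forall e, 0 < e -> exists2 b1, 0 < b1 & forall b, 0 < b <= b1 -> h b <= e) ->
 (forall s, D s -> 0 < normc s <= b0 -> defect_mass s <= C0 * h (normc s)) ->
 (forall b, 0 < b <= b0 -> b `^ gamma <= C0 * h b `^ 2^-1) ->
 (forall s, Q s -> 0 < normc s <= b0 ->
  c0 * h (normc s) <= complex.Re (cintegral mu (defect s))) ->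
 cmeasurable w -> (forall y, normc (w y) <= 1) ->
 exists C1 c t, [/\ 0 < C1, 0 < c, 0 < t < 1 & forall e, 0 < e ->
  exists2 r, 0 < r & forall s, D s -> Q s -> 0 < normc s <= r -> exists lam,
  [/\ normc lam <= expR (- c * h (normc s)),
    normc (1 - lam - cintegral mu (defect s)) <= C1 * h (normc s) `^ (65 / 64) &
    forall n, normc (cpair u (fun y => es s n y * w (iter n F y)) -
     cpair u (fun=> 1) * cintegral mu w * lam ^+ n) <=
     e * normc lam ^+ n + C1 * t ^+ n]].
Proof.
move=> p8 b00 c00 C01 h01 hlim hm hgam hQ mw w1.
have bw : btest w by split => //; exists 1.
have [K K0 hK] := embedding_bounded.
have one1 : cpair one (fun=> 1) = 1.
 by rewrite one_pair ?cintegral_cst//; exact: btest_cst.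
have [rho [eta [N [[rho0 eta0 e4 N1] [r1 r10 heig]]]]] := leading_eigenvector one1.
have [B1 [t1 [B10 t101 hexp]]] := eigen_expansion rho0 eta0 e4 N1.
have [B2 [t2 [B20 t201 hasy]]] := eigen_asymptotics rho0.
have a78 : 7 / 8 <= a < 1.
 have p0 : 0 < p by exact: lt_trans p_gt1.
 have : p^-1 <= 8^-1 by rewrite lef_pV2 ?posrE.
 by have : 0 < p^-1 by [rewrite invr_gt0]; lra.
have [C1 C10 herr] := error_choice B20 t201 C01 a78.
have hpow k e : 0 < k -> 0 < e -> exists2 b1, 0 < b1 & forall b, 0 < b <= b1 -> h b `^ k <= e.
 move=> k0 e0; have [b1 b10 hb1] := hlim _ (powR_gt0 k^-1 e0).
 exists (Num.min b1 b0); first by rewrite lt_min b10.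
 move=> b /andP[bg0]; rewrite le_min => /andP[bb1 bb0].
 have hb : 0 < h b <= 1 by apply: h01; rewrite bg0.
 rewrite -[leRHS](powRr1 (ltW e0)) -(mulVf (lt0r_neq0 k0)) powRrM.
 apply: ge0_ler_powR; rewrite ?nnegrE ?(ltW k0) ?powR_ge0//.
  by case/andP: hb => /ltW.
 by apply: hb1; rewrite bg0.
pose U := rnorm u; have U0 : 0 <= U by exact: rnorm_ge0.
pose m := cpair u (fun=> 1); have m0 := normc_ge0 m.
have K20 : 0 <= 2 * K by rewrite mulr_ge0// ltW.
exists (C1 + 2 * K * (B1 * U)), (c0 / 4), t1; split => //.
- by rewrite ltr_pwDl// mulr_ge0// mulr_ge0// ltW.
- by rewrite divr_gt0.
move=> e e0.
pose q := 2 * (B1 * U * (2 * K * rho) + 1).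
have q0 : 0 < q by rewrite mulr_gt0// ltr_wpDl// !mulr_ge0// ltW.
pose e1 := Num.min eta (e / q).
have e10 : 0 < e1 by rewrite lt_min eta0 divr_gt0.
have [r2 r20 hmean] := mean_perturbation N e10.
(* [h^(1/2)] controls the eigenvector error in [cpair v w]; [h^(1/64)], the excess of [h^(65/64)]
   over [h], controls the eigenvalue error. *)
have [b1 b10 hb1] := hpow 2^-1 (e / 2 / (normc m * C1 + 1)) ltac:(by rewrite invr_gt0)
  (divr_gt0 (divr_gt0 e0 (ltr0n _ 2)) (ltr_wpDl (mulr_ge0 m0 (ltW C10)) ltr01)).
have [b2 b20 hb2] := hpow 64^-1 (c0 / 4 / C1) ltac:(by rewrite invr_gt0)
  (divr_gt0 (divr_gt0 c00 (ltr0n _ 4)) C10).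
have CC0 : 0 < 4 * (C0 * C0).
 by rewrite !mulr_gt0// (lt_le_trans ltr01).
have [b3 b30 hb3] := hlim (Num.min c0^-1 (c0 / (4 * (C0 * C0))))
  ltac:(by rewrite lt_min invr_gt0 c00 divr_gt0).
exists (Num.min (Num.min (r1 / 2) (r2 / 2)) (Num.min b0 (Num.min b1 (Num.min b2 b3)))).
 by rewrite !lt_min !divr_gt0// b00 b10 b20.
move=> s Ds Qs /andP[s0]; rewrite !le_min => /andP[/andP[sr1 sr2] /and4P[sb0 sb1 sb2 sb3]].
have sr1' : normc s < r1 by rewrite (le_lt_trans sr1)// ltr_pdivrMr// ltr_pMr// ltr1n.
have sr2' : normc s < r2 by rewrite (le_lt_trans sr2)// ltr_pdivrMr// ltr_pMr// ltr1n.
have sB0 : 0 < normc s <= b0 by rewrite s0.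
have /andP[hs0 hs1] := h01 _ sB0.
have {}hb1 := hb1 (normc s) ltac:(by rewrite s0).
have {}hb2 := hb2 (normc s) ltac:(by rewrite s0).
have {}hb3 := hb3 (normc s) ltac:(by rewrite s0).
set hs := h (normc s) in hs0 hs1 hb1 hb2 hb3 *.
have [v [lam [[v1 vr Tv lamN] hf]]] := heig s Ds sr1'.
have [hv hl] := hasy s v lam Ds v1 vr Tv.
have msm : 0 <= defect_mass s <= C0 * hs by rewrite defect_mass_ge0 hm.
have xsm : 0 <= normc s `^ gamma <= C0 * hs `^ 2^-1 by rewrite powR_ge0 hgam.
have [k [k1 k2]] := herr hs _ _ ltac:(by rewrite hs0) msm xsm.
have {}hl := le_trans (hl k) k2.
have {}hv : normc (cpair v w - cintegral mu w) <= C1 * hs `^ 2^-1 by exact: le_trans (hv k w mw w1) k1.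
have h65 : hs `^ (65 / 64) = hs `^ 64^-1 * hs.
 by rewrite -{3}(powRr1 (ltW hs0)) -powRD ?(gt_eqF hs0) ?implybT//; congr (_ `^ _); field.
have lamE : normc lam <= expR (- (c0 / 4) * hs).
 move: hb3; rewrite le_min => /andP[hb3 hb3'].
 apply: (@normc_contraction R (cintegral mu (defect s)) lam c0 C0 (C1 * hs `^ 64^-1)) => //.
 - exact: ltW.
 - by rewrite mulrC -ler_pdivlMr// mul1r.
 - by rewrite mulrC -ler_pdivlMr.
 - by rewrite mulrC -ler_pdivlMr.
 - exact: hQ.
 - rewrite (le_trans (normc_cintegral _))//.
   apply: (cintegrable_bounded mu (cmeasurable_defect s) (M := 2)) => y.
   exact: defect_le2 (D_Re Ds).
  by rewrite ler_wpM2l//; case/andP: msm.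
 - by rewrite -mulrA -h65.
exists lam; split => //.
 by rewrite (le_trans hl)// ler_wpM2r ?powR_ge0// lerDl mulr_ge0// mulr_ge0// ltW.
move=> n.
have [c [hc1 hc2]] : exists c,
   rnorm (iter n (T s) u - c *: v) <= B1 * t1 ^+ n * rnorm u /\
   normc (c - cpair u (fun=> 1) * lam ^+ n) <= B1 * e1 * normc lam ^+ n * rnorm u.
 apply: (hexp s v lam e1 Ds v1 vr Tv lamN).
  by rewrite ltW// ge_min lexx.
 move=> f f0; split; first by case: (hf f f0).
 by have := hmean s Ds sr2' f; rewrite f0 subr0.
pose z := iter n (T s) u - c *: v.
have tn0 : 0 <= t1 ^+ n by case/andP: t101 => ? _; rewrite exprn_ge0// ltW.
have ln0 : 0 <= normc lam ^+ n by rewrite exprn_ge0// normc_ge0.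
have zw : normc (cpair z w) <= 2 * K * (B1 * U) * t1 ^+ n.
 rewrite (le_trans (cpair_bound _ mw w1))// mulr1 -!mulrA ler_wpM2l//.
 rewrite (le_trans (hK _))// ler_wpM2l ?(ltW K0)// (le_trans hc1)//.
 by rewrite -mulrA [U * _]mulrC.
have vw : normc (cpair v w) <= 2 * K * rho.
 rewrite (le_trans (cpair_bound _ mw w1))// mulr1 -!mulrA ler_wpM2l//.
 by rewrite (le_trans (hK _))// ler_wpM2l// ltW.
have E : cpair u (fun y => es s n y * w (iter n F y)) = c * cpair v w + cpair z w.
 rewrite -iterT_pair// -[iter n (T s) u](subrK (c *: v)) -/z addrC cpairD//.
rewrite E -/m.
have -> : c * cpair v w + cpair z w - m * cintegral mu w * lam ^+ n =
  (c - m * lam ^+ n) * cpair v w + m * lam ^+ n * (cpair v w - cintegral mu w) + cpair z w by ring.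
rewrite (le_trans (le_normcD _ _))// [(C1 + _) * _]mulrDl [leRHS]addrA; apply: lerD; last exact: zw.
rewrite (le_trans (le_normcD _ _))// !normcM.
have nX : normc (lam ^+ n) = normc lam ^+ n.
 by elim: n {hc1 hc2 z tn0 ln0 zw E} => [|n IH]; rewrite ?expr0 ?normc1// !exprS normcM IH.
rewrite nX.
have t1' : normc (c - m * lam ^+ n) * normc (cpair v w) <= e / 2 * normc lam ^+ n.
 rewrite (le_trans (_ : _ <= B1 * e1 * normc lam ^+ n * rnorm u * (2 * K * rho)))//.
  by apply: ler_pM; rewrite ?normc_ge0.
 rewrite -/U (_ : B1 * e1 * normc lam ^+ n * U * (2 * K * rho) =
   e1 * (B1 * U * (2 * K * rho)) * normc lam ^+ n); last by ring.
 rewrite ler_wpM2r// (le_trans (_ : _ <= e / q * (B1 * U * (2 * K * rho))))//.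
  by rewrite ler_wpM2r ?ge_min ?lexx ?orbT// !mulr_ge0// ltW.
 set X := B1 * U * (2 * K * rho).
 rewrite mulrAC ler_pdivrMr// (_ : e / 2 * q = e * X + e); last by rewrite /q -/X; field.
 by rewrite lerDl ltW.
have t2' : normc m * normc lam ^+ n * normc (cpair v w - cintegral mu w) <= e / 2 * normc lam ^+ n.
 rewrite mulrAC ler_wpM2r// (le_trans (ler_wpM2l m0 hv))// mulrA.
 have pp : 0 < normc m * C1 + 1 by rewrite ltr_wpDl// mulr_ge0// ltW.
 rewrite (le_trans (_ : _ <= (normc m * C1 + 1) * hs `^ 2^-1))//.
  by rewrite ler_wpM2r ?powR_ge0// lerDl.
 by rewrite mulrC -ler_pdivlMr.
by rewrite (le_trans (lerD t1' t2'))// -mulrDl -splitr lerDl mulr_ge0// ltW.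
Qed.

End operator.

(** * Means over orbits from [A] to [B] *)

Section marked_mean.
Context d (Y : measurableType d) (R : realType) (mu : probability Y R).
Variables (F : Y -> Y) (tau : Y -> R) (A B : set Y).
Hypothesis F_mp : measure_preserving mu F.
Hypothesis tau_meas : mfunT tau.
Hypothesis tau_pos : forall y, 0 < tau y.
Hypothesis mA : measurable A.
Hypothesis mB : measurable B.

Definition visit n : set Y := A `&` iter n F @^-1` B.

Definition marked_mean n (f : R -> R) : R :=
 \int[mu]_y (\1_(visit n) y * f (birkhoff_sum F tau n y)).
Local Notation es := (laplace_weight F tau).

Lemma measurable_visit n : measurable (visit n).
Proof.
apply: measurableI => //; rewrite -[X in measurable X]setTI.
exact: (measurable_iter F_mp n).
Qed.

Lemma marked_mean_laplace n s : 0 <= complex.Re s -> forall (BB : banach_fun_space mu) (u : BB),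
 cmeasurable (bfun u) ->
 bfun u = (fun y => (\1_A y : R)%:C%C) %[ae mu] ->
 cpair u (fun y => es s n y * (\1_B (iter n F y) : R)%:C%C) =
 (marked_mean n (fun x => expR (- (complex.Re s * x)) * cos (complex.Im s * x)) +i*
  - marked_mean n (fun x => expR (- (complex.Re s * x)) * sin (complex.Im s * x)))%C.
Proof.
move=> s0 BB u mu0 uA.
have bw : btest (fun y => es s n y * (\1_B (iter n F y) : R)%:C%C).
 by apply: btestM; [exact: (btest_es F_mp tau_meas tau_pos n s0)|exact: (btest_iter F_mp n (@btest_indic _ Y R _ mB))].
have mS := measurable_birkhoff F_mp tau_meas n.
pose fc y := \1_(visit n) y * (expR (- (complex.Re s * birkhoff_sum F tau n y)) *
 cos (complex.Im s * birkhoff_sum F tau n y)).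
pose fs y := \1_(visit n) y * (expR (- (complex.Re s * birkhoff_sum F tau n y)) *
 sin (complex.Im s * birkhoff_sum F tau n y)).
have E y : (\1_A y : R)%:C%C * (es s n y * (\1_B (iter n F y) : R)%:C%C) = (fc y +i* - fs y)%C.
 have -> : es s n y = (expR (- (complex.Re s * birkhoff_sum F tau n y)) *
   cos (complex.Im s * birkhoff_sum F tau n y) +i* -
   (expR (- (complex.Re s * birkhoff_sum F tau n y)) * sin (complex.Im s * birkhoff_sum F tau n y)))%C.
  rewrite /laplace_weight /cexp; case: s {s0 bw fc fs} => a b /=.
  by rewrite !mulr0 subr0 add0r cosN sinN mulrN.
 rewrite /fc /fs /visit indicI /=; simpc.
 by congr (_ +i* _)%C; rewrite /preimage !indicE /=; ring.
have mfc : mfunT fc.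
 apply: measurable_funM; first exact: measurable_indic (measurable_visit n).
 apply: measurable_funM; first by apply: measurableT_comp => //; apply: measurableT_comp => //; exact: measurable_funM.
 apply: (measurableT_comp (f := @cos R)); last exact: measurable_funM.
 exact: (continuous_measurable_fun (@continuous_cos R)).
have mfs : mfunT fs.
 apply: measurable_funM; first exact: measurable_indic (measurable_visit n).
 apply: measurable_funM; first by apply: measurableT_comp => //; apply: measurableT_comp => //; exact: measurable_funM.
 apply: (measurableT_comp (f := @sin R)); last exact: measurable_funM.
 exact: (continuous_measurable_fun (@continuous_sin R)).
rewrite /cpair (@cintegral_ae _ _ _ mu _ (fun y => (fc y +i* - fs y)%C)).
- rewrite /cintegral; congr (_ +i* _)%C => /=.
 have rfs : rintegrable mu fs; last first.
  rewrite /marked_mean -mulN1r -RintegralZl//.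
  by apply: eq_Rintegral => y _; rewrite mulN1r.
 apply: (rintegrable_bounded mu mfs (M := 1)) => y.
 rewrite /fs !normrM -[leRHS]mulr1; apply: ler_pM => //.
  by rewrite indicE; case: (_ \in _); rewrite ?normr1 ?normr0.
 rewrite -[leRHS]mulr1; apply: ler_pM => //.
  rewrite ger0_norm// expRN_le1 mulr_ge0//.
  exact: birkhoff_ge0.
 by rewrite ler_norml sin_geN1 sin_le1.
- by apply: cmeasurableM => //; case: bw.
- by split => //=; exact: measurable_funN.
- by apply: filterS uA => y + _ => ->//; rewrite E.
Qed.

(** It identifies the operator supplied by (S)(ii) with the one chosen from (H). *)
Lemma induces_unique (BB : banach_fun_space mu) Q (T1 T2 : BB -> BB) :
 induces Q T1 -> induces Q T2 -> T1 =1 T2.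
Proof.
move=> h1 h2 v; apply/subr0_eq/bfun_inj.
have := bfun_linear (-1) (T2 v) (T1 v); rewrite scaleN1r addrC.
move=> h3; near=> y => yT.
rewrite (near h3 y) ?(near (h1 v) y) ?(near (h2 v) y)//.
by rewrite mulN1r addNr.
Unshelve. all: end_near. Qed.

End marked_mean.

Lemma normc_exprB (R : realType) (z w : R[i]) (q : R) n : normc z <= q -> normc w <= q ->
 normc (z ^+ n.+1 - w ^+ n.+1) <= n.+1%:R * q ^+ n * normc (z - w).
Proof.
move=> zq wq; have q0 : 0 <= q by rewrite (le_trans _ zq)// normc_ge0.
have nX k : normc (w ^+ k) <= q ^+ k.
 elim: k => [|k IH]; first by rewrite !expr0 normc1.
 by rewrite !exprS normcM ler_pM ?normc_ge0.
elim: n => [|n IH]; first by rewrite !expr1 expr0 mulr1 mul1r.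
have -> : z ^+ n.+2 - w ^+ n.+2 = z * (z ^+ n.+1 - w ^+ n.+1) + w ^+ n.+1 * (z - w).
 by rewrite exprS [w ^+ n.+2]exprS; ring.
rewrite (le_trans (le_normcD _ _))// !normcM.
rewrite -[n.+2]addn1 natrD !mulrDl mul1r; apply: lerD.
 rewrite [q ^+ n.+1]exprS (le_trans (ler_pM _ _ zq IH))// ?normc_ge0//.
 by apply: eq_ler; ring.
by rewrite ler_wpM2r ?normc_ge0.
Qed.

(** * Fourier and Laplace estimates from (H) and (S)(ii) *)

Section operator_estimates.
Context d (Y : measurableType d) (R : realType) (mu : probability Y R).
Variables (F : Y -> Y) (tau : Y -> R) (P : (Y -> R[i]) -> (Y -> R[i])).
Variables (p0 beta gamma : R) (BB : R -> R -> R -> banach_fun_space mu) (A B : set Y).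
Hypothesis F_mp : measure_preserving mu F.
Hypothesis F_mixing : mixing mu F.
Hypothesis tau_meas : mfunT tau.
Hypothesis tau_pos : forall y, 0 < tau y.
Hypothesis P_transfer : transfer_operator mu F P.
Hypothesis p0_ge1 : 1 <= p0.
Hypothesis beta_lt1 : beta < 1.
Hypothesis gamma_beta : 0 < gamma < beta.
Hypothesis H : forall p gamma L : R, p0 < p -> 0 < gamma < beta -> 0 < L ->
 hypothesis_H P tau p gamma L (BB p gamma L).
Hypothesis Sii : forall p gamma L : R, p0 < p -> 0 < gamma < beta -> 0 < L ->
 hypothesis_Sii P tau L (BB p gamma L).
Hypothesis mA : measurable A.
Hypothesis mB : measurable B.
Hypothesis A_in_BB : forall p gamma L : R, p0 < p -> 0 < gamma < beta -> 0 < L ->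
 in_space (BB p gamma L) (fun y => (\1_A y : R)%:C%C).
Local Notation es := (laplace_weight F tau).
Local Notation marked := (marked_mean mu F tau A B).
(** [p >= 8] makes the Hölder exponent [1 - p^-1] at least 7/8, as [error_choice] requires. *)
Let p := Num.max p0 8 + 1.
Let wB := fun y => (\1_B y : R)%:C%C.

Let p_p0 : p0 < p. Proof. by rewrite /p ltr_pwDr// le_max lexx. Qed.
Let p8 : 8 <= p. Proof. by rewrite /p ler_wpDr// le_max lexx orbT. Qed.
Let p1 : 1 < p. Proof. exact: le_lt_trans p_p0. Qed.

Lemma operator_family (L : R) : 0 < L ->
 exists (delta alpha C : R) (T : R[i] -> BB p gamma L -> BB p gamma L),
 [/\ 0 < delta < L, 0 < alpha < 1, 0 < C, compactly_embedded (BB p gamma L) p%:E &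
  exists one : BB p gamma L, [/\ bfun one = (fun=> 1) %[ae mu],
   in_Lp mu 1%E (fun y => (tau y `^ gamma)%:C%C * bfun one y),
   in_Lp mu p%:E (P (fun y => (tau y `^ gamma)%:C%C * bfun one y)) &
  (forall s, halfdisc_segment delta L s -> induces (Rhat P tau s) (T s)) /\
  (forall s, halfdisc_segment delta L s -> forall v n, (1 <= n)%N ->
   rnorm (iter n (T s) v) <= C * (fine (cLnorm mu p%:E (bfun v)) + alpha ^+ n * rnorm v))]].
Proof.
move=> L0; have [cst [delta [alpha [C [[dL al C0] [cE hT h3]]]]]] := H p_p0 gamma_beta L0.
have hT' s : exists T : BB p gamma L -> BB p gamma L, halfdisc_segment delta L s ->
  induces (Rhat P tau s) T /\ forall v n, (1 <= n)%N ->
   rnorm (iter n T v) <= C * (fine (cLnorm mu p%:E (bfun v)) + alpha ^+ n * rnorm v).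
 (* Outside the region of (H) the operator is given the dummy value [id]. *)
 have [Ds|nD] := pselect (halfdisc_segment delta L s); last by exists id.
 by have [T hTs] := hT s Ds; exists T.
have [T TP] := boolp.choice hT'.
have [one h1] := cst 1; have [hL1 [hLp _]] := h3 one.
by exists delta, alpha, C, T; split => //; exists one; split => //; split=> s /TP[].
Qed.

(** The space depends on [L], so each range of frequencies uses its own [BB p gamma L]; the
    conclusion no longer refers to it. *)
Lemma fourier_decay (d' L : R) : 0 < d' -> d' <= L ->
 exists M t, [/\ 0 <= M, 0 < t < 1 & forall b n, d' <= b <= L ->
  `|marked n (fun x => cos (b * x))| + `|marked n (fun x => sin (b * x))| <= M * t ^+ n].
Proof.
move=> d'0 d'L; have L0 := lt_le_trans d'0 d'L.
have [delta [alpha [C [T [/andP[d0 dL] al C0 cE [_ [_ _ _ [TI LY]]]]]]]] := operator_family L0.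
have DL b : d' <= b <= L -> halfdisc_segment delta L (0 +i* b)%C.
 by move=> /andP[b1 b2]; right; split => //=; rewrite ger0_norm// (le_trans (ltW d'0)).
have [b bE|M [t [t01 hM]]] := decay_off_zero F_mp tau_meas tau_pos P_transfer p1 al C0 cE TI LY d'0.
 have /andP[b1 b2] := bE.
 have [|| T' [T'I sr]] := Sii p_p0 gamma_beta L0 (b := b).
 - by rewrite b2 (le_trans _ (le_trans (ltW d'0) b1))// oppr_le0 ltW.
 - by rewrite gt_eqF// (lt_le_trans d'0).
 have -> // : T (0 +i* b)%C = T'.
 by apply/funext; exact: induces_unique (TI _ (DL _ bE)) T'I.
have [K K0 hK] := embedding_bounded p1 cE.
have [u uA] := A_in_BB p_p0 gamma_beta L0.
have bwB := @btest_indic _ Y R _ mB.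
exists (4 * K * (`|M| * rnorm u)), t; split => //.
 by rewrite mulr_ge0 ?mulr_ge0 ?rnorm_ge0// ltW.
move=> b n bE; have Ds := DL _ bE.
have tn : 0 <= t ^+ n by case/andP: t01 => ? _; rewrite exprn_ge0// ltW.
have nB y : normc (wB y) <= 1 by exact: normc_indic.
have := cpair_bound p1 cE (iter n (T (0 +i* b)%C) u) bwB.1 nB.
rewrite (iterT_pair F_mp tau_meas tau_pos P_transfer p1 cE TI)//.
rewrite (marked_mean_laplace F_mp tau_meas tau_pos mA mB n _ _ uA)//=; last first.
 exact: (bfun_cmeasurable p1 cE).
have E (f : R -> R) : (fun x => expR (- (0 * x)) * f (b * x)) = (fun x => f (b * x)).
 by apply/funext => x; rewrite mul0r oppr0 expR0 mul1r.
rewrite !E => h.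
have h2 : 2 * 1 * fine (cLnorm mu p%:E (bfun (iter n (T (0 +i* b)%C) u))) <= 2 * K * (`|M| * rnorm u) * t ^+ n.
 rewrite mulr1 -!mulrA ler_wpM2l// (le_trans (hK _))// ler_wpM2l ?(ltW K0)//.
 rewrite (le_trans (hM _ bE _ _))// mulrAC -mulrA ler_wpM2r ?mulr_ge0 ?rnorm_ge0//.
 exact: ler_norm.
have h3 := le_trans h h2.
have := le_trans (le_Re_normc _) h3; have := le_trans (le_Im_normc _) h3; rewrite /= normrN => i1 i2.
rewrite (_ : 4 * K * _ * t ^+ n = 2 * K * (`|M| * rnorm u) * t ^+ n + 2 * K * (`|M| * rnorm u) * t ^+ n); last by ring.
exact: lerD.
Qed.

Variables (h : R -> R) (b0 C0 c0 : R).
Hypothesis b0_gt0 : 0 < b0.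
Hypothesis c0_gt0 : 0 < c0.
Hypothesis C0_ge1 : 1 <= C0.
Hypothesis h01 : forall b, 0 < b <= b0 -> 0 < h b <= 1.
Hypothesis h_small : forall e, 0 < e -> exists2 b1, 0 < b1 & forall b, 0 < b <= b1 -> h b <= e.
Hypothesis h_mass : forall b, 0 < b <= b0 -> \int[mu]_y Num.min 2 (3 * b * tau y) <= C0 * h b.
Hypothesis h_gamma : forall b, 0 < b <= b0 -> b `^ gamma <= C0 * h b `^ 2^-1.
Hypothesis h_cos : forall b, 0 < b <= b0 -> c0 * h b <= \int[mu]_y (1 - cos (b * tau y)).
Hypothesis h_exp : forall b, 0 < b <= b0 -> c0 * h b <= \int[mu]_y (1 - expR (- (b * tau y))).

Definition laplace_defect s := \int[mu]_y (1 - expR (- (s * tau y))).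

Lemma defectE s y : defect F tau s y =
 ((1 - expR (- (complex.Re s * tau y)) * cos (complex.Im s * tau y)) +i*
  (expR (- (complex.Re s * tau y)) * sin (complex.Im s * tau y)))%C.
Proof.
rewrite /defect es1E /cexp; case: s => a b; apply/eqP.
by rewrite eq_complex/= !mulr0 subr0 add0r cosN sinN mulrN sub0r opprK !eqxx.
Qed.

(** Near 0 the space with [L = 1] suffices. In the Laplace estimate [lam] is replaced by the
    explicit [1 - laplace_defect s]: both are at most [e^(- c h)] in modulus, so the [n]-th powers
    differ by at most [n e^(- c h (n - 1))] times [O(h^(65/64))], and the spare [h^(1/64)] is made
    smaller than a multiple of [e]. This accounts for the factor [1 + n h]. *)
Lemma fourier_laplace_small : exists C c t, [/\ 0 < C, 0 < c, 0 < t < 1,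
 exists2 r, 0 < r & forall b n, 0 < b <= r ->
  `|marked n (fun x => cos (b * x))| + `|marked n (fun x => sin (b * x))| <=
   C * (expR (- c * (n%:R * h b)) + t ^+ n) &
 forall e, 0 < e -> exists2 r, 0 < r & forall s n, 0 < s <= r ->
  `|marked n (fun x => expR (- (s * x))) -
   fine (mu A) * fine (mu B) * (1 - laplace_defect s) ^+ n| <=
   e * ((1 + n%:R * h s) * expR (- c * (n%:R * h s))) + C * t ^+ n].
Proof.
have [delta [alpha [C [T [/andP[d0 dL] al C'0 cE [one [one1 oL1 oLp [TI LY]]]]]]]] := operator_family ltr01.
have [u uA] := A_in_BB p_p0 gamma_beta ltr01.
have g1 : 0 < gamma <= 1.
 by case/andP: gamma_beta => -> g; rewrite (le_trans (ltW g))// ltW.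
pose Q s := exists2 b : R, 0 < b & s = b%:C%C \/ s = (0 +i* b)%C.
have bwB := @btest_indic _ Y R _ mB.
have nB y : normc (wB y) <= 1 by exact: normc_indic.
have i2 b : 0 < b -> rintegrable mu (fun y => Num.min 2 (3 * b * tau y)).
 move=> b_0; apply: (rintegrable_bounded mu _ (M := 2)).
  by apply: measurable_minr => //; exact: measurable_funM.
 move=> y; rewrite ger0_norm ?ge_min ?lexx// le_min.
 by rewrite !mulr_ge0// ltW.
have T2 s : halfdisc_segment delta 1 s -> 0 < normc s <= b0 ->
  defect_mass mu F tau s <= C0 * h (normc s).
 move=> /D_Re s0 /andP[ns0 nsb]; rewrite (le_trans _ (h_mass _))// ?ns0//.
 apply: Rintegral_le; [exact: rintegrable_defect|exact: i2|].
 by move=> y; rewrite le_min defect_le2// defect_le.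
have T4 s : Q s -> 0 < normc s <= b0 -> c0 * h (normc s) <= complex.Re (cintegral mu (defect F tau s)).
 move=> [b b_0 [->|->]].
  rewrite normc_real gtr0_norm// => bb; rewrite (le_trans (h_exp bb))// le_eqVlt.
  apply/orP; left; apply/eqP; apply: eq_Rintegral => y _.
  by rewrite defectE/= mul0r cos0 mulr1.
 have -> : normc (0 +i* b)%C = b by rewrite /normc/= expr0n/= add0r sqrtr_sqr gtr0_norm.
 move=> bb; rewrite (le_trans (h_cos bb))// le_eqVlt.
 apply/orP; left; apply/eqP; apply: eq_Rintegral => y _.
 by rewrite defectE/= mul0r oppr0 expR0 mul1r.
have [C1 [c [t [C10 c_gt0 t01 hS]]]] := spectral_expansion F_mp tau_meas tau_pos F_mixing
 P_transfer p1 d0 al C'0 cE TI LY one1 g1 oL1 oLp u p8 b0_gt0 c0_gt0 C0_ge1 h01 h_small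
 T2 h_gamma T4 bwB.1 nB.
set M := cpair u (fun=> 1) * cintegral mu wB in hS.
have ME : M = (fine (mu A) * fine (mu B))%:C%C.
 have cI E : measurable E -> cintegral mu (fun y => (\1_E y : R)%:C%C) = (fine (mu E))%:C%C.
  move=> mE; rewrite /cintegral/=; congr (_ +i* _)%C; last by rewrite Rintegral_cst1// mul0r.
  by rewrite /Rintegral integral_indic// setIT.
 rewrite /M cI// rmorphM/=; congr (_ * _).
 rewrite -cI//; apply: cintegral_ae.
 - by apply: cmeasurableM; [exact: (bfun_cmeasurable p1 cE)|exact: cmeasurable_cst].
 - by case: (@btest_indic _ Y R _ mA).
 - by apply: filterS uA => y + _ => ->//; rewrite mulr1.
have cu := bfun_cmeasurable p1 cE u.
have D_b b : 0 < b <= delta / 2 -> halfdisc_segment delta 1 (0 +i* b)%C.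
 move=> /andP[b_0 bd]; left; split => //.
 rewrite /normc/= expr0n/= add0r sqrtr_sqr gtr0_norm// (le_lt_trans bd)//.
 by rewrite ltr_pdivrMr// ltr_pMr// ltr1n.
have D_s s : 0 < s <= delta / 2 -> halfdisc_segment delta 1 s%:C%C.
 move=> /andP[b_0 bd]; left; split => /=; first exact: ltW.
 rewrite normc_real gtr0_norm// (le_lt_trans bd)//.
 by rewrite ltr_pdivrMr// ltr_pMr// ltr1n.
(* [c] serves for [lam], and [c0] for [1 - laplace_defect s]. *)
pose c' := Num.min c c0.
have c'0 : 0 < c' by rewrite lt_min c_gt0.
exists (2 * (normc M + 1 + C1)), c', t; split => //.
- by rewrite mulr_gt0// ltr_wpDl// addr_ge0// normc_ge0.
- have [r r0 hr] := hS _ ltr01.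
 exists (Num.min r (Num.min b0 (delta / 2))); first by rewrite !lt_min r0 b0_gt0 divr_gt0.
 move=> b n /andP[b_0]; rewrite !le_min => /and3P[br bb0 bd].
 have nb : normc (0 +i* b)%C = b by rewrite /normc/= expr0n/= add0r sqrtr_sqr gtr0_norm.
 have bR : 0 < normc (0 +i* b)%C <= r by rewrite nb b_0.
 have [lam [l1 _ l3]] := hr _ (D_b b ltac:(by rewrite b_0)) (ex_intro2 _ _ b b_0 (or_intror erefl)) bR.
 have := l3 n; rewrite nb in l1.
 rewrite (marked_mean_laplace F_mp tau_meas tau_pos mA mB n _ cu uA)//=.
 have E (f : R -> R) : (fun x => expR (- (0 * x)) * f (b * x)) = (fun x => f (b * x)).
  by apply/funext => x; rewrite mul0r oppr0 expR0 mul1r.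
 rewrite !E mul1r; set z := (X in X - _) => hz.
 have /andP[hb0 _] := h01 (b := b) ltac:(by rewrite b_0).
 have ln : normc lam ^+ n <= expR (- c' * (n%:R * h b)).
  rewrite mulrCA expRM_natl; apply: lerXn2r => //; rewrite ?nnegrE ?normc_ge0 ?expR_ge0//.
  rewrite (le_trans l1)// ler_expR !mulNr lerN2 ler_wpM2r ?(ltW hb0)//.
  by rewrite ge_min lexx.
 have nz : normc z <= (normc M + 1 + C1) * (expR (- c' * (n%:R * h b)) + t ^+ n).
  have -> : z = M * lam ^+ n + (z - M * lam ^+ n) by ring.
  have nX : normc (M * lam ^+ n) = normc M * normc lam ^+ n.
   rewrite normcM; congr (_ * _).
   by elim: n {l3 z hz ln} => [|n IH]; rewrite ?expr0 ?normc1// !exprS normcM IH.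
  rewrite (le_trans (le_normcD _ _))// nX.
  set x := expR _ in ln *; have x0 : 0 <= x by exact: expR_ge0.
  have tn : 0 <= t ^+ n by case/andP: t01 => ? _; rewrite exprn_ge0// ltW.
  have m0 := normc_ge0 M.
  have i3 := ler_wpM2l m0 ln.
  have i4 := mulr_ge0 (ltW C10) x0.
  have i5 : 0 <= (normc M + 1) * t ^+ n by rewrite mulr_ge0// addr_ge0.
  rewrite (le_trans (lerD i3 hz))// (le_trans (_ : _ <= normc M * x + (x + C1 * t ^+ n)))//.
   by rewrite lerD2l lerD2r.
  rewrite -subr_ge0 (_ : _ - _ = C1 * x + (normc M + 1) * t ^+ n); last by ring.
  exact: addr_ge0.
 rewrite -[leRHS]mulrA [leRHS]mulr_natl mulr2n; apply: lerD.
  exact: le_trans (le_Re_normc _) nz.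
 by have := le_trans (le_Im_normc _) nz; rewrite /= normrN.
move=> e e0; have [r r0 hr] := hS _ e0.
have k0 : 0 < normc M * C1 * expR c' + 1 by rewrite ltr_wpDl// !mulr_ge0 ?normc_ge0 ?expR_ge0// ltW.
have [b1 b10 hb1] := h_small (powR_gt0 64 (divr_gt0 e0 k0)).
exists (Num.min (Num.min r b1) (Num.min b0 (delta / 2))).
 by rewrite !lt_min r0 b0_gt0 b10 divr_gt0.
move=> s n /andP[s0]; rewrite !le_min => /andP[/andP[sr sb1] /andP[sb0 sd]].
have ns : normc s%:C%C = s by rewrite normc_real gtr0_norm.
have sR : 0 < normc s%:C%C <= r by rewrite ns s0.
have [lam [l1 l2 l3]] := hr _ (D_s s ltac:(by rewrite s0)) (ex_intro2 _ _ s s0 (or_introl erefl)) sR.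
have /andP[hs0 hs1] := h01 (b := s) ltac:(by rewrite s0).
have {}hb1 := hb1 s ltac:(by rewrite s0).
rewrite ns in l1 l2.
set x := 1 - laplace_defect s.
have xE : 1 - cintegral mu (defect F tau s%:C%C) = x%:C%C.
 rewrite /x rmorphB/= rmorph1; congr (_ - _); rewrite /cintegral; congr (_ +i* _)%C.
  by apply: eq_Rintegral => y _; rewrite defectE/= mul0r cos0 mulr1.
 rewrite -[RHS](mul0r (fine (mu setT))) -Rintegral_cst//.
 by apply: eq_Rintegral => y _; rewrite defectE/= mul0r sin0 mulr0.
have xl : normc (lam - x%:C%C) <= C1 * h s `^ (65 / 64).
 by rewrite -xE -normcN (_ : - _ = 1 - lam - cintegral mu (defect F tau s%:C%C))//; ring.
have x0 : 0 <= x.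
 rewrite /x subr_ge0 /laplace_defect.
 rewrite (le_trans (_ : _ <= \int[mu]_y 1))//; last by rewrite Rintegral_cst1.
 apply: Rintegral_le; [|exact: (rintegrable_cst mu)|by move=> y; rewrite gerBl expR_ge0].
 apply: (rintegrable_bounded mu _ (M := 1)).
  apply: measurable_funB => //; apply: measurableT_comp => //; apply: measurableT_comp => //.
  exact: measurable_funM.
 move=> y; rewrite ger0_norm ?gerBl ?expR_ge0// subr_ge0 expRN_le1.
 by rewrite mulr_ge0// ltW.
pose q := expR (- (c' * h s)).
have lq : normc lam <= q.
 by rewrite (le_trans l1)// ler_expR mulNr lerN2 ler_wpM2r ?(ltW hs0)// ge_min lexx.
have xq : normc x%:C%C <= q.
 rewrite normc_real ger0_norm// (le_trans _ (expR_ge1Dx _))// /x lerD2l lerN2.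
 rewrite (le_trans _ (h_exp _)) ?s0// ler_wpM2r ?(ltW hs0)// ge_min lexx orbT//.
set E := expR (- c' * (n%:R * h s)).
have qE : q ^+ n = E by rewrite /q /E -expRM_natl; congr expR; ring.
have ln : normc lam ^+ n <= E.
 by rewrite -qE; apply: lerXn2r => //; rewrite ?nnegrE ?normc_ge0 ?expR_ge0.
have E0 : 0 <= E by exact: expR_ge0.
have tn : 0 <= t ^+ n by case/andP: t01 => ? _; rewrite exprn_ge0// ltW.
have h64 : h s `^ 64^-1 <= e / (normc M * C1 * expR c' + 1).
 have i0 : 0 <= 64^-1 :> R by rewrite invr_ge0.
 have := ge0_ler_powR i0 _ _ hb1; rewrite !nnegrE (ltW hs0) powR_ge0 => /(_ isT isT).
 rewrite -powRrM [64 * _]mulfV ?pnatr_eq0// powRr1//.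
 exact/ltW/divr_gt0.
have h65 : h s `^ (65 / 64) = h s `^ 64^-1 * h s.
 by rewrite -{3}(powRr1 (ltW hs0)) -powRD ?(gt_eqF hs0) ?implybT//; congr (_ `^ _); field.
have diff : normc M * normc (lam ^+ n - x%:C%C ^+ n) <= e * (n%:R * h s) * E.
 case: n {l3 ln tn} @E qE E0 => [|n] E qE E0; first by rewrite !expr0 subrr normc0 mulr0 !mul0r mulr0 mul0r.
 rewrite (le_trans (ler_wpM2l (normc_ge0 M) (normc_exprB n lq xq)))//.
 have qn : q ^+ n <= expR c' * E.
  rewrite -qE exprS mulrA ler_peMl ?exprn_ge0 ?expR_ge0// /q -expRD -expR0 ler_expR.
  by rewrite -[X in X - _]mulr1 -mulrBr mulr_ge0 ?subr_ge0// ltW.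
 have i6 : normc M * C1 * expR c' * h s `^ 64^-1 <= e.
  rewrite (le_trans (_ : _ <= (normc M * C1 * expR c' + 1) * h s `^ 64^-1))//.
   by rewrite ler_wpM2r ?powR_ge0// lerDl.
  by rewrite mulrC -ler_pdivlMr.
 have n0 : 0 <= n.+1%:R * h s by rewrite mulr_ge0// ltW.
 rewrite (le_trans (_ : _ <= normc M * (n.+1%:R * (expR c' * E) * (C1 * h s `^ (65 / 64)))))//.
  rewrite ler_wpM2l ?normc_ge0//; apply: ler_pM; rewrite ?normc_ge0 ?mulr_ge0 ?exprn_ge0 ?expR_ge0//.
  by rewrite ler_wpM2l.
 rewrite h65 (_ : _ * _ = normc M * C1 * expR c' * h s `^ 64^-1 * (n.+1%:R * h s) * E); last by ring.
 by rewrite ler_wpM2r// ler_wpM2r.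
have := l3 n; rewrite (marked_mean_laplace F_mp tau_meas tau_pos mA mB n _ cu uA)//=; last exact: ltW.
set z := (X in X - _) => hz.
have zR : complex.Re (z - M * x%:C%C ^+ n) =
  marked n (fun y => expR (- (s * y))) - fine (mu A) * fine (mu B) * x ^+ n.
 rewrite ME -rmorphXn -rmorphM /z/=; congr (_ - _); congr marked_mean.
 by apply/funext => y; rewrite mul0r cos0 mulr1.
rewrite -zR (le_trans (le_Re_normc _))//.
have -> : z - M * x%:C%C ^+ n = z - M * lam ^+ n + M * (lam ^+ n - x%:C%C ^+ n) by ring.
rewrite (le_trans (le_normcD _ _))// normcM (le_trans (lerD hz diff))//.
have i7 := ler_wpM2l (ltW e0) ln.
have i8 : 0 <= (2 * (normc M + 1) + C1) * t ^+ n.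
 by rewrite mulr_ge0// addr_ge0// ?mulr_ge0 ?addr_ge0 ?normc_ge0// ltW.
rewrite -subr_ge0 (_ : _ - _ = (e * E - e * normc lam ^+ n) + (2 * (normc M + 1) + C1) * t ^+ n).
 by rewrite addr_ge0// subr_ge0.
by ring.
Qed.

End operator_estimates.

(** * Dominated convergence and explicit improper integrals *)

Lemma dominated_cvg d (T : measurableType d) (R : realType) (nu : {measure set T -> \bar R})
  (D : set T) (f : nat -> T -> R) (g m : T -> R) :
 measurable D -> (forall n, measurable_fun D (f n)) ->
 (forall x, D x -> f n x @[n --> \oo] --> g x) ->
 nu.-integrable D (EFin \o m) -> (forall n x, D x -> `|f n x| <= m x) ->
 nu.-integrable D (EFin \o g) /\
 (\int[nu]_(x in D) (f n x)%:E)%E @[n --> \oo] --> (\int[nu]_(x in D) (g x)%:E)%E.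
Proof.
move=> mD mf fg im dom.
have mg : measurable_fun D g by exact: (measurable_fun_cvg mf fg).
have mf' n : measurable_fun D (EFin \o f n) by apply/measurable_EFinP.
have mg' : measurable_fun D (EFin \o g) by apply/measurable_EFinP.
have fg' : {ae nu, forall x, D x -> (EFin \o f n) x @[n --> \oo] --> (EFin \o g) x}.
 by apply: aeW => x Dx; apply: cvg_EFin; [exact: nearW|exact: fg].
have dom' : {ae nu, forall x n, D x -> (`|(EFin \o f n) x| <= (EFin \o m) x)%E}.
 by apply: aeW => x n Dx; rewrite lee_fin; exact: dom.
by have [i _ c] := dominated_convergence mD mf' mg' fg' im dom'.
Qed.

Section integrals.
Context {R : realType}.
Local Notation leb := (@lebesgue_measure R).
Implicit Types (f F : R -> R) (a b c l s x : R).

Lemma continuous_for_within f c a b : c < a ->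
 (forall x, c < x -> {for x, continuous f}) -> {within `[a, b], continuous f}.
Proof.
move=> ca cf; apply: continuous_in_subspaceT => x /set_mem/=.
by rewrite in_itv/= => /andP[ax _]; apply: cf; exact: lt_le_trans ax.
Qed.

Lemma integrable_itv f c a b : c < a ->
 (forall x, c < x -> {for x, continuous f}) -> leb.-integrable `[a, b] (EFin \o f).
Proof.
move=> ca cf; apply: continuous_compact_integrable; first exact: segment_compact.
exact: (continuous_for_within ca).
Qed.

(** Regularity is required on an open half-line containing the segment, so that the one-sided limits
    at the endpoints follow from continuity. *)
Lemma FTC_itv f F c a b : c < a -> a <= b ->
 (forall x, c < x -> is_derive x 1 F (f x)) ->
 (forall x, c < x -> {for x, continuous f}) ->
 (\int[leb]_(x in `[a, b]) (f x)%:E = (F b - F a)%:E)%E.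
Proof.
move=> ca ab dF cf; have [->|nab] := eqVneq a b; first by rewrite set_itv1 integral_set1 subrr.
have {nab}ab : a < b by rewrite lt_neqAle nab.
have cF x : c < x -> {for x, continuous F}.
 by move=> cx; apply/differentiable_continuous/derivable1_diffP; apply: ex_derive; exact: dF.
rewrite EFinB; apply: continuous_FTC2 => //.
- exact: (continuous_for_within ca).
- split.
 + move=> x; rewrite in_itv/= => /andP[ax _]; apply: ex_derive; apply: dF.
  exact: lt_trans ax.
 + by apply: cvg_at_right_filter; exact: cF.
 + by apply: cvg_at_left_filter; apply: cF; exact: lt_trans ab.
- move=> x; rewrite in_itv/= => /andP[ax _].
 by rewrite derive1E; apply: derive_val; apply: dF; exact: lt_trans ax.
Qed.

Lemma FTC_itvR f F c a b : c < a -> a <= b ->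
 (forall x, c < x -> is_derive x 1 F (f x)) ->
 (forall x, c < x -> {for x, continuous f}) ->
 \int[leb]_(x in `[a, b]) f x = F b - F a.
Proof. by move=> ca ab dF cf; rewrite /Rintegral (FTC_itv ca ab dF cf). Qed.

Lemma FTC_infty f F c a l : c < a ->
 (forall x, a <= x -> 0 <= f x) ->
 (forall x, c < x -> is_derive x 1 F (f x)) ->
 (forall x, c < x -> {for x, continuous f}) ->
 F x @[x --> +oo] --> l ->
 (\int[leb]_(x in `[a, +oo[) (f x)%:E = (l - F a)%:E)%E.
Proof.
move=> ca f0 dF cf Fl.
have cF x : c < x -> {for x, continuous F}.
 by move=> cx; apply/differentiable_continuous/derivable1_diffP; apply: ex_derive; exact: dF.
rewrite EFinB; apply: ge0_continuous_FTC2y => //.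
- apply: continuous_in_subspaceT => x /set_mem/=.
 by rewrite in_itv/= andbT => ax; apply: cf; exact: lt_le_trans ax.
- by move=> x ax; apply: ex_derive; apply: dF; exact: lt_trans ax.
- by apply: cvg_at_right_filter; exact: cF.
- move=> x; rewrite in_itv/= andbT => ax.
 by rewrite derive1E; apply: derive_val; apply: dF; exact: lt_trans ax.
Qed.

Lemma continuous_derive f x l : is_derive x 1 f l -> {for x, continuous f}.
Proof.
by move=> h; apply/differentiable_continuous/derivable1_diffP; apply: ex_derive.
Qed.

Lemma is_derive_powR_div s x : 0 < x -> s != 0 ->
 is_derive x 1 (fun y => y `^ s / s) (x `^ (s - 1)).
Proof.
move=> x0 s0; have h := is_derive1_powR s x0.
rewrite (_ : (fun y => _) = s^-1 \*: (fun y : R => y `^ s)); last by apply/funext => y /=; rewrite mulrC.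
have -> : x `^ (s - 1) = s^-1 *: (s * x `^ (s - 1)) by rewrite /GRing.scale/= mulKf.
exact: is_deriveZ.
Qed.

Lemma continuous_powR s x : 0 < x -> {for x, continuous (fun y => y `^ s)}.
Proof. by move=> x0; apply: continuous_derive (is_derive1_powR s x0). Qed.

Lemma natS_cvgy : (n.+1%:R : R) @[n --> \oo] --> +oo.
Proof.
apply/cvgryPge => A; near=> n; rewrite (le_trans (ltW (truncnS_gt A)))// ler_nat ltnS.
by near: n; exists (Num.truncn A).
Unshelve. all: end_near. Qed.

Lemma powR_cvg0 s : 0 < s -> (x `^ (- s)) @[x --> +oo] --> (0 : R).
Proof.
move=> s0; apply/cvgrPdist_le => e e0; near=> x.
rewrite sub0r normrN ger0_norm ?powR_ge0// powRN.
have eV : 0 <= e^-1 by rewrite invr_ge0 ltW.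
rewrite -[e]invrK lef_pV2 ?posrE ?powR_gt0 ?invr_gt0//.
rewrite -[leLHS](powRr1 eV) -(mulVf (lt0r_neq0 s0)) powRrM.
by apply: ge0_ler_powR; rewrite ?nnegrE ?powR_ge0 ?(ltW s0).
Unshelve. all: end_near. Qed.

Lemma integral_powR_infty s : 0 < s ->
 (\int[leb]_(x in `[1%R, +oo[) (x `^ (- s - 1))%:E = (s^-1)%:E)%E.
Proof.
move=> s0.
have := @FTC_infty (fun x => x `^ (- s - 1)) (fun y => y `^ (- s) / - s) 0 1 0 ltr01.
rewrite powR1 div1r sub0r -invrN opprK; apply.
- by move=> x _; exact: powR_ge0.
- by move=> x x0; apply: is_derive_powR_div; rewrite // oppr_eq0 gt_eqF.
- by move=> x x0; exact: continuous_powR.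
- by rewrite -(mul0r (- s)^-1); apply: cvgM; [exact: powR_cvg0|exact: cvg_cst].
Qed.

(** The integrand may be unbounded at 0, so the integral is obtained as a monotone limit over
    [[1 / (n + 1), 1]]. *)
Lemma integral_powR01 s : 0 < s ->
 (\int[leb]_(x in `]0%R, 1%R]) (x `^ (s - 1))%:E = (s^-1)%:E)%E.
Proof.
move=> s0; have m01 : measurable (`]0%R, 1%R]%classic : set R) by [].
pose f (x : R) := (x `^ (s - 1))%:E.
have mf : measurable_fun (`]0%R, 1%R]%classic : set R) f.
 by apply: measurable_EFinS; exact: measurable_powR.
pose g (n : nat) x := (f x * (\1_(`[n.+1%:R^-1, 1%R]%classic : set R) x)%:E)%E.
have f0 (x : R) : (0 <= f x)%E by rewrite lee_fin powR_ge0.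
have := @cvg_monotone_convergence _ _ R leb _ m01 g.
have mg n : measurable_fun (`]0%R, 1%R]%classic : set R) (g n).
 by apply: emeasurable_funM => //; apply/measurable_EFinP; exact: measurable_indic.
move=> /(_ mg) mc.
have gE n : (\int[leb]_(x in `]0%R, 1%R]) g n x = (s^-1 - n.+1%:R `^ (- s) / s)%:E)%E.
 have n0 : 0 < n.+1%:R^-1 :> R by rewrite invr_gt0.
 have n1 : n.+1%:R^-1 <= 1 :> R by rewrite invf_le1// ler1n.
 transitivity (\int[leb]_(x in `[(n.+1%:R^-1)%R, 1%R]) f x)%E.
  rewrite [RHS]integral_mkcond [LHS]integral_mkcond; apply: eq_integral => x _.
  rewrite !patchE /g indicE; case: ifPn => h1; case: ifPn => h2; rewrite ?mule1 ?mule0//.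
  exfalso; move: h1 h2; rewrite !inE/= !in_itv/= => /negP h1 /andP[h2 h3]; apply: h1.
  by rewrite inE/= in_itv/= h3 andbT (lt_le_trans n0).
 have d1 x : 0 < x -> is_derive x 1 (fun y => y `^ s / s) (x `^ (s - 1)).
  by move=> x0; apply: is_derive_powR_div; rewrite // gt_eqF.
 rewrite /f (FTC_itv n0 n1 d1 (@continuous_powR (s - 1))) powR1 div1r.
 by rewrite -[n.+1%:R^-1]powR_inv1// -powRrM mulN1r.
have lim1 : (s^-1 - n.+1%:R `^ (- s) / s)%:E @[n --> \oo] --> (s^-1)%:E.
 apply: cvg_EFin; first exact: nearW.
 rewrite -[X in _ --> X]subr0 -[X in _ - X](mul0r s^-1).
 apply: cvgB; first exact: cvg_cst.
 apply: cvgM; last exact: cvg_cst.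
 have := @powR_cvg0 s s0; move=> /cvg_pinftyP; apply.
 exact: natS_cvgy.
have lim2 : (\int[leb]_(x in `]0%R, 1%R]) g n x)%E @[n --> \oo] --> (s^-1)%:E.
 by under eq_fun do rewrite gE; exact: lim1.
have g0 n x : `]0%R, 1%R]%classic x -> (0 <= g n x)%E by move=> _; rewrite mule_ge0// lee_fin.
have gh x : `]0%R, 1%R]%classic x -> {homo g^~ x : n m / (n <= m)%N >-> (n <= m)%E}.
 move=> _ m n mn; rewrite lee_wpmul2l// lee_fin !indicE ler_nat.
 case: (boolP (x \in _)) => // /set_mem/=; rewrite in_itv/= => /andP[h1 h2].
 rewrite mem_set//= in_itv/= h2 andbT (le_trans _ h1)//.
 by rewrite lef_pV2 ?posrE// ler_nat.
rewrite -(cvg_unique _ (mc g0 gh) lim2)//; apply: eq_integral => x /set_mem/=.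
rewrite in_itv/= => /andP[x0 x1]; apply/esym/cvg_lim => //.
apply: cvg_near_cst; near=> n; rewrite /g indicE mem_set ?mule1//=.
rewrite in_itv/= x1 andbT invf_ple ?posrE// (le_trans (ltW (truncnS_gt _)))// ler_nat ltnS.
by near: n; exists (Num.truncn x^-1).
Unshelve. all: end_near. Qed.

Lemma is_derive_expN (k x : R) : is_derive x 1 (fun y => expR (- (k * y))) (- k * expR (- (k * x))).
Proof.
have h1 : is_derive x 1 (fun y => - k * y) (- k).
 by have := is_deriveZ (- k) (is_derive_id x (1 : R)); rewrite /GRing.scale/= mulr1.
have := is_derive1_comp (is_derive_expR (- k * x)) h1.
have -> : expR \o *%R (- k) = (fun y => expR (- (k * y))) by apply/funext => y /=; rewrite mulNr.
have E : - k * x = - (k * x) by rewrite mulNr.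
by rewrite E mulrC.
Qed.

Lemma continuous_expN (k : R) : continuous (fun x : R => expR (- (k * x))).
Proof. by move=> x; exact: continuous_derive (is_derive_expN k x). Qed.

Lemma is_derive_expNV (k x : R) : k != 0 ->
 is_derive x 1 (fun y => - k^-1 * expR (- (k * y))) (expR (- (k * x))).
Proof.
move=> k0; have := is_deriveZ (- k^-1) (is_derive_expN k x).
by rewrite /GRing.scale/= mulrA mulrNN mulVf// mul1r.
Qed.

Lemma expR_cvg0 (k : R) : 0 < k -> expR (- (k * x)) @[x --> +oo] --> (0 : R).
Proof.
move=> k0; apply/cvgrPdist_le => e e0; near=> x.
rewrite sub0r normrN ger0_norm// expRN -[e]invrK lef_pV2 ?posrE ?expR_gt0 ?invr_gt0//.
rewrite (le_trans _ (expR_ge1Dx _))// (le_trans (_ : _ <= k * x)) ?lerDr//.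
rewrite mulrC -ler_pdivrMr//; near: x; apply: nbhs_pinfty_ge; exact: num_real.
Unshelve. all: end_near. Qed.

Lemma integral_expN (k : R) : 0 < k ->
 (\int[leb]_(x in `]0%R, +oo[) (expR (- (k * x)))%:E = (k^-1)%:E)%E.
Proof.
move=> k0; rewrite integral_itv_obnd_cbnd; last first.
 apply: measurable_EFinS; apply: continuous_measurable_fun.
 exact: continuous_expN.
have := @FTC_infty (fun x => expR (- (k * x))) (fun x => - k^-1 * expR (- (k * x))) (-1) 0 0 (ltrN10 R).
rewrite mulr0 oppr0 expR0 mulr1 sub0r opprK; apply.
- by move=> x _; exact: expR_ge0.
- by move=> x _; apply: is_derive_expNV; rewrite gt_eqF.
- by move=> x _; exact: continuous_expN.
- by rewrite -(mulr0 (- k^-1)); apply: cvgM; [exact: cvg_cst|exact: expR_cvg0].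
Qed.

Lemma integral_expN_itv (a : R) : 0 <= a ->
 (\int[leb]_(x in `]0%R, a[) (expR (- x))%:E = (1 - expR (- a))%:E)%E.
Proof.
move=> a0; have me : mfunT (fun x : R => (expR (- x))%:E).
 by apply/measurable_EFinP; apply: measurableT_comp.
rewrite integral_itv_obnd_cbnd; last exact: measurable_funTS.
rewrite integral_itv_bndo_bndc; last exact: measurable_funTS.
have d1 (x : R) : -1 < x -> is_derive x 1 (fun y : R => - expR (- y)) (expR (- x)).
 move=> _; have := is_derive_expNV x (oner_neq0 R); rewrite invr1 mul1r.
 by have -> // : (fun y : R => - 1 * expR (- (1 * y))) = (fun y : R => - expR (- y));
  apply/funext => y; rewrite mul1r mulN1r.
have c1 (x : R) : -1 < x -> {for x, continuous (fun x : R => expR (- x))}.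
 by move=> _; have := @continuous_expN 1 x; under eq_fun do rewrite mul1r.
rewrite (FTC_itv (ltrN10 R) a0 d1 c1) oppr0 expR0 opprK addrC//.
Qed.

Lemma measurable_exp_powR b : mfunT (fun x : R => expR (- x) * x `^ (- b)).
Proof. by apply: measurable_funM; [exact: measurableT_comp|exact: measurable_powR]. Qed.

Lemma integrable_exp_powR b : 0 <= b < 1 ->
 leb.-integrable (`]0, +oo[%classic : set R) (fun x => (expR (- x) * x `^ (- b))%:E).
Proof.
move=> /andP[b0 b1]; have mf := measurable_exp_powR b.
apply/integrableP; split; first exact: measurable_EFinS.
have f0 x : 0 <= expR (- x) * x `^ (- b) by rewrite mulr_ge0 ?powR_ge0.
under eq_integral do rewrite gee0_abs ?lee_fin//.
have E : (`]0, +oo[%classic : set R) = `]0, 1] `|` `]1, +oo[.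
 apply/seteqP; split => y /=; rewrite !in_itv/= ?andbT.
  by move=> y0; have [y1|y1] := leP y 1; [left; rewrite y0|right].
 by move=> [/andP[]//|y1]; exact: lt_trans y1.
rewrite E ge0_integral_setU//=; last 3 first.
- exact: measurable_EFinS.
- by move=> x _; rewrite lee_fin.
- by apply/disj_setPS => y [/=]; rewrite !in_itv/= andbT => /andP[_ h] /(le_lt_trans h); rewrite ltxx.
apply: lte_add_pinfty.
 apply: (@le_lt_trans _ _ ((1 - b)^-1)%:E); last exact: ltry.
 rewrite -integral_powR01 ?subr_gt0//; apply: ge0_le_integral => //.
 - by move=> x _; rewrite lee_fin.
 - exact: measurable_EFinS.
 - by apply: measurable_EFinS; exact: measurable_powR.
 - move=> x /=; rewrite in_itv/= => /andP[x0 _]; rewrite lee_fin (_ : 1 - b - 1 = - b); last by ring.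
  by rewrite ler_piMl ?powR_ge0// expRN_le1 ltW.
apply: (@le_lt_trans _ _ (1^-1)%:E); last exact: ltry.
rewrite -integral_expN// E ge0_integral_setU//=; last 2 first.
- apply: measurable_EFinS; apply: continuous_measurable_fun.
 exact: continuous_expN.
- by apply/disj_setPS => y [/=]; rewrite !in_itv/= andbT => /andP[_ h] /(le_lt_trans h); rewrite ltxx.
rewrite (le_trans (_ : _ <= \int[leb]_(x in `]1%R, +oo[) (expR (- (1 * x)))%:E)%E)//; last first.
 by rewrite leeDr// integral_ge0// => x _; rewrite lee_fin expR_ge0.
apply: ge0_le_integral => //.
- by move=> x _; rewrite lee_fin.
- exact: measurable_EFinS.
- apply: measurable_EFinS; apply: continuous_measurable_fun.
 exact: continuous_expN.
move=> x /=; rewrite in_itv/= andbT => x1; rewrite lee_fin mul1r ler_piMr//.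
by rewrite -[leRHS](powRr0 x); apply: ler_powR; rewrite ?oppr_le0// ltW.
Qed.

(** The value of Euler's Gamma function at [1 - b]. *)
Definition gamma_const b : R := \int[leb]_(x in `]0, +oo[) (expR (- x) * x `^ (- b)).

Lemma gamma_constE b : 0 <= b < 1 ->
 (\int[leb]_(x in `]0%R, +oo[) (expR (- x) * x `^ (- b))%:E = (gamma_const b)%:E)%E.
Proof.
by move=> b01; rewrite /gamma_const /Rintegral fineK//; exact: integrable_fin_num (integrable_exp_powR b01).
Qed.

Lemma gamma_const_ge0 b : 0 <= gamma_const b.
Proof. by apply: Rintegral_ge0 => x _; rewrite mulr_ge0 ?powR_ge0. Qed.

End integrals.

(** * The beta integral as an alternating series *)

Section reflection.
Context {R : realType}.
Local Notation leb := (@lebesgue_measure R).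

Lemma geometric_alternating (x : R) n : 1 + x != 0 ->
 (1 + x)^-1 - \sum_(k < n) (-1) ^+ k * x ^+ k = (-1) ^+ n * x ^+ n * (1 + x)^-1.
Proof.
move=> x0; elim: n => [|n IH]; first by rewrite big_ord0 subr0 !expr0 !mul1r.
rewrite big_ord_recr/= opprD addrA IH !exprS; field.
exact: x0.
Qed.

(* Integrates the expansion [w / (1 + x) = \sum_k (-1)^k w x^k] with its remainder. *)
Lemma alternating_moments d (T : measurableType d) (leb : {measure set T -> \bar R})
  (D : set T) (w x : T -> R) (mu : nat -> R) :
 measurable D -> measurable_fun D w -> measurable_fun D x ->
 (forall y, D y -> 0 <= w y) -> (forall y, D y -> 0 <= x y <= 1) ->
 (forall k, (\int[leb]_(y in D) (w y * x y ^+ k)%:E = (mu k)%:E)%E) ->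
 leb.-integrable D (fun y => (w y / (1 + x y))%:E) /\
 forall n, `|\int[leb]_(y in D) (w y / (1 + x y)) - \sum_(k < n) (-1) ^+ k * mu k| <= mu n.
Proof.
move=> mD mw mx w0 x01 hmu.
have mwk k : measurable_fun D (fun y => w y * x y ^+ k).
 by apply: measurable_funM => //; exact: measurable_funX.
have wk0 k y : D y -> 0 <= w y * x y ^+ k.
 by move=> Dy; have /andP[? ?] := x01 y Dy; rewrite mulr_ge0 ?w0// exprn_ge0.
have iwk k : leb.-integrable D (fun y => (w y * x y ^+ k)%:E).
 apply/integrableP; split; first by apply/measurable_EFinP; exact: mwk.
 apply: (@le_lt_trans _ _ (mu k)%:E); last exact: ltry.
 rewrite -hmu; apply: eq_ler.
 by apply: eq_integral => y /set_mem Dy; rewrite gee0_abs// lee_fin wk0.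
have Iwk k : \int[leb]_(y in D) (w y * x y ^+ k) = mu k by rewrite /Rintegral hmu.
have x1 y : D y -> 1 <= 1 + x y by move=> /x01/andP[? _]; rewrite lerDl.
have iv y : D y -> 0 <= (1 + x y)^-1 <= 1.
 by move=> /x1 h; rewrite invr_ge0 (le_trans ler01)//= invf_le1// (lt_le_trans ltr01).
have miv : measurable_fun D (fun y => (1 + x y)^-1).
 have h : measurable_fun D (fun y => (1 + x y) `^ (- 1)).
  apply: (measurableT_comp (f := fun z : R => z `^ (- 1))); first exact: measurable_powR.
  exact: measurable_funD.
 apply: eq_measurable_fun h => y /set_mem Dy; rewrite powR_inv1//.
 by rewrite (le_trans ler01)// x1.
have ii k : leb.-integrable D (fun y => (w y * x y ^+ k * (1 + x y)^-1)%:E).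
 apply: (le_integrable mD _ _ (iwk k)).
  by apply/measurable_EFinP; exact: measurable_funM.
 move=> y Dy /=; rewrite lee_fin normrM ler_piMr// ger0_norm.
  by case/andP: (iv y Dy).
 by case/andP: (iv y Dy).
have ii0 : leb.-integrable D (fun y => (w y / (1 + x y))%:E).
 by move: (ii 0%N); under eq_fun do rewrite expr0 mulr1.
split => // n.
have isum k : leb.-integrable D (fun y => (\sum_(j < k) (-1) ^+ j * (w y * x y ^+ j))%:E) /\
  \int[leb]_(y in D) (\sum_(j < k) (-1) ^+ j * (w y * x y ^+ j)) = \sum_(j < k) (-1) ^+ j * mu j.
 elim: k => [|k [IH1 IH2]].
  rewrite big_ord0; split.
   under eq_fun do rewrite big_ord0; exact: integrable0.
  under eq_Rintegral do rewrite big_ord0; rewrite /Rintegral integral0//.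
 have iZ : leb.-integrable D (fun y => ((-1) ^+ k * (w y * x y ^+ k))%:E).
  by have := integrableZl mD ((-1) ^+ k) (iwk k); apply: eq_integrable => // y _; rewrite EFinM.
 split.
  under eq_fun do rewrite big_ord_recr/= EFinD; exact: integrableD.
 under eq_Rintegral do rewrite big_ord_recr/=; rewrite RintegralD// IH2 big_ord_recr/= RintegralZl ?Iwk//.
 exact: iwk.
have [is1 is2] := isum n.
rewrite -is2 -RintegralB// (le_trans (le_normr_Rintegral _ _))//.
 by have := integrableB mD ii0 is1; apply: eq_integrable => // y _; rewrite EFinB.
rewrite -(Iwk n); apply: le_Rintegral => //.
- by apply: integrable_norm; have := integrableB mD ii0 is1; apply: eq_integrable => // y _; rewrite EFinB.
- exact: iwk.
move=> y Dy.
have -> : w y / (1 + x y) - \sum_(j < n) (-1) ^+ j * (w y * x y ^+ j) =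
  w y * ((1 + x y)^-1 - \sum_(k < n) (-1) ^+ k * x y ^+ k).
 by rewrite mulrBr mulr_sumr; congr (_ - _); apply: eq_bigr => j _; rewrite mulrCA.
rewrite geometric_alternating; last by rewrite gt_eqF// (lt_le_trans ltr01)// x1.
have /andP[x0 _] := x01 y Dy; have /andP[i0 i1] := iv y Dy.
rewrite normrM (ger0_norm (w0 y Dy)) ler_wpM2l ?w0//.
rewrite !normrM normrX normrN1 expr1n mul1r !ger0_norm ?exprn_ge0//.
by rewrite ler_piMr ?exprn_ge0.
Qed.

(** Partial sums of the partial fraction series of [pi / sin (b pi)]. *)
Definition reflection_sum (b : R) n : R :=
 \sum_(k < n) (-1) ^+ k * ((k%:R + b)^-1 + (k%:R + (1 - b))^-1).

Definition beta_kernel (b y : R) : R := y `^ (b - 1) / (1 + y).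

Lemma measurable_powR_pos (s : R) (D : set R) : measurable_fun D (fun y => y `^ s).
Proof. by apply: measurable_funTS; exact: measurable_powR. Qed.

(** The integral is split at 1. Below, [1 / (1 + y)] is expanded in powers of [y]; above, the kernel
    is written [y^(b - 2) / (1 + y^-1)] and expanded in powers of [1 / y]. The two families of
    moments are the two halves of [reflection_sum]. *)
Lemma beta_kernel_integral (b : R) : 0 < b < 1 -> exists I : R,
 (\int[leb]_(y in `]0%R, +oo[) (beta_kernel b y)%:E = I%:E)%E /\
 reflection_sum b n @[n --> \oo] --> I.
Proof.
move=> /andP[b0 b1].
have B0 k : 0 < k%:R + b :> R by rewrite ltr_wpDl.
have B1 k : 0 < k%:R + (1 - b) :> R by rewrite ltr_wpDl// subr_gt0.
have m01 : measurable (`]0, 1]%classic : set R) by [].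
have m1y : measurable (`[1, +oo[%classic : set R) by [].
have [i1 h1] := @alternating_moments _ _ leb (`]0, 1]%classic : set R)
 (fun y => y `^ (b - 1)) id (fun k => (k%:R + b)^-1) m01 (@measurable_powR_pos _ _)
 (@measurable_id _ _ _) (fun y _ => powR_ge0 y _)
 ltac:(by move=> y /=; rewrite in_itv/= => /andP[/ltW -> ->])
 ltac:(move=> k; rewrite -(integral_powR01 (B0 k)); apply: eq_integral => y /set_mem/=;
  rewrite in_itv/= => /andP[y0 _]; rewrite -powR_mulrn ?(ltW y0)// -powRD ?(gt_eqF y0) ?implybT//;
  congr ((_ `^ _)%:E); ring).
have [i2 h2] := @alternating_moments _ _ leb (`[1, +oo[%classic : set R)
 (fun y => y `^ (b - 2)) (fun y => y `^ (- 1)) (fun k => (k%:R + (1 - b))^-1) m1y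
 (@measurable_powR_pos _ _) (@measurable_powR_pos _ _) (fun y _ => powR_ge0 y _)
 ltac:(by move=> y /=; rewrite in_itv/= andbT => y1;
  rewrite powR_ge0 powR_inv1 ?invf_le1 ?(lt_le_trans ltr01)// (le_trans ler01))
 ltac:(move=> k; rewrite -(integral_powR_infty (B1 k)); apply: eq_integral => y /set_mem/=;
  rewrite in_itv/= andbT => y1; have y0 := lt_le_trans ltr01 y1;
  rewrite -powR_mulrn ?powR_ge0// -powRrM -powRD ?(gt_eqF y0) ?implybT//;
  congr ((_ `^ _)%:E); ring).
set I1 := \int[leb]_(y in _) _ in h1; set I2 := \int[leb]_(y in _) _ in h2.
exists (I1 + I2); split.
 have E : (`]0, +oo[%classic : set R) = `]0, 1] `|` `]1, +oo[.
  apply/seteqP; split => y /=; rewrite !in_itv/= ?andbT.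
   by move=> y0; have [y1|y1] := leP y 1; [left; rewrite y0|right].
  by move=> [/andP[]//|y1]; exact: lt_trans y1.
 have mk : measurable_fun (`]0, +oo[%classic : set R) (fun y : R => (beta_kernel b y)%:E).
  apply/measurable_EFinP; apply: measurable_funM; first exact: measurable_powR_pos.
  have h : measurable_fun (`]0, +oo[%classic : set R) (fun y : R => (1 + y) `^ (- 1)).
   apply: (measurableT_comp (f := fun z : R => z `^ (- 1))); first exact: measurable_powR.
   exact: measurable_funD.
  apply: eq_measurable_fun h => y /set_mem/=; rewrite in_itv/= andbT => y0.
  by rewrite powR_inv1// addr_ge0// ltW.
 rewrite E in mk *.
 rewrite ge0_integral_setU//=.
 - rewrite EFinD; congr (_ + _)%E.
   by rewrite /I1 /Rintegral fineK//; exact: integrable_fin_num i1.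
  rewrite integral_itv_obnd_cbnd; last first.
   by apply: measurable_funS mk; [exact: measurableU|right].
  rewrite /I2 /Rintegral fineK; last exact: integrable_fin_num i2.
  apply: eq_integral => y /set_mem/=; rewrite in_itv/= andbT => y1.
  have y0 := lt_le_trans ltr01 y1; rewrite /beta_kernel; congr EFin.
  have -> : y `^ (b - 1) = y `^ (b - 2) * y.
   rewrite -{3}(powRr1 (ltW y0)) -powRD ?(gt_eqF y0) ?implybT//; congr (_ `^ _); ring.
  rewrite powR_inv1 ?ltW//; field.
  by rewrite !gt_eqF// addr_gt0.
 - move=> y h; have y0 : 0 < y.
   by case: h; rewrite in_itv/= ?andbT; [move=> /andP[]|exact: lt_trans ltr01].
  by rewrite lee_fin mulr_ge0 ?powR_ge0// invr_ge0 addr_ge0// ltW.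
 - by apply/disj_setPS => y [/=]; rewrite !in_itv/= andbT => /andP[_ h] /(le_lt_trans h); rewrite ltxx.
have sE n : reflection_sum b n = \sum_(k < n) (-1) ^+ k * (k%:R + b)^-1 +
  \sum_(k < n) (-1) ^+ k * (k%:R + (1 - b))^-1.
 by rewrite -big_split; apply: eq_bigr => k _; rewrite mulrDr.
have nV c : 0 < c -> (n%:R + c)^-1 @[n --> \oo] --> (0 : R).
 move=> c0; apply/cvgrPdist_le => e e0; near=> n.
 rewrite sub0r normrN ger0_norm ?invr_ge0 ?addr_ge0 ?(ltW c0)//.
 rewrite invf_ple ?posrE// ?ltr_wpDl// (le_trans (ltW (truncnS_gt _)))//.
 rewrite (le_trans (_ : _ <= n%:R))// ?lerDl ?(ltW c0)// ler_nat.
 by near: n; exists (Num.truncn e^-1).+1.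
have lim (c m : nat -> R) J : (forall n, `|J - m n| <= c n) -> c n @[n --> \oo] --> (0 : R) ->
  m n @[n --> \oo] --> J.
 move=> hJ /cvgrPdist_le c0; apply/cvgrPdist_le => e e0.
 apply: filterS (c0 e e0) => n; rewrite sub0r normrN => h.
 by rewrite (le_trans (hJ n))// (le_trans (ler_norm _)).
under eq_fun do rewrite sE; apply: cvgD.
 by apply: (lim _ _ _ h1); exact: nV.
by apply: (lim _ _ _ h2); apply: nV; rewrite subr_gt0.
Unshelve. all: end_near. Qed.

End reflection.

(** * The value of the reflection series *)

Section reflection_value.
Context {R : realType}.
Local Notation leb := (@lebesgue_measure R).
Implicit Types (a b x : R).

Lemma is_derive_sin_scale a x : a != 0 -> is_derive x 1 (fun y => sin (a * y) / a) (cos (a * x)).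
Proof.
move=> a0.
have h1 : is_derive x 1 (fun y => a * y) a.
 by have := is_deriveZ a (is_derive_id x (1 : R)); rewrite /GRing.scale/= mulr1.
have h2 := is_derive1_comp (is_derive_sin (a * x)) h1.
have := is_deriveZ a^-1 h2; rewrite /GRing.scale/= mulrCA mulVf// mulr1.
rewrite (_ : (fun y => _) = a^-1 \*: (@sin R \o *%R a))//.
by apply/funext => y /=; rewrite mulrC.
Qed.

Lemma continuous_cos_scale a : continuous (fun x : R => cos (a * x)).
Proof.
move=> x; apply: (@continuous_comp _ _ _ (fun y : R => a * y) (@cos R)).
 exact: mulrl_continuous.
exact: continuous_cos.
Qed.

(** The alternating series is traded for the integral of a cosine sum over [[0, pi]]:
    [sin ((k + b) pi)] carries both the sign and the factor [sin (b pi)], and so does the term with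
    [1 - b]. *)
Definition cos_sum b n x : R :=
 \sum_(k < n) (cos ((k%:R + b) * x) + cos ((k%:R + (1 - b)) * x)).

Lemma continuous_cos_sum b n : continuous (cos_sum b n).
Proof.
elim: n => [|n IH] x.
 rewrite (_ : cos_sum b 0 = cst 0); first exact: cvg_cst.
 by apply/funext => y; rewrite /cos_sum big_ord0.
rewrite (_ : cos_sum b n.+1 = fun y => cos_sum b n y +
 (cos ((n%:R + b) * y) + cos ((n%:R + (1 - b)) * y))).
 by apply: cvgD; [exact: IH|apply: cvgD; exact: continuous_cos_scale].
by apply/funext => y; rewrite /cos_sum big_ord_recr.
Qed.

Lemma sin_natDpi b (k : nat) : sin ((k%:R + b) * pi) = (-1) ^+ k * sin (b * pi).
Proof.
elim: k => [|k IH]; first by rewrite add0r expr0 mul1r.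
rewrite (_ : (k.+1%:R + b) * pi = (k%:R + b) * pi + pi); last by rewrite -natr1; ring.
by rewrite sinDpi IH exprS mulN1r mulNr.
Qed.

Lemma reflection_sumE b n : 0 < b < 1 ->
 \int[leb]_(x in `[0, pi]) cos_sum b n x = sin (b * pi) * reflection_sum b n.
Proof.
move=> /andP[b0 b1].
have B0 k : k%:R + b != 0 by rewrite gt_eqF// ltr_wpDl.
have B1 k : k%:R + (1 - b) != 0 by rewrite gt_eqF// ltr_wpDl// subr_gt0.
pose G x := \sum_(k < n) (sin ((k%:R + b) * x) / (k%:R + b) +
 sin ((k%:R + (1 - b)) * x) / (k%:R + (1 - b))).
have dG x : -1 < x -> is_derive x 1 G (cos_sum b n x).
 move=> _; rewrite /G /cos_sum.
 rewrite (_ : (fun x => _) = \sum_(k < n) (fun x => sin ((k%:R + b) * x) / (k%:R + b) +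
  sin ((k%:R + (1 - b)) * x) / (k%:R + (1 - b)))); last first.
  by apply/funext => y; rewrite fct_sumE.
 by apply: is_derive_sum => k; apply: is_deriveD; exact: is_derive_sin_scale.
have cc x : -1 < x -> {for x, continuous (cos_sum b n)} by move=> _; exact: continuous_cos_sum.
rewrite (FTC_itvR (ltrN10 R) (pi_ge0 R) dG cc).
rewrite {2}/G big1 ?subr0; last by move=> k _; rewrite !mulr0 sin0 !mul0r addr0.
rewrite /G /reflection_sum mulr_sumr; apply: eq_bigr => k _.
rewrite !sin_natDpi (_ : (1 - b) * pi = pi - b * pi); last by ring.
by rewrite sinB sinpi cospi mul0r mulN1r opprK add0r; ring.
Qed.

Lemma cos_sum_factor b n x :
 cos_sum b n x = cos ((b - 2^-1) * x) * \sum_(k < n) 2 * cos ((k%:R + 2^-1) * x).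
Proof.
rewrite /cos_sum mulr_sumr; apply: eq_bigr => k _.
rewrite (_ : (k%:R + b) * x = (k%:R + 2^-1) * x + (b - 2^-1) * x); last by ring.
rewrite (_ : (k%:R + (1 - b)) * x = (k%:R + 2^-1) * x - (b - 2^-1) * x); last by field.
by rewrite cosD cosB; ring.
Qed.

Lemma dirichlet_sum n x : sin (x / 2) * (\sum_(k < n) 2 * cos ((k%:R + 2^-1) * x)) = sin (n%:R * x).
Proof.
elim: n => [|n IH]; first by rewrite big_ord0 mulr0 mul0r sin0.
rewrite big_ord_recr/= mulrDr IH -[n.+1%:R]natr1.
rewrite (_ : (n%:R + 1) * x = (n%:R + 2^-1) * x + x / 2); last by field.
rewrite (_ : n%:R * x = (n%:R + 2^-1) * x - x / 2); last by field.
by rewrite sinB sinD; ring.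
Qed.

Lemma fejer_sum m x : 2 * sin (x / 2) ^+ 2 *
 (\sum_(n < m) \sum_(k < n) 2 * cos ((k%:R + 2^-1) * x)) = cos (x / 2) - cos ((m%:R - 2^-1) * x).
Proof.
elim: m => [|m IH].
 by rewrite big_ord0 mulr0 (_ : (0 - 2^-1) * x = - (x / 2)) ?cosN//; ring.
rewrite big_ord_recr/= mulrDr IH (_ : 2 * sin (x / 2) ^+ 2 * _ = 2 * sin (x / 2) *
 (sin (x / 2) * (\sum_(k < m) 2 * cos ((k%:R + 2^-1) * x)))); last by ring.
rewrite dirichlet_sum -[m.+1%:R]natr1.
rewrite (_ : (m%:R + 1 - 2^-1) * x = m%:R * x + x / 2); last by field.
rewrite (_ : (m%:R - 2^-1) * x = m%:R * x - x / 2); last by field.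
by rewrite cosB cosD; ring.
Qed.

Lemma abs_cos_le1 x : `|cos x| <= 1.
Proof. by rewrite ler_norml cos_geN1 cos_le1. Qed.

(** The double sum of cosines behaves like [1 / sin^2 (x / 2)] at 0. Comparison with [b = 1/2]
    supplies the factor [cos ((b - 1/2) x) - 1], at most [1 - cos x = 2 sin^2 (x / 2)] in modulus,
    which cancels this singularity. *)
Lemma cos_sum_bounded b m x : 0 < b < 1 -> 0 <= x <= pi ->
 `|\sum_(n < m) (cos_sum b n x - cos_sum 2^-1 n x)| <= 2.
Proof.
move=> b01 /andP[x0 xp].
pose Q := \sum_(n < m) \sum_(k < n) 2 * cos ((k%:R + 2^-1) * x).
have -> : \sum_(n < m) (cos_sum b n x - cos_sum 2^-1 n x) = (cos ((b - 2^-1) * x) - 1) * Q.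
 rewrite /Q mulr_sumr; apply: eq_bigr => n _.
 by rewrite !cos_sum_factor subrr mul0r cos0 -mulrBl.
have hQ : 2 * sin (x / 2) ^+ 2 * `|Q| <= 2.
 have := fejer_sum m x; rewrite -/Q => h.
 have s0 : 0 <= 2 * sin (x / 2) ^+ 2 by rewrite mulr_ge0// sqr_ge0.
 rewrite -[X in X * _](ger0_norm s0) -normrM h (le_trans (ler_normB _ _))//.
 by rewrite (_ : 2 = 1 + 1) ?lerD ?abs_cos_le1//.
have cE : cos x = 1 - 2 * sin (x / 2) ^+ 2.
 rewrite {1}(splitr x) cosD; have := cos2Dsin2 (x / 2); rewrite !expr2; lra.
rewrite normrM (le_trans _ hQ)// ler_wpM2r//.
rewrite distrC ger0_norm//.
suff : cos x <= cos ((b - 2^-1) * x) by rewrite cE; lra.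
have -> : cos ((b - 2^-1) * x) = cos `|(b - 2^-1) * x|.
 have [h|h] := leP 0 ((b - 2^-1) * x); first by rewrite ger0_norm.
 by rewrite ltr0_norm// cosN.
have ax : `|(b - 2^-1) * x| <= x.
 rewrite normrM (ger0_norm x0) ler_piMl// ler_norml.
 by case/andP: b01 => *; apply/andP; split; lra.
move: ax; rewrite le_eqVlt => /predU1P[->//|ax].
apply: ltW; rewrite ltr_cos// in_itv/= ?x0// normr_ge0/=.
by rewrite (le_trans (ltW ax)).
Qed.

(** At [b = 1/2] the series is four times the Leibniz series, the moment expansion of
    [\int_0^1 1 / (1 + y^2) = pi / 4]. *)
Lemma reflection_half n : `|pi - reflection_sum (2^-1 : R) n| <= 4 * (2 * n%:R + 1)^-1.
Proof.
have m01 : measurable (`[0, 1]%classic : set R) by [].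
have p1 k : 0 < 2 * k%:R + 1 :> R by rewrite ltr_wpDl// mulr_ge0.
have mom k : (\int[leb]_(y in `[0%R, 1%R]) (1 * (y ^+ 2) ^+ k)%:E = ((2 * k%:R + 1)^-1)%:E)%E.
 have dX x : -1 < x -> is_derive x 1 (fun y : R => y ^+ k.*2.+1 / (2 * k%:R + 1)) (x ^+ k.*2).
  move=> _; have h := is_deriveX k.*2.+1 (is_derive_id x (1 : R)).
  have := is_deriveZ (2 * k%:R + 1)^-1 h.
  rewrite /GRing.scale/= mulr1 mulrA (_ : k.*2.+1%:R = 2 * k%:R + 1); last first.
   by rewrite -natr1 -mul2n natrM.
  rewrite mulVf// mul1r.
  have -> // : (fun y : R => y ^+ k.*2.+1 / (2 * k%:R + 1)) = (2 * k%:R + 1)^-1 \*: (id ^+ k.*2.+1).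
  by apply/funext => y /=; rewrite exprfctE mulrC.
 have cX x : -1 < x -> {for x, continuous (fun y : R => y ^+ k.*2)}.
  by move=> _; exact: exprn_continuous.
 have := FTC_itv (ltrN10 R) ler01 dX cX; rewrite expr1n expr0n/= mul0r subr0 div1r => <-.
 by apply: eq_integral => y _; rewrite mul1r -exprM mul2n.
have [_ h] := @alternating_moments R _ _ leb (`[0, 1]%classic : set R) (fun=> 1)
 (fun y => y ^+ 2) (fun k => (2 * k%:R + 1)^-1) m01 (@measurable_cst _ _ _ _ _ _)
 (measurable_funX 2 (@measurable_id _ _ _)) (fun _ _ => ler01)
 ltac:(by move=> y /=; rewrite in_itv/= => /andP[y0 y1]; rewrite exprn_ge0// exprn_ile1) mom.
have -> : reflection_sum (2^-1 : R) n = 4 * \sum_(k < n) (-1) ^+ k * (2 * k%:R + 1)^-1.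
 rewrite /reflection_sum mulr_sumr; apply: eq_bigr => k _.
 have k0 := p1 k; rewrite (_ : 1 - 2^-1 = 2^-1); last by field.
 by field; rewrite (gt_eqF k0).
have pE : pi = 4 * \int[leb]_(y in `[0, 1]) (1 / (1 + y ^+ 2)).
 have c1 x : -1 < x -> {for x, continuous (fun y : R => (1 + y ^+ 2)^-1)}.
  move=> _; apply: (@cvgV _ _ _ _ (fun y : R => 1 + y ^+ 2)).
   by rewrite gt_eqF// ltr_pwDl// sqr_ge0.
  by apply: cvgD; [exact: cvg_cst|exact: exprn_continuous].
 rewrite (_ : \int[leb]_(y in _) _ = atan 1 - atan 0).
  by rewrite atan1 atan0 subr0; field.
 rewrite -(FTC_itvR (ltrN10 R) ler01 (fun x _ => is_derive1_atan x) c1).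
 by apply: eq_Rintegral => y _; rewrite div1r.
rewrite {1}pE -mulrBr normrM ger0_norm//.
by rewrite ler_wpM2l.
Qed.

(** With [I] the limit of the series, [D n] tends to [sin (b pi) I - pi]. The partial sums of [D n]
    stay within [2 pi], so its Cesàro means tend to 0, and the limit is 0. *)
Theorem beta_integral_reflection b : 0 < b < 1 ->
 (\int[leb]_(y in `]0%R, +oo[) (beta_kernel b y)%:E = (pi / sin (b * pi))%:E)%E.
Proof.
move=> b01; have [I [IE hI]] := beta_kernel_integral b01; rewrite IE; congr EFin.
have s0 : 0 < sin (b * pi).
 case/andP: b01 => b0 b1; apply: sin_gt0_pi; rewrite mulr_gt0 ?pi_gt0//=.
 by rewrite gtr_pMl ?pi_gt0.
have h2 : reflection_sum (2^-1 : R) n @[n --> \oo] --> (pi : R).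
 apply/cvgrPdist_le => e e0; near=> n.
 have p1 : 0 < 2 * n%:R + 1 :> R by rewrite ltr_wpDl// mulr_ge0.
 rewrite (le_trans (reflection_half n))// ler_pdivrMr// mulrC -ler_pdivrMr//.
 rewrite (le_trans (ltW (truncnS_gt _)))// (le_trans (_ : _ <= n%:R))//.
  by rewrite ler_nat; near: n; exists (Num.truncn (4 / e)).+1.
 have : 0 <= n%:R :> R by []. lra.
pose D n := sin (b * pi) * reflection_sum b n - reflection_sum 2^-1 n.
have hD : D n @[n --> \oo] --> sin (b * pi) * I - pi.
 by apply: cvgB => //; apply: cvgM => //; exact: cvg_cst.
have icos c n : leb.-integrable `[0, pi] (EFin \o cos_sum c n).
 by apply: (@integrable_itv R _ (-1)) => // x _; exact: continuous_cos_sum.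
have DE n : D n = \int[leb]_(x in `[0, pi]) (cos_sum b n x - cos_sum 2^-1 n x).
 have h12 : 0 < (2^-1 : R) < 1 by lra.
 rewrite RintegralB// !reflection_sumE// /D.
 by rewrite [2^-1 * pi]mulrC sin_pihalf mul1r.
have sumE m : leb.-integrable `[0, pi] (EFin \o (fun x => \sum_(n < m) (cos_sum b n x - cos_sum 2^-1 n x))) /\
  \int[leb]_(x in `[0, pi]) (\sum_(n < m) (cos_sum b n x - cos_sum 2^-1 n x)) = \sum_(n < m) D n.
 elim: m => [|m [IH1 IH2]].
  rewrite big_ord0; split.
   by rewrite (_ : _ \o _ = fun=> 0%E); [exact: integrable0|apply/funext => x /=; rewrite big_ord0].
  by under eq_Rintegral do rewrite big_ord0; rewrite /Rintegral integral0.
 have iB : leb.-integrable `[0, pi] (EFin \o (fun x => cos_sum b m x - cos_sum 2^-1 m x)).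
  apply: (@integrable_itv R _ (-1)) => // x _.
  by apply: cvgB; exact: continuous_cos_sum.
 split.
  rewrite (_ : _ \o _ = fun x => ((\sum_(n < m) (cos_sum b n x - cos_sum 2^-1 n x))%:E +
    (cos_sum b m x - cos_sum 2^-1 m x)%:E)%E); first exact: integrableD.
  by apply/funext => x /=; rewrite big_ord_recr.
 under eq_Rintegral do rewrite big_ord_recr/=.
 by rewrite RintegralD// IH2 big_ord_recr/= DE.
have bnd m : `|\sum_(n < m) D n| <= 2 * pi.
 have [i1 <-] := sumE m.
 rewrite (le_trans (le_normr_Rintegral _ i1))//.
 rewrite (le_trans (le_Rintegral _ (f2 := fun=> 2) _ _ _))//.
 - exact: integrable_norm.
 - by apply: finite_measure_integrable_cst || apply: (@integrable_itv R _ (-1)) => // x _; exact: cst_continuous.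
 - by move=> x /=; rewrite in_itv/= => x0; exact: cos_sum_bounded.
 - rewrite Rintegral_cst//= lebesgue_measure_itv/= lte_fin pi_gt0 oppr0 adde0//.
have hc := cesaro hD.
have h0 : arithmetic_mean D n @[n --> \oo] --> (0 : R).
 apply/cvgrPdist_le => e e0; near=> n.
 rewrite sub0r normrN /arithmetic_mean normrM /series/= big_mkord.
 rewrite ger0_norm// ler_pdivrMl//.
 rewrite (le_trans (bnd _))// -ler_pdivrMr//.
 rewrite (le_trans (ltW (truncnS_gt _)))// ler_nat.
 by rewrite ltnS; near: n; exists (Num.truncn (2 * pi / e)).
have /subr0_eq piE : sin (b * pi) * I - pi = 0 by apply: cvg_unique hc h0.
by apply: (canRL (mulfK _)); rewrite ?gt_eqF// mulrC.
Unshelve. all: end_near. Qed.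

End reflection_value.

(** * Regular variation of the tail and Abelian estimates *)

Section tail.
Context d (Y : measurableType d) (R : realType) (mu : probability Y R).
Variables (tau : Y -> R) (ell : R -> R) (beta : R).
Hypothesis tau_meas : mfunT tau.
Hypothesis tau_pos : forall y, 0 < tau y.
Hypothesis ell_sv : slowly_varying ell.
Hypothesis beta01 : 0 < beta < 1.
Hypothesis tau_tail : forall t : R, 0 < t ->
 mu [set y | t < tau y] = (ell t * t `^ (- beta))%:E.

Definition tail_fun t : R := fine (mu [set y | t < tau y]).
Local Notation H := tail_fun.

Lemma measurable_tail t : measurable [set y | t < tau y].
Proof.
rewrite (_ : [set _ | _] = tau @^-1` `]t, +oo[%classic).
 by rewrite -[X in measurable X]setTI; exact: tau_meas.
by apply/seteqP; split => y /=; rewrite in_itv/= andbT.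
Qed.

Lemma tail_fin t : mu [set y | t < tau y] = (H t)%:E.
Proof. by rewrite fineK// fin_num_measure//; exact: measurable_tail. Qed.

Lemma tail_ge0 t : 0 <= H t.
Proof. by rewrite -lee_fin -tail_fin. Qed.

Lemma tail_le1 t : H t <= 1.
Proof. by rewrite -lee_fin -tail_fin probability_le1//; exact: measurable_tail. Qed.

Lemma tail_noninc s t : s <= t -> H t <= H s.
Proof.
move=> st; rewrite -lee_fin -!tail_fin; apply: le_measure; rewrite ?inE//; try exact: measurable_tail.
by move=> y /=; exact: le_lt_trans.
Qed.

Lemma tailE t : 0 < t -> H t = ell t * t `^ (- beta).
Proof. by move=> t0; rewrite /H tau_tail. Qed.

Lemma m_funE t : 0 < t -> m_fun ell beta t = t * H t.
Proof.
move=> t0; rewrite /m_fun tailE// mulrCA; congr (_ * _).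
by rewrite powRD ?powRr1 ?ltW// (gt_eqF t0) implybT.
Qed.

(** Division by 0 gives 0, so the ratio [ell t / ell t], which tends to 1, forces [ell] to be
    nonzero at large arguments; monotonicity of the tail carries positivity back to every [t]. *)
Lemma tail_gt0 t : 0 < H t.
Proof.
have [_ _ /(_ 1 ltr01)] := ell_sv; under eq_fun do rewrite mul1r.
move=> /cvgrPdist_lt/(_ 1 ltr01) h.
have [s [s0 [ts e]]] : exists s, 0 < s /\ (t <= s /\ ell s != 0).
 near (pinfty_nbhs R) => s; exists s; split; first by [].
 split; first by [].
 apply/eqP => e0; have := near h s; rewrite e0 mul0r subr0 normr1 ltxx.
 by move=> /(_ _)/negP; apply=> //; near: s.
rewrite (lt_le_trans _ (tail_noninc ts))// lt_neqAle tail_ge0 andbT eq_sym.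
by rewrite tailE// mulf_neq0// gt_eqF// powR_gt0.
Unshelve. all: end_near. Qed.

Lemma tail_ratio x : 0 < x -> (H (x * t) / H t) @[t --> +oo] --> x `^ (- beta).
Proof.
move=> x0; have [_ _ /(_ _ x0) h] := ell_sv.
rewrite -[X in _ --> X]mul1r.
apply: cvg_trans (cvgM h (cvg_cst (x `^ (- beta)))).
apply: near_eq_cvg; near=> t.
have t0 : 0 < t by [].
rewrite /= !tailE ?mulr_gt0// powRM ?ltW//.
have p0 := powR_gt0 (- beta) t0.
have e0 : ell t != 0 by apply: contra_neq (lt0r_neq0 (tail_gt0 t)) => e; rewrite tailE// e mul0r.
by field; rewrite e0 gt_eqF.
Unshelve. all: end_near. Qed.

Lemma tail_double e : 0 < e -> exists2 t0, 1 <= t0 & forall t, t0 <= t ->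
 2 `^ (- (beta + e)) * H t <= H (2 * t) <= 2 `^ (- (beta - e)) * H t.
Proof.
move=> e0; have := @tail_ratio 2 ltac:(by []).
have h1 : 2 `^ (- (beta + e)) < 2 `^ (- beta) :> R.
 by rewrite /powR pnatr_eq0/= ltr_expR ltr_pM2r ?ln_gt0//; lra.
have h2 : 2 `^ (- beta) < 2 `^ (- (beta - e)) :> R.
 by rewrite /powR pnatr_eq0/= ltr_expR ltr_pM2r ?ln_gt0 ?ltr1n//; lra.
set p := Num.min (2 `^ (- beta) - 2 `^ (- (beta + e))) (2 `^ (- (beta - e)) - 2 `^ (- beta)) : R.
have p0 : 0 < p by rewrite lt_min !subr_gt0 h1.
move=> /cvgrPdist_le/(_ _ p0) [M [_ hM]].
exists (Num.max 1 (M + 1)); first by rewrite le_max lexx.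
move=> t; rewrite ge_max => /andP[t1 tM].
have := hM t ltac:(by rewrite (lt_le_trans _ tM)// ltrDl).
have Ht := tail_gt0 t.
rewrite /= ler_norml => /andP[]; rewrite lerNl opprB.
have pl : p <= 2 `^ (- beta) - 2 `^ (- (beta + e)) by rewrite ge_min lexx.
have pr : p <= 2 `^ (- (beta - e)) - 2 `^ (- beta) by rewrite ge_min lexx orbT.
by move=> i1 i2; apply/andP; split; [rewrite -ler_pdivlMr//|rewrite -ler_pdivrMr//]; lra.
Qed.

(* Dyadic iteration on [2 ^ k <= x < 2 ^ (k + 1)]. *)
Lemma doubling_ind (Q : R -> Prop) : (forall x, 1 <= x <= 2 -> Q x) ->
 (forall x, 1 <= x -> Q x -> Q (2 * x)) -> forall x, 1 <= x -> Q x.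
Proof.
move=> h1 h2 x x1.
have [k xk] : exists k : nat, x <= 2 ^+ k.
 exists (Num.truncn x).+1; rewrite (le_trans (ltW (truncnS_gt _)))//.
 by rewrite -natrX ler_nat ltnW// ltn_expl.
elim: k x x1 xk => [|k IH] x x1 xk.
 by apply: h1; rewrite x1 (le_trans xk)// expr0 ler1n.
have [x2|x2] := leP x 2; first by apply: h1; rewrite x1.
rewrite -(mulVKf (_ : 2 != 0 :> R) x)//; apply: h2; last apply: IH.
- by rewrite mulrC ler_pdivlMr// mul1r ltW.
- by rewrite mulrC ler_pdivlMr// mul1r ltW.
- by rewrite mulrC ler_pdivrMr// -exprSr.
Qed.

(** Potter bounds, by iterating the doubling estimate. The constant only has to cover [1 <= x <= 2];
    the absolute values allow a negative exponent [a]. *)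
Lemma potter a b : a < beta < b -> exists C t0, [/\ 1 <= C, 1 <= t0 &
 forall t x, t0 <= t -> 1 <= x ->
  H t <= C * x `^ b * H (x * t) /\ H (x * t) <= C * x `^ (- a) * H t].
Proof.
move=> /andP[ab bb].
have [t1 t11 h1] := @tail_double (b - beta) ltac:(by rewrite subr_gt0).
have [t2 t21 h2] := @tail_double (beta - a) ltac:(by rewrite subr_gt0).
pose C : R := 2 `^ `|b| + 2 `^ `|a|.
have two (x : R) : 1 <= 2 `^ `|x|.
 by rewrite -[leLHS](powRr0 (2 : R)); apply: ler_powR; rewrite ?ler1n.
exists C, (Num.max t1 t2); split.
- by rewrite /C (le_trans (two a))// lerDr powR_ge0.
- by rewrite le_max t11.
move=> t x; rewrite ge_max => /andP[tt1 tt2] x1.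
have t0 : 0 < t by rewrite (lt_le_trans _ tt1)// (lt_le_trans _ t11).
move: x x1; apply: doubling_ind => [x /andP[x1 x2]|x x1 [IH1 IH2]].
 have x0 : 0 < x by exact: lt_le_trans x1.
 have xt : t <= x * t by rewrite ler_peMl// ltW.
 split; last first.
  rewrite (le_trans (tail_noninc xt))// ler_peMl ?tail_ge0//.
  rewrite (le_trans (_ : _ <= 2 `^ `|a| * x `^ (- a)))//; last first.
   by rewrite ler_wpM2r ?powR_ge0// /C lerDr powR_ge0.
  rewrite powRN ler_pdivlMr ?powR_gt0// mul1r.
  rewrite (le_trans (_ : _ <= x `^ `|a|))//.
   by apply: ler_powR => //; exact: ler_norm.
  by apply: ge0_ler_powR; rewrite ?nnegrE// ltW.
 have /andP[i1 _] := h1 _ tt1; rewrite (_ : beta + (b - beta) = b) in i1; last by ring.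
 have i2 : H (2 * t) <= H (x * t) by apply: tail_noninc; rewrite ler_wpM2r// ltW.
 have i3 : 2 `^ (- b) * H t <= H (x * t) by exact: le_trans i2.
 rewrite powRN mulrC ler_pdivrMr// in i3.
 rewrite (le_trans i3)// mulrC ler_wpM2r ?tail_ge0//.
 have xb : x `^ b * 2 `^ `|b| >= 2 `^ b.
  have [b0|b0] := leP 0 b.
   by rewrite ger0_norm// ler_peMl// -[leLHS](powRr0 x); apply: ler_powR.
  rewrite ltr0_norm// powRN -ler_pdivrMr ?powR_gt0// invrK.
  rewrite (le_trans (_ : _ <= 2 `^ b))//.
   rewrite ler_piMr ?powR_ge0// -[leRHS](powRr0 (2 : R)); apply: ler_powR; rewrite ?ler1n//.
   exact: ltW.
  rewrite -[b]opprK powRN [leRHS]powRN lef_pV2 ?posrE ?powR_gt0//.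
  by apply: ge0_ler_powR; rewrite ?nnegrE ?oppr_ge0// ltW.
 by rewrite (le_trans xb)// mulrC ler_wpM2r ?powR_ge0// /C lerDl powR_ge0.
have x0 : 0 < x by exact: lt_le_trans x1.
have xt1 : t1 <= x * t by rewrite (le_trans tt1)// ler_peMl// ltW.
have xt2 : t2 <= x * t by rewrite (le_trans tt2)// ler_peMl// ltW.
have /andP[i1 _] := h1 _ xt1; have /andP[_ i2] := h2 _ xt2.
rewrite (_ : beta + (b - beta) = b) in i1; last by ring.
rewrite (_ : beta - (beta - a) = a) in i2; last by ring.
have C0 : 0 <= C by rewrite addr_ge0 ?powR_ge0.
rewrite -!mulrA !powRM ?(ltW x0)//; split.
 rewrite (le_trans IH1)// -!mulrA ler_wpM2l//.
 rewrite powRN mulrC ler_pdivrMr ?powR_gt0// in i1.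
 by rewrite [leRHS]mulrCA ler_wpM2l ?powR_ge0// [leRHS]mulrC.
rewrite (le_trans i2)// (le_trans (ler_wpM2l (powR_ge0 _ _) IH2))// le_eqVlt.
by apply/orP; left; apply/eqP; ring.
Qed.

(** A bound valid down to small [x], as domination requires. When [x t] falls below the Potter
    threshold [t0], the left side is at most 1, and the Potter bound from [t0] to [t] shows that the
    right side is at least 1. *)
Lemma tail_upper b : beta < b -> exists C t0, [/\ 1 <= C, 1 <= t0 &
 forall t x, t0 <= t -> 0 < x -> H (x * t) <= C * (1 + x `^ (- b)) * H t].
Proof.
move=> bb; have := @potter (beta - 1) b ltac:(rewrite bb andbT; lra).
move=> [C [t0 [C1 t01 h]]].
have C0 : 0 < C by exact: lt_le_trans C1.
have t00 : 0 < t0 by exact: lt_le_trans t01.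
pose K := C / H t0.
have CK : C <= K by rewrite ler_pdivlMr ?tail_gt0// ler_piMr ?tail_le1// ltW.
exists K, t0; split => //; first exact: le_trans CK.
move=> t x tt x0; have tp : 0 < t by exact: lt_le_trans tt.
have K0 : 0 <= K by exact: le_trans (ltW C0) CK.
have Ht := tail_ge0 t.
have [x1|x1] := leP 1 x.
 rewrite (le_trans (tail_noninc (_ : t <= x * t)))//; first by rewrite ler_peMl// ltW.
 rewrite ler_peMl// (le_trans C1)// (le_trans CK)// ler_peMr// lerDl powR_ge0//.
have xV1 : 1 <= x^-1 by rewrite invf_ge1// ltW.
have xV : x^-1 `^ b = x `^ (- b) by rewrite -powR_inv1 ?ltW// -powRrM mulN1r.
have [xt|xt] := leP t0 (x * t).
 have [i _] := h _ _ xt xV1; rewrite mulKf ?gt_eqF// xV in i.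
 rewrite (le_trans i)// ler_wpM2r// ler_pM ?powR_ge0 ?(ltW C0)//.
 by rewrite lerDr.
have tt0 : 1 <= t / t0 by rewrite ler_pdivlMr// mul1r.
have [i _] := h _ _ (lexx t0) tt0; rewrite divfK ?gt_eqF// in i.
rewrite (le_trans (tail_le1 _))//.
have j : 1 <= K * (t / t0) `^ b * H t.
 rewrite (_ : _ * _ = C * (t / t0) `^ b * H t / H t0); last by rewrite /K; ring.
 by rewrite ler_pdivlMr ?tail_gt0// mul1r.
rewrite (le_trans j)// ler_wpM2r// ler_wpM2l//.
rewrite (le_trans (_ : _ <= x `^ (- b)))// ?lerDr// -xV.
apply: ge0_ler_powR; rewrite ?nnegrE ?invr_ge0 ?(ltW x0)//.
- by case/andP: beta01 => b0 _; rewrite ltW// (lt_trans b0).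
- by rewrite divr_ge0// ltW.
- by rewrite ler_pdivrMr// mulrC ler_pdivlMr// mulrC ltW.
Qed.

Local Notation leb := (@lebesgue_measure R).
Local Notation G := (laplace_defect mu tau).

(* Tonelli, from [1 - exp (- a) = \int_0^a exp (- x) dx]. *)
Lemma laplace_defect_tail s : 0 < s ->
 (G s)%:E = (\int[leb]_(x in `]0%R, +oo[) (expR (- x) * H (x / s))%:E)%E.
Proof.
move=> s0; pose E : set (Y * R) := [set z | 0 < z.2 /\ z.2 < s * tau z.1].
have mE : measurable E.
 have -> : E = (snd @^-1` `]0, +oo[%classic) `&` ((fun z => s * tau z.1 - z.2) @^-1` `]0, +oo[%classic).
  by apply/seteqP; split => z /=; rewrite /E /= !in_itv/= !andbT subr_gt0.
 apply: measurableI; rewrite -[X in measurable X]setTI.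
  exact: (measurable_snd measurableT).
 have mf : mfunT (fun z : Y * R => s * tau z.1 - z.2).
  apply: measurable_funB => //; apply: measurable_funM => //.
  exact: measurableT_comp.
 exact: mf.
pose f (z : Y * R) : \bar R := (expR (- z.2) * \1_E z)%:E.
have mf : mfunT f.
 apply/measurable_EFinP; apply: measurable_funM; last exact: measurable_indic.
 by apply: measurableT_comp => //; apply: measurableT_comp.
have f0 z : (0 <= f z)%E by rewrite lee_fin mulr_ge0.
have := @fubini_tonelli _ _ _ _ _ mu leb f mf f0.
rewrite /fubini_F /fubini_G => FT.
transitivity (\int[mu]_y \int[leb]_x f (y, x))%E.
 rewrite /laplace_defect /Rintegral fineK; last first.
  have : rintegrable mu (fun y => 1 - expR (- (s * tau y))).
   apply: (rintegrable_bounded mu _ (M := 1)).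
    apply: measurable_funB => //; apply: measurableT_comp => //; apply: measurableT_comp => //.
    exact: measurable_funM.
   move=> y; rewrite ger0_norm// subr_ge0 expRN_le1.
   by rewrite mulr_ge0// ltW.
  by move=> /integrable_fin_num; apply.
 apply: eq_integral => y _.
 rewrite -integral_expN_itv; last by rewrite mulr_ge0// ltW.
 rewrite integral_mkcond; apply: eq_integral => x _.
 rewrite patchE /f indicE /=; case: ifPn => [/set_mem/=|/negP h].
  by rewrite in_itv/= => /andP[h1 h2]; rewrite mem_set ?mulr1.
 rewrite memNset ?mulr0// => -[/= h1 h2]; apply: h; rewrite inE/= in_itv/=.
 by rewrite h1.
rewrite FT [RHS]integral_mkcond; apply: eq_integral => x _.
rewrite patchE; case: ifPn => [/set_mem/=|/negP h].
 rewrite in_itv/= andbT => x0.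
 have mA := measurable_tail (x / s).
 rewrite EFinM -tail_fin//.
 have -> : mu [set y | x / s < tau y] = (\int[mu]_y (\1_[set y | x / s < tau y] y)%:E)%E.
  by rewrite integral_indic// setIT.
 rewrite -ge0_integralZl//; last by apply/measurable_EFinP; exact: measurable_indic.
 apply: eq_integral => y _; rewrite /f EFinM; congr (_ * (_)%:E)%E.
 rewrite !indicE; congr (nat_of_bool _)%:R; apply/idP/idP => /set_mem/= h; apply/mem_set => /=.
  by case: h => _ h; rewrite ltr_pdivrMr// mulrC.
 by split => //; move: h; rewrite ltr_pdivrMr// mulrC.
rewrite integral0_eq// => y _; rewrite /f indicE memNset ?mulr0// => -[/= h1 _].
by apply: h; rewrite inE/= in_itv/= h1.
Qed.

Lemma measurable_tail_fun : mfunT H.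
Proof.
rewrite (_ : H = -%R \o (fun t => - H t)); last by apply/funext => t /=; rewrite opprK.
apply: measurableT_comp => //; apply: nondecreasing_measurable => // s t st.
by rewrite lerN2; apply: tail_noninc.
Qed.

(** In the tail representation of the defect, [H (x t / s) / H t] converges to [(x / s)^-beta], and
    the integrand is dominated by a multiple of [e^-x (1 + x^-b)] with [beta < b < 1]. *)
Lemma laplace_defect_ratio s : 0 < s ->
 (G (s / t) / H t) @[t --> +oo] --> gamma_const beta * s `^ beta.
Proof.
move=> s0; apply/cvg_pinftyP => u uy; have /andP[b0 b1] := beta01.
pose b := (1 + beta) / 2.
have bb : beta < b by rewrite /b; lra.
have b01 : 0 <= b < 1 by apply/andP; split; rewrite /b; lra.
have [C [t0 [C1 t01 hC]]] := tail_upper bb.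
have C0 : 0 <= C by exact: le_trans C1.
move/cvgryPge : uy (uy) => /(_ t0) [N _ hN] uy.
rewrite -(cvg_shiftn N)/=; set v := fun n => u (n + N)%N.
have v0 n : t0 <= v n by apply: hN => /=; exact: leq_addl.
have vp n : 0 < v n by rewrite (lt_le_trans _ (v0 n))// (lt_le_trans ltr01).
have vy : v n @[n --> \oo] --> +oo by rewrite /v (cvg_shiftn N).
have H0 t : 0 < H t by exact: tail_gt0.
pose D : set R := `]0, +oo[%classic.
have mD : measurable D by exact: measurable_itv.
pose f0 n (x : R) := expR (- x) * (H (x / s * v n) / H (v n)); pose f n x := (f0 n x)%:E.
pose g0 (x : R) := expR (- x) * (x / s) `^ (- beta); pose g x := (g0 x)%:E.
have fE n : (G (s / v n) / H (v n))%:E = (\int[leb]_(x in D) f n x)%E.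
 rewrite EFinM laplace_defect_tail ?divr_gt0// muleC -ge0_integralZl//.
 - apply: eq_integral => x _; rewrite /f /f0 -EFinM; congr EFin.
  have -> : x / (s / v n) = x / s * v n by rewrite invf_div mulrA mulrAC.
  ring.
 - apply: measurable_EFinS; apply: measurable_funM.
   by apply: measurableT_comp.
  by apply: (measurableT_comp measurable_tail_fun); exact: measurable_funM.
 - by move=> x _; rewrite lee_fin mulr_ge0 ?expR_ge0// ltW.
 - by rewrite lee_fin invr_ge0 ltW.
have mf n : measurable_fun D (f0 n).
 apply: measurable_funTS; apply: measurable_funM.
  by apply: measurableT_comp.
 apply: measurable_funM => //; apply: (measurableT_comp measurable_tail_fun).
 by apply: measurable_funM => //; exact: measurable_funM.
have fg x : D x -> f0 n x @[n --> \oo] --> g0 x.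
 rewrite /D/= in_itv/= andbT => x0.
 apply: cvgM; first exact: cvg_cst.
 have h := tail_ratio (divr_gt0 x0 s0).
 by have /cvg_pinftyP := h; apply.
pose K := C * (1 + s `^ b).
pose m (x : R) := (K * (expR (- x) * x `^ (- 0) + expR (- x) * x `^ (- b)))%:E.
have im : leb.-integrable D m.
 have h00 : 0 <= (0 : R) < 1 by rewrite lexx ltr01.
 have i1 := integrable_exp_powR h00; have i2 := integrable_exp_powR b01.
 rewrite (_ : m = fun x => (K%:E * ((expR (- x) * x `^ (- 0))%:E + (expR (- x) * x `^ (- b))%:E))%E).
  by apply: integrableZl => //; exact: integrableD.
 by apply/funext => x; rewrite /m EFinM EFinD.
have dom n x : D x -> `|f0 n x| <= K * (expR (- x) * x `^ (- 0) + expR (- x) * x `^ (- b)).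
 rewrite /D/= in_itv/= andbT => x0; rewrite ger0_norm; last first.
  by rewrite mulr_ge0 ?expR_ge0// divr_ge0// ltW.
 rewrite (_ : K * _ = expR (- x) * (K * (1 + x `^ (- b)))); last by rewrite oppr0 powRr0; ring.
 rewrite ler_wpM2l ?expR_ge0//.
 rewrite ler_pdivrMr// (le_trans (hC _ _ (v0 n) (divr_gt0 x0 s0)))// ler_wpM2r ?(ltW (H0 _))//.
 rewrite /K -mulrA ler_wpM2l// powRM ?invr_ge0 ?(ltW x0) ?(ltW s0)//.
 have -> : s^-1 `^ (- b) = s `^ b by rewrite -powR_inv1 ?ltW// -powRrM mulN1r opprK.
 have := powR_ge0 s b; have := powR_ge0 x (- b); nra.
have [_ hcv] : leb.-integrable D g /\ (\int[leb]_(x in D) f n x)%E @[n --> \oo] --> (\int[leb]_(x in D) g x)%E.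
 pose m0 (x : R) : R := K * (expR (- x) * x `^ (- 0) + expR (- x) * x `^ (- b)).
 by apply: (@dominated_cvg _ _ R leb D f0 g0 m0).
move: hcv.
rewrite (_ : \int[leb]_(x in D) g x = (gamma_const beta * s `^ beta)%:E)%E; last first.
 have h01 : 0 <= beta < 1 by rewrite ltW.
 have i := integrable_exp_powR h01.
 have -> : (gamma_const beta * s `^ beta)%:E =
   (\int[leb]_(x in D) ((s `^ beta)%:E * (expR (- x) * x `^ (- beta))%:E))%E.
  rewrite ge0_integralZl//; last 3 first.
  - by apply: measurable_EFinS; exact: measurable_exp_powR.
  - by move=> x _; rewrite lee_fin mulr_ge0 ?expR_ge0 ?powR_ge0.
  - by rewrite lee_fin powR_ge0.
  by rewrite gamma_constE// -EFinM mulrC.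
 apply: eq_integral => x /set_mem; rewrite /D/= in_itv/= andbT => x0.
 rewrite /g /g0 -EFinM powRM ?invr_ge0 ?(ltW x0) ?(ltW s0)//; congr EFin.
 have -> : s^-1 `^ (- beta) = s `^ beta by rewrite -powR_inv1 ?ltW// -powRrM mulN1r opprK.
 ring.
move=> hcv.
have : (G (s / v n) / H (v n))%:E @[n --> \oo] --> (gamma_const beta * s `^ beta)%:E.
 by under eq_fun do rewrite fE.
by move=> /fine_cvg.
Qed.

(** [Num.min 2 (3 x) <= 6 x / (1 + x) <= 6 (1 - e^-x)] reduces the truncated mean, which dominates
    the defect in every direction, to the Laplace defect. *)
Lemma laplace_kernel_bound : exists C b0 : R, [/\ 1 <= C, 0 < b0 & forall b, 0 < b <= b0 ->
 \int[mu]_y Num.min 2 (3 * b * tau y) <= C * H b^-1].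
Proof.
have h := @laplace_defect_ratio 1 ltr01; rewrite powR1 mulr1 in h.
have g0 := gamma_const_ge0 beta.
have /cvgrPdist_le/(_ _ ltr01) [M [_ hM]] := h.
exists (6 * (gamma_const beta + 2)), (`|M| + 1)^-1; split.
- by lra.
- by rewrite invr_gt0 ltr_wpDl.
move=> b /andP[b_0 bM].
have bV : M < b^-1.
 rewrite (le_lt_trans (ler_norm _))// (lt_le_trans (_ : _ < `|M| + 1)) ?ltrDl//.
 by rewrite -[leLHS]invrK lef_pV2// posrE invr_gt0 ltr_wpDl.
have H0 : 0 < H b^-1 by exact: tail_gt0.
have := hM _ bV; rewrite div1r invrK ler_norml => /andP[hG _].
have {}hG : G b <= (gamma_const beta + 2) * H b^-1.
 by rewrite -ler_pdivrMr//; move: hG; set q := G b / _; lra.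
rewrite -mulrA (le_trans _ (ler_wpM2l _ hG))// /laplace_defect.
have i1 : rintegrable mu (fun y => 1 - expR (- (b * tau y))).
 apply: (rintegrable_bounded mu _ (M := 1)).
  apply: measurable_funB => //; apply: measurableT_comp => //; apply: measurableT_comp => //.
  exact: measurable_funM.
 move=> y; rewrite ger0_norm ?gerBl ?expR_ge0// subr_ge0 expRN_le1.
 by rewrite mulr_ge0// ltW.
have i2 : rintegrable mu (fun y => Num.min 2 (3 * b * tau y)).
 apply: (rintegrable_bounded mu _ (M := 2)).
  by apply: measurable_minr => //; exact: measurable_funM.
 move=> y; rewrite ger0_norm ?ge_min ?lexx// le_min.
 by rewrite !mulr_ge0// ltW.
rewrite -RintegralZl//; apply: Rintegral_le => //; first exact: rintegrableZ.
move=> y; rewrite -mulrA; set x := b * tau y.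
have x0 : 0 < x by rewrite mulr_gt0.
have x1 : 0 < 1 + x by rewrite addr_gt0.
have : x / (1 + x) <= 1 - expR (- x).
 have : expR (- x) <= (1 + x)^-1 by rewrite expRN lef_pV2 ?posrE ?expR_gt0// expR_ge1Dx.
 have -> : x / (1 + x) = 1 - (1 + x)^-1 by field; rewrite gt_eqF.
 lra.
have : Num.min 2 (3 * x) <= 6 * (x / (1 + x)).
 rewrite mulrA ler_pdivlMr//.
 have [h2|h2] := leP 2 (3 * x); nra.
lra.
Qed.

(** [1 - cos] is at least 1 on [[pi/2, pi]], and by regular variation the event [pi/2 < b tau <= pi]
    has mass comparable to the tail at [1 / b], the limiting ratio being
    [(pi/2)^-beta - pi^-beta > 0]. *)
Lemma cos_defect_lower : exists c b0 : R, [/\ 0 < c, 0 < b0 & forall b, 0 < b <= b0 ->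
 c * H b^-1 <= \int[mu]_y (1 - cos (b * tau y))].
Proof.
have /andP[be0 be1] := beta01.
have p0 := pi_gt0 R.
have r1 := tail_ratio (divr_gt0 p0 (ltr0n _ 2)).
have r2 := tail_ratio p0.
have l12 : (pi / 2) `^ (- beta) - pi `^ (- beta) > 0 :> R.
 rewrite subr_gt0 !powRN ltf_pV2 ?posrE ?powR_gt0 ?divr_gt0//.
 apply: gt0_ltr_powR; rewrite ?nnegrE ?divr_ge0 ?(ltW p0)//.
 by rewrite ltr_pdivrMr// ltr_pMr// ltr1n.
set l := _ - _ in l12.
have l20 : 0 < l / 2 by rewrite divr_gt0.
have /cvgrPdist_le/(_ _ l20) [M [_ hM]] :
  (H (pi / 2 * t) / H t - H (pi * t) / H t) @[t --> +oo] --> l by exact: cvgB.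
have M0 : 0 < (`|M| + 1)^-1 by rewrite invr_gt0 ltr_wpDl.
exists (l / 2), (`|M| + 1)^-1; split => //.
move=> b /andP[b_0 bM].
have bV : M < b^-1.
 rewrite (le_lt_trans (ler_norm _))// (lt_le_trans (_ : _ < `|M| + 1)) ?ltrDl//.
 by rewrite -[leLHS]invrK lef_pV2// posrE invr_gt0 ltr_wpDl.
have H0 : 0 < H b^-1 by exact: tail_gt0.
have := hM _ bV; rewrite /= -/l -mulrBl ler_norml => /andP[_ hd].
have {}hd : l / 2 * H b^-1 <= H (pi / 2 * b^-1) - H (pi * b^-1).
 by rewrite -ler_pdivlMr//; move: hd; set q := (_ - _) / _; lra.
rewrite (le_trans hd)//.
have m1 := measurable_tail (pi / 2 * b^-1).
have m2 := measurable_tail (pi * b^-1).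
have iI E : measurable E -> rintegrable mu (fun y => \1_E y) /\ \int[mu]_y \1_E y = fine (mu E).
 move=> mE; split.
  apply: (rintegrable_bounded mu _ (M := 1)); first exact: measurable_indic.
  by move=> y; rewrite indicE; case: (_ \in _); rewrite ?normr1 ?normr0.
 by rewrite /Rintegral integral_indic// setIT.
have [i1 e1] := iI _ m1; have [i2 e2] := iI _ m2.
rewrite /tail_fun -e1 -e2 -[X in X <= _](_ : \int[mu]_y (\1_[set y | pi / 2 * b^-1 < tau y] y - \1_[set y | pi * b^-1 < tau y] y) = _); last first.
 by rewrite RintegralB.
apply: Rintegral_le.
- exact: rintegrableB.
- apply: (rintegrable_bounded mu _ (M := 2)).
  apply: measurable_funB => //; apply: (measurableT_comp (f := @cos R)); last exact: measurable_funM.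
  exact: (continuous_measurable_fun (@continuous_cos R)).
 move=> y; rewrite (le_trans (ler_normB _ _))// normr1 (_ : 2 = 1 + 1)// lerD2l.
 by rewrite ler_norml cos_geN1 cos_le1.
move=> y; rewrite !indicE.
have c1 := cos_le1 (b * tau y).
case: (boolP (y \in [set y | pi / 2 * b^-1 < tau y])) => [/set_mem/= h1|_]; last first.
 by case: (_ \in _); rewrite /=; lra.
case: (boolP (y \in [set y | pi * b^-1 < tau y])) => [_|/negP h2]; first by rewrite /=; lra.
have {}h2 : b * tau y <= pi.
 rewrite leNgt; apply/negP => h; apply: h2; rewrite inE/=.
 by rewrite ltr_pdivrMr// mulrC.
have {}h1 : pi / 2 <= b * tau y by move: h1; rewrite ltr_pdivrMr// [tau y * b]mulrC => /ltW.
have : cos (b * tau y) <= 0.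
 have := @ltr_cos R; rewrite le_eqVlt in h1.
 case/predU1P : h1 => [<-|h1]; first by rewrite cos_pihalf.
 move=> mono; rewrite -(cos_pihalf R) ltW// mono// in_itv/= ?h2 ?andbT.
  by rewrite divr_ge0 ?(ltW p0)//= ler_pdivrMr// ler_pMr// ler1n.
 by rewrite (le_trans _ (ltW h1))// divr_ge0// ltW.
rewrite /=; lra.
Qed.

Lemma exp_defect_lower b : 0 < b -> (1 - expR (- 1)) * H b^-1 <= \int[mu]_y (1 - expR (- (b * tau y))).
Proof.
move=> b_0; have mA := measurable_tail b^-1.
have iA : rintegrable mu (fun y => \1_[set y | b^-1 < tau y] y).
 apply: (rintegrable_bounded mu _ (M := 1)); first exact: measurable_indic.
 by move=> y; rewrite indicE; case: (_ \in _); rewrite ?normr1 ?normr0.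
have -> : H b^-1 = \int[mu]_y \1_[set y | b^-1 < tau y] y.
 by rewrite /Rintegral integral_indic// setIT.
rewrite -RintegralZl//; apply: Rintegral_le; first exact: rintegrableZ.
 apply: (rintegrable_bounded mu _ (M := 1)).
  apply: measurable_funB => //; apply: measurableT_comp => //; apply: measurableT_comp => //.
  exact: measurable_funM.
 move=> y; rewrite ger0_norm ?gerBl ?expR_ge0// subr_ge0 expRN_le1.
 by rewrite mulr_ge0// ltW.
move=> y; rewrite indicE; case: (boolP (_ \in _)) => [/set_mem/= h|_].
 rewrite mulr1 lerB// ler_expR lerN2 ltW//.
 by rewrite mulrC -ltr_pdivrMr// div1r.
by rewrite mulr0 subr_ge0 expRN_le1 mulr_ge0// ltW.
Qed.

Lemma tail_small e : 0 < e -> exists2 b1, 0 < b1 & forall b, 0 < b <= b1 -> H b^-1 <= e.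
Proof.
move=> e0; have /andP[be0 be1] := beta01.
have [C [t0 [C1 t01 h]]] := @potter (beta / 2) 1
 ltac:(rewrite be1 andbT; lra).
have C0 : 0 < C by exact: lt_le_trans C1.
have t00 : 0 < t0 by exact: lt_le_trans t01.
have ce0 : 0 < C / e by rewrite divr_gt0.
pose X := Num.max 1 ((C / e) `^ (beta / 2)^-1).
have X1 : 1 <= X by rewrite le_max lexx.
exists (X * t0)^-1; first by rewrite invr_gt0 mulr_gt0// (lt_le_trans ltr01).
move=> b /andP[b_0 bX].
have bV : X * t0 <= b^-1 by rewrite -[leLHS]invrK lef_pV2 ?posrE// invr_gt0 mulr_gt0// (lt_le_trans ltr01).
rewrite (le_trans (tail_noninc bV))//.
have [_ hX] := h t0 X (lexx _) X1.
rewrite (le_trans hX)// (le_trans (_ : _ <= C * X `^ (- (beta / 2))))//.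
 by rewrite ler_piMr ?tail_le1// mulr_ge0 ?powR_ge0// ltW.
have X0 : 0 < X by exact: lt_le_trans X1.
have b20 : 0 < beta / 2 by rewrite divr_gt0.
have hx : C / e <= X `^ (beta / 2).
 have h1 : (C / e) `^ (beta / 2)^-1 <= X by rewrite /X le_max lexx orbT.
 have := ge0_ler_powR (ltW b20) _ _ h1; rewrite !nnegrE powR_ge0 (ltW X0) => /(_ isT isT).
 by rewrite -powRrM mulVf ?gt_eqF// powRr1// ltW.
by rewrite powRN ler_pdivrMr ?powR_gt0// mulrC -ler_pdivrMr.
Qed.

(** Potter with exponent [3 beta / 2 > beta] gives [b^(3 beta / 2) = O(H (1 / b))]; a square root
    yields the exponent [3 beta / 4], which is still below [beta] and so admissible as [gamma]. *)
Lemma tail_gamma : exists C b0 : R, [/\ 1 <= C, 0 < b0 & forall b, 0 < b <= b0 ->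
 b `^ (3 * beta / 4) <= C * H b^-1 `^ 2^-1].
Proof.
have /andP[be0 be1] := beta01.
have [C [t0 [C1 t01 h]]] := @potter (beta / 2) (3 * beta / 2)
 ltac:(apply/andP; split; lra).
have C0 : 0 < C by exact: lt_le_trans C1.
have t00 : 0 < t0 by exact: lt_le_trans t01.
have H0 t : 0 < H t by exact: tail_gt0.
have K1 : 1 <= C / H t0 by rewrite ler_pdivlMr// mul1r (le_trans (tail_le1 _)).
exists (C / H t0), t0^-1; split => //; first by rewrite invr_gt0.
move=> b /andP[b_0 bt].
have tb : t0 <= b^-1 by rewrite -[leLHS]invrK lef_pV2 ?posrE// invr_gt0.
have x1 : 1 <= b^-1 / t0 by rewrite ler_pdivlMr// mul1r.
have [hx _] := h t0 _ (lexx _) x1; rewrite divfK ?gt_eqF// in hx.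
have hb : b `^ (3 * beta / 2) <= C / H t0 * H b^-1.
 have bq : b `^ (3 * beta / 2) * b^-1 `^ (3 * beta / 2) = 1.
  by rewrite -powRM ?invr_ge0 ?(ltW b_0)// mulfV ?gt_eqF// powR1.
 have hxQ : H t0 <= C * b^-1 `^ (3 * beta / 2) * H b^-1.
  rewrite (le_trans hx)// ler_wpM2r ?(ltW (H0 _))// ler_wpM2l ?(ltW C0)//.
  apply: ge0_ler_powR; rewrite ?nnegrE ?divr_ge0 ?invr_ge0 ?mulr_ge0 ?(ltW be0) ?(ltW b_0) ?(ltW t00)//.
  by rewrite ler_pdivrMr// ler_peMr ?invr_ge0// ltW.
 rewrite [leRHS]mulrAC ler_pdivlMr// (le_trans (ler_wpM2l (powR_ge0 b _) hxQ))//.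
 rewrite (_ : b `^ (3 * beta / 2) * (C * b^-1 `^ (3 * beta / 2) * H b^-1) =
  C * H b^-1 * (b `^ (3 * beta / 2) * b^-1 `^ (3 * beta / 2))); last by ring.
 by rewrite bq mulr1.
have -> : b `^ (3 * beta / 4) = (b `^ (3 * beta / 2)) `^ 2^-1.
 by rewrite -powRrM; congr (_ `^ _); field.
have K0 : 0 <= C / H t0 by exact: le_trans K1.
have i2 : 0 <= 2^-1 :> R by rewrite invr_ge0.
rewrite (le_trans (_ : _ <= (C / H t0 * H b^-1) `^ 2^-1))//.
 by apply: ge0_ler_powR; rewrite ?nnegrE ?powR_ge0// mulr_ge0// ltW.
rewrite powRM ?(ltW (H0 _))// ler_wpM2r ?powR_ge0//.
rewrite -[leRHS](powRr1 K0); apply: ler_powR => //; lra.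
Qed.

End tail.

(** * Fubini for bounded functions on sets of finite measure *)

Section bounded_fubini.
Context d1 d2 (T1 : measurableType d1) (T2 : measurableType d2) (R : realType).
Variables (m1 : {sigma_finite_measure set T1 -> \bar R}).
Variables (m2 : {sigma_finite_measure set T2 -> \bar R}).
Variables (D1 : set T1) (D2 : set T2) (f : T1 * T2 -> R) (M : R).
Hypotheses (mD1 : measurable D1) (mD2 : measurable D2).
Hypotheses (fD1 : (m1 D1 < +oo)%E) (fD2 : (m2 D2 < +oo)%E).
Hypothesis mf : mfunT f.
Hypothesis fM : forall x y, D1 x -> D2 y -> `|f (x, y)| <= M.
Let g z := f z * \1_(D1 `*` D2) z.

Let mD : measurable (D1 `*` D2).
Proof. exact: measurableX. Qed.

Let ig : (m1 \x m2)%E.-integrable setT (EFin \o g).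
Proof.
have mg : mfunT g by apply: measurable_funM => //; exact: measurable_indic.
apply: (le_integrable measurableT (g := fun z => (`|M| * \1_(D1 `*` D2) z)%:E)).
- exact/measurable_EFinP.
- move=> [x y] _; rewrite lee_fin /g indicE !normrM normr_id.
 case: (boolP (_ \in _)) => [/set_mem[/= hx hy]|_]; last by rewrite normr0 !mulr0.
 by rewrite ler_wpM2r// (le_trans (fM hx hy))// ler_norm.
apply/integrableP; split.
 by apply/measurable_EFinP; apply: measurable_funM => //; exact: measurable_indic.
under eq_integral => z _ do rewrite abse_EFin ger0_norm ?mulr_ge0// EFinM.
rewrite ge0_integralZl//; last by apply/measurable_EFinP; exact: measurable_indic.
rewrite integral_indic// setIT /= product_measure1E// lte_mul_pinfty ?lee_fin//.
by rewrite lte_mul_pinfty// ge0_fin_numE.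
Qed.

Let section_int x : D1 x -> m2.-integrable D2 (fun y => (f (x, y))%:E).
Proof.
move=> hx; apply: measurable_bounded_integrable => //.
 by apply: measurable_funTS; exact: (measurableT_comp mf (pair1_measurable x)).
by exists M; split; [exact: num_real|move=> N MN y hy /=; exact: le_trans (fM hx hy) (ltW MN)].
Qed.

Let section_int2 y : D2 y -> m1.-integrable D1 (fun x => (f (x, y))%:E).
Proof.
move=> hy; apply: measurable_bounded_integrable => //.
 by apply: measurable_funTS; exact: (measurableT_comp mf (pair2_measurable y)).
by exists M; split; [exact: num_real|move=> N MN x hx /=; exact: le_trans (fM hx hy) (ltW MN)].
Qed.

Let innerE x : (\int[m2]_y (g (x, y))%:E)%E = (\1_D1 x * \int[m2]_(y in D2) f (x, y))%:E.
Proof.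
have [hx|hx] := pselect (D1 x); last first.
 rewrite indicE memNset// mul0r integral0_eq// => y _.
 by rewrite /g indicE memNset ?mulr0// => -[].
rewrite indicE mem_set// mul1r fineK; last by apply: integrable_fin_num => //; exact: section_int.
rewrite [RHS]integral_mkcond; apply: eq_integral => y _.
rewrite patchE /g indicE; case: ifPn => hy.
 by rewrite mem_set ?mulr1//; split => //=; exact: set_mem.
by rewrite memNset ?mulr0// => -[/= _ /mem_set]; exact/negP.
Qed.

Let innerE2 y : (\int[m1]_x (g (x, y))%:E)%E = (\1_D2 y * \int[m1]_(x in D1) f (x, y))%:E.
Proof.
have [hy|hy] := pselect (D2 y); last first.
 rewrite indicE memNset// mul0r integral0_eq// => x _.
 by rewrite /g indicE memNset ?mulr0// => -[].
rewrite indicE mem_set// mul1r fineK; last by apply: integrable_fin_num => //; exact: section_int2.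
rewrite [RHS]integral_mkcond; apply: eq_integral => x _.
rewrite patchE /g indicE; case: ifPn => hx.
 by rewrite mem_set ?mulr1//; split => //=; exact: set_mem.
by rewrite memNset ?mulr0// => -[/= /mem_set + _]; exact/negP.
Qed.

Lemma bounded_fubini_integrable :
 m1.-integrable D1 (fun x => (\int[m2]_(y in D2) f (x, y))%:E).
Proof.
have := integrable_fubini_F ig => h.
have {}h := integrableS measurableT mD1 (@subsetT _ _) h.
move: h; apply: eq_integrable => // x /set_mem hx.
by rewrite /fubini_F /= innerE indicE mem_set// mul1r.
Qed.

Lemma bounded_fubini :
 \int[m1]_(x in D1) \int[m2]_(y in D2) f (x, y) =
 \int[m2]_(y in D2) \int[m1]_(x in D1) f (x, y).
Proof.
rewrite /Rintegral; congr fine.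
have := Fubini ig; rewrite /=.
under eq_integral do rewrite innerE.
under [in X in _ = X -> _]eq_integral do rewrite innerE2.
move=> E; rewrite [LHS]integral_mkcond [RHS]integral_mkcond.
transitivity (\int[m1]_x (\1_D1 x * \int[m2]_(y in D2) f (x, y))%:E)%E.
 apply: eq_integral => x _; rewrite patchE indicE; case: ifPn => _; last by rewrite mul0r.
 by rewrite mul1r.
rewrite E; apply: eq_integral => y _; rewrite patchE indicE; case: ifPn => _; last by rewrite mul0r.
by rewrite mul1r.
Qed.

End bounded_fubini.

(** * The Fejér kernel and smoothed indicators *)

Section fejer_kernel.
Context {R : realType}.
Implicit Types L u x y h : R.
Local Notation leb := (@lebesgue_measure R).

Lemma measurable_invr : mfunT (fun x : R => x^-1).
Proof.
rewrite (_ : (fun x => _) = fun x : R => x * (x ^+ 2) `^ (- 1)); last first.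
 apply/funext => x; rewrite powR_inv1 ?sqr_ge0//.
 by have [->|x0] := eqVneq x 0; [rewrite invr0 mul0r|field].
apply: measurable_funM => //.
by apply: (measurableT_comp (f := fun z : R => z `^ (- 1))); [exact: measurable_powR|exact: measurable_funX].
Qed.

Lemma measurable_cosR : mfunT (@cos R).
Proof. exact: (continuous_measurable_fun (@continuous_cos R)). Qed.

Lemma measurable_sinR : mfunT (@sin R).
Proof. exact: (continuous_measurable_fun (@continuous_sin R)). Qed.

Lemma sin_diff_le x y : `|sin x - sin y| <= `|x - y|.
Proof.
wlog xy : x y / y < x => [hw|].
 have [xy|xy|->] := ltgtP x y; [|exact: hw|by rewrite !subrr].
 by rewrite distrC [leRHS]distrC; exact: hw.
have [c _ ->] : exists2 c, c \in `]y, x[ & sin x - sin y = cos c * (x - y).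
 by apply: MVT => //; apply: continuous_subspaceT; exact: continuous_sin.
by rewrite normrM ler_piMl// ler_norml cos_geN1 cos_le1.
Qed.

Lemma cos_diff_le x y : `|cos x - cos y| <= `|x - y|.
Proof.
have E z : cos z = sin (z + pi / 2) by rewrite sinD cos_pihalf sin_pihalf mulr0 mulr1 add0r.
by rewrite !E (le_trans (sin_diff_le _ _))// opprD addrACA subrr addr0.
Qed.

(** A nonnegative kernel with frequencies in [[0, L]]: its mean against a measure involves the
    cosine and sine transforms at frequencies up to [L] only. *)
Definition fejer L u : R := \int[leb]_(b in `]0, L]) ((1 - b / L) * cos (b * u)).

Definition fejer_prim L u : R := \int[leb]_(b in `]0, L]) ((1 - b / L) * (sin (b * u) / b)).

Let finite_itv (a b : R) : (leb `]a, b] < +oo)%E.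
Proof. by rewrite lebesgue_measure_itv/=; case: ifP => // _; rewrite -EFinB ltry. Qed.

Let itv_length (a b : R) : a <= b -> fine (leb `]a, b]) = b - a.
Proof.
rewrite le_eqVlt => /predU1P[->|ab]; first by rewrite set_itvoc0 measure0 subrr.
by rewrite lebesgue_measure_itv/= lte_fin ab.
Qed.

Lemma fejer_weight01 L b : 0 < L -> 0 < b <= L -> 0 <= 1 - b / L <= 1.
Proof.
by move=> L0 /andP[b0 bL]; rewrite gerBl divr_ge0 ?(ltW b0) ?(ltW L0)// subr_ge0 ler_pdivrMr// mul1r bL.
Qed.

Lemma integrable_bounded_itv (f : R -> R) (a b M : R) : mfunT f ->
 (forall x, a < x <= b -> `|f x| <= M) -> leb.-integrable `]a, b] (EFin \o f).
Proof.
move=> mf fM; apply: measurable_bounded_integrable => //.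
- exact: finite_itv.
- exact: measurable_funTS.
exists M; split; first exact: num_real.
by move=> N MN x /=; rewrite in_itv/= => xab; exact: le_trans (fM _ xab) (ltW MN).
Qed.

Lemma measurable_fejer_weight L : mfunT (fun b : R => 1 - b / L).
Proof. by apply: measurable_funB => //; exact: measurable_funM. Qed.

Lemma integrable_fejer L u : 0 < L ->
 leb.-integrable `]0, L] (fun b => ((1 - b / L) * cos (b * u))%:E).
Proof.
move=> L0; apply: (integrable_bounded_itv (M := 1)).
 apply: measurable_funM; first exact: measurable_fejer_weight.
 by apply: (measurableT_comp measurable_cosR); exact: measurable_funM.
move=> b bL; have /andP[w0 w1] := fejer_weight01 L0 bL.
by rewrite normrM (ger0_norm w0) mulr_ile1// ler_norml cos_geN1 cos_le1.
Qed.

Lemma integrable_fejer_prim L u : 0 < L ->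
 leb.-integrable `]0, L] (fun b => ((1 - b / L) * (sin (b * u) / b))%:E).
Proof.
move=> L0; apply: (integrable_bounded_itv (M := `|u|)).
 apply: measurable_funM; first exact: measurable_fejer_weight.
 apply: measurable_funM; last exact: measurable_invr.
 by apply: (measurableT_comp measurable_sinR); exact: measurable_funM.
move=> b bL; have /andP[w0 w1] := fejer_weight01 L0 bL; have /andP[b0 _] := bL.
rewrite normrM (ger0_norm w0) (le_trans (ler_piMl _ w1))// normrM normfV.
rewrite ler_pdivrMr ?normr_gt0 ?gt_eqF//.
by have := sin_diff_le (b * u) 0; rewrite sin0 !subr0 normrM [`|b| * _]mulrC.
Qed.

Lemma fejerE L u : 0 < L -> u != 0 -> fejer L u = (1 - cos (L * u)) / (L * u ^+ 2).
Proof.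
move=> L0 u0; rewrite /fejer Rintegral_itv_obnd_cbnd; last exact: integrable_fejer.
pose F b := (1 - b / L) * (sin (u * b) / u) - cos (u * b) / (L * u ^+ 2).
have d1 (b : R) : -1 < b -> is_derive b 1 F ((1 - b / L) * cos (b * u)).
 move=> _; have hs := is_derive_sin_scale b u0.
 have hl : is_derive b 1 (fun b => 1 - b / L) (- L^-1).
  have := is_deriveB (is_derive_cst (1 : R) b (1 : R)) (is_deriveZ L^-1 (is_derive_id b (1 : R))).
  rewrite sub0r [_%:A]mulr1 (_ : cst 1 - L^-1 \*: id = fun b => 1 - b / L)//.
  by apply/funext => z; rewrite [z / L]mulrC.
 have hc : is_derive b 1 (fun b => cos (u * b) / (L * u ^+ 2)) (- (sin (u * b) / (L * u))).
  have h1 : is_derive b 1 (fun y => u * y) u.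
   by have := is_deriveZ u (is_derive_id b (1 : R)); rewrite /GRing.scale/= mulr1.
  have := is_deriveZ (L * u ^+ 2)^-1 (is_derive1_comp (is_derive_cos (u * b)) h1).
  rewrite /GRing.scale/= (_ : _ \*: _ = fun b => cos (u * b) / (L * u ^+ 2)); last first.
   by apply/funext => z; rewrite [RHS]mulrC.
  by rewrite (_ : (L * u ^+ 2)^-1 * (- sin (u * b) * u) = - (sin (u * b) / (L * u))) //; field; rewrite u0 gt_eqF.
 have := is_deriveB (is_deriveM hl hs) hc; rewrite /GRing.scale/=.
 have E : (1 - b / L) * cos (u * b) + sin (u * b) / u * - L^-1 - - (sin (u * b) / (L * u)) =
  (1 - b / L) * cos (b * u) by rewrite [u * b]mulrC; field; rewrite u0 gt_eqF.
 by rewrite E.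
have c1 (b : R) : -1 < b -> {for b, continuous (fun b : R => (1 - b / L) * cos (b * u))}.
 move=> _; apply: cvgM; first by apply: cvgB; [exact: cvg_cst|apply: cvgMl; exact: cvg_id].
 by apply: (continuous_comp (f := fun b : R => b * u)); [apply: cvgMl; exact: cvg_id|exact: continuous_cos].
rewrite (FTC_itvR (ltrN10 R) (ltW L0) d1 c1) /F mulfV ?gt_eqF// subrr !mul0r mulr0 sin0 cos0.
by rewrite !mul0r mulr0 [u * L]mulrC; field; rewrite u0 gt_eqF.
Qed.

Lemma fejer_ge0 L u : 0 < L -> 0 <= fejer L u.
Proof.
move=> L0; have [->|u0] := eqVneq u 0.
 apply: Rintegral_ge0 => b /=; rewrite in_itv/= => bL.
 by rewrite mulr0 cos0 mulr1; have /andP[] := fejer_weight01 L0 bL.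
rewrite fejerE//; apply: divr_ge0; first by rewrite subr_ge0 cos_le1.
by rewrite mulr_ge0 ?(ltW L0) ?sqr_ge0.
Qed.

Lemma fejer_le L u : 0 < L -> 0 < u -> fejer L u <= 2 / L * u `^ (- 2).
Proof.
move=> L0 u0; rewrite fejerE ?gt_eqF// powRN powR_mulrn ?(ltW u0)//.
rewrite -mulrA -invfM.
rewrite ler_wpM2r ?invr_ge0 ?mulr_ge0 ?(ltW L0) ?(ltW u0)//.
by have := cos_geN1 (L * u); lra.
Qed.

Lemma fejer_lower L u a : 0 < L -> 0 < a -> L * `|u| <= a ->
 (1 - cos (L * u)) * (L / a ^+ 2) <= fejer L u.
Proof.
move=> L0 a0 ua; have [u0|u0] := eqVneq u 0.
 by rewrite u0 mulr0 cos0 subrr mul0r fejer_ge0.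
rewrite fejerE// ler_wpM2l//.
have u2 : 0 < u ^+ 2 by rewrite exprn_even_gt0.
have Lu2 : 0 < L * u ^+ 2 by rewrite mulr_gt0.
rewrite (ler_pdivrMr _ _ (exprn_gt0 2 a0)) mulrC (ler_pdivlMr _ _ Lu2).
have : (L * `|u|) ^+ 2 <= a ^+ 2 by rewrite lerXn2r ?nnegrE ?mulr_ge0 ?(ltW L0) ?(ltW a0).
rewrite exprMn real_normK ?num_real// (_ : L * (L * u ^+ 2) = L ^+ 2 * u ^+ 2)//.
by ring.
Qed.

(** A single Fejér kernel has zeros. The shift by [pi / L] exchanges [1 - cos] and [1 + cos], so the
    two numerators add up to 2 and the pair dominates a positive function everywhere. *)
Lemma fejer_pair L u : 0 < L ->
 ((L * `|u| + pi) ^- 2) <= (fejer L u + fejer L (u + pi / L)) / (2 * L).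
Proof.
move=> L0; have p0 := pi_gt0 R; set a := L * `|u| + pi.
have a0 : 0 < a by rewrite ltr_wpDl// mulr_ge0// ltW.
have h1 : L * `|u| <= a by rewrite lerDl ltW.
have h2 : L * `|u + pi / L| <= a.
 rewrite -{1}(ger0_norm (ltW L0)) -normrM mulrDr [L * (pi / L)]mulrC divfK ?gt_eqF//.
 by rewrite (le_trans (ler_normD _ _))// normrM /a (ger0_norm (ltW p0)) (ger0_norm (ltW L0)).
have := lerD (fejer_lower L0 a0 h1) (fejer_lower L0 a0 h2).
rewrite mulrDr [L * (pi / L)]mulrC divfK ?gt_eqF// cosDpi => hs.
rewrite ler_pdivlMr ?mulr_gt0// (le_trans _ hs)// -mulrDl.
by apply: eq_ler; ring.
Qed.

Lemma fejer_primN L u : 0 < L -> fejer_prim L (- u) = - fejer_prim L u.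
Proof.
move=> L0; rewrite -[RHS]mulN1r /fejer_prim -RintegralZl//; last exact: integrable_fejer_prim.
by apply: eq_Rintegral => b _; rewrite mulrN sinN; ring.
Qed.

Lemma fejer_prim0 L : fejer_prim L 0 = 0.
Proof.
rewrite /fejer_prim (@eq_Rintegral _ _ _ _ _ (fun=> 0)).
 by rewrite /Rintegral integral0.
by move=> b _; rewrite mulr0 sin0 mul0r mulr0.
Qed.

Lemma fejer_prim_diff L x y : 0 < L -> 0 <= x -> x <= y ->
 leb.-integrable `]x, y] (EFin \o fejer L) /\
 fejer_prim L y - fejer_prim L x = \int[leb]_(w in `]x, y]) fejer L w.
Proof.
move=> L0 x0 xy; pose f (z : R * R) := (1 - z.2 / L) * cos (z.2 * z.1).
have mf : mfunT f.
 apply: measurable_funM; first by apply: measurable_funB => //; exact: measurable_funM.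
 by apply: (measurableT_comp measurable_cosR); exact: measurable_funM.
have fM (w b : R) : `]x, y]%classic w -> `]0, L]%classic b -> `|f (w, b)| <= 1.
 rewrite /= !in_itv/= => _ bL; have /andP[w0 w1] := fejer_weight01 L0 bL.
 by rewrite normrM (ger0_norm w0) mulr_ile1// ler_norml cos_geN1 cos_le1.
split; first by apply: (@bounded_fubini_integrable _ _ _ _ R leb leb `]x, y]%classic `]0, L]%classic f 1) => //; exact: finite_itv.
rewrite (_ : (\int[leb]_(w in `]x, y]) fejer L w)%R = (\int[leb]_(b in `]0%R, L]) (\int[leb]_(w in `]x, y]) f (w, b)))%R); last first.
 by apply: (@bounded_fubini _ _ _ _ R leb leb `]x, y]%classic `]0, L]%classic f 1) => //; exact: finite_itv.
rewrite /fejer_prim -RintegralB//; [|exact: integrable_fejer_prim|exact: integrable_fejer_prim].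
apply: eq_Rintegral => b /set_mem/=; rewrite in_itv/= => /andP[b0 bL].
rewrite Rintegral_itv_obnd_cbnd; last first.
 apply: (integrable_bounded_itv (M := 1)).
  rewrite /f/=; apply: measurable_funM => //.
  by apply: (measurableT_comp measurable_cosR); exact: measurable_funM.
 by move=> w wxy; apply: fM; rewrite /= in_itv/= ?b0.
pose G w := (1 - b / L) * (sin (b * w) / b).
have d1 (w : R) : -1 < w -> is_derive w 1 G (f (w, b)).
 move=> _; have hs := is_derive_sin_scale w (lt0r_neq0 b0).
 exact: (is_deriveZ (1 - b / L) hs).
have c1 (w : R) : -1 < w -> {for w, continuous (fun w : R => (1 - b / L) * cos (b * w))}.
 move=> _; apply: cvgM; first exact: cvg_cst.
 exact: continuous_cos_scale.
by rewrite (FTC_itvR (lt_le_trans (ltrN10 R) x0) xy d1 c1) /G.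
Qed.

Lemma fejer_prim_mono L x y : 0 < L -> 0 <= x -> x <= y -> fejer_prim L x <= fejer_prim L y.
Proof.
move=> L0 x0 xy; rewrite -subr_ge0; have [_ ->] := fejer_prim_diff L0 x0 xy.
by apply: Rintegral_ge0 => w _; exact: fejer_ge0.
Qed.

Lemma fejer_prim_ge0 L x : 0 < L -> 0 <= x -> 0 <= fejer_prim L x.
Proof. by move=> L0 x0; rewrite -(fejer_prim0 L) fejer_prim_mono. Qed.

Lemma fejer_prim_diff_le L x y : 0 < L -> 0 < x -> x <= y ->
 fejer_prim L y - fejer_prim L x <= 2 / L * (x^-1 - y^-1).
Proof.
move=> L0 x0 xy; have [ik ->] := fejer_prim_diff L0 (ltW x0) xy.
have y0 : 0 < y by exact: lt_le_trans xy.
have d1 (w : R) : 0 < w -> is_derive w 1 (fun w => 2 / L * (w `^ (- 1) / (- 1))) (2 / L * w `^ (- 2)).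
 move=> w0; have n1 : (- 1 : R) != 0 by rewrite oppr_eq0 oner_eq0.
 have := is_deriveZ (2 / L) (is_derive_powR_div w0 n1).
 by rewrite (_ : - 1 - 1 = - 2 :> R)//; ring.
have c1 (w : R) : 0 < w -> {for w, continuous (fun w => 2 / L * w `^ (- 2))}.
 by move=> w0; apply: cvgM; [exact: cvg_cst|exact: continuous_powR].
have i2 := integrable_itv y x0 c1.
have i2' : leb.-integrable `]x, y] (EFin \o (fun w => 2 / L * w `^ (- 2))).
 by apply: (integrableS _ _ _ i2) => //; apply: subset_itvr; rewrite bnd_simp.
rewrite (le_trans (le_Rintegral _ ik i2' _))//.
 by move=> w /=; rewrite in_itv/= => /andP[xw _]; rewrite fejer_le// (lt_trans x0).
rewrite Rintegral_itv_obnd_cbnd// (FTC_itvR x0 xy d1 c1) -mulrBr.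
rewrite ler_wpM2l ?divr_ge0 ?(ltW L0)//.
by rewrite !powR_inv1 ?(ltW x0) ?(ltW y0)// !invrN1 !mulrN1 opprK addrC.
Qed.

(** The limit of [fejer_prim L] at [+oo], taken as a supremum since the primitive is nondecreasing
    on the half-line; half of the total mass of the kernel. *)
Definition fejer_lim L : R := sup [set fejer_prim L x | x in [set x | 0 <= x]].

Let fejer_prim_bound L x y : 0 < L -> 0 <= x -> 0 < y -> fejer_prim L x <= fejer_prim L y + 2 / (L * y).
Proof.
move=> L0 x0 y0; have h0 : 0 <= 2 / (L * y) by rewrite divr_ge0 ?mulr_ge0 ?ltW.
have [xy|yx] := leP x y; first by rewrite (le_trans (fejer_prim_mono L0 x0 xy))// lerDl.
rewrite -lerBlDl (le_trans (fejer_prim_diff_le L0 y0 (ltW yx)))//.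
rewrite mulrBr invfM mulrA gerBl mulr_ge0 ?divr_ge0 ?invr_ge0 ?(ltW L0)//.
Qed.

Let fejer_has_sup L : 0 < L -> has_sup [set fejer_prim L x | x in [set x | 0 <= x]].
Proof.
move=> L0; split; first by exists (fejer_prim L 0), 0 => //=.
exists (fejer_prim L 1 + 2 / (L * 1)) => _ [x /= x0 <-].
exact: fejer_prim_bound.
Qed.

Lemma fejer_prim_le_lim L x : 0 < L -> 0 <= x -> fejer_prim L x <= fejer_lim L.
Proof. by move=> L0 x0; apply: sup_ubound; [case: (fejer_has_sup L0)|exists x]. Qed.

Lemma fejer_lim_le L x : 0 < L -> 0 < x -> fejer_lim L <= fejer_prim L x + 2 / (L * x).
Proof.
move=> L0 x0; apply: sup_le_ub; first by case: (fejer_has_sup L0).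
by move=> _ [y /= y0 <-]; exact: fejer_prim_bound.
Qed.

(** On [[pi / (2 L), pi / L]] the kernel is at least [L / pi^2]. The resulting bound does not depend
    on [L]. *)
Lemma fejer_lim_lower L : 0 < L -> (2 * pi)^-1 <= fejer_lim L.
Proof.
move=> L0; have p0 := pi_gt0 R.
have x0 : 0 < pi / (2 * L) by rewrite divr_gt0 ?mulr_gt0.
have y0 : 0 < pi / L by rewrite divr_gt0.
have xy : pi / (2 * L) <= pi / L by rewrite ler_pM2l// lef_pV2 ?posrE ?mulr_gt0// ler_peMl ?(ltW L0)// ler1n.
rewrite (le_trans _ (fejer_prim_le_lim L0 (ltW y0)))//.
rewrite -[leRHS]subr0 (le_trans _ (lerB (lexx _) (fejer_prim_ge0 L0 (ltW x0))))// .
have [ik ->] := fejer_prim_diff L0 (ltW x0) xy.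
have ic : leb.-integrable `]pi / (2 * L), pi / L] (EFin \o (fun=> L / pi ^+ 2)).
 by apply: (integrable_bounded_itv (M := `|L / pi ^+ 2|)).
rewrite (le_trans _ (le_Rintegral _ ic ik _))//.
 rewrite Rintegral_cst// (_ : fine _ = pi / L - pi / (2 * L)); last exact: itv_length.
 apply: eq_ler.
 by move: (pi : R) p0 {x0 y0 xy ik ic} => p p0; field; rewrite !gt_eqF.
move=> w /=; rewrite in_itv/= => /andP[xw wy].
have w0 : 0 < w by exact: lt_trans xw.
have wp : L * w <= pi by rewrite mulrC -ler_pdivlMr.
have wp2 : pi / 2 <= L * w.
 move: xw; rewrite ltr_pdivrMr ?mulr_gt0// => /ltW xw.
 by rewrite ler_pdivrMr// (_ : L * w * 2 = w * (2 * L)) //; ring.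
rewrite (le_trans _ (fejer_lower L0 p0 _)) ?(gtr0_norm w0)//.
rewrite ler_peMl ?divr_ge0 ?sqr_ge0 ?(ltW L0)//.
rewrite lerBrDl addrC -lerBrDl subrr.
have p20 : 0 <= pi / 2 :> R by rewrite divr_ge0 ?(ltW p0).
move: wp2; rewrite le_eqVlt => /predU1P[<-|h]; first by rewrite cos_pihalf.
rewrite -(cos_pihalf R) ltW// ltr_cos// in_itv/= ?p20/=.
 by rewrite ler_piMr ?(ltW p0)// invf_le1// ler1n.
by rewrite (le_trans p20)// ltW.
Qed.

(** The convolution of the indicator of []0, h]] with the Fejér kernel normalized to mass 1. *)
Definition smoothed_indicator h L u : R := (fejer_prim L u - fejer_prim L (u - h)) / (2 * fejer_lim L).

(** With [s = l a], the inequality [(s + pi)^2 <= 2 s^2 + 32], from [pi <= 4], converts [v <= 1] and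
    the bound on [v s^2] into quadratic decay without singularity at 0. *)
Let decay_square (l a v E : R) : 0 < l -> 0 <= a -> 0 <= v <= 1 -> v * (l ^+ 2 * a ^+ 2) <= E ->
 v <= (2 * E + 32) * (l * a + pi) ^- 2.
Proof.
move=> l0 a0 /andP[v0 v1] vE; have p0 := pi_gt0 R; have p4 : pi <= 4 :> R.
 by have := pihalf_02 R => /andP[_]; rewrite ltr_pdivrMr//; lra.
have la : 0 <= l * a by rewrite mulr_ge0// ltW.
move: (pi : R) p0 p4 => p p0 p4.
rewrite ler_pdivlMr ?exprn_gt0 ?ltr_wpDl//.
rewrite (le_trans (y := v * (2 * (l * a) ^+ 2 + 32)))//.
 rewrite ler_wpM2l//.
 have : 0 <= (l * a - p) ^+ 2 by rewrite sqr_ge0.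
 have : p ^+ 2 <= 16 :> R by rewrite (_ : 16 = 4 ^+ 2) ?lerXn2r ?nnegrE ?(ltW p0)//; ring.
 move: (l * a) => s; nra.
rewrite mulrDr exprMn; nra.
Qed.

(** The tail of the primitive at distance [a] is [O(1 / (L a))]. For [L = l^2] and [a <= h] this is
    [O(h (l a)^-2)]; outside the window the difference [1 / a - 1 / (a + h)] gives the same order.
    The error at bandwidth [l^2] thus decays on the scale [1 / l] around each endpoint, where
    [fejer_pair] at bandwidth [l] dominates it. *)
Lemma smoothed_indicator_error h l u : 0 < h -> 0 < l ->
 `|\1_(`]0, h]%classic) u - smoothed_indicator h (l ^+ 2) u| <=
 (32 * h + 32) * ((l * `|u| + pi) ^- 2 + (l * `|u - h| + pi) ^- 2).
Proof.
move=> h0 l0; have [L LE] : exists L, L = l ^+ 2 by exists (l ^+ 2).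
rewrite -LE; have L0 : 0 < L by rewrite LE exprn_gt0.
have p0 := pi_gt0 R; have lim0 := fejer_lim_lower L0.
have lp : 0 < fejer_lim L by rewrite (lt_le_trans _ lim0)// invr_gt0 mulr_gt0.
have lV : (2 * fejer_lim L)^-1 <= 4.
 have p4 : pi <= 4 :> R.
  by have := pihalf_02 R => /andP[_]; rewrite ltr_pdivrMr//; lra.
 rewrite (le_trans _ p4)// -[leRHS]invrK lef_pV2 ?posrE ?mulr_gt0 ?invr_gt0//.
 by rewrite -ler_pdivrMl// -invfM.
have tail a : 0 <= a -> a <= h -> (fejer_lim L - fejer_prim L a) / (2 * fejer_lim L) <=
  (2 * (8 * h) + 32) * (l * a + pi) ^- 2.
 move=> a0 ah; apply: decay_square => //; rewrite -?LE.
  rewrite divr_ge0 ?subr_ge0 ?fejer_prim_le_lim ?mulr_ge0 ?(ltW lp)//=.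
  by rewrite ler_pdivrMr ?mulr_gt0// mul1r; have := fejer_prim_ge0 L0 a0; lra.
 move: a0; rewrite le_eqVlt => /predU1P[<-|a0]; first by rewrite expr0n/= !mulr0 mulr_ge0 ?ltW.
 rewrite (le_trans (y := 4 * (2 / (L * a)) * (L * a ^+ 2)))//.
  rewrite ler_wpM2r ?mulr_ge0 ?(ltW L0) ?sqr_ge0 ?(ltW a0)//.
  rewrite mulrC; apply: ler_pM => //; first by rewrite invr_ge0 mulr_ge0 ?(ltW lp).
   by rewrite subr_ge0 fejer_prim_le_lim ?(ltW a0).
  by rewrite lerBlDl fejer_lim_le.
 rewrite (_ : _ * _ = 8 * a) ?ler_wpM2l//.
 by field; rewrite !gt_eqF.
have outer a : 0 <= a -> (fejer_prim L (a + h) - fejer_prim L a) / (2 * fejer_lim L) <=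
  (2 * (8 * h) + 32) * (l * a + pi) ^- 2.
 move=> a0; have ah : a <= a + h by rewrite lerDl ltW.
 have ah0 : 0 <= a + h by exact: le_trans ah.
 apply: decay_square => //; rewrite -?LE.
  rewrite divr_ge0 ?subr_ge0 ?fejer_prim_mono ?mulr_ge0 ?(ltW lp)//=.
  rewrite ler_pdivrMr ?mulr_gt0// mul1r.
  by have := fejer_prim_ge0 L0 a0; have := fejer_prim_le_lim L0 ah0; lra.
 move: a0; rewrite le_eqVlt => /predU1P[<-|a0]; first by rewrite expr0n/= !mulr0 mulr_ge0 ?ltW.
 rewrite (le_trans (y := 4 * (2 / L * (a^-1 - (a + h)^-1)) * (L * a ^+ 2)))//.
  rewrite ler_wpM2r ?mulr_ge0 ?(ltW L0) ?sqr_ge0 ?(ltW a0)//.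
  rewrite mulrC; apply: ler_pM => //; first by rewrite invr_ge0 mulr_ge0 ?(ltW lp).
   by rewrite subr_ge0 fejer_prim_mono ?(ltW a0).
  exact: fejer_prim_diff_le.
 have ah1 : 0 < a + h by exact: lt_le_trans ah.
 have -> : 4 * (2 / L * (a^-1 - (a + h)^-1)) * (L * a ^+ 2) = 8 * h * (a / (a + h)).
  by field; rewrite !gt_eqF.
 by rewrite ler_piMr ?mulr_ge0 ?(ltW h0)// ler_pdivrMr// mul1r.
have qpos (a : R) : 0 <= (l * `|a| + pi) ^- 2.
 by rewrite invr_ge0 exprn_ge0// addr_ge0 ?mulr_ge0 ?(ltW p0) ?(ltW l0).
have pos (a : R) : 0 <= (32 * h + 32) * (l * `|a| + pi) ^- 2.
 by rewrite mulr_ge0// addr_ge0// mulr_ge0// ltW.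
have out_ge a : 0 <= a -> 0 <= (fejer_prim L (a + h) - fejer_prim L a) / (2 * fejer_lim L).
 move=> a0; rewrite divr_ge0 ?subr_ge0 ?fejer_prim_mono ?mulr_ge0 ?(ltW lp)//.
 by rewrite lerDl ltW.
have weak (q : R) : 0 <= q -> (2 * (8 * h) + 32) * q <= (32 * h + 32) * q.
 by move=> q0; rewrite ler_wpM2r//; lra.
rewrite /smoothed_indicator mulrDr indicE; case: (boolP (_ \in _)) => [/set_mem/=|/negP hu].
 rewrite in_itv/= => /andP[u0 uh].
 have hu0 : 0 <= h - u by rewrite subr_ge0.
 have E : fejer_prim L (u - h) = - fejer_prim L (h - u) by rewrite -fejer_primN// opprB.
 rewrite (_ : true%:R - _ = (fejer_lim L - fejer_prim L u) / (2 * fejer_lim L) +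
  (fejer_lim L - fejer_prim L (h - u)) / (2 * fejer_lim L)); last first.
  by rewrite E/= ?mulr1n; field; rewrite gt_eqF.
 rewrite ger0_norm; last by rewrite addr_ge0// divr_ge0 ?mulr_ge0 ?(ltW lp)// subr_ge0 fejer_prim_le_lim// ltW.
 apply: lerD.
  rewrite (gtr0_norm u0); have := qpos u; rewrite (gtr0_norm u0) => q.
  exact: (le_trans (tail _ (ltW u0) uh) (weak _ q)).
 rewrite distrC; have := qpos (h - u); rewrite (ger0_norm hu0) => q.
 by apply: (le_trans (tail _ hu0 _) (weak _ q)); rewrite gerBl ltW.
rewrite sub0r normrN; have [u0|u0] := leP u 0.
 have u1 : 0 <= - u by rewrite oppr_ge0.
 rewrite (_ : _ - _ = fejer_prim L (- u + h) - fejer_prim L (- u)); last first.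
  rewrite fejer_primN// (_ : u - h = - (- u + h)); last by ring.
  by rewrite fejer_primN//; ring.
 rewrite ger0_norm ?out_ge// ler_wpDr//.
 have := qpos u; rewrite (ler0_norm u0) => q.
 exact: (le_trans (outer _ u1) (weak _ q)).
have uh : h < u by rewrite ltNge; apply/negP => uh; apply: hu; rewrite inE/= in_itv/= u0.
have u1 : 0 <= u - h by rewrite subr_ge0 ltW.
rewrite -{1}[u](subrK h) ger0_norm ?out_ge// ler_wpDl//.
have := qpos (u - h); rewrite (ger0_norm u1) => q.
exact: (le_trans (outer _ u1) (weak _ q)).
Qed.

End fejer_kernel.

(** * Measurability and boundedness of the smoothing kernels *)

Section bounded_interval.
Context {R : realType}.
Local Notation leb := (@lebesgue_measure R).

Definition bounded_meas (f : R -> R) := mfunT f /\ exists M, forall x, `|f x| <= M.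

Lemma lipschitz_measurable (f : R -> R) (K : R) :
 (forall u v, `|f u - f v| <= K * `|u - v|) -> mfunT f.
Proof.
move=> fK; apply: continuous_measurable_fun => u.
have /cvgrPdist_le hid : x @[x --> u] --> u by exact: cvg_id.
apply/cvgrPdist_le => e e0; near=> v.
rewrite (le_trans (fK _ _))// (le_trans (y := (`|K| + 1) * `|u - v|))//.
 by rewrite ler_wpM2r// (le_trans (ler_norm _))// lerDl.
rewrite -ler_pdivlMl//; near: v.
by apply: hid; rewrite mulr_gt0// invr_gt0.
Unshelve. all: end_near. Qed.

Lemma itv_integral_bound (f : R -> R) (L M : R) : 0 < L -> mfunT f ->
 (forall b, 0 < b <= L -> `|f b| <= M) -> `|\int[leb]_(b in `]0, L]) f b| <= M * L.
Proof.
move=> L0 mf fM; have i1 := integrable_bounded_itv mf fM.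
have ic (c : R) : leb.-integrable `]0, L] (EFin \o (fun=> c)) by apply: (integrable_bounded_itv (M := `|c|)).
have E (c : R) : \int[leb]_(b in `]0, L]) c = c * L.
 rewrite Rintegral_cst// (_ : fine _ = L)//.
 have := lebesgue_measure_itv (`]0, L] : interval R).
 by rewrite /= lte_fin L0 sube0 => ->.
rewrite ler_norml -mulNr -!E; apply/andP; split.
 by apply: le_Rintegral => // b /=; rewrite in_itv/= => /fM; rewrite ler_norml => /andP[].
by apply: le_Rintegral => // b /=; rewrite in_itv/= => /fM; rewrite ler_norml => /andP[].
Qed.

Let weight01 (L b : R) : 0 < L -> 0 < b <= L -> 0 <= 1 - b / L <= 1.
Proof.
by move=> L0 /andP[b0 bL]; rewrite gerBl divr_ge0 ?(ltW b0) ?(ltW L0)// subr_ge0 ler_pdivrMr// mul1r bL.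
Qed.

Lemma fejer_lipschitz (L u v : R) : 0 < L -> `|fejer L u - fejer L v| <= L * L * `|u - v|.
Proof.
move=> L0; rewrite /fejer -RintegralB//; [|exact: integrable_fejer|exact: integrable_fejer].
rewrite mulrAC; apply: itv_integral_bound => //.
 by apply: measurable_funB; apply: measurable_funM; (try exact: measurable_fejer_weight);
  apply: (measurableT_comp measurable_cosR); exact: measurable_funM.
move=> b bL; have /andP[w0 w1] := weight01 L0 bL; have /andP[b0 bl] := bL.
rewrite -mulrBr normrM (ger0_norm w0) (le_trans (ler_piMl _ w1))// (le_trans (cos_diff_le _ _))//.
by rewrite -mulrBr normrM (gtr0_norm b0) ler_wpM2r.
Qed.

Lemma fejer_prim_lipschitz (L u v : R) : 0 < L -> `|fejer_prim L u - fejer_prim L v| <= L * `|u - v|.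
Proof.
move=> L0; rewrite /fejer_prim -RintegralB//; [|exact: integrable_fejer_prim|exact: integrable_fejer_prim].
rewrite mulrC; apply: itv_integral_bound => //.
 by apply: measurable_funB; apply: measurable_funM; (try exact: measurable_fejer_weight);
  apply: measurable_funM; (try exact: measurable_invr);
  apply: (measurableT_comp measurable_sinR); exact: measurable_funM.
move=> b bL; have /andP[w0 w1] := weight01 L0 bL; have /andP[b0 bl] := bL.
rewrite -mulrBr normrM (ger0_norm w0) (le_trans (ler_piMl _ w1))//.
rewrite -mulrBl normrM normfV (gtr0_norm b0) ler_pdivrMr// (le_trans (sin_diff_le _ _))//.
by rewrite -mulrBr normrM (gtr0_norm b0) mulrC.
Qed.

Lemma bounded_fejer (L x : R) : 0 < L -> bounded_meas (fun u => fejer L (u - x)).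
Proof.
move=> L0; split.
 apply: (lipschitz_measurable (K := L * L)) => u v.
 by rewrite (le_trans (fejer_lipschitz _ _ L0))// opprB addrA subrK.
exists (1 * L) => u; apply: itv_integral_bound => //.
 apply: measurable_funM; first exact: measurable_fejer_weight.
 by apply: (measurableT_comp measurable_cosR); exact: measurable_funM.
move=> b bL; have /andP[w0 w1] := weight01 L0 bL.
by rewrite normrM (ger0_norm w0) mulr_ile1// ler_norml cos_geN1 cos_le1.
Qed.

Lemma bounded_smoothed (h L x : R) : 0 < L -> bounded_meas (fun u => smoothed_indicator h L (u - x)).
Proof.
move=> L0; have l0 : 0 < fejer_lim L.
 by rewrite (lt_le_trans _ (fejer_lim_lower L0))// invr_gt0 mulr_gt0// pi_gt0.
have mp (x' : R) : mfunT (fun u : R => fejer_prim L (u - x')).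
 apply: (lipschitz_measurable (K := L)) => u v.
 by rewrite (le_trans (fejer_prim_lipschitz _ _ L0))// opprB addrA subrK.
split.
 apply: measurable_funM => //; apply: measurable_funB => //.
 rewrite (_ : (fun u => _) = fun u => fejer_prim L (u - (x + h)))//.
 by apply/funext => u; rewrite opprD addrA.
exists (L * `|h| / (2 * fejer_lim L)) => u.
rewrite /smoothed_indicator normrM normfV [`|2 * _|]ger0_norm ?mulr_ge0 ?(ltW l0)//.
rewrite ler_wpM2r ?invr_ge0 ?mulr_ge0 ?(ltW l0)//.
by rewrite (le_trans (fejer_prim_lipschitz _ _ L0))// opprB addrC subrK.
Qed.

End bounded_interval.

(** * Weighted sums of marked means *)

Section weighted_mean.
Context d (Y : measurableType d) (R : realType) (mu : probability Y R).
Variables (F : Y -> Y) (tau : Y -> R) (A B : set Y).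
Hypothesis F_mp : measure_preserving mu F.
Hypothesis tau_meas : mfunT tau.
Hypothesis mA : measurable A.
Hypothesis mB : measurable B.
Local Notation leb := (@lebesgue_measure R).
Local Notation marked := (marked_mean mu F tau A B).
Local Notation S := (birkhoff_sum F tau).
Implicit Types (f g : R -> R) (phi : R -> R -> R) (w : nat -> R).

Let mS n : mfunT (S n). Proof. exact: measurable_birkhoff F_mp tau_meas n. Qed.
Let mV n : measurable (visit F A B n). Proof. exact: (measurable_visit F_mp mA mB). Qed.

Lemma rintegrable_marked n f : bounded_meas f ->
 rintegrable mu (fun y => \1_(visit F A B n) y * f (S n y)).
Proof.
move=> [mf [M fM]]; apply: (rintegrable_bounded mu _ (M := M)).
 by apply: measurable_funM; [by apply: measurable_indic; exact: mV|exact: measurableT_comp].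
move=> y; rewrite indicE; case: (_ \in _); rewrite ?mul1r// mul0r normr0.
exact: le_trans (fM 0).
Qed.

Lemma marked_mean_le n f g : bounded_meas f -> bounded_meas g -> (forall x, f x <= g x) ->
 marked n f <= marked n g.
Proof.
move=> bf bg fg; apply: Rintegral_le; [exact: rintegrable_marked|exact: rintegrable_marked|].
by move=> y; rewrite ler_wpM2l.
Qed.

Lemma marked_meanD n f g : bounded_meas f -> bounded_meas g ->
 marked n (fun x => f x + g x) = marked n f + marked n g.
Proof.
move=> bf bg; rewrite /marked_mean -RintegralD//; [|exact: rintegrable_marked|exact: rintegrable_marked].
by apply: eq_Rintegral => y _; rewrite mulrDr.
Qed.

Lemma marked_meanZ n a f : bounded_meas f -> marked n (fun x => a * f x) = a * marked n f.
Proof.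
move=> bf; rewrite /marked_mean -RintegralZl//; last exact: rintegrable_marked.
by apply: eq_Rintegral => y _; rewrite mulrCA.
Qed.

Lemma marked_mean_fubini n (L M : R) phi : 0 < L ->
 mfunT (fun z : R * R => phi z.1 z.2) ->
 (forall b u, 0 < b <= L -> `|phi b u| <= M) ->
 leb.-integrable `]0, L] (fun b => (marked n (phi b))%:E) /\
 marked n (fun u => \int[leb]_(b in `]0, L]) phi b u) = \int[leb]_(b in `]0, L]) marked n (phi b).
Proof.
move=> L0 mphi phiM; have finL : (leb `]0%R, L] < +oo)%E.
 by rewrite lebesgue_measure_itv/= lte_fin L0 -EFinB ltry.
have mi (u : R) : mfunT (fun b => phi b u).
 by apply: (measurableT_comp mphi (g := fun b : R => (b, u))); exact: measurable_fun_pair.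
have muT : (mu setT < +oo)%E by rewrite probability_setT ltry.
have m1 : mfunT (\1_(visit F A B n) : Y -> R) by apply: measurable_indic; exact: mV.
split.
 pose f (z : R * Y) := \1_(visit F A B n) z.2 * phi z.1 (S n z.2).
 have mf : mfunT f.
  apply: measurable_funM.
   exact: (measurableT_comp m1 measurable_snd).
  apply: (measurableT_comp mphi (g := fun z : R * Y => (z.1, S n z.2))).
  by apply: measurable_fun_pair => //; exact: measurableT_comp.
 apply: (@bounded_fubini_integrable _ _ _ _ R leb mu `]0, L]%classic setT f M) => //.
 move=> b y /=; rewrite in_itv/= => bL _; rewrite /f normrM indicE.
  by case: (_ \in _); rewrite ?normr1 ?mul1r ?normr0 ?mul0r ?phiM// (le_trans _ (phiM b 0 bL)).
pose f (z : Y * R) := \1_(visit F A B n) z.1 * phi z.2 (S n z.1).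
have mf : mfunT f.
 apply: measurable_funM.
  exact: (measurableT_comp m1 measurable_fst).
 apply: (measurableT_comp mphi (g := fun z : Y * R => (z.2, S n z.1))).
 by apply: measurable_fun_pair => //; exact: measurableT_comp.
transitivity (\int[mu]_(y in setT) \int[leb]_(b in `]0, L]) f (y, b)).
 apply: eq_Rintegral => y _; rewrite /f/= RintegralZl//.
 apply: (integrable_bounded_itv (M := M)); first exact: mi.
 by move=> b bL; exact: phiM.
apply: (@bounded_fubini _ _ _ _ R mu leb setT `]0, L]%classic f M) => //.
move=> y b _ /=; rewrite in_itv/= => bL; rewrite /f normrM indicE.
by case: (_ \in _); rewrite ?normr1 ?mul1r ?normr0 ?mul0r ?phiM// (le_trans _ (phiM b 0 bL)).
Qed.

Definition weighted_mean w N f : R := \sum_(n < N) w n * marked n f.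
Variables (w : nat -> R) (N : nat).
Hypothesis w_ge0 : forall n, 0 <= w n.
Local Notation wm := (weighted_mean w N).

Lemma weighted_mean_le f g : bounded_meas f -> bounded_meas g -> (forall x, f x <= g x) ->
 wm f <= wm g.
Proof. by move=> bf bg fg; apply: ler_sum => n _; rewrite ler_wpM2l// marked_mean_le. Qed.

Lemma weighted_meanD f g : bounded_meas f -> bounded_meas g ->
 wm (fun x => f x + g x) = wm f + wm g.
Proof.
by move=> bf bg; rewrite /weighted_mean -big_split/=; apply: eq_bigr => n _; rewrite marked_meanD// mulrDr.
Qed.

Lemma weighted_meanZ a f : bounded_meas f -> wm (fun x => a * f x) = a * wm f.
Proof.
by move=> bf; rewrite /weighted_mean mulr_sumr; apply: eq_bigr => n _; rewrite marked_meanZ// mulrCA.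
Qed.

Lemma weighted_mean_fubini (L M : R) phi : 0 < L ->
 mfunT (fun z : R * R => phi z.1 z.2) ->
 (forall b u, 0 < b <= L -> `|phi b u| <= M) ->
 leb.-integrable `]0, L] (fun b => (wm (phi b))%:E) /\
 wm (fun u => \int[leb]_(b in `]0, L]) phi b u) = \int[leb]_(b in `]0, L]) wm (phi b).
Proof.
move=> L0 mphi phiM; rewrite /weighted_mean; elim: N => [|k [ik IH]].
 split; first by apply: eq_integrable (integrable0 _ _) => // b _; rewrite big_ord0.
 by rewrite big_ord0 /Rintegral integral0_eq// => b _; rewrite big_ord0.
have [ik1 E] := marked_mean_fubini k L0 mphi phiM.
have iZ : leb.-integrable `]0, L] (fun b => (w k * marked k (phi b))%:E).
 by apply: eq_integrable (integrableZl _ (w k) ik1) => // b _; rewrite EFinM.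
split.
 apply: eq_integrable (integrableD _ ik iZ) => // b _.
 by rewrite big_ord_recr/= EFinD.
rewrite big_ord_recr/= IH E -RintegralZl// -RintegralD//.
by apply: eq_Rintegral => b _; rewrite big_ord_recr.
Qed.

End weighted_mean.

(** * Window estimates from a Fourier majorant *)

Section smoothing.
Context d (Y : measurableType d) (R : realType) (mu : probability Y R).
Variables (F : Y -> Y) (tau : Y -> R) (A B : set Y).
Hypothesis F_mp : measure_preserving mu F.
Hypothesis tau_meas : mfunT tau.
Hypothesis mA : measurable A.
Hypothesis mB : measurable B.
Variables (w : nat -> R) (N : nat).
Hypothesis w_ge0 : forall n, 0 <= w n.
Local Notation leb := (@lebesgue_measure R).
Local Notation wm := (weighted_mean mu F tau A B w N).
Variables (L B1 B2 : R) (maj : R -> R).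
Hypothesis L_gt0 : 0 < L.
Hypothesis maj_int : leb.-integrable `]0, L] (EFin \o maj).
Hypothesis maj_ge0 : forall b, 0 <= maj b.
Hypothesis majP : forall b, 0 < b <= L ->
 `|wm (fun x => cos (b * x))| + `|wm (fun x => sin (b * x))| <= maj b.
Hypothesis maj_mass : \int[leb]_(b in `]0, L]) maj b <= B1.
Hypothesis maj_moment : \int[leb]_(b in `]0, L]) (b * maj b) <= B2.

Let triangle4 (p q r s D e : R) : `|p - r| <= e -> `|q - s| <= e -> `|r - s| <= D ->
 `|p - q| <= D + (e + e).
Proof.
move=> h1 h2 h3; have -> : p - q = (r - s) + ((p - r) + (s - q)) by ring.
rewrite (le_trans (ler_normD _ _))// lerD// (le_trans (ler_normD _ _))// lerD//.
by rewrite distrC.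
Qed.

Let bcos b : bounded_meas (fun x : R => cos (b * x)).
Proof.
split; first by apply: (measurableT_comp measurable_cosR); exact: measurable_funM.
by exists 1 => x; rewrite ler_norml cos_geN1 cos_le1.
Qed.

Let bsin b : bounded_meas (fun x : R => sin (b * x)).
Proof.
split; first by apply: (measurableT_comp measurable_sinR); exact: measurable_funM.
by exists 1 => x; rewrite ler_norml sin_geN1 sin_le1.
Qed.

Let bZ a f : bounded_meas f -> bounded_meas (fun x : R => a * f x).
Proof.
move=> [mf [M fM]]; split; first exact: measurable_funM.
by exists (`|a| * M) => x; rewrite normrM ler_wpM2l.
Qed.

Let bD f g : bounded_meas f -> bounded_meas g -> bounded_meas (fun x : R => f x + g x).
Proof.
move=> [mf [M fM]] [mg [M' gM]]; split; first exact: measurable_funD.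
by exists (M + M') => x; rewrite (le_trans (ler_normD _ _))// lerD.
Qed.

Lemma weighted_mean_trig b p q : 0 < b <= L ->
 `|wm (fun x => p * cos (b * x) + q * sin (b * x))| <= Num.max `|p| `|q| * maj b.
Proof.
move=> bL; rewrite weighted_meanD//; [|exact: bZ|exact: bZ].
rewrite weighted_meanZ// weighted_meanZ// (le_trans (ler_normD _ _))// !normrM.
rewrite (le_trans _ (ler_wpM2l _ (majP bL))) ?le_max ?normr_ge0// mulrDr.
by apply: lerD; rewrite ler_wpM2r// le_max lexx// orbT.
Qed.

(** By Fubini the mean is an integral of transforms over [b], in which the shift by [x] only rotates
    cosine into sine; hence the bound is uniform in [x]. *)
Lemma weighted_mean_fejer l x : 0 < l <= L -> wm (fun u => fejer l (u - x)) <= B1.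
Proof.
move=> /andP[l0 lL]; rewrite (le_trans _ maj_mass)//.
pose phi (b u : R) := (1 - b / l) * cos (b * (u - x)).
have mphi : mfunT (fun z : R * R => phi z.1 z.2).
 apply: measurable_funM; first by apply: measurable_funB => //; exact: measurable_funM.
 by apply: (measurableT_comp measurable_cosR); apply: measurable_funM => //; exact: measurable_funB.
have phiM b u : 0 < b <= l -> `|phi b u| <= 1.
 move=> bl; have /andP[w0 w1] := fejer_weight01 l0 bl.
 by rewrite normrM (ger0_norm w0) mulr_ile1// ler_norml cos_geN1 cos_le1.
have [ip E] := weighted_mean_fubini F_mp tau_meas mA mB w N l0 mphi phiM.
rewrite [leLHS]E.
have imaj : leb.-integrable `]0, l] (EFin \o maj).
 by apply: (integrableS _ _ _ maj_int) => //; apply: subset_itvl; rewrite bnd_simp.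
apply: (@le_trans _ _ (\int[leb]_(b in `]0, l]) maj b)).
 apply: le_Rintegral => // b /=; rewrite in_itv/= => bl.
 have /andP[w0 w1] := fejer_weight01 l0 bl; have /andP[b0 bl'] := bl.
 have bL : 0 < b <= L by rewrite b0 (le_trans bl').
 rewrite (le_trans (ler_norm _))//.
 have -> : phi b = fun u => ((1 - b / l) * cos (b * x)) * cos (b * u) + ((1 - b / l) * sin (b * x)) * sin (b * u).
  by apply/funext => u; rewrite /phi mulrBr cosB; ring.
 rewrite (le_trans (weighted_mean_trig _ _ bL))// ler_piMl// ge_max !normrM (ger0_norm w0).
 by rewrite !mulr_ile1// ler_norml ?cos_geN1 ?cos_le1 ?sin_geN1 ?sin_le1.
rewrite /Rintegral; apply: fine_le.
- by apply: integrable_fin_num imaj.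
- by apply: integrable_fin_num maj_int.
- apply: ge0_subset_integral => //.
 + by case/integrableP : maj_int.
 + by move=> b _; rewrite lee_fin.
 + by apply: subset_itvl; rewrite bnd_simp.
Qed.

(** The double difference of sines factors as [-4 sin (b h / 2) sin (b (x' - x) / 2)] times a single
    sine; after division by [b] it is at most [b h |x - x'|], whence the first moment [B2] of the
    majorant. *)
Lemma weighted_mean_smoothed_diff h x x' : 0 < h ->
 `|wm (fun u => smoothed_indicator h L (u - x)) - wm (fun u => smoothed_indicator h L (u - x'))|
 <= 4 * h * `|x - x'| * B2.
Proof.
move=> h0; have l0 : 0 < fejer_lim L.
 by rewrite (lt_le_trans _ (fejer_lim_lower L_gt0))// invr_gt0 mulr_gt0// pi_gt0.
have lV : (2 * fejer_lim L)^-1 <= 4.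
 have p4 : pi <= 4 :> R by have := pihalf_02 R => /andP[_]; rewrite ltr_pdivrMr//; lra.
 rewrite (le_trans _ p4)// -[leRHS]invrK lef_pV2 ?posrE ?mulr_gt0 ?invr_gt0 ?pi_gt0//.
 by rewrite -ler_pdivrMl// -invfM fejer_lim_lower.
set c := (2 * fejer_lim L)^-1 in lV.
have c0 : 0 <= c by rewrite invr_ge0 mulr_ge0 ?ltW.
have bs (z : R) := bounded_smoothed h z L_gt0.
rewrite -[X in _ + X]mulN1r -weighted_meanZ// -weighted_meanD//; last exact: bZ.
pose phi (b u : R) := (1 - b / L) * ((sin (b * (u - x)) - sin (b * (u - x - h)) -
 (sin (b * (u - x')) - sin (b * (u - x' - h)))) / b).
have trig (b u : R) : phi b u = (1 - b / L) * (- 4 * sin (b * h / 2) * sin (b * (x' - x) / 2) / b) *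
  sin (b * u - b * (x + x' + h) / 2).
 rewrite /phi.
 pose a := b * u - b * (x + x' + h) / 2; pose s := b * h / 2; pose t := b * (x' - x) / 2.
 have -> : b * (u - x) = a + s + t by rewrite /a /s /t; field.
 have -> : b * (u - x - h) = a - s + t by rewrite /a /s /t; field.
 have -> : b * (u - x') = a + s - t by rewrite /a /s /t; field.
 have -> : b * (u - x' - h) = a - s - t by rewrite /a /s /t; field.
 by rewrite -/a -/s -/t !(sinD, cosD) !(sinN, cosN); ring.
have trigM (b u : R) : 0 < b <= L -> `|(1 - b / L) * (- 4 * sin (b * h / 2) * sin (b * (x' - x) / 2) / b)| <=
  b * (h * `|x - x'|).
 move=> bL; have /andP[w0 w1] := fejer_weight01 L_gt0 bL; have /andP[b0 _] := bL.
 rewrite normrM (ger0_norm w0) (le_trans (ler_piMl _ w1))//.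
 rewrite !normrM normrN normfV (gtr0_norm b0) ler_pdivrMr//.
 have s0 (y : R) : `|sin y| <= `|y| by have := sin_diff_le y 0; rewrite sin0 !subr0.
 rewrite (ger0_norm (_ : 0 <= 4)) //.
 apply: (@le_trans _ _ (4 * `|b * h / 2| * `|b * (x' - x) / 2|)).
  by rewrite -!mulrA ler_wpM2l// !mulrA ler_pM.
 rewrite !normrM (gtr0_norm b0) (gtr0_norm h0) (gtr0_norm (_ : 0 < 2^-1))// [`|x' - x|]distrC.
 by apply: eq_ler; field.
have phiM b u : 0 < b <= L -> `|phi b u| <= L * (h * `|x - x'|).
 move=> bL; rewrite trig normrM (le_trans (ler_piMr _ _))//.
  by rewrite ler_norml sin_geN1 sin_le1.
 have /andP[b0 bl] := bL.
 by rewrite (le_trans (trigM _ 0 bL))// ler_wpM2r// mulr_ge0// ltW.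
have mphi : mfunT (fun z : R * R => phi z.1 z.2).
 apply: measurable_funM; first by apply: measurable_funB => //; exact: measurable_funM.
 apply: measurable_funM; last by apply: (measurableT_comp measurable_invr).
 by apply: measurable_funB; apply: measurable_funB; apply: (measurableT_comp measurable_sinR);
  apply: measurable_funM => //; repeat apply: measurable_funB.
have [ip E] := weighted_mean_fubini F_mp tau_meas mA mB w N L_gt0 mphi phiM.
have fourE u : fejer_prim L (u - x) - fejer_prim L (u - x - h) -
  (fejer_prim L (u - x') - fejer_prim L (u - x' - h)) = \int[leb]_(b in `]0, L]) phi b u.
 have ifp (z : R) := integrable_fejer_prim z L_gt0.
 rewrite /fejer_prim -RintegralB//; [|exact: ifp|exact: ifp].
 rewrite -RintegralB//; [|exact: ifp|exact: ifp].
 rewrite -RintegralB//.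
 + by apply: eq_Rintegral => b _; rewrite /phi; ring.
 + by apply: eq_integrable (integrableB _ (ifp (u - x)) (ifp (u - x - h))) => // b _; rewrite EFinB.
 + by apply: eq_integrable (integrableB _ (ifp (u - x')) (ifp (u - x' - h))) => // b _; rewrite EFinB.
have bphi : bounded_meas (fun u => \int[leb]_(b in `]0, L]) phi b u).
 have -> : (fun u => \int[leb]_(b in `]0, L]) phi b u) =
  fun u => (2 * fejer_lim L) * (smoothed_indicator h L (u - x) + -1 * smoothed_indicator h L (u - x')).
  apply/funext => u; rewrite -fourE /smoothed_indicator mulN1r -mulrBl mulrCA mulfV ?mulr1//.
  by rewrite gt_eqF// mulr_gt0.
 by apply: bZ; apply: bD => //; exact: bZ.
rewrite (_ : (fun u => _) = fun u => c * \int[leb]_(b in `]0, L]) phi b u); last first.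
 by apply/funext => u; rewrite /smoothed_indicator -/c mulN1r -mulrBl mulrC fourE.
rewrite weighted_meanZ// normrM (ger0_norm c0) -!mulrA; apply: ler_pM => //.
rewrite E mulrA.
have ibm : leb.-integrable `]0, L] (EFin \o (fun b => b * maj b)).
 apply: (le_integrable _ _ _ (integrableZl _ L maj_int)) => //.
  by apply/measurable_EFinP; apply: measurable_funM => //; case/integrableP : maj_int => /measurable_EFinP.
 move=> b /=; rewrite in_itv/= => /andP[b0 bL]; rewrite lee_fin !normrM ler_wpM2r//.
 by rewrite (gtr0_norm b0) (gtr0_norm L_gt0).
have ihm : leb.-integrable `]0, L] (EFin \o (fun b => (h * `|x - x'|) * (b * maj b))).
 by apply: eq_integrable (integrableZl _ (h * `|x - x'|) ibm) => // b _; rewrite /= EFinM.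
apply: (@le_trans _ _ (\int[leb]_(b in `]0, L]) ((h * `|x - x'|) * (b * maj b)))); last first.
 by rewrite RintegralZl// ler_wpM2l// mulr_ge0// ltW.
have pw (b : R) : 0 < b <= L -> `|wm (phi b)| <= (h * `|x - x'|) * (b * maj b).
 move=> bL; have hs := trigM b 0 bL.
 set q := (1 - b / L) * _ in hs.
 have -> : phi b = fun u => (- q * sin (b * (x + x' + h) / 2)) * cos (b * u) +
   (q * cos (b * (x + x' + h) / 2)) * sin (b * u).
  by apply/funext => u; rewrite trig -/q sinB; ring.
 clearbody q.
 rewrite (le_trans (weighted_mean_trig _ _ bL))// mulrA [leRHS](_ : _ = b * (h * `|x - x'|) * maj b); last by ring.
 rewrite ler_wpM2r// (le_trans _ hs)// ge_max !normrM normrN.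
 by apply/andP; split; rewrite ler_piMr// ler_norml ?cos_geN1 ?cos_le1 ?sin_geN1 ?sin_le1.
rewrite ler_norml; apply/andP; split.
 rewrite -mulN1r -RintegralZl//; apply: le_Rintegral => //.
  by apply: eq_integrable (integrableZl _ (- 1) ihm) => // b _; rewrite /= EFinM.
 by move=> b /=; rewrite in_itv/= => /pw; rewrite ler_norml mulN1r => /andP[].
by apply: le_Rintegral => // b /=; rewrite in_itv/= => /pw; rewrite ler_norml => /andP[].
Qed.

Definition window_indicator h x : R -> R := \1_(`]x, (x + h)]%classic).

Let bounded_window h x : bounded_meas (window_indicator h x).
Proof.
split; first exact: measurable_indic.
by exists 1 => u; rewrite /window_indicator indicE; case: (_ \in _); rewrite ?normr1 ?normr0.
Qed.

Let window_shift h x u : window_indicator h x u = \1_(`]0, h]%classic : set R) (u - x).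
Proof.
by rewrite /window_indicator !indicE !mem_setE !in_itv/= subr_gt0 lerBlDr [h + x]addrC.
Qed.

Let fejer_sum_le l e : 0 < l <= L ->
 wm (fun u => (fejer l (u - e) + fejer l (u - (e - pi / l))) / (2 * l)) <= B1 / l.
Proof.
move=> lL; have /andP[l0 _] := lL.
have b1 := bounded_fejer e l0; have b2 := bounded_fejer (e - pi / l) l0.
rewrite (_ : (fun u => _) = fun u => (2 * l)^-1 * (fejer l (u - e) + fejer l (u - (e - pi / l)))); last first.
 by apply/funext => u; rewrite mulrC.
rewrite weighted_meanZ//; last exact: bD.
rewrite weighted_meanD// mulrC ler_pdivrMr ?mulr_gt0//.
rewrite (le_trans (lerD (weighted_mean_fejer _ lL) (weighted_mean_fejer _ lL)))//.
by apply: eq_ler; field; rewrite gt_eqF.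
Qed.

(** The window is dominated by [(h + pi)^2] times a pair of Fejér kernels of bandwidth 1. *)
Lemma weighted_mean_window h x : 0 < h -> 1 <= L -> wm (window_indicator h x) <= (h + pi) ^+ 2 * B1.
Proof.
move=> h0 L1; have l1 : 0 < (1 : R) <= L by rewrite ltr01.
have p0 := pi_gt0 R.
have b1 := bounded_fejer x (@ltr01 R); have b2 := bounded_fejer (x - pi / 1) (@ltr01 R).
have bb : bounded_meas (fun u => (fejer 1 (u - x) + fejer 1 (u - (x - pi / 1))) / (2 * 1)).
 rewrite (_ : (fun u => _) = fun u => (2 * 1)^-1 * (fejer 1 (u - x) + fejer 1 (u - (x - pi / 1)))); last first.
  by apply/funext => u; rewrite mulrC.
 by apply: bZ; exact: bD.
have := fejer_sum_le x l1; rewrite (divr1 B1) => hB.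
have hp : 0 <= (h + pi) ^+ 2 by rewrite sqr_ge0.
rewrite (le_trans _ (ler_wpM2l hp hB))// -weighted_meanZ//; apply: weighted_mean_le => //; first exact: bZ.
move=> u; rewrite window_shift indicE.
have fp := fejer_pair (u - x) (@ltr01 R); rewrite mul1r in fp.
have pp : 0 < `|u - x| + pi by rewrite ltr_wpDl.
have -> : u - (x - pi / 1) = u - x + pi / 1 by ring.
rewrite (le_trans _ (ler_wpM2l hp fp))//.
rewrite ler_pdivlMr ?exprn_gt0//; case: (boolP (_ \in _)) => [/set_mem/=|_]; last by rewrite mul0r.
rewrite in_itv/= => /andP[u0 uh]; rewrite mul1r (gtr0_norm u0).
have q1 : 0 <= u - x + pi by rewrite addr_ge0// ltW.
have q2 : 0 <= h + pi by rewrite addr_ge0// ltW.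
by rewrite lerXn2r// lerD2r.
Qed.

(** Each window is replaced by its smoothing at bandwidth [l^2]. The error is dominated by Fejér
    kernels of bandwidth [l] and costs [O(B1 / l)], however irregular the underlying measure. *)
Lemma weighted_mean_window_diff h l x x' : 0 < h -> 0 < l <= L -> L = l ^+ 2 ->
 `|wm (window_indicator h x) - wm (window_indicator h x')| <=
 4 * h * `|x - x'| * B2 + 128 * (h + 1) * (B1 / l).
Proof.
move=> h0 lL LE; have /andP[l0 _] := lL.
pose err z (u : R) := (32 * h + 32) * ((fejer l (u - z) + fejer l (u - (z - pi / l))) / (2 * l) +
 (fejer l (u - (z + h)) + fejer l (u - (z + h - pi / l))) / (2 * l)).
have bf (z : R) : bounded_meas (fun u => (fejer l (u - z) + fejer l (u - (z - pi / l))) / (2 * l)).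
 rewrite (_ : (fun u => _) = fun u => (2 * l)^-1 * (fejer l (u - z) + fejer l (u - (z - pi / l)))); last first.
  by apply/funext => u; rewrite mulrC.
 by apply: bZ; apply: bD; exact: bounded_fejer.
have be z : bounded_meas (err z) by apply: bZ; exact: bD.
have errB z : wm (err z) <= 64 * (h + 1) * (B1 / l).
 rewrite weighted_meanZ; [|done..|exact: bD].
 rewrite weighted_meanD// (_ : 64 * (h + 1) * (B1 / l) = (32 * h + 32) * (B1 / l + B1 / l)); last by ring.
 rewrite ler_wpM2l ?addr_ge0 ?mulr_ge0 ?(ltW h0)//.
 by apply: lerD; exact: fejer_sum_le.
have bs (z : R) := bounded_smoothed h z L_gt0.
have pe z u : `|window_indicator h z u - smoothed_indicator h L (u - z)| <= err z u.
 rewrite window_shift LE (le_trans (smoothed_indicator_error _ h0 l0))//.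
 rewrite ler_wpM2l ?addr_ge0 ?mulr_ge0 ?(ltW h0)//.
 apply: lerD; rewrite (le_trans (fejer_pair _ l0))//.
  by rewrite (_ : u - z + pi / l = u - (z - pi / l)) //; ring.
 rewrite (_ : u - z - h + pi / l = u - (z + h - pi / l)); last by ring.
 by rewrite (_ : u - z - h = u - (z + h)) //; ring.
have close z : `|wm (window_indicator h z) - wm (fun u => smoothed_indicator h L (u - z))| <=
  64 * (h + 1) * (B1 / l).
 rewrite (le_trans _ (errB z))// ler_distl lerBlDr.
 rewrite -!weighted_meanD//; apply/andP; split; apply: weighted_mean_le => //; try exact: bD.
  by move=> u; have := pe z u; rewrite ler_distl lerBlDr => /andP[].
 by move=> u; have := pe z u; rewrite ler_distl => /andP[].
have -> : 128 * (h + 1) * (B1 / l) = 64 * (h + 1) * (B1 / l) + 64 * (h + 1) * (B1 / l) by ring.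
exact: triangle4 (close x) (close x') (weighted_mean_smoothed_diff x x' h0).
Qed.

End smoothing.

(** * Exponential sums and damping weights *)

Section exponential_sums.
Context {R : realType}.
Implicit Types (a c h x y : R).

Lemma geometric_sum_le (q : R) N : 0 <= q < 1 -> \sum_(n < N) q ^+ n <= (1 - q)^-1.
Proof.
move=> /andP[q0 q1]; have q' : 0 < 1 - q by rewrite subr_gt0.
rewrite -[leRHS]mul1r ler_pdivlMr//.
have -> : (\sum_(n < N) q ^+ n) * (1 - q) = 1 - q ^+ N.
 by rewrite -[RHS]opprB subrX1; ring.
by rewrite gerBl exprn_ge0.
Qed.

Lemma exp_sum_le a N : 0 < a -> \sum_(n < N) expR (- (a * n%:R)) <= (1 + a) / a.
Proof.
move=> a0; have e1 : 0 <= expR (- a) < 1 by rewrite expR_ge0 -expR0 ltr_expR oppr_lt0.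
rewrite (eq_bigr (fun n : 'I_N => expR (- a) ^+ n)); last first.
 by move=> n _; rewrite -expRM_natl; congr expR; ring.
rewrite (le_trans (geometric_sum_le _ e1))//.
have a1 : 0 < 1 + a by rewrite addr_gt0.
rewrite -[leRHS]invrK invf_div lef_pV2 ?posrE ?subr_gt0 ?divr_gt0//; last by case/andP : e1.
have -> : a / (1 + a) = 1 - (1 + a)^-1 by field; rewrite gt_eqF.
by rewrite lerB// expRN lef_pV2 ?posrE ?expR_gt0// expR_ge1Dx.
Qed.

Lemma pow_exp_le k x : 0 <= x -> x ^+ k * expR (- x) <= k%:R ^+ k.
Proof.
move=> x0; case: k => [|k]; first by rewrite !expr0 mul1r expRN_le1.
rewrite expRN ler_pdivrMr ?expR_gt0//.
have k0 : 0 < k.+1%:R :> R by rewrite ltr0n.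
have -> : expR x = expR (x / k.+1%:R) ^+ k.+1.
 by rewrite -expRM_natl; congr expR; field; rewrite gt_eqF.
rewrite -exprMn lerXn2r ?nnegrE ?mulr_ge0 ?expR_ge0// -ler_pdivrMl// mulrC.
by rewrite (le_trans _ (expR_ge1Dx _))// lerDr.
Qed.

(** Half of the exponential absorbs [n^k], the other half is summed as a geometric series; the order
    [h^-(k+1)] is that of [\int_0^oo y^k e^(- c h y) dy]. *)
Lemma pow_exp_sum_le k c h N : 0 < c -> 0 < h <= 1 ->
 \sum_(n < N) n%:R ^+ k * expR (- (c * (n%:R * h))) <=
 k%:R ^+ k * (2 / c) ^+ k * ((c + 2) / c) * h ^- k.+1.
Proof.
move=> c0 /andP[h0 h1]; have a0 : 0 < c * h / 2 by rewrite divr_gt0// mulr_gt0.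
set K := k%:R ^+ k * _.
have K0 : 0 <= K by rewrite mulr_ge0 ?exprn_ge0 ?divr_ge0 ?(ltW c0).
apply: (@le_trans _ _ (\sum_(n < N) K * h ^- k * expR (- (c * h / 2 * n%:R)))).
 apply: ler_sum => n _.
 have -> : expR (- (c * (n%:R * h))) = expR (- (c * h / 2 * n%:R)) * expR (- (c * h / 2 * n%:R)).
  by rewrite -expRD; congr expR; field.
 rewrite mulrA ler_wpM2r ?expR_ge0//.
 have x0 : 0 <= c * h / 2 * n%:R by rewrite mulr_ge0// ltW.
 have := pow_exp_le k x0; set x := _ * n%:R => hx.
 have -> : n%:R = 2 / c * h^-1 * x by rewrite /x; field; rewrite !gt_eqF.
 rewrite exprMn -[leLHS]mulrA /K [leRHS](_ : _ = (2 / c * h^-1) ^+ k * k%:R ^+ k); last first.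
  by rewrite [in RHS]exprMn exprVn; ring.
 by rewrite ler_wpM2l// exprn_ge0// mulr_ge0 ?invr_ge0 ?(ltW h0)// divr_ge0// ltW.
rewrite -mulr_sumr.
have Kh : 0 <= K * h ^- k by rewrite mulr_ge0// invr_ge0 exprn_ge0// ltW.
rewrite (le_trans (ler_wpM2l Kh (exp_sum_le N a0)))//.
have -> : K * ((c + 2) / c) * h ^- k.+1 = K * h ^- k * ((c + 2) / c * h^-1).
 by clearbody K; rewrite exprSr invfM; ring.
rewrite ler_wpM2l//.
have -> : (1 + c * h / 2) / (c * h / 2) = (c * h + 2) / c * h^-1 by field; rewrite !gt_eqF.
rewrite ler_wpM2r ?invr_ge0 ?(ltW h0)// ler_wpM2r ?invr_ge0 ?(ltW c0)// lerD2r.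
by rewrite ler_piMr// ltW.
Qed.

Lemma pow_geometric_sum k (q : R) : 0 < q < 1 -> exists2 K, 0 <= K &
 forall N, \sum_(n < N) n%:R ^+ k * q ^+ n <= K.
Proof.
move=> /andP[q0 q1]; have c0 : 0 < - ln q by rewrite oppr_gt0 ln_lt0// q0.
exists (k%:R ^+ k * (2 / (- ln q)) ^+ k * ((- ln q + 2) / (- ln q)) * 1 ^- k.+1).
 by rewrite !mulr_ge0 ?exprn_ge0 ?divr_ge0 ?invr_ge0 ?addr_ge0 ?exprn_ge0 ?(ltW c0).
move=> N; have h1 : 0 < (1 : R) <= 1 by rewrite ltr01 lexx.
rewrite (le_trans _ (pow_exp_sum_le k N c0 h1))//.
apply: ler_sum => n _; rewrite mulr1 mulNr opprK ler_wpM2l ?exprn_ge0//.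
by rewrite -{1}[q]lnK ?posrE// -expRM_natl [_ * n%:R]mulrC.
Qed.

(** For positive [z] and [e], a cutoff vanishing to order [k] at 0 and exponentially small at
    infinity. On the half-line it stays below 1, tends to 1 for [y > 0] as [z -> oo] and [e -> 0],
    and is a combination of exponentials, so that Laplace transforms remain explicit. *)
Definition damped_weight (k : nat) (z e y : R) : R := (1 - expR (- (z * y))) ^+ k * expR (- (e * y)).

Lemma damped_weight_ge0 k z e y : 0 <= z -> 0 <= y -> 0 <= damped_weight k z e y.
Proof.
move=> z0 y0; rewrite mulr_ge0 ?expR_ge0// exprn_ge0// subr_ge0 expRN_le1.
by rewrite mulr_ge0.
Qed.

Lemma damped_weight_le_exp k z e y : 0 <= z -> 0 <= y -> damped_weight k z e y <= expR (- (e * y)).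
Proof.
move=> z0 y0; rewrite ler_piMl ?expR_ge0// exprn_ile1 ?gerBl ?expR_ge0//.
by rewrite subr_ge0 expRN_le1 mulr_ge0.
Qed.

Lemma damped_weight_le_pow k z e y : 0 <= z -> 0 <= e -> 0 <= y -> damped_weight k z e y <= (z * y) ^+ k.
Proof.
move=> z0 e0 y0; have zy := mulr_ge0 z0 y0.
rewrite /damped_weight (le_trans (ler_piMr _ _)) //.
- by rewrite exprn_ge0// subr_ge0 expRN_le1.
- by rewrite expRN_le1 mulr_ge0.
rewrite lerXn2r ?nnegrE// ?subr_ge0 -?expR0 ?ler_expR ?oppr_le0//.
by rewrite expR0; have := expR_ge1Dx (- (z * y)); lra.
Qed.

End exponential_sums.

(** * Uniform estimates for damped windows *)

Section local_estimate.
Context d (Y : measurableType d) (R : realType) (mu : probability Y R).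
Variables (F : Y -> Y) (tau : Y -> R) (ell : R -> R) (beta : R) (A B : set Y).
Hypothesis F_mp : measure_preserving mu F.
Hypothesis tau_meas : mfunT tau.
Hypothesis ell_sv : slowly_varying ell.
Hypothesis beta01 : 0 < beta < 1.
Hypothesis tau_tail : forall t : R, 0 < t ->
 mu [set y | t < tau y] = (ell t * t `^ (- beta))%:E.
Hypothesis mA : measurable A.
Hypothesis mB : measurable B.
Local Notation leb := (@lebesgue_measure R).
Local Notation H := (tail_fun mu tau).
Local Notation marked := (marked_mean mu F tau A B).
Local Notation trig b n := (`|marked n (fun x => cos (b * x))| + `|marked n (fun x => sin (b * x))|).
Variables (C0 c0 th r0 : R).
Hypothesis C0_gt0 : 0 < C0.
Hypothesis c0_gt0 : 0 < c0.
Hypothesis th01 : 0 < th < 1.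
Hypothesis r0_gt0 : 0 < r0.
Hypothesis fourier_near : forall b n, 0 < b <= r0 ->
 trig b n <=
  C0 * (expR (- c0 * (n%:R * H b^-1)) + th ^+ n).
Hypothesis fourier_far : forall d' L : R, 0 < d' -> d' <= L -> exists M q : R,
 [/\ 0 <= M, 0 < q < 1 & forall b n, d' <= b <= L ->
  trig b n <= M * q ^+ n].
Variables (k : nat) (z e : R).
Hypothesis z_gt0 : 0 < z.
Hypothesis e_gt0 : 0 < e.
Hypothesis k_large : 4 <= k.+1%:R * (beta / 2).

(** The prefactor [t * H t] is [m_fun ell beta t] for [t > 0], and [n * H t] measures [n] in units
    of the number of steps typically needed to reach level [t]. *)
Definition renewal_weight t n : R := t * H t * damped_weight k z e (n%:R * H t).
Definition weighted_window h N t x : R :=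
 weighted_mean mu F tau A B (renewal_weight t) N (window_indicator h x).

Let H0 t : 0 < H t. Proof. exact: (tail_gt0 tau_meas ell_sv tau_tail). Qed.
Let H1 t : H t <= 1. Proof. exact: (tail_le1 mu tau_meas). Qed.

Let nH t (n : nat) : 0 <= n%:R * H t. Proof. by rewrite mulr_ge0 ?ler0n ?(ltW (H0 _)). Qed.

Let rw0 t n : 0 <= t -> 0 <= renewal_weight t n.
Proof.
move=> t0; rewrite /renewal_weight; apply: mulr_ge0; first by rewrite mulr_ge0 ?(ltW (H0 _)).
by apply: damped_weight_ge0; [exact: ltW|exact: nH].
Qed.

Let pow4_le (x : R) : 1 <= x -> x ^- 4 <= 4 * (1 + x ^+ 2) ^- 2.
Proof.
move=> x1; have x0 : 0 < x by exact: lt_le_trans x1.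
have q0 : 0 < (1 + x ^+ 2) ^+ 2 by rewrite exprn_gt0// ltr_wpDr ?sqr_ge0.
rewrite (ler_pdivlMr _ _ q0) mulrC ler_pdivrMr ?exprn_gt0//.
have -> : 4 * x ^+ 4 = (2 * x ^+ 2) ^+ 2 by ring.
have x2 : 1 <= x ^+ 2 by rewrite exprn_ege1.
by rewrite lerXn2r// ?nnegrE; lra.
Qed.

Let trig_sum N t b : 0 <= t ->
 `|weighted_mean mu F tau A B (renewal_weight t) N (fun x => cos (b * x))| +
 `|weighted_mean mu F tau A B (renewal_weight t) N (fun x => sin (b * x))| <=
 \sum_(n < N) renewal_weight t n *
  trig b n.
Proof.
move=> t0; have w0 n := rw0 n t0.
under [leRHS]eq_bigr do rewrite mulrDr; rewrite big_split/=; apply: lerD.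
 by rewrite (le_trans (ler_norm_sum _ _ _))//; apply: ler_sum => n _; rewrite normrM ger0_norm.
by rewrite (le_trans (ler_norm_sum _ _ _))//; apply: ler_sum => n _; rewrite normrM ger0_norm.
Qed.

(** Potter with exponent [beta / 2]; [k_large] turns the power [k + 1] into decay of order 4. *)
Let tail_pow : exists C t0, [/\ 0 < C, 1 <= t0 & forall t x, t0 <= t -> 1 <= x ->
 H (x * t) ^+ k.+1 <= C * x ^- 4 * H t ^+ k.+1].
Proof.
have /andP[be0 be1] := beta01.
have [C [t0 [C1 t01 hP]]] := @potter _ _ _ _ _ _ _ tau_meas ell_sv tau_tail (beta / 2) 1
 ltac:(rewrite be1 andbT; lra).
have C0' : 0 < C by exact: lt_le_trans C1.
exists (C ^+ k.+1), t0; split; rewrite ?exprn_gt0//.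
move=> t x tt x1; have [_ hx] := hP _ _ tt x1; have x0 : 0 < x by exact: lt_le_trans x1.
apply: (@le_trans _ _ ((C * x `^ (- (beta / 2)) * H t) ^+ k.+1)).
 by rewrite lerXn2r ?nnegrE ?mulr_ge0 ?powR_ge0 ?(ltW (H0 _)) ?(ltW C0').
rewrite !exprMn ler_wpM2r ?exprn_ge0 ?(ltW (H0 _))// ler_wpM2l ?exprn_ge0 ?(ltW C0')//.
rewrite -powR_mulrn ?powR_ge0// -powRrM -(powR_mulrn 4 (ltW x0)) -powRN.
by apply: ler_powR => //; rewrite mulNr lerN2 mulrC.
Qed.

Let tail_decay : exists C t0, [/\ 0 < C, 1 <= t0 & forall t, t0 <= t -> H t ^+ k.+1 <= C * t ^- 4].
Proof.
have [C [t0 [C1 t01 hP]]] := tail_pow; have t00 : 0 < t0 by exact: lt_le_trans t01.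
exists (C * t0 ^+ 4), t0; split => //; first by rewrite mulr_gt0// exprn_gt0.
move=> t tt; have x1 : 1 <= t / t0 by rewrite ler_pdivlMr// mul1r.
have := hP t0 _ (lexx _) x1; rewrite divfK ?gt_eqF// => h; rewrite (le_trans h)//.
have t_0 : 0 < t by exact: lt_le_trans tt.
have K0 : 0 <= C * (t / t0) ^- 4 by rewrite mulr_ge0 ?invr_ge0 ?exprn_ge0 ?divr_ge0 ?(ltW C1) ?(ltW t_0) ?(ltW t00).
rewrite (le_trans (ler_piMr K0 _)) ?exprn_ile1 ?(ltW (H0 _)) ?H1//.
by apply: eq_ler; field; rewrite !gt_eqF.
Qed.

Let weight_pow t n : 0 < t -> renewal_weight t n <= t * z ^+ k * H t ^+ k.+1 * n%:R ^+ k.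
Proof.
move=> t0; rewrite /renewal_weight.
have tH : 0 <= t * H t by rewrite mulr_ge0 ?ltW.
rewrite (le_trans (ler_wpM2l tH (damped_weight_le_pow k (ltW z_gt0) (ltW e_gt0) _))) ?nH//.
by apply: eq_ler; rewrite !exprMn exprS; ring.
Qed.

(** Contributions decaying exponentially in [n] only see the weight near 0, where it vanishes to
    order [k]; they are therefore of order [t (H t)^(k+1) = O(t^-3)]. *)
Let geometric_part (q M : R) : 0 < q < 1 -> 0 <= M -> exists K t0, [/\ 0 < K, 1 <= t0 &
 forall t N, t0 <= t -> \sum_(n < N) renewal_weight t n * (M * q ^+ n) <= K * t ^- 3].
Proof.
move=> q01 M0; have /andP[q0 q1] := q01.
have [C [t0 [C1 t01 hd]]] := tail_decay; have [K K0 hK] := pow_geometric_sum k q01.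
exists (M * z ^+ k * C * K + 1), t0; split => //.
 by rewrite ltr_wpDl// !mulr_ge0 ?exprn_ge0 ?(ltW z_gt0) ?(ltW C1).
move=> t N tt; have t_0 : 0 < t by rewrite (lt_le_trans _ tt)// (lt_le_trans ltr01).
apply: (@le_trans _ _ (\sum_(n < N) M * t * z ^+ k * (C * t ^- 4) * (n%:R ^+ k * q ^+ n))).
 apply: ler_sum => n _.
 have Mq : 0 <= M * q ^+ n by rewrite mulr_ge0// exprn_ge0// ltW.
 rewrite (le_trans (ler_wpM2r Mq (weight_pow n t_0)))//.
 rewrite [leLHS](_ : _ = (M * t * z ^+ k * (n%:R ^+ k * q ^+ n)) * H t ^+ k.+1); last by ring.
 rewrite [leRHS](_ : _ = (M * t * z ^+ k * (n%:R ^+ k * q ^+ n)) * (C * t ^- 4)); last by ring.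
 by rewrite ler_wpM2l ?hd// !mulr_ge0 ?exprn_ge0 ?(ltW z_gt0) ?(ltW t_0) ?(ltW q0).
rewrite -mulr_sumr; have P0 : 0 <= M * t * z ^+ k * (C * t ^- 4).
 by rewrite !mulr_ge0 ?invr_ge0 ?exprn_ge0 ?(ltW z_gt0) ?(ltW t_0) ?(ltW C1).
rewrite (le_trans (ler_wpM2l P0 (hK N)))//.
have -> : M * t * z ^+ k * (C * t ^- 4) * K = M * z ^+ k * C * K * t ^- 3.
 by field; rewrite gt_eqF.
by rewrite mulrDl mul1r lerDl invr_ge0 exprn_ge0// ltW.
Qed.

(** For [b >= 1 / t] the sum is of order [t (H t / H (1 / b))^(k+1)], that is [O(t (t b)^-4)] by
    Potter between [1 / b] and [t]. This is the gain from damping small [n]. *)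
Let near_part : exists K t0 b1, [/\ 0 < K, 1 <= t0, 0 < b1 &
 forall t b N, t0 <= t -> 1 <= t * b -> b <= b1 ->
  \sum_(n < N) renewal_weight t n * (C0 * expR (- c0 * (n%:R * H b^-1))) <=
  K * (t / (1 + (t * b) ^+ 2) ^+ 2)].
Proof.
have [C [t0 [C1 t01 hP]]] := tail_pow; have t00 : 0 < t0 by exact: lt_le_trans t01.
pose K := k%:R ^+ k * (2 / c0) ^+ k * ((c0 + 2) / c0).
have K0 : 0 <= K by rewrite !mulr_ge0 ?exprn_ge0 ?divr_ge0 ?invr_ge0 ?addr_ge0 ?(ltW c0_gt0).
have P1 : 0 <= C0 * z ^+ k * C by rewrite !mulr_ge0 ?exprn_ge0 ?(ltW z_gt0) ?(ltW C1) ?(ltW C0_gt0).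
exists (4 * (C0 * z ^+ k * C * K) + 1), t0, t0^-1; split => //.
- by rewrite ltr_wpDl// mulr_ge0// mulr_ge0.
- by rewrite invr_gt0.
move=> t b N tt x1 bb; have t_0 : 0 < t by exact: lt_le_trans tt.
have b_0 : 0 < b by rewrite -(pmulr_rgt0 _ t_0) (lt_le_trans ltr01).
have bV : t0 <= b^-1 by rewrite -[leLHS]invrK lef_pV2 ?posrE ?invr_gt0.
have := hP _ _ bV x1; rewrite mulfK ?gt_eqF// => hH.
set x := t * b in x1 hH *; set hb := H b^-1 in hH *.
have hb0 : 0 < hb by exact: H0.
have hb1 : 0 < hb <= 1 by rewrite hb0 H1.
apply: (@le_trans _ _ (\sum_(n < N) C0 * t * z ^+ k * H t ^+ k.+1 * (n%:R ^+ k * expR (- (c0 * (n%:R * hb)))))).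
 apply: ler_sum => n _.
 have Ce : 0 <= C0 * expR (- c0 * (n%:R * hb)) by rewrite mulr_ge0 ?expR_ge0 ?ltW.
 rewrite (le_trans (ler_wpM2r Ce (weight_pow n t_0)))// mulNr.
 by apply: eq_ler; ring.
have P0 : 0 <= C0 * t * z ^+ k by rewrite !mulr_ge0 ?exprn_ge0 ?(ltW z_gt0) ?(ltW t_0) ?(ltW C0_gt0).
rewrite -mulr_sumr (le_trans (ler_wpM2l _ (pow_exp_sum_le k N c0_gt0 hb1)))//.
 by rewrite mulr_ge0// exprn_ge0// ltW.
rewrite -/K; have hbk : 0 < hb ^+ k.+1 by rewrite exprn_gt0.
apply: (@le_trans _ _ (C0 * t * z ^+ k * (C * x ^- 4) * K)).
 rewrite [leLHS](_ : _ = C0 * t * z ^+ k * K * (H t ^+ k.+1 / hb ^+ k.+1)); last by ring.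
 rewrite [leRHS](_ : _ = C0 * t * z ^+ k * K * (C * x ^- 4)); last by ring.
 have PK : 0 <= C0 * t * z ^+ k * K by exact: mulr_ge0.
 by rewrite (ler_wpM2l PK)// ler_pdivrMr.
have x0 : 0 < x by exact: lt_le_trans x1.
have hx : x ^- 4 <= 4 * (1 + x ^+ 2) ^- 2 by exact: pow4_le.
rewrite [leLHS](_ : _ = C0 * z ^+ k * C * K * t * x ^- 4); last by ring.
have Q0 : 0 <= C0 * z ^+ k * C * K by rewrite mulr_ge0.
have Q1 := mulr_ge0 Q0 (ltW t_0).
rewrite (le_trans (ler_wpM2l Q1 hx))//.
rewrite [leLHS](_ : _ = 4 * (C0 * z ^+ k * C * K) * (t / (1 + x ^+ 2) ^+ 2)); last by ring.
have q0 : 0 <= t / (1 + x ^+ 2) ^+ 2 by rewrite divr_ge0 ?(ltW t_0)//; exact: sqr_ge0.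
by rewrite (ler_wpM2r q0)// lerDl.
Qed.

(** For [t b <= 1] no cancellation is used: the factor [e^(- e n H t)] alone makes the sum of the
    weights [O(t)]. *)
Let trivial_part t b N : 0 < t -> 0 <= t * b <= 1 ->
 \sum_(n < N) renewal_weight t n *
  trig b n <=
 8 * (1 + e) / e * (t / (1 + (t * b) ^+ 2) ^+ 2).
Proof.
move=> t0 /andP[x0 x1]; set x := t * b in x0 x1 *.
have bnd n (f : R -> R) : mfunT f -> (forall y, `|f y| <= 1) -> `|marked n f| <= 1.
 move=> mf f1; have bf : bounded_meas f by split => //; exists 1.
 have bc (c : R) : bounded_meas (fun=> c) by split => //; exists `|c|.
 have i1 : \int[mu]_y (\1_(visit F A B n) y * 1) <= 1.
  rewrite -[leRHS](Rintegral_cst1 mu 1); apply: Rintegral_le.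
  - exact: (rintegrable_marked F_mp tau_meas mA mB n (bc 1)).
  - exact: rintegrable_cst.
  - by move=> y; rewrite mulr1 indicE lern1 leq_b1.
 rewrite ler_norml; apply/andP; split.
  rewrite (le_trans (y := marked n (fun=> - 1)))//.
   have := marked_meanZ F_mp tau_meas mA mB n (- 1) (bc 1); rewrite mulN1r => ->.
   by rewrite mulN1r lerN2.
  by apply: marked_mean_le => // y; have := f1 y; rewrite ler_norml => /andP[].
 rewrite (le_trans _ i1)//; apply: (marked_mean_le F_mp tau_meas mA mB n bf (bc 1)) => y.
 by have := f1 y; rewrite ler_norml => /andP[].
have eH : 0 < e * H t by rewrite mulr_gt0.
apply: (@le_trans _ _ (\sum_(n < N) 2 * (t * H t) * expR (- (e * H t * n%:R)))).
 apply: ler_sum => n _.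
 rewrite [leRHS](_ : _ = t * H t * expR (- (e * (n%:R * H t))) * 2); last first.
  by rewrite (_ : e * H t * n%:R = e * (n%:R * H t)); ring.
 apply: ler_pM; rewrite ?addr_ge0//.
 - exact: rw0 (ltW t0).
 - rewrite ler_wpM2l ?mulr_ge0 ?(ltW t0) ?(ltW (H0 _))// damped_weight_le_exp ?(ltW z_gt0) ?nH//.
 - rewrite (_ : 2 = 1 + 1)//; apply: lerD; apply: bnd.
  + by apply: (measurableT_comp measurable_cosR); exact: measurable_funM.
  + by move=> y; rewrite ler_norml cos_geN1 cos_le1.
  + by apply: (measurableT_comp measurable_sinR); exact: measurable_funM.
  + by move=> y; rewrite ler_norml sin_geN1 sin_le1.
rewrite -mulr_sumr (le_trans (ler_wpM2l _ (exp_sum_le N eH)))//.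
 by rewrite !mulr_ge0 ?(ltW t0) ?(ltW (H0 _)).
have -> : 2 * (t * H t) * ((1 + e * H t) / (e * H t)) = 2 * (1 + e * H t) / e * t.
 by field; rewrite !gt_eqF.
apply: (@le_trans _ _ (2 * (1 + e) / e * t)).
 by rewrite ler_wpM2r ?(ltW t0)// ler_wpM2r ?invr_ge0 ?(ltW e_gt0)// ler_wpM2l// lerD2l ler_piMr// ltW.
have K0 : 0 <= 2 * (1 + e) / e by rewrite divr_ge0 ?mulr_ge0 ?addr_ge0 ?(ltW e_gt0).
have -> : 8 * (1 + e) / e * (t / (1 + x ^+ 2) ^+ 2) = 2 * (1 + e) / e * (t * (4 / (1 + x ^+ 2) ^+ 2)) by ring.
rewrite ler_wpM2l// ler_peMr ?(ltW t0)// ler_pdivlMr ?exprn_gt0 ?ltr_wpDr ?sqr_ge0// mul1r.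
rewrite (_ : 4 = 2 ^+ 2); last by ring.
rewrite lerXn2r ?nnegrE ?addr_ge0 ?sqr_ge0// (_ : 2 = 1 + 1)// lerD2l.
exact: exprn_ile1.
Qed.

(** The second term collects the errors exponentially small in [n]; its factor [L^-2] keeps its mass
    and first moment over []0, L]] of the same order as those of the first term, whatever [L]. *)
Definition majorant t L b : R := t / (1 + (t * b) ^+ 2) ^+ 2 + (t * L ^+ 2)^-1.

(** Three regimes: [b] below [1 / t], from [1 / t] to a fixed [r], and from [r] to [L]. Only the
    threshold [t0] depends on [L], not the constant [C], so that the bandwidth may be chosen after
    [C]. *)
Lemma fourier_majorant : exists2 C, 0 < C & forall L, 1 <= L -> exists2 t0, 1 <= t0 &
 forall t N b, t0 <= t -> 0 < b <= L ->
 `|weighted_mean mu F tau A B (renewal_weight t) N (fun x => cos (b * x))| +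
 `|weighted_mean mu F tau A B (renewal_weight t) N (fun x => sin (b * x))| <=
 C * majorant t L b.
Proof.
have [K [t1 [b1 [K0 t11 b10 hnear]]]] := near_part.
pose r := Num.min r0 b1; have r_0 : 0 < r by rewrite lt_min r0_gt0.
have E0 : 0 < 8 * (1 + e) / e by rewrite divr_gt0// mulr_gt0// addr_gt0.
pose C := K + 8 * (1 + e) / e + 1.
have C_gt0 : 0 < C by rewrite !addr_gt0.
exists C => // L L1; have L0 : 0 < L by exact: lt_le_trans L1.
have [K2 [t2 [K20 t21 hgeo]]] := geometric_part th01 (ltW C0_gt0).
have [K3 [t3 [K30 t31 hfar]]] : exists K3 t3, [/\ 0 < K3, 1 <= t3 & forall t N b, t3 <= t -> r <= b <= L ->
  \sum_(n < N) renewal_weight t n *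
  trig b n <= K3 * t ^- 3].
 have [rL|Lr] := leP r L; last first.
  exists 1, 1; split => // t N b _ /andP[rb bL].
  by have := lt_le_trans Lr (le_trans rb bL); rewrite ltxx.
 have [M [q [M0 q01 hMq]]] := fourier_far r_0 rL.
 have [K3 [t3 [K30 t31 h3]]] := geometric_part q01 M0.
 exists K3, t3; split => // t N b tt bb; rewrite (le_trans _ (h3 _ N tt))//.
 apply: ler_sum => n _; rewrite ler_wpM2l ?hMq//.
 have t_0 : 0 < t by rewrite (lt_le_trans _ tt)// (lt_le_trans ltr01).
 exact: rw0 (ltW t_0).
pose t4 := (K2 + K3) * L ^+ 2.
have t40 : 0 <= t4 by rewrite mulr_ge0 ?addr_ge0 ?sqr_ge0 ?ltW.
exists (1 + t1 + t2 + t3 + t4); first by lra.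
move=> t N b tt /andP[b_0 bL].
have [tt1 tt2 tt3 tt4] : [/\ t1 <= t, t2 <= t, t3 <= t & t4 <= t] by split; lra.
have t_1 : 1 <= t by lra.
have t_0 : 0 < t by exact: lt_le_trans t_1.
rewrite (le_trans (trig_sum N b (ltW t_0)))//.
have den : 0 < (1 + (t * b) ^+ 2) ^+ 2 by rewrite exprn_gt0// ltr_wpDr ?sqr_ge0.
have maj1 : 0 <= t / (1 + (t * b) ^+ 2) ^+ 2 by rewrite divr_ge0 ?(ltW t_0) ?(ltW den).
have maj2 : 0 <= (t * L ^+ 2)^-1 by rewrite invr_ge0 mulr_ge0 ?sqr_ge0 ?(ltW t_0).
have small Q : 0 <= Q -> Q <= K2 + K3 -> Q * t ^- 3 <= (t * L ^+ 2)^-1.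
 move=> Q0 hQ; rewrite -[leRHS]div1r ler_pdivlMr ?mulr_gt0 ?exprn_gt0//.
 have -> : Q * t ^- 3 * (t * L ^+ 2) = Q * L ^+ 2 / t ^+ 2 by field; rewrite gt_eqF.
 rewrite ler_pdivrMr ?exprn_gt0// mul1r.
 rewrite (le_trans (ler_wpM2r (sqr_ge0 _) hQ))// (le_trans tt4)//.
 by rewrite expr2 ler_peMl ?(ltW t_0).
have maj_ge : forall a b', 0 <= a -> 0 <= b' -> a <= C -> b' <= 1 ->
  a * (t / (1 + (t * b) ^+ 2) ^+ 2) + b' * (t * L ^+ 2)^-1 <= C * majorant t L b.
 move=> a b' a0 b'0 aC b'1; rewrite /majorant mulrDr; apply: lerD; first by rewrite ler_wpM2r.
 by rewrite ler_wpM2r// (le_trans b'1)// /C lerDr addr_ge0 ?(ltW K0) ?(ltW E0).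
have [x1|x1] := leP (t * b) 1.
 have x01 : 0 <= t * b <= 1 by rewrite x1 mulr_ge0 ?ltW.
 rewrite (le_trans (trivial_part N t_0 x01))//.
 have := maj_ge (8 * (1 + e) / e) 0 (ltW E0) (lexx _); rewrite mul0r addr0; apply => //.
 by rewrite /C addrAC lerDr addr_ge0// ltW.
have [br|rb] := leP b r; last first.
 have rbL : r <= b <= L by rewrite (ltW rb).
 rewrite (le_trans (hfar t N b tt3 rbL))//.
 have := maj_ge 0 1 (lexx _) ler01; rewrite mul0r add0r mul1r => hm.
 by rewrite (le_trans _ (hm _ _)) ?(ltW C_gt0)// small ?(ltW K30)// lerDr ltW.
have /andP[br0 bb1] : (b <= r0) && (b <= b1) by rewrite -le_min.
apply: (@le_trans _ _ (\sum_(n < N) (renewal_weight t n * (C0 * expR (- c0 * (n%:R * H b^-1))) +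
  renewal_weight t n * (C0 * th ^+ n)))).
 apply: ler_sum => n _; rewrite -mulrDr ler_wpM2l//.
  exact: rw0 (ltW t_0).
 by rewrite -mulrDr fourier_near// b_0.
rewrite big_split/= (le_trans (lerD (hnear _ _ N tt1 (ltW x1) bb1) (hgeo _ N tt2)))//.
have := maj_ge K 1 (ltW K0) ler01; rewrite mul1r => hm.
rewrite (le_trans _ (hm _ _))//.
 by rewrite lerD2l small ?(ltW K20)// lerDl ltW.
by rewrite /C -addrA lerDl addr_ge0// ltW.
Qed.

Lemma majorant_bounds t L : 1 <= t -> 1 <= L ->
 [/\ leb.-integrable `]0, L] (EFin \o majorant t L),
   \int[leb]_(b in `]0, L]) majorant t L b <= 4 &
   \int[leb]_(b in `]0, L]) (b * majorant t L b) <= 2 / t].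
Proof.
move=> t1 L1; have t_0 : 0 < t by exact: lt_le_trans t1. have L0 : 0 < L by exact: lt_le_trans L1.
have q0 (b : R) : 0 < 1 + (t * b) ^+ 2 by rewrite ltr_wpDr ?sqr_ge0.
have dq (b : R) : is_derive b 1 (fun b : R => 1 + (t * b) ^+ 2) (2 * t ^+ 2 * b).
 have h1 : is_derive b 1 (fun y : R => t * y) t.
  by have := is_deriveZ t (is_derive_id b (1 : R)); rewrite /GRing.scale/= mulr1.
 have := is_deriveD (is_derive_cst (1 : R) b (1 : R)) (is_deriveX 2 h1).
 rewrite add0r (_ : (2%:R * (t * b) ^+ 2.-1) *: t = 2 * t ^+ 2 * b)//.
 by rewrite /GRing.scale/= expr1; ring.
have cq (b : R) : {for b, continuous (fun b : R => 1 + (t * b) ^+ 2)} by exact: (continuous_derive (dq b)).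
have cm (b : R) : {for b, continuous (majorant t L)}.
 apply: cvgD; last exact: cvg_cst.
 apply: cvgM; first exact: cvg_cst.
 apply: cvgV; first by rewrite gt_eqF// exprn_gt0.
 by under eq_fun do rewrite expr2; rewrite expr2; apply: cvgM; exact: cq.
have im : leb.-integrable `[0, L] (EFin \o majorant t L).
 by apply: (@integrable_itv _ _ (- 1)) => // b _; exact: cm.
have cbm (b : R) : {for b, continuous (fun b : R => b * majorant t L b)}.
 by apply: cvgM; [exact: cvg_id|exact: cm].
have ibm : leb.-integrable `[0, L] (EFin \o (fun b => b * majorant t L b)).
 by apply: (@integrable_itv _ _ (- 1)) => // b _; exact: cbm.
have sub : `]0, L]%classic `<=` (`[0, L]%classic : set R) by apply: subset_itvr; rewrite bnd_simp.
have im' : leb.-integrable `]0, L] (EFin \o majorant t L) by apply: (integrableS _ _ _ im).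
have ibm' : leb.-integrable `]0, L] (EFin \o (fun b => b * majorant t L b)) by apply: (integrableS _ _ _ ibm).
split => //.
 rewrite Rintegral_itv_obnd_cbnd//.
 (* One factor [1 + (t b)^2] is dropped to reach the derivative of [atan (t b)]. *)
 pose f (b : R) := t / (1 + (t * b) ^+ 2) + (t * L ^+ 2)^-1.
 pose G (b : R) := atan (t * b) + (t * L ^+ 2)^-1 * b.
 have dG (b : R) : - 1 < b -> is_derive b 1 G (f b).
  move=> _; have h1 : is_derive b 1 (fun y : R => t * y) t.
   by have := is_deriveZ t (is_derive_id b (1 : R)); rewrite /GRing.scale/= mulr1.
  have h2 := is_derive1_comp (is_derive1_atan (t * b)) h1.
  have h3 := is_deriveZ (t * L ^+ 2)^-1 (is_derive_id b (1 : R)).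
  have := is_deriveD h2 h3; rewrite /GRing.scale/= mulr1.
  by rewrite (_ : (1 + (t * b) ^+ 2)^-1 * t = t / (1 + (t * b) ^+ 2)) // mulrC.
 have cf (b : R) : - 1 < b -> {for b, continuous f}.
  move=> _; apply: cvgD; last exact: cvg_cst.
  by apply: cvgM; [exact: cvg_cst|apply: cvgV; [rewrite gt_eqF|exact: cq]].
 have if' := integrable_itv L (ltrN10 R) cf.
 rewrite (le_trans (le_Rintegral _ im if' _))//.
  move=> b _; rewrite /majorant /f lerD2r ler_wpM2l ?(ltW t_0)// lef_pV2 ?posrE ?exprn_gt0//.
  by rewrite expr2 ler_peMl ?(ltW (q0 b))// lerDl sqr_ge0.
 rewrite (FTC_itvR (ltrN10 R) (ltW L0) dG cf) /G !mulr0 atan0 add0r subr0.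
 have a1 : atan (t * L) <= 2.
  by rewrite (le_trans (ltW (atan_ltpi2 _)))//; have /andP[_ /ltW] := pihalf_02 R.
 have a2 : (t * L ^+ 2)^-1 * L <= 1.
  rewrite -div1r mulrAC mul1r ler_pdivrMr ?mulr_gt0 ?exprn_gt0// mul1r expr2 mulrA.
  by rewrite ler_peMl ?(ltW L0)// mulr_ege1.
 lra.
rewrite Rintegral_itv_obnd_cbnd//.
pose G (b : R) := - (2 * t)^-1 * (1 + (t * b) ^+ 2)^-1 + (2 * t * L ^+ 2)^-1 * b ^+ 2.
have dG (b : R) : - 1 < b -> is_derive b 1 G (b * majorant t L b).
 move=> _; have n0 : 1 + (t * b) ^+ 2 != 0 by rewrite gt_eqF.
 have h1 := is_deriveZ (- (2 * t)^-1) (@realfun.is_deriveV R (fun b : R => 1 + (t * b) ^+ 2) b _ 1 n0 (dq b)).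
 have h2 := is_deriveZ (2 * t * L ^+ 2)^-1 (is_deriveX 2 (is_derive_id b (1 : R))).
 have := is_deriveD h1 h2; rewrite /GRing.scale/= expr1.
 set u := (X in is_derive _ _ _ X).
 have -> // : u = b * majorant t L b.
 rewrite /u /majorant.
 field; rewrite !gt_eqF//=.
have cbm' (b : R) : - 1 < b -> {for b, continuous (fun b : R => b * majorant t L b)} by move=> _; exact: cbm.
rewrite (FTC_itvR (ltrN10 R) (ltW L0) dG cbm') /G mulr0 expr0n/= mulr0 !addr0 invr1 mulr1.
have p1 : 0 <= (2 * t)^-1 * (1 + (t * L) ^+ 2)^-1 by rewrite mulr_ge0 ?invr_ge0 ?(ltW (q0 _)) ?mulr_ge0 ?(ltW t_0).
have -> : (2 * t * L ^+ 2)^-1 * L ^+ 2 = (2 * t)^-1 by field; rewrite !gt_eqF.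
have -> : 2 / t = 4 * (2 * t)^-1 by field; rewrite gt_eqF.
have p2 : 0 <= (2 * t)^-1 by rewrite invr_ge0 mulr_ge0 ?ltW.
rewrite mulNr; lra.
Qed.

(** Boundedness uses bandwidth 1. For regularity the bandwidth [l^2] is chosen after [eps], so that
    the smoothing error [O(1 / l)] is below [eps]; the Lipschitz constant [C / t] is unaffected,
    because the first moment of the majorant is [O(1 / t)] for every [L]. *)
Lemma weighted_window_regular h : 0 < h -> exists C t0, [/\ 0 < C, 1 <= t0,
 (forall t N x, t0 <= t -> weighted_window h N t x <= C) &
 forall eps, 0 < eps -> exists t1, forall t N x x', t1 <= t ->
  `|weighted_window h N t x - weighted_window h N t x'| <= C * `|x - x'| / t + eps].
Proof.
move=> h0; have [C C0' hC] := fourier_majorant.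
have w0 t n : 1 <= t -> 0 <= renewal_weight t n.
 move=> t1; have t_0 : 0 < t by exact: lt_le_trans t1.
 exact: rw0 (ltW t_0).
have majZ t L : 1 <= t -> 1 <= L -> [/\ leb.-integrable `]0, L] (EFin \o (fun b => C * majorant t L b)),
  \int[leb]_(b in `]0, L]) (C * majorant t L b) <= C * 4,
  \int[leb]_(b in `]0, L]) (b * (C * majorant t L b)) <= C * (2 / t) &
  forall b, 0 <= C * majorant t L b].
 move=> t1 L1; have t_0 : 0 < t by exact: lt_le_trans t1. have L0 : 0 < L by exact: lt_le_trans L1.
 have [i1 h1 h2] := majorant_bounds t1 L1.
 have m0 b : 0 <= majorant t L b.
  rewrite addr_ge0 ?divr_ge0 ?invr_ge0 ?(ltW t_0)//; first exact: sqr_ge0.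
  by rewrite mulr_ge0 ?sqr_ge0 ?(ltW t_0).
 split.
 - by apply: eq_integrable (integrableZl _ C i1) => // b _; rewrite /= EFinM.
 - by rewrite RintegralZl// ler_wpM2l// ltW.
 - have ib : leb.-integrable `]0, L] (EFin \o (fun b => b * majorant t L b)).
   apply: (le_integrable _ _ _ (integrableZl _ L i1)) => //.
    by apply/measurable_EFinP; apply: measurable_funM => //; case/integrableP : i1 => /measurable_EFinP.
   move=> b /=; rewrite in_itv/= => /andP[b0 bL]; rewrite lee_fin !normrM ler_wpM2r//.
   by rewrite (gtr0_norm b0) (gtr0_norm L0).
  rewrite (_ : Rintegral _ _ _ = \int[leb]_(b in `]0, L]) (C * (b * majorant t L b))); last first.
   by apply: eq_Rintegral => b _; ring.
  by rewrite RintegralZl// ler_wpM2l// ltW.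
 - by move=> b; rewrite mulr_ge0// ltW.
have [t0 t01 ht0] := hC 1 (lexx _).
have K1 : 0 <= (h + pi) ^+ 2 * (C * 4) by apply: mulr_ge0; [exact: sqr_ge0|rewrite mulr_ge0// ltW].
exists ((h + pi) ^+ 2 * (C * 4) + 8 * h * C + 1), t0; split => //.
- by rewrite ltr_wpDl// addr_ge0// !mulr_ge0 ?(ltW h0) ?(ltW C0').
- move=> t N x tt; have t1 := le_trans t01 tt.
 have [i1 h1 h2 m0] := majZ t 1 t1 (lexx _).
 have hm b : 0 < b <= 1 -> _ := ht0 t N b tt.
 rewrite (le_trans (weighted_mean_window F_mp tau_meas mA mB (fun n => w0 t n t1) i1 m0 hm h1 x h0 (lexx _)))//.
 by rewrite -addrA lerDl addr_ge0// !mulr_ge0 ?(ltW h0) ?(ltW C0').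
move=> eps eps0.
pose l : R := 1 + 128 * (h + 1) * (C * 4) / eps.
have l1 : 1 <= l by rewrite lerDl divr_ge0 ?(ltW eps0)// !mulr_ge0 ?addr_ge0 ?(ltW h0) ?(ltW C0').
have l0 : 0 < l by exact: lt_le_trans l1.
have L1 : 1 <= l ^+ 2 by rewrite exprn_ege1.
have lL : 0 < l <= l ^+ 2 by rewrite l0 expr2 ler_peMr// ltW.
have [t1 t11 ht1] := hC _ L1; exists t1 => t N x x' tt; have tt1 := le_trans t11 tt.
have t_0 : 0 < t by exact: lt_le_trans tt1.
have [i1 h1 h2 m0] := majZ t _ tt1 L1.
have hm b : 0 < b <= l ^+ 2 -> _ := ht1 t N b tt.
have L0 : 0 < l ^+ 2 by exact: lt_le_trans L1.
rewrite (le_trans (weighted_mean_window_diff F_mp tau_meas mA mB (fun n => w0 t n tt1) L0 i1 m0 hm h1 h2 x x' h0 lL erefl))//.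
apply: lerD.
 rewrite [leLHS](_ : _ = 8 * h * C * (`|x - x'| / t)); last by ring.
 rewrite -[leRHS]mulrA; have q0 : 0 <= `|x - x'| / t by rewrite divr_ge0// ltW.
 by rewrite (ler_wpM2r q0)// addrAC lerDr addr_ge0.
by rewrite mulrA ler_pdivrMr// [leRHS]mulrC -ler_pdivrMr// /l lerDr ler01.
Qed.

End local_estimate.

(** * Limits of Laplace transforms of damped sums *)

Section laplace_limit.
Context d (Y : measurableType d) (R : realType) (mu : probability Y R).
Variables (F : Y -> Y) (tau : Y -> R) (ell : R -> R) (beta : R) (A B : set Y).
Hypothesis tau_meas : mfunT tau.
Hypothesis tau_pos : forall y, 0 < tau y.
Hypothesis ell_sv : slowly_varying ell.
Hypothesis beta01 : 0 < beta < 1.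
Hypothesis tau_tail : forall t : R, 0 < t ->
 mu [set y | t < tau y] = (ell t * t `^ (- beta))%:E.
Local Notation H := (tail_fun mu tau).
Local Notation G := (laplace_defect mu tau).
Local Notation g := (gamma_const beta).
Local Notation c := (fine (mu A) * fine (mu B)).
Variables (C0 c0 th : R).
Hypothesis C0_gt0 : 0 < C0.
Hypothesis c0_gt0 : 0 < c0.
Hypothesis th01 : 0 < th < 1.

Definition laplace_mean n s : R := marked_mean mu F tau A B n (fun x => expR (- (s * x))).
Local Notation phi := laplace_mean.

Hypothesis laplace_near : forall e, 0 < e -> exists2 r, 0 < r & forall s n, 0 < s <= r ->
 `|phi n s - c * (1 - G s) ^+ n| <=
 e * ((1 + n%:R * H s^-1) * expR (- c0 * (n%:R * H s^-1))) + C0 * th ^+ n.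

Let H0 t : 0 < H t. Proof. exact: (tail_gt0 tau_meas ell_sv tau_tail). Qed.
Let H1 t : H t <= 1. Proof. exact: (tail_le1 mu tau_meas). Qed.

Lemma tail_cvg0 : H t @[t --> +oo] --> (0 : R).
Proof.
apply/cvgrPdist_le => e e0.
have [b1 b10 hb] := tail_small tau_meas ell_sv beta01 tau_tail e0.
near=> t; have tb : b1^-1 <= t by [].
have t0 : 0 < t by rewrite (lt_le_trans _ tb)// invr_gt0.
rewrite sub0r normrN gtr0_norm// -[t]invrK hb// invr_gt0 t0/=.
by rewrite -[leRHS]invrK lef_pV2// posrE invr_gt0.
Unshelve. all: end_near. Qed.

Let G01 s : 0 < s -> 0 < G s <= 1.
Proof.
move=> s0; apply/andP; split.
 have := exp_defect_lower mu tau_meas tau_pos s0; apply: lt_le_trans.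
 by rewrite mulr_gt0// subr_gt0 -expR0 ltr_expR oppr_lt0.
rewrite -[leRHS](Rintegral_cst1 mu 1); apply: Rintegral_le; last by move=> y; rewrite gerBl expR_ge0.
 apply: (rintegrable_bounded mu _ (M := 1)).
  apply: measurable_funB => //; apply: measurableT_comp => //; apply: measurableT_comp => //.
  exact: measurable_funM.
 move=> y; rewrite ger0_norm// subr_ge0 expRN_le1.
 by rewrite mulr_ge0// ltW.
exact: rintegrable_cst.
Qed.

Lemma gamma_const_gt0 : 0 < g.
Proof.
have h := laplace_defect_ratio tau_meas tau_pos ell_sv beta01 tau_tail ltr01.
rewrite powR1 mulr1 in h.
have e1 : 0 < 1 - expR (- 1) :> R by rewrite subr_gt0 -expR0 ltr_expR oppr_lt0.
set e := 1 - expR (- 1) in e1.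
have /cvgrPdist_lt/(_ (e / 2)) : (G (1 / t) / H t) @[t --> +oo] --> g by [].
rewrite divr_gt0// => /(_ isT) hn; near +oo_R => t.
have t0 : 0 < t by [].
have hd : `|g - G (1 / t) / H t| < e / 2 by near: t.
have := exp_defect_lower mu tau_meas tau_pos (divr_gt0 ltr01 t0).
rewrite invf_div divr1 -/e -ler_pdivlMr// => hl.
move: hd hl; rewrite /laplace_defect; set u := Rintegral _ _ _ / H t => hd hl.
by move: hd; rewrite ltr_norml => /andP[]; lra.
Unshelve. all: end_near. Qed.

Local Notation psum q sig t N := (H t * (\sum_(n < N) q (n%:R * H t) * phi n (sig / t))).

(** An iterated limit: [N] is sent to infinity for each fixed large [t], with no uniformity in
    [t]. *)
Definition laplace_limit sig (q : R -> R) l := forall e, 0 < e ->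
 \forall t \near +oo, \forall N \near \oo,
  `|psum q sig t N - l| <= e.

Lemma exp_defect_cvg kap : 0 <= kap ->
 ((1 - expR (- (kap * H t))) / H t) @[t --> +oo] --> kap.
Proof.
move=> k0; apply/cvgrPdist_le => e e0.
have K0 : 0 < kap ^+ 2 + 1 by rewrite ltr_wpDl// sqr_ge0.
have /cvgrPdist_le/(_ (e / (kap ^+ 2 + 1))) := tail_cvg0; rewrite divr_gt0// => /(_ isT) hn.
near=> t; have hH : `|0 - H t| <= e / (kap ^+ 2 + 1) by near: t.
move: hH; rewrite sub0r normrN gtr0_norm// ler_pdivlMr// => hH.
have Ht := H0 t; set x := kap * H t; have x0 : 0 <= x by rewrite mulr_ge0// ltW.
have u1 : 1 - expR (- x) <= x by have := expR_ge1Dx (- x); lra.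
have u2 : x - x ^+ 2 <= 1 - expR (- x).
 have x1 : 0 < 1 + x by rewrite ltr_wpDr.
 have : expR (- x) <= (1 + x)^-1 by rewrite expRN lef_pV2 ?posrE ?expR_gt0// expR_ge1Dx.
 have : (1 + x)^-1 <= 1 - x + x ^+ 2.
  rewrite -div1r ler_pdivrMr// -subr_ge0 (_ : _ - _ = x ^+ 3); last by ring.
  by rewrite exprn_ge0.
 lra.
rewrite -(ler_pM2r Ht) -{2}(gtr0_norm Ht) -normrM mulrBl divfK ?gt_eqF// -/x.
rewrite ger0_norm ?subr_ge0//; apply: (@le_trans _ _ (x ^+ 2)); first lra.
rewrite /x exprMn expr2 [H t ^+ 2]expr2 mulrA ler_wpM2r ?(ltW Ht)//.
by rewrite (le_trans _ hH)// -expr2 mulrC ler_wpM2l ?(ltW Ht)// lerDl.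
Unshelve. all: end_near. Qed.

(** Replacing [phi n] by its approximation leaves a geometric series of ratio [rho t], where
    [1 - rho t] is equivalent to [(kap + g sig^beta) H t]. The errors sum to
    [O(eps / H (t / sig)) + O(1)], and the prefactor [H t] makes both small, since the two tails are
    comparable. *)
Lemma laplace_limit_exp kap sig : 0 <= kap -> 0 < sig ->
 laplace_limit sig (fun y => expR (- (kap * y))) (c / (kap + g * sig `^ beta)).
Proof.
move=> k0 s0 e e0.
have gs0 : 0 < g * sig `^ beta by rewrite mulr_gt0 ?powR_gt0 ?gamma_const_gt0.
set Lm := kap + g * sig `^ beta; have Lm0 : 0 < Lm by rewrite ltr_wpDl.
have ca : 0 <= c by rewrite mulr_ge0// fine_ge0.
pose rho t := expR (- (kap * H t)) * (1 - G (sig / t)).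
pose Q t := (1 - rho t) / H t.
have hQ : Q t @[t --> +oo] --> Lm.
 have e1 := exp_defect_cvg k0.
 have e2 : (1 - expR (- (kap * H t))) @[t --> +oo] --> 0 * kap.
  rewrite (_ : (fun t => 1 - expR (- (kap * H t))) = fun t => H t * ((1 - expR (- (kap * H t))) / H t)).
   by apply: cvgM; [exact: tail_cvg0|exact: e1].
  by apply/funext => t; field; rewrite gt_eqF.
 have e3 := laplace_defect_ratio tau_meas tau_pos ell_sv beta01 tau_tail s0.
 have e4 : (1 - (1 - expR (- (kap * H t)))) @[t --> +oo] --> 1 - 0 * kap by apply: cvgB => //; exact: cvg_cst.
 have -> : Lm = kap + (1 - 0 * kap) * (g * sig `^ beta) by rewrite mul0r subr0 mul1r.
 have -> : Q = fun t => (1 - expR (- (kap * H t))) / H t + (1 - (1 - expR (- (kap * H t)))) * (G (sig / t) / H t).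
  by apply/funext => t; rewrite /Q /rho; field; rewrite gt_eqF.
 by apply: cvgD => //; exact: cvgM.
have hcQ : (c / Q t) @[t --> +oo] --> c / Lm.
 by apply: cvgM; [exact: cvg_cst|apply: cvgV => //; rewrite gt_eqF].
pose x0 := sig^-1 `^ (- beta); have x00 : 0 < x0 by rewrite powR_gt0// invr_gt0.
have hr : (H (sig^-1 * t) / H t) @[t --> +oo] --> x0.
 by apply: (tail_ratio tau_meas ell_sv tau_tail); rewrite invr_gt0.
(* [K / hh] bounds the sum of [(1 + n hh) e^(- c0 n hh)] for every [hh] in []0, 1]]. *)
pose K := (c0 + 2) / c0 * (1 + 2 / c0).
have K0 : 0 < K by rewrite mulr_gt0 ?divr_gt0 ?addr_gt0 ?divr_gt0.
have e40 : 0 < e / 4 by rewrite divr_gt0.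
pose eps := e / 4 * (x0 / 2) / K; have eps0 : 0 < eps by rewrite divr_gt0// mulr_gt0// divr_gt0.
have [r r_0 hr0] := laplace_near eps0.
have th1 : 0 < 1 - th by rewrite subr_gt0; case/andP : th01.
have /cvgrPdist_le/(_ _ e40) n1 := hcQ.
have x20 : 0 < x0 / 2 by rewrite divr_gt0.
have /cvgrPdist_le/(_ _ x20) n2 := hr.
pose D := C0 / (1 - th); have D0 : 0 < D by rewrite divr_gt0.
have eD : 0 < e / 4 / D by rewrite !divr_gt0.
have /cvgrPdist_le/(_ _ eD) n3 := tail_cvg0.
near=> t.
have h1 : `|c / Lm - c / Q t| <= e / 4 by near: t.
have h2 : `|x0 - H (sig^-1 * t) / H t| <= x0 / 2 by near: t.
have h3 : `|0 - H t| <= e / 4 / D by near: t.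
have st0 : 0 < sig / t by rewrite divr_gt0.
have st : 0 < sig / t <= r by rewrite st0/= ler_pdivrMr// mulrC -ler_pdivrMr.
have Ht := H0 t; have /andP[G0 G1] := G01 st0.
have hE : H (sig / t)^-1 = H (sig^-1 * t) by rewrite invf_div mulrC.
set hh := H (sig^-1 * t) in h2 hE; have hh0 : 0 < hh by exact: H0.
have hh1 : 0 < hh <= 1 by rewrite hh0 H1.
have hhH : x0 / 2 * H t <= hh.
 by rewrite -ler_pdivlMr//; move: h2; rewrite ler_norml => /andP[_]; set q := hh / _; lra.
have E1 : expR (- (kap * H t)) <= 1 by rewrite expRN_le1 mulr_ge0// ltW.
have rho0 : 0 <= rho t by rewrite mulr_ge0 ?expR_ge0// subr_ge0.
have rho1 : rho t < 1.
 rewrite (le_lt_trans (y := 1 - G (sig / t)))//; last by rewrite gtrBl.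
 by rewrite ler_piMl// subr_ge0.
have rV : 0 < 1 - rho t by rewrite subr_gt0.
have cQ : 0 <= c / Q t by rewrite divr_ge0// divr_ge0 ?ltW.
have hrN : (rho t) ^+ N @[N --> \oo] --> (0 : R) by apply: cvg_expr; rewrite ger0_norm.
have cQ1 : 0 < c / Q t + 1 by rewrite ltr_wpDl.
have eQ : 0 < e / 4 / (c / Q t + 1) by rewrite divr_gt0.
have /cvgrPdist_le/(_ _ eQ) n4 := hrN.
near=> N.
have h4 : `|0 - rho t ^+ N| <= e / 4 / (c / Q t + 1) by near: N.
move: h4; rewrite sub0r normrN ger0_norm ?exprn_ge0// ler_pdivlMr// => h4.
move: h3; rewrite sub0r normrN gtr0_norm// ler_pdivlMr// => h3.
set S := \sum_(n < N) _.
pose S' := \sum_(n < N) c * rho t ^+ n.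
have d1 : `|H t * S - H t * S'| <= e / 4 + e / 4.
 rewrite -mulrBr normrM (gtr0_norm Ht).
 have : `|S - S'| <= \sum_(n < N) (eps * (n%:R ^+ 0 * expR (- (c0 * (n%:R * hh)))) +
   eps * hh * (n%:R ^+ 1 * expR (- (c0 * (n%:R * hh)))) + C0 * th ^+ n).
  rewrite /S /S' -sumrB (le_trans (ler_norm_sum _ _ _))//; apply: ler_sum => n _.
  have -> : expR (- (kap * (n%:R * H t))) * phi n (sig / t) - c * rho t ^+ n =
    expR (- (kap * (n%:R * H t))) * (phi n (sig / t) - c * (1 - G (sig / t)) ^+ n).
   rewrite /rho exprMn -expRM_natl mulrBr; congr (_ - _).
   rewrite (_ : n%:R * - (kap * H t) = - (kap * (n%:R * H t))); last by ring.
   by ring.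
  rewrite normrM (ger0_norm (expR_ge0 _)) (le_trans (ler_piMl _ _))//.
   by rewrite expRN_le1 mulr_ge0// mulr_ge0 ?ler0n// ltW.
  rewrite (le_trans (hr0 _ n st))// hE mulNr; apply: eq_ler; ring.
 rewrite !big_split/= -!mulr_sumr mul1r => hS.
 have s0' := pow_exp_sum_le 0 N c0_gt0 hh1; have s1' := pow_exp_sum_le 1 N c0_gt0 hh1.
 rewrite !expr0 !mul1r expr1 in s0'; rewrite !expr1 mul1r in s1'.
 rewrite (eq_bigr (fun n : 'I_N => expR (- (c0 * (n%:R * hh))))) in s0'; last first.
  by move=> n _; rewrite expr0 mul1r.
 have s2' : \sum_(n < N) th ^+ n <= (1 - th)^-1.
  by apply: geometric_sum_le; have /andP[a b] := th01; rewrite ltW.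
 have eh : 0 <= eps * hh by rewrite mulr_ge0 ?ltW.
 have hS2 : `|S - S'| <= eps * K / hh + D.
  rewrite (le_trans hS)//; apply: lerD; last by rewrite /D ler_wpM2l ?(ltW C0_gt0).
  rewrite (_ : eps * K / hh = eps * ((c0 + 2) / c0 * hh^-1) + eps * hh * (2 / c0 * ((c0 + 2) / c0) * hh ^- 2)); last first.
   by rewrite /K; field; rewrite !gt_eqF.
  by apply: lerD; rewrite ler_wpM2l ?(ltW eps0).
 rewrite (le_trans (ler_wpM2l (ltW Ht) hS2))// mulrDr; apply: lerD; last by rewrite mulrC mulrC.
 rewrite mulrA ler_pdivrMr// (le_trans (y := e / 4 * (x0 / 2 * H t)))//; last by rewrite ler_wpM2l ?(ltW e40).
 by rewrite /eps; apply: eq_ler; field; rewrite gt_eqF.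
have d2 : H t * S' = c / Q t * (1 - rho t ^+ N).
 rewrite /S' -mulr_sumr.
 have := subrX1 (rho t) N; set s := \sum_(i < N) _ => hs.
 have -> : 1 - rho t ^+ N = (1 - rho t) * s by rewrite -opprB hs; ring.
 by rewrite /Q; field; rewrite !gt_eqF.
rewrite (_ : _ - _ = (H t * S - H t * S') + ((c / Q t - c / Lm) - c / Q t * rho t ^+ N)); last by rewrite d2; ring.
rewrite (le_trans (ler_normD _ _))// (_ : e = (e / 4 + e / 4) + (e / 4 + e / 4)); last by field.
apply: lerD => //; rewrite (le_trans (ler_normB _ _))//; apply: lerD; first by rewrite distrC.
have rN : 0 <= rho t ^+ N by exact: exprn_ge0.
rewrite (ger0_norm (mulr_ge0 cQ rN)) (le_trans _ h4)// mulrC.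
by rewrite (ler_wpM2l rN)// lerDl.
Unshelve. all: end_near. Qed.

Lemma laplace_limitD sig q1 q2 l1 l2 : laplace_limit sig q1 l1 -> laplace_limit sig q2 l2 ->
 laplace_limit sig (fun y => q1 y + q2 y) (l1 + l2).
Proof.
move=> h1 h2 e e0; have e2 : 0 < e / 2 by rewrite divr_gt0.
near=> t.
have g1 : \forall N \near \oo, `|psum q1 sig t N - l1| <= e / 2.
 by near: t; exact: h1.
have g2 : \forall N \near \oo, `|psum q2 sig t N - l2| <= e / 2.
 by near: t; exact: h2.
near=> N.
under eq_bigr do rewrite mulrDl; rewrite big_split/= mulrDr opprD addrACA.
rewrite (le_trans (ler_normD _ _))// [e](splitr e); apply: lerD; first by near: N.
by near: N.
Unshelve. all: end_near. Qed.

Lemma laplace_limitZ sig a q l : laplace_limit sig q l ->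
 laplace_limit sig (fun y => a * q y) (a * l).
Proof.
move=> h e e0; have a1 : 0 < `|a| + 1 by rewrite ltr_wpDl.
have e2 : 0 < e / (`|a| + 1) by rewrite divr_gt0.
near=> t.
have g1 : \forall N \near \oo, `|psum q sig t N - l| <= e / (`|a| + 1).
 by near: t; exact: h.
near=> N.
have : `|psum q sig t N - l| <= e / (`|a| + 1) by near: N.
rewrite ler_pdivlMr// => hN.
have -> : \sum_(n < N) a * q (n%:R * H t) * phi n (sig / t) = a * \sum_(n < N) q (n%:R * H t) * phi n (sig / t).
 by rewrite mulr_sumr; apply: eq_bigr => n _; rewrite mulrA.
rewrite mulrCA -mulrBr.
by rewrite normrM (le_trans _ hN)// mulrC ler_wpM2l// lerDl.
Unshelve. all: end_near. Qed.

(** The binomial expansion of [damped_weight], each exponential contributing its limit from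
    [laplace_limit_exp]. *)
Definition renewal_laplace k z e sig : R :=
 \sum_(j < k.+1) (-1) ^+ j * 'C(k, j)%:R * (c / (j%:R * z + e + g * sig `^ beta)).

Lemma laplace_limit_damped k z e sig : 0 <= z -> 0 <= e -> 0 < sig ->
 laplace_limit sig (damped_weight k z e) (renewal_laplace k z e sig).
Proof.
move=> z0 e0 s0.
have -> : damped_weight k z e = fun y => \sum_(j < k.+1) ((-1) ^+ j * 'C(k, j)%:R) * expR (- ((j%:R * z + e) * y)).
 apply/funext => y; rewrite /damped_weight exprBn mulr_suml; apply: eq_bigr => j _.
 rewrite expr1n mulr1 -expRM_natl -mulr_natr -!mulrA; congr (_ * _); rewrite [RHS]mulrC.
 rewrite mulrCA -expRD mulrC; congr (_ * expR _); rewrite -mulr_natr; ring.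
rewrite /renewal_laplace; elim: k.+1 => [|K IH].
 move=> e' e'0; apply: nearW => t; apply: nearW => N.
 rewrite big1 ?mulr0; last by move=> n _; rewrite big_ord0 mul0r.
 by rewrite big_ord0 subr0 normr0 ltW.
have -> : (fun y => \sum_(j < K.+1) ((-1) ^+ j * 'C(k, j)%:R) * expR (- ((j%:R * z + e) * y))) =
 fun y => \sum_(j < K) ((-1) ^+ j * 'C(k, j)%:R) * expR (- ((j%:R * z + e) * y)) +
  ((-1) ^+ K * 'C(k, K)%:R) * expR (- ((K%:R * z + e) * y)).
 by apply/funext => y; rewrite big_ord_recr.
rewrite big_ord_recr/=; apply: laplace_limitD => //; apply: laplace_limitZ.
by apply: laplace_limit_exp => //; rewrite addr_ge0// mulr_ge0.
Qed.

End laplace_limit.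

(** * Laplace transform of a single window *)

Section window_integral.
Context {R : realType}.
Local Notation leb := (@lebesgue_measure R).

Definition halfline : set R := `]0, +oo[%classic.

Lemma integral_halfline (f : R -> R) :
 (\int[leb]_(y in `]0%R, +oo[) (f y)%:E = \int[leb]_y (f y * \1_halfline y)%:E)%E.
Proof.
rewrite integral_mkcond; apply: eq_integral => y _; rewrite patchE indicE /halfline.
by case: (y \in _); rewrite ?mulr1 ?mulr0.
Qed.

Lemma measurable_halfline : mfunT (\1_halfline : R -> R).
Proof. by apply: measurable_indic; exact: measurable_itv. Qed.

Lemma measurable_scaled_indic (M : R) (i : interval R) :
 mfunT (fun y : R => M * \1_([set` i]) y).
Proof.
exact: measurable_funM.
Qed.

Lemma integral_scaled_indic (M : R) (i : interval R) : 0 <= M ->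
 (\int[leb]_y (M * \1_([set` i]) y)%:E = M%:E * leb [set` i])%E.
Proof.
move=> M0; have m1 : mfunT (\1_([set` i]) : R -> R) by apply: measurable_indic; exact: measurable_itv.
under eq_integral do rewrite EFinM.
rewrite ge0_integralZl//; last exact/measurable_EFinP.
by rewrite integral_indic// setIT.
Qed.

Variables (h t sig : R).
Hypothesis h_gt0 : 0 < h.
Hypothesis t_gt0 : 0 < t.
Hypothesis sig_gt0 : 0 < sig.

(** As a function of [y] the indicator is that of an interval of length [h / t] ending at [S / t],
    on which the exponential varies by at most a factor [e^(sig h / t)]. *)
Definition window_integral (S : R) : \bar R :=
 (\int[leb]_(y in `]0%R, +oo[) (expR (- (sig * y)) * window_indicator h (t * y) S)%:E)%E.

Lemma window_indicatorE y S :
 window_indicator h (t * y) S = (((S - h) / t <= y) && (y < S / t))%:R.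
Proof.
rewrite /window_indicator indicE mem_setE in_itv/= andbC; congr ((_ && _)%:R).
 by rewrite ler_pdivrMr// lerBlDr [y * t]mulrC.
by rewrite ltr_pdivlMr// [y * t]mulrC.
Qed.

Let width S : S / t - (S - h) / t = h / t. Proof. by rewrite -mulrBl opprB addrC subrK. Qed.

Let lt_ends S : (S - h) / t < S / t. Proof. by rewrite ltr_pM2r ?invr_gt0// gtrBl. Qed.

Lemma measurable_window_indicator S : mfunT (fun y : R => window_indicator h (t * y) S).
Proof.
rewrite (_ : (fun y => _) = \1_(`[((S - h) / t), (S / t)[%classic : set R)); first exact: measurable_indic.
by apply/funext => y; rewrite window_indicatorE indicE mem_setE in_itv.
Qed.

Let mexp : mfunT (fun y : R => expR (- (sig * y))).
Proof. by apply: measurableT_comp => //; apply: measurableT_comp => //; exact: measurable_funM. Qed.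

Lemma window_integral_le S : (window_integral S <= (h / t * (expR (sig * h / t) * expR (- (sig / t * S))))%:E)%E.
Proof.
pose D : set R := `[(S - h) / t, S / t[%classic.
pose M := expR (sig * h / t) * expR (- (sig / t * S)); have M0 : 0 <= M by rewrite mulr_ge0.
apply: (@le_trans _ _ (\int[leb]_y (M * \1_D y)%:E)%E).
 rewrite /window_integral integral_halfline; apply: ge0_le_integral => //.
 - by move=> y _; rewrite lee_fin !mulr_ge0// window_indicatorE.
 - apply/measurable_EFinP; apply: measurable_funM; last exact: measurable_halfline.
  by apply: measurable_funM => //; exact: measurable_window_indicator.
 - by apply/measurable_EFinP; exact: measurable_scaled_indic.
 move=> y _; rewrite lee_fin (le_trans (y := expR (- (sig * y)) * window_indicator h (t * y) S))//.
  by rewrite ler_piMr ?mulr_ge0//// indicE lern1 leq_b1.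
 rewrite window_indicatorE indicE mem_setE in_itv/=.
 case: (boolP (_ <= y)) => [hy|_] /=; last by rewrite !mulr0.
 case: (y < _); rewrite ?mulr0// !mulr1 /M -expRD ler_expR.
 rewrite (_ : sig * h / t + _ = - (sig * ((S - h) / t))); last by field; rewrite gt_eqF.
 by rewrite lerN2 ler_wpM2l// ltW.
rewrite /D integral_scaled_indic// lebesgue_measure_itv/= lte_fin lt_ends -EFinB width -EFinM lee_fin.
by rewrite mulrC.
Qed.

(** The condition [h <= S] keeps the interval inside the half-line, so that none of its length is
    lost. *)
Lemma window_integral_ge S : h <= S -> ((h / t * expR (- (sig / t * S)))%:E <= window_integral S)%E.
Proof.
move=> hS; pose D : set R := `](S - h) / t, S / t[%classic.
pose M := expR (- (sig / t * S)); have M0 : 0 <= M by rewrite expR_ge0.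
apply: (@le_trans _ _ (\int[leb]_y (M * \1_D y)%:E)%E).
 rewrite /D integral_scaled_indic// lebesgue_measure_itv/= lte_fin lt_ends -EFinB width -EFinM lee_fin.
 by rewrite mulrC.
have int_ge0 (y : R) : 0 <= expR (- (sig * y)) * window_indicator h (t * y) S * \1_halfline y.
 by rewrite !mulr_ge0// window_indicatorE.
rewrite /window_integral integral_halfline; apply: ge0_le_integral => //.
- by move=> y _; rewrite lee_fin mulr_ge0.
- by apply/measurable_EFinP; exact: measurable_scaled_indic.
- apply/measurable_EFinP; apply: measurable_funM; last exact: measurable_halfline.
 by apply: measurable_funM => //; exact: measurable_window_indicator.
move=> y _; rewrite lee_fin [X in M * X]indicE mem_setE in_itv/=.
case: (boolP (_ < y)) => [hy|_] /=; last by rewrite mulr0.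
case: (boolP (y < _)) => [yS|_]; last by rewrite mulr0.
have y0 : 0 < y by rewrite (le_lt_trans _ hy)// divr_ge0 ?subr_ge0// ltW.
rewrite [X in _ <= _ * X]indicE mem_setE in_itv/= y0.
rewrite window_indicatorE (ltW hy) yS !mulr1 /M ler_expR lerN2.
by rewrite mulrAC -mulrA ler_wpM2l// ltW.
Qed.

End window_integral.

(** * Complete window sums and their transforms *)

Section full_window.
Context d (Y : measurableType d) (R : realType) (mu : probability Y R).
Variables (F : Y -> Y) (tau : Y -> R) (ell : R -> R) (beta : R) (A B : set Y).
Hypothesis F_mp : measure_preserving mu F.
Hypothesis tau_meas : mfunT tau.
Hypothesis tau_pos : forall y, 0 < tau y.
Hypothesis tau_essinf : (1 < ess_inf mu (fun y => (tau y)%:E))%E.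
Hypothesis ell_sv : slowly_varying ell.
Hypothesis beta01 : 0 < beta < 1.
Hypothesis tau_tail : forall t : R, 0 < t ->
 mu [set y | t < tau y] = (ell t * t `^ (- beta))%:E.
Hypothesis mA : measurable A.
Hypothesis mB : measurable B.
Local Notation leb := (@lebesgue_measure R).
Local Notation S := (birkhoff_sum F tau).
Local Notation marked := (marked_mean mu F tau A B).
Local Notation phi := (laplace_mean mu F tau A B).
Local Notation H := (tail_fun mu tau).

Let mS n : mfunT (S n). Proof. exact: measurable_birkhoff F_mp tau_meas n. Qed.
Let mV n : measurable (visit F A B n). Proof. exact: (measurable_visit F_mp mA mB). Qed.

(** The bound [1 <= tau] almost everywhere is transported along the orbit by invariance. It makes
    every window sum finite. *)
Lemma birkhoff_ge n : {ae mu, forall y, n%:R <= S n y}.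
Proof.
have t1 : {ae mu, forall y, 1 <= tau y}.
 have /ess_infP := ltW tau_essinf; apply: filterS => y.
 by rewrite lee_fin.
have tj j : {ae mu, forall y, 1 <= tau (iter j F y)}.
 have mE : measurable [set y | tau y < 1].
  rewrite (_ : [set y | _] = tau @^-1` `]-oo, 1[%classic).
   by rewrite -[X in measurable X]setTI; exact: tau_meas.
  by apply/seteqP; split => y /=; rewrite in_itv.
 have E0 : mu [set y | tau y < 1] = 0%E.
  apply: (measure_negligible mE); move: t1; rewrite /almost_everywhere/=.
  by apply: negligibleS => y /= yt h; move: (le_lt_trans h yt); rewrite ltxx.
 have mEj : measurable (iter j F @^-1` [set y | tau y < 1]).
  by rewrite -[X in measurable X]setTI; apply: (measurable_iter F_mp j).
 have : mu.-negligible (iter j F @^-1` [set y | tau y < 1]).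
  exists (iter j F @^-1` [set y | tau y < 1]); split => //.
  by rewrite (measure_iter F_mp).
 by apply: negligibleS => y /= /negP; rewrite -ltNge.
elim: n => [|n IH]; first by apply: aeW => y; rewrite /birkhoff_sum big_ord0.
by move: IH (tj n); apply: filterS2 => y h1 h2; rewrite /birkhoff_sum big_ord_recr/= -natr1 lerD.
Qed.

Lemma marked_mean_eq_ge n f g : bounded_meas f -> bounded_meas g ->
 (forall x, n%:R <= x -> f x = g x) -> marked n f = marked n g.
Proof.
move=> bf bg fg; rewrite /marked_mean /Rintegral; congr fine; apply: ae_eq_integral => //.
- by apply/measurable_EFinP; apply: (rintegrable_measurable (rintegrable_marked F_mp tau_meas mA mB n bf)).
- by apply/measurable_EFinP; apply: (rintegrable_measurable (rintegrable_marked F_mp tau_meas mA mB n bg)).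
by move: (birkhoff_ge n); apply: filterS => y h _; rewrite fg.
Qed.

Variable h : R.
Hypothesis h_gt0 : 0 < h.
Local Notation win n x := (marked n (window_indicator h x)).

Let bwin x : bounded_meas (window_indicator h x).
Proof.
split; first exact: measurable_indic.
by exists 1 => u; rewrite /window_indicator indicE; case: (_ \in _); rewrite ?normr1 ?normr0.
Qed.

Let bcst (c : R) : bounded_meas (fun=> c). Proof. by split => //; exists `|c|. Qed.

Lemma marked_cst0 n : marked n (fun=> 0) = 0.
Proof. by rewrite /marked_mean /Rintegral integral0_eq// => y _; rewrite mulr0. Qed.

Lemma marked_window_ge0 n x : 0 <= win n x.
Proof.
by rewrite -(marked_cst0 n); apply: marked_mean_le => // u; rewrite /window_indicator indicE.
Qed.

Lemma marked_window0 n x : x + h < n%:R -> win n x = 0.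
Proof.
move=> xn; rewrite -(marked_cst0 n); apply: marked_mean_eq_ge => // u nu.
rewrite /window_indicator indicE mem_setE in_itv/= leNgt (lt_le_trans xn nu) andbF.
by [].
Qed.

Lemma measurable_visit_window n t : mfunT
 (fun z : R * Y => \1_(visit F A B n) z.2 * window_indicator h (t * z.1) (S n z.2)).
Proof.
have m1 : mfunT (\1_(visit F A B n) : Y -> R) by apply: measurable_indic; exact: mV.
apply: measurable_funM; first exact: (measurableT_comp m1 measurable_snd).
pose E : set (R * Y) := [set z | 0 < S n z.2 - t * z.1] `&` [set z | 0 <= t * z.1 + h - S n z.2].
have mS2 : mfunT (fun z : R * Y => S n z.2) by exact: (measurableT_comp (mS n) measurable_snd).
have mt1 : mfunT (fun z : R * Y => t * z.1) by apply: measurable_funM => //; exact: measurable_fst.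
have mE : measurable E.
 apply: measurableI.
  rewrite (_ : [set z | _] = (fun z : R * Y => S n z.2 - t * z.1) @^-1` `]0, +oo[%classic).
   rewrite -[X in measurable X]setTI.
   by have mf : mfunT (fun z : R * Y => S n z.2 - t * z.1) by [exact: measurable_funB]; exact: mf.
  by apply/seteqP; split => z /=; rewrite in_itv/= andbT.
 rewrite (_ : [set z | _] = (fun z : R * Y => t * z.1 + h - S n z.2) @^-1` `[0, +oo[%classic).
  rewrite -[X in measurable X]setTI.
  have mf : mfunT (fun z : R * Y => t * z.1 + h - S n z.2).
   by apply: measurable_funB => //; exact: measurable_funD.
  exact: mf.
 by apply/seteqP; split => z /=; rewrite in_itv/= andbT.
rewrite (_ : (fun z => _) = \1_E); first exact: measurable_indic.
apply/funext => z; rewrite /window_indicator !indicE mem_setE in_itv/=.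
have -> // : (z \in E) = (t * z.1 < S n z.2 <= t * z.1 + h).
apply/idP/idP; last first.
 by move=> /andP[a b]; rewrite inE /E/=; split; rewrite ?subr_gt0 ?subr_ge0.
by rewrite inE /E/= subr_gt0 subr_ge0 => -[-> ->].
Qed.

Let mexp sig : mfunT (fun y : R => expR (- (sig * y))).
Proof. by apply: measurableT_comp => //; apply: measurableT_comp => //; exact: measurable_funM. Qed.

Let winE n t y : (win n (t * y))%:E =
 (\int[mu]_w (\1_(visit F A B n) w * window_indicator h (t * y) (S n w))%:E)%E.
Proof.
by rewrite /marked_mean /Rintegral fineK// integrable_fin_num//; exact: (rintegrable_marked F_mp tau_meas mA mB).
Qed.

Let f_ge0 n t (z : R * Y) :
 (0 <= (\1_(visit F A B n) z.2 * window_indicator h (t * z.1) (S n z.2))%:E)%E.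
Proof. by rewrite lee_fin mulr_ge0// /window_indicator indicE. Qed.

Lemma measurable_marked_window n t : mfunT (fun y : R => win n (t * y)).
Proof.
apply/measurable_EFinP; rewrite (_ : EFin \o _ = fun y => \int[mu]_w
 (\1_(visit F A B n) w * window_indicator h (t * y) (S n w))%:E)%E; last by apply/funext => y; exact: winE.
have mf : mfunT (fun z : R * Y => (\1_(visit F A B n) z.2 * window_indicator h (t * z.1) (S n z.2))%:E).
 by apply/measurable_EFinP; exact: measurable_visit_window.
exact: (@measurable_fun_fubini_tonelli_F _ _ _ _ R mu _ mf (f_ge0 n t)).
Qed.

Definition window_transform n t sig : \bar R :=
 (\int[leb]_(y in `]0%R, +oo[) (expR (- (sig * y)) * win n (t * y))%:E)%E.

Lemma window_transformP n t sig : 0 < t -> 0 < sig ->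
 mfunT (fun w => ((\1_(visit F A B n) w)%:E * window_integral h t sig (S n w))%E) /\
 window_transform n t sig = (\int[mu]_w ((\1_(visit F A B n) w)%:E * window_integral h t sig (S n w)))%E.
Proof.
move=> t0 s0; pose f (z : R * Y) := (expR (- (sig * z.1)) * \1_halfline z.1 * (\1_(visit F A B n) z.2 * window_indicator h (t * z.1) (S n z.2)))%:E.
have mD := @measurable_halfline R.
have mf : mfunT f.
 apply/measurable_EFinP; apply: measurable_funM; last exact: measurable_visit_window.
 apply: measurable_funM; last exact: (measurableT_comp mD measurable_fst).
 exact: (measurableT_comp (mexp sig) measurable_fst).
have f0 z : (0 <= f z)%E.
 by rewrite lee_fin !mulr_ge0// /window_indicator indicE.
have := @fubini_tonelli _ _ _ _ _ leb mu f mf f0; rewrite /fubini_F /fubini_G => FT.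
have E w : (\int[leb]_y f (y, w) = (\1_(visit F A B n) w)%:E * window_integral h t sig (S n w))%E.
 rewrite /window_integral integral_halfline -ge0_integralZl//.
 - by apply: eq_integral => y _; rewrite /f/= -EFinM; congr EFin; ring.
 - apply/measurable_EFinP; apply: measurable_funM; last exact: measurable_halfline.
  have mw := measurable_window_indicator h t0 (S n w).
  exact: (measurable_funM (mexp sig) mw).
 - by move=> y _; rewrite lee_fin !mulr_ge0// /window_indicator indicE.
split.
 rewrite (_ : (fun w => _) = fun w => (\int[leb]_y f (y, w))%E); last by apply/funext => w; rewrite E.
 exact: (@measurable_fun_fubini_tonelli_G _ _ _ _ R leb _ mf f0).
rewrite /window_transform integral_halfline.
transitivity (\int[leb]_y \int[mu]_w f (y, w))%E.
 apply: eq_integral => y _; rewrite mulrAC EFinM winE -ge0_integralZl//.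
 - by apply/measurable_EFinP; apply: (rintegrable_measurable (rintegrable_marked F_mp tau_meas mA mB n (bwin _))).
 - by move=> w _; exact: (f_ge0 n t (y, w)).
by rewrite FT; apply: eq_integral => w _; rewrite E.
Qed.

Let S_ge0 n y : 0 <= S n y.
Proof. by apply: sumr_ge0 => j _; rewrite ltW. Qed.

Lemma rintegrable_laplace n s : 0 <= s ->
 rintegrable mu (fun y => \1_(visit F A B n) y * expR (- (s * S n y))).
Proof.
move=> s0; apply: (rintegrable_bounded mu _ (M := 1)).
 apply: measurable_funM; first by apply: measurable_indic; exact: mV.
 apply: measurableT_comp => //; apply: measurableT_comp => //; exact: measurable_funM.
move=> y; rewrite ger0_norm ?mulr_ge0 ?expR_ge0// indicE.
have e1 : expR (- (s * S n y)) <= 1 by rewrite expRN_le1 mulr_ge0.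
by case: (_ \in _); rewrite ?mul1r// mul0r.
Qed.

Lemma laplace_mean_ge0 n s : 0 <= phi n s.
Proof. by apply: Rintegral_ge0 => y _; rewrite mulr_ge0. Qed.

Lemma laplace_mean_le1 n s : 0 <= s -> phi n s <= 1.
Proof.
move=> s0; rewrite -[leRHS](Rintegral_cst1 mu 1); apply: Rintegral_le.
- exact: rintegrable_laplace.
- exact: rintegrable_cst.
move=> y; have e1 : expR (- (s * S n y)) <= 1 by rewrite expRN_le1 mulr_ge0.
by rewrite indicE; case: (_ \in _); rewrite ?mul1r// mul0r.
Qed.

Let laplaceE n s a : 0 <= s -> 0 <= a ->
 ((a * phi n s)%:E = \int[mu]_w ((\1_(visit F A B n) w)%:E * (a * expR (- (s * S n w)))%:E))%E.
Proof.
move=> s0 a0; have il := rintegrable_laplace n s0.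
rewrite EFinM /laplace_mean /marked_mean /Rintegral fineK ?integrable_fin_num//.
rewrite -ge0_integralZl//.
- by apply: eq_integral => w _; rewrite -!EFinM mulrCA.
- by apply/measurable_EFinP; exact: rintegrable_measurable il.
Qed.

Let mlap n s a : mfunT (fun w => ((\1_(visit F A B n) w)%:E * (a * expR (- (s * S n w)))%:E)%E).
Proof.
rewrite (_ : (fun w => _) = fun w => (\1_(visit F A B n) w * (a * expR (- (s * S n w))))%:E) //.
apply/measurable_EFinP; apply: measurable_funM; first by apply: measurable_indic; exact: mV.
apply: measurable_funM => //.
apply: measurableT_comp => //; apply: measurableT_comp => //; exact: measurable_funM.
Qed.

Let J_ge0 t sig s : (0 <= window_integral h t sig s)%E.
Proof. by apply: integral_ge0 => y _; rewrite lee_fin mulr_ge0 ?expR_ge0// /window_indicator indicE. Qed.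

Lemma window_transform_le n t sig : 0 < t -> 0 < sig ->
 (window_transform n t sig <= (h / t * expR (sig * h / t) * phi n (sig / t))%:E)%E.
Proof.
move=> t0 s0; have [mJ ->] := window_transformP n t0 s0.
have st : 0 <= sig / t by rewrite divr_ge0 ?ltW.
have a0 : 0 <= h / t * expR (sig * h / t) by rewrite mulr_ge0 ?expR_ge0// divr_ge0 ?ltW.
rewrite (laplaceE n st a0).
apply: ge0_le_integral => //.
- by move=> w _; rewrite mule_ge0 ?lee_fin.
move=> w _; rewrite lee_wpmul2l ?lee_fin//.
by rewrite -[X in (_ <= X%:E)%E]mulrA; exact: window_integral_le.
Qed.

Lemma window_transform_ge n t sig : 0 < t -> 0 < sig -> h <= n%:R ->
 ((h / t * phi n (sig / t))%:E <= window_transform n t sig)%E.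
Proof.
move=> t0 s0 hn; have [mJ ->] := window_transformP n t0 s0.
have st : 0 <= sig / t by rewrite divr_ge0 ?ltW.
have a0 : 0 <= h / t by rewrite divr_ge0 ?ltW.
rewrite (laplaceE n st a0).
apply: ae_ge0_le_integral => //.
- by move=> w _; rewrite mule_ge0 ?lee_fin// !mulr_ge0 ?expR_ge0 ?invr_ge0 ?(ltW h_gt0) ?(ltW t0).
- by move=> w _; rewrite mule_ge0 ?lee_fin.
move: (birkhoff_ge n); apply: filterS => w hw _; rewrite lee_wpmul2l ?lee_fin//.
by apply: window_integral_ge => //; exact: le_trans hw.
Qed.

Lemma window_transform_ge0 n t sig : (0 <= window_transform n t sig)%E.
Proof. by apply: integral_ge0 => y _; rewrite lee_fin mulr_ge0 ?marked_window_ge0. Qed.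

Variables (k : nat) (z e : R).
Hypothesis z_ge0 : 0 <= z.
Hypothesis e_ge0 : 0 <= e.
Local Notation W := (renewal_weight mu tau k z e).
Local Notation psum N t sig := (H t * \sum_(n < N) damped_weight k z e (n%:R * H t) * phi n (sig / t)).
Local Notation ww := (weighted_window mu F tau A B k z e h).

(** Since [tau_n >= n] almost everywhere, the terms with [n > x + h] vanish: from this index on the
    sum is complete. *)
Definition window_bound x : nat := (Num.truncn (x + h)).+1.
Definition full_window t x : R := ww (window_bound x) t x.

Let H0 t : 0 < H t. Proof. exact: (tail_gt0 tau_meas ell_sv tau_tail). Qed.

Let W_ge0 t n : 0 <= t -> 0 <= W t n.
Proof.
move=> t0; rewrite /renewal_weight; apply: mulr_ge0; first by rewrite mulr_ge0 ?(ltW (H0 _)).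
by apply: damped_weight_ge0 => //; rewrite mulr_ge0 ?(ltW (H0 _)).
Qed.

Let win_ge0 n x : 0 <= win n x. Proof. exact: marked_window_ge0. Qed.

Lemma weighted_window_full N t x : (window_bound x <= N)%N -> ww N t x = full_window t x.
Proof.
move=> /subnK <-; elim: (N - _)%N => [|m IH]; first by rewrite add0n.
rewrite addSn /weighted_window /weighted_mean big_ord_recr/= -[X in X + _]/(ww _ _ _) IH.
rewrite marked_window0 ?mulr0 ?addr0//.
by rewrite (lt_le_trans (truncnS_gt _))// ler_nat leq_addl.
Qed.

Lemma weighted_window_mono N M t x : 0 <= t -> (N <= M)%N -> ww N t x <= ww M t x.
Proof.
move=> t0 /subnK <-; elim: (M - N)%N => [|m IH]; first by rewrite add0n.
rewrite (le_trans IH)// addSn /weighted_window /weighted_mean [leRHS]big_ord_recr/= lerDl.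
by rewrite mulr_ge0 ?W_ge0.
Qed.

Lemma weighted_window_le_full N t x : 0 <= t -> ww N t x <= full_window t x.
Proof.
move=> t0; rewrite -(weighted_window_full (N := maxn N (window_bound x))) ?leq_maxr//.
by rewrite weighted_window_mono// leq_maxl.
Qed.

Lemma weighted_window_ge0 N t x : 0 <= t -> 0 <= ww N t x.
Proof. by move=> t0; apply: sumr_ge0 => n _; rewrite mulr_ge0 ?W_ge0. Qed.

Lemma measurable_weighted_window N t s : mfunT (fun y : R => ww N t (s * y)).
Proof.
rewrite /weighted_window /weighted_mean.
apply: measurable_sum => n.
by apply: measurable_funM => //; exact: measurable_marked_window.
Qed.

Lemma full_window_cvg t x : ww N t x @[N --> \oo] --> full_window t x.
Proof.
apply/cvgrPdist_le => r r0; near=> N.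
rewrite weighted_window_full ?subrr ?normr0 ?ltW//.
by near: N; exact: nbhs_infty_ge.
Unshelve. all: end_near. Qed.

Lemma measurable_full_window t s : mfunT (fun y : R => full_window t (s * y)).
Proof.
apply: (@measurable_fun_cvg _ _ _ _ (fun N (y : R) => ww N t (s * y))).
 by move=> N; exact: measurable_weighted_window.
by move=> y _; exact: full_window_cvg.
Qed.

Let truncated_transform N t sig : 0 < t ->
 (\int[leb]_(y in `]0%R, +oo[) (expR (- (sig * y)) * ww N t (t * y))%:E =
  \sum_(n < N) (W t n)%:E * window_transform n t sig)%E.
Proof.
move=> t0.
transitivity (\int[leb]_(y in `]0%R, +oo[) (\sum_(n < N) (W t n)%:E * (expR (- (sig * y)) * win n (t * y))%:E))%E.
 apply: eq_integral => y _; rewrite /weighted_window /weighted_mean mulr_sumr -sumEFin.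
 by apply: eq_bigr => n _; rewrite -EFinM; congr EFin; ring.
have mw n : measurable_fun (`]0, +oo[%classic : set R) (fun y : R => (expR (- (sig * y)) * win n (t * y))%:E).
 apply: measurable_EFinS; apply: measurable_funM => //.
 exact: measurable_marked_window.
have tr n : (\int[leb]_(y in `]0%R, +oo[) ((W t n)%:E * (expR (- (sig * y)) * win n (t * y))%:E) =
  (W t n)%:E * window_transform n t sig)%E.
 apply: ge0_integralZl => //.
 - exact: mw.
 - by move=> y _; rewrite lee_fin mulr_ge0 ?expR_ge0.
 - by rewrite lee_fin W_ge0// ltW.
rewrite ge0_integral_sum//.
- by apply: eq_bigr => n _; exact: tr.
- by move=> n; apply: measurable_funeM; exact: mw.
- by move=> n y _; rewrite mule_ge0 ?lee_fin ?W_ge0 ?(ltW t0)// mulr_ge0 ?expR_ge0.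
Qed.

Let weight_sum N t sig : 0 < t ->
 \sum_(n < N) W t n * (h / t * phi n (sig / t)) =
 h * psum N t sig.
Proof.
move=> t0; rewrite !mulr_sumr; apply: eq_bigr => n _; rewrite /renewal_weight.
by field; rewrite gt_eqF.
Qed.

Lemma truncated_transform_le N t sig : 0 < t -> 0 < sig ->
 (\int[leb]_(y in `]0%R, +oo[) (expR (- (sig * y)) * ww N t (t * y))%:E <=
  (expR (sig * h / t) * (h * psum N t sig))%:E)%E.
Proof.
move=> t0 s0; rewrite truncated_transform// -weight_sum// mulr_sumr -sumEFin.
apply: lee_sum => n _; rewrite [leRHS](_ : _ = (W t n)%:E * (h / t * expR (sig * h / t) * phi n (sig / t))%:E)%E; last first.
 by rewrite -EFinM; congr EFin; ring.
rewrite lee_wpmul2l ?lee_fin ?W_ge0 ?(ltW t0)//.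
exact: window_transform_le.
Qed.

Let count_lt N m : (\sum_(n < N) (n < m)%N)%N = minn N m.
Proof.
elim: N => [|N IH]; first by rewrite big_ord0 min0n.
rewrite big_ord_recr/= IH; case: (ltnP N m) => hN.
 by rewrite (minn_idPl hN) addn1.
by rewrite addn0 (minn_idPr (leqW hN)).
Qed.

(** The lower bound for a single transform needs [h <= n]; the finitely many smaller [n] cost at
    most [h * H t] each, which vanishes in the limit. *)
Lemma truncated_transform_ge N t sig : 0 < t -> 0 < sig ->
 ((h * psum N t sig - h * H t * (Num.truncn h).+1%:R)%:E <=
 \int[leb]_(y in `]0%R, +oo[) (expR (- (sig * y)) * ww N t (t * y))%:E)%E.
Proof.
move=> t0 s0; rewrite truncated_transform// -weight_sum//.
have st : 0 <= sig / t by rewrite divr_ge0 ?ltW.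
pose b (n : nat) : R := (n < (Num.truncn h).+1)%N%:R.
apply: (@le_trans _ _ (\sum_(n < N) (W t n * (h / t * phi n (sig / t)) - h * H t * b n))%:E).
 rewrite lee_fin sumrB lerB// -mulr_sumr ler_wpM2l ?mulr_ge0 ?(ltW h_gt0) ?(ltW (H0 _))//.
 by rewrite /b -natr_sum ler_nat count_lt geq_minr.
rewrite -sumEFin; apply: lee_sum => n _.
have [hn|hn] := leqP (Num.truncn h).+1 n.
 have -> : b n = 0 by rewrite /b ltnNge hn.
 rewrite mulr0 subr0 EFinM lee_wpmul2l ?lee_fin ?W_ge0 ?(ltW t0)//.
 apply: window_transform_ge => //.
 by rewrite ltW// (lt_le_trans (truncnS_gt _))// ler_nat.
apply: (@le_trans _ _ 0%E); last first.
 by rewrite mule_ge0 ?lee_fin ?W_ge0 ?(ltW t0)//; exact: window_transform_ge0.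
have -> : b n = 1 by rewrite /b hn.
rewrite lee_fin mulr1 subr_le0 /renewal_weight.
have q1 : damped_weight k z e (n%:R * H t) <= 1.
 have nH : 0 <= n%:R * H t by rewrite mulr_ge0 ?(ltW (H0 _)).
 have enH := mulr_ge0 e_ge0 nH.
 by rewrite (le_trans (damped_weight_le_exp k e z_ge0 nH))// expRN_le1.
have q0 : 0 <= damped_weight k z e (n%:R * H t).
 by apply: damped_weight_ge0 => //; rewrite mulr_ge0 ?ler0n ?(ltW (H0 _)).
have p1 := laplace_mean_le1 n st.
have p0 := laplace_mean_ge0 n (sig / t).
rewrite [leLHS](_ : _ = h * H t * (damped_weight k z e (n%:R * H t) * phi n (sig / t))); last by field; rewrite gt_eqF.
by rewrite ler_piMr ?mulr_ge0 ?(ltW h_gt0) ?(ltW (H0 _))// mulr_ile1.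
Qed.

(** The truncated sums increase to the complete one: a large [N] gives the lower bound, monotone
    convergence the upper one. Here [t] stays fixed, in accordance with the order of limits in
    [laplace_limit]. *)
Lemma full_window_transform sig l : 0 < sig ->
 laplace_limit mu F tau A B sig (damped_weight k z e) l ->
 forall r, 0 < r -> \forall t \near +oo,
 ((h * l - r)%:E <= \int[leb]_(y in `]0%R, +oo[) (expR (- (sig * y)) * full_window t (t * y))%:E <=
  (h * l + r)%:E)%E.
Proof.
move=> s0 hl r r0.
have r4 : 0 < r / 4 / h by rewrite !divr_gt0.
have K0 : 0 < h * (Num.truncn h).+1%:R + 1 by rewrite ltr_wpDl// mulr_ge0// ltW.
have rK : 0 < r / 4 / (h * (Num.truncn h).+1%:R + 1) by rewrite !divr_gt0.
have /cvgrPdist_le/(_ _ rK) nH := tail_cvg0 tau_meas ell_sv beta01 tau_tail.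
pose M := `|h * l| + r; have M0 : 0 < M by rewrite ltr_wpDl.
have rM : 0 < r / 4 / M by rewrite !divr_gt0.
have hexp : expR (sig * h / t) @[t --> +oo] --> (1 : R).
 have c0 : (sig * h / t) @[t --> +oo] --> (0 : R).
  apply/cvgrPdist_le => q q0; near=> t.
  have t0 : 0 < t by [].
  have tq : sig * h / q <= t by [].
  rewrite sub0r normrN ger0_norm ?divr_ge0 ?mulr_ge0 ?(ltW s0) ?(ltW h_gt0) ?(ltW t0)//.
  by rewrite ler_pdivrMr// [leRHS]mulrC -ler_pdivrMr.
 have := @continuous_expR R 0; rewrite /continuous_at expR0 => cE.
 exact: (cvg_comp _ _ c0 cE).
have /cvgrPdist_le/(_ _ rM) nE := hexp.
have hl' := hl _ r4.
near=> t.
have t0 : 0 < t by [].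
have h1 : \forall N \near \oo, `|psum N t sig - l| <= r / 4 / h.
 by near: t.
have h2 : `|0 - H t| <= r / 4 / (h * (Num.truncn h).+1%:R + 1) by near: t.
have h3 : `|1 - expR (sig * h / t)| <= r / 4 / M by near: t.
move: h2; rewrite sub0r normrN gtr0_norm// ler_pdivlMr// => h2.
have hH : h * H t * (Num.truncn h).+1%:R <= r / 4.
 by rewrite (le_trans _ h2)// mulrDr mulr1 mulrAC [leLHS]mulrC lerDl ltW.
pose I N := (\int[leb]_(y in `]0%R, +oo[) (expR (- (sig * y)) * ww N t (t * y))%:E)%E.
have fin_bound N : `|psum N t sig - l| <= r / 4 / h ->
  h * l - r / 4 <= h * psum N t sig <= h * l + r / 4.
 rewrite ler_pdivlMr// => hN.
 have : `|h * psum N t sig - h * l| <= r / 4.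
  by rewrite -mulrBr normrM (gtr0_norm h_gt0) mulrC.
 by rewrite ler_distl.
have mI N : measurable_fun (`]0, +oo[%classic : set R) (fun y : R => (expR (- (sig * y)) * ww N t (t * y))%:E).
 apply: measurable_EFinS; apply: measurable_funM => //.
 exact: measurable_weighted_window.
have mF : measurable_fun (`]0, +oo[%classic : set R) (fun y : R => (expR (- (sig * y)) * full_window t (t * y))%:E).
 apply: measurable_EFinS; apply: measurable_funM => //.
 exact: measurable_full_window.
apply/andP; split.
 near \oo => N.
 have hN : `|psum N t sig - l| <= r / 4 / h by near: N.
 apply: (@le_trans _ _ (I N)).
  rewrite (le_trans _ (truncated_transform_ge N t0 s0))// lee_fin.
  by have /andP[a _] := fin_bound _ hN; lra.
 apply: ge0_le_integral => //.
 - by move=> y _; rewrite lee_fin mulr_ge0 ?expR_ge0 ?weighted_window_ge0 ?ltW.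
 - exact: mI.
 - by move=> y _; rewrite lee_fin ler_wpM2l ?expR_ge0 ?weighted_window_le_full ?ltW.
have mono : {homo I : N M / (N <= M)%N >-> (N <= M)%E}.
 move=> N N' NN; apply: ge0_le_integral => //.
 - by move=> y _; rewrite lee_fin mulr_ge0 ?expR_ge0 ?weighted_window_ge0 ?ltW.
 - exact: mI.
 - exact: mI.
 - by move=> y _; rewrite lee_fin ler_wpM2l ?expR_ge0 ?weighted_window_mono ?ltW.
have Ic : I N @[N --> \oo] --> (\int[leb]_(y in `]0%R, +oo[) (expR (- (sig * y)) * full_window t (t * y))%:E)%E.
 have -> : (\int[leb]_(y in `]0%R, +oo[) (expR (- (sig * y)) * full_window t (t * y))%:E =
   \int[leb]_(y in `]0%R, +oo[) limn (fun N => (expR (- (sig * y)) * ww N t (t * y))%:E))%E.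
  apply: eq_integral => y _; apply/esym/cvg_lim => //; apply: cvg_EFin; first exact: nearW.
  by apply: cvgM; [exact: cvg_cst|exact: full_window_cvg].
 apply: cvg_monotone_convergence => //.
 - by move=> N y _; rewrite lee_fin mulr_ge0 ?expR_ge0 ?weighted_window_ge0 ?ltW.
 - by move=> y _ N N' NN; rewrite lee_fin ler_wpM2l ?expR_ge0 ?weighted_window_mono ?ltW.
rewrite -(cvg_lim _ Ic)//; apply: lime_le; first by apply/cvg_ex; eexists; exact: Ic.
near=> N.
have hN : `|psum N t sig - l| <= r / 4 / h by near: N.
rewrite (le_trans (truncated_transform_le N t0 s0))// lee_fin.
have /andP[_ b2] := fin_bound _ hN.
rewrite (le_trans (ler_wpM2l (expR_ge0 _) b2))//.
set E := expR _ in h3 *; set q := h * l + r / 4.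
have qM : `|q| <= M.
 by rewrite (le_trans (ler_normD _ _))// lerD2l gtr0_norm ?divr_gt0// ler_pdivrMr//; lra.
rewrite -lerBlDr (_ : E * q - r = (h * l - 0) + ((E - 1) * q + (r / 4 - r))); last by rewrite /q; ring.
rewrite subr0 gerDl.
have : `|(E - 1) * q| <= r / 4.
 rewrite normrM distrC (le_trans (ler_pM _ _ h3 qM))// divfK ?gt_eqF//.
rewrite ler_norml => /andP[_ a]; lra.
Unshelve. all: end_near. Qed.

End full_window.

(** * Integrability of real functions *)

Section real_integrable.
Context d (T : measurableType d) (R : realType) (nu : {measure set T -> \bar R}) (D : set T).
Hypothesis mD : measurable D.
Implicit Types f g : T -> R.
Local Notation int f := (nu.-integrable D (EFin \o f)).

Lemma real_integrableZ a f : int f -> int (fun y => a * f y).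
Proof. by move=> fi; have := integrableZl mD a fi; exact: eq_integrable. Qed.

Lemma real_integrableD f g : int f -> int g -> int (fun y => f y + g y).
Proof. by move=> fi gi; have := integrableD mD fi gi; exact: eq_integrable. Qed.

Lemma real_integrableB f g : int f -> int g -> int (fun y => f y - g y).
Proof. by move=> fi gi; have := integrableB mD fi gi; exact: eq_integrable. Qed.

Lemma real_integrable_norm f : int f -> int (fun y => `|f y|).
Proof. by move=> fi; have := integrable_abse fi; exact: eq_integrable. Qed.

Lemma real_integrable_sum (n : nat) (f : nat -> T -> R) : (forall i, int (f i)) ->
 int (fun y => \sum_(i < n) f i y) /\
 \int[nu]_(y in D) (\sum_(i < n) f i y) = \sum_(i < n) \int[nu]_(y in D) f i y.
Proof.
move=> fi; elim: n => [|n [IH e]].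
 rewrite big_ord0 (_ : (fun y => _) = cst 0); last by apply/funext => y; rewrite big_ord0.
 by split; [exact: integrable0|rewrite Rintegral_cst// mul0r].
rewrite (_ : (fun y => _) = (fun y => \sum_(i < n) f i y + f n y)); last first.
 by apply/funext => y; rewrite big_ord_recr.
by split; [exact: real_integrableD|rewrite RintegralD// e big_ord_recr].
Qed.

Lemma integrable_dominated f g (C : R) : measurable_fun D f ->
 int g -> (forall y, D y -> `|f y| <= C * g y) -> int f.
Proof.
move=> mf ig fg; apply: (@le_integrable _ _ _ nu _ mD _ (EFin \o (fun y => C * g y))).
- exact/measurable_EFinP.
- by move=> y Dy /=; rewrite lee_fin (le_trans (fg _ Dy))// ler_norm.
exact: real_integrableZ.
Qed.

End real_integrable.

(** * Convergence of a value from Laplace limits *)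

Section peak_kernel.
Context {R : realType}.
Local Notation leb := (@lebesgue_measure R).
Local Notation D := (`]0%R, +oo[%classic : set R).

Definition half_exp (y : R) : R := expR (- (ln 2 * y)).
(** With [p = 2^-y] this concentrates at [p = 1/2], that is at [y = 1], as [k] grows. Being a
    polynomial in [p] without constant term, it has integrals against [w] that are combinations of
    Laplace transforms. *)
Definition peak k (y : R) : R := half_exp y * (4 * half_exp y * (1 - half_exp y)) ^+ k.

Lemma peak_sum k : exists (a : nat -> R) N, forall y,
 peak k y = \sum_(i < N) a i * expR (- (i.+1%:R * ln 2 * y)).
Proof.
pose Q : {poly R} := (4%:P * 'X * (1 - 'X)) ^+ k.
exists (fun i => Q`_i), (size Q) => y.
have -> : peak k y = half_exp y * Q.[half_exp y].
 by rewrite /peak /Q horner_exp !hornerE.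
rewrite horner_coef mulr_sumr; apply: eq_bigr => i _.
rewrite mulrCA -exprS; congr (_ * _).
by rewrite /half_exp -expRM_natl; congr expR; rewrite -mulr_natl; ring.
Qed.

Let ln2_bounds : 1 / 2 <= (ln 2 : R) <= 1.
Proof.
apply/andP; split.
 rewrite -[leLHS](@expRK R) ler_ln ?posrE//.
 have := @expR_ge1Dx R (- (1 / 2)); rewrite expRN -[X in _ <= X -> _]mul1r.
 rewrite ler_pdivlMr// => h1.
 have : 1 / 2 * expR (1 / 2) <= (1 : R) by rewrite (le_trans _ h1)// ler_pM2r//; lra.
 by lra.
by rewrite -[leRHS](@expRK R) ler_ln ?posrE// (le_trans _ (expR_ge1Dx 1)).
Qed.

Let half_expE y : 2 * half_exp y = expR (- (ln 2 * (y - 1))).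
Proof.
rewrite -{1}(@lnK R 2) ?posrE// /half_exp -expRD; congr expR; ring.
Qed.

(** The distance to the peak is controlled linearly by [|1 - 2 p|], except where the latter is
    bounded below; there the boundedness of [w] suffices. *)
Lemma half_exp_gap y : 1 <= 4 * `|1 - 2 * half_exp y| \/ `|y - 1| <= 4 * `|1 - 2 * half_exp y|.
Proof.
have /andP[c1 c2] := ln2_bounds.
rewrite half_expE; set u := ln 2 * (y - 1); set E := expR (- u).
have E0 : 0 < E by exact: expR_gt0.
have [y1|y1] := ltP y 1.
 right; have h1 : 1 - u <= E := expR_ge1Dx (- u).
 have u0 : 1 / 2 * (1 - y) <= - u by rewrite /u -mulrN opprB ler_wpM2r// subr_ge0 ltW.
 rewrite distrC gtr0_norm ?subr_gt0// distrC ger0_norm; lra.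
have u0 : 0 <= u by rewrite mulr_ge0//; lra.
have hE : E * (1 + u) <= 1.
 by rewrite /E expRN mulrC ler_pdivrMr ?expR_gt0// mul1r expR_ge1Dx.
have Eu0 : 0 <= E * u by rewrite mulr_ge0// ltW.
have E1 : 0 <= 1 - E by lra.
rewrite (ger0_norm E1) ger0_norm ?subr_ge0//.
have [u1|u1] := leP 1 u.
 left; have : E <= E * u by rewrite ler_peMr// ltW.
 lra.
right; have : 1 / 2 * (y - 1) <= u by rewrite ler_wpM2r// subr_ge0.
have : (1 - E) * u <= 1 - E by rewrite ler_piMr// ltW.
by rewrite mulrBl mul1r; lra.
Qed.

Let half_exp01 y : 0 <= y -> 0 <= half_exp y <= 1.
Proof.
move=> y0; rewrite expR_ge0/= expRN_le1 mulr_ge0//.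
by have /andP[c1 c2] := ln2_bounds; lra.
Qed.

Lemma peak_bounds k y : 0 <= y -> 0 <= peak k y <= half_exp y.
Proof.
move=> /half_exp01 /andP[p0 p1]; have q0 : 0 <= 4 * half_exp y * (1 - half_exp y).
 by rewrite mulr_ge0 ?mulr_ge0 ?subr_ge0.
rewrite /peak; apply/andP; split; first by rewrite mulr_ge0 ?exprn_ge0.
rewrite ler_piMr// exprn_ile1//.
have -> : 4 * half_exp y * (1 - half_exp y) = 1 - (1 - 2 * half_exp y) ^+ 2 by ring.
by rewrite gerBl sqr_ge0.
Qed.

Let peakS k y : peak k y - peak k.+1 y = peak k y * (1 - 2 * half_exp y) ^+ 2.
Proof. by rewrite /peak exprS; ring. Qed.

Lemma measurable_expN (sig : R) : mfunT (fun y : R => expR (- (sig * y))).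
Proof. by apply: continuous_measurable_fun; exact: continuous_expN. Qed.

Lemma measurable_peak k : mfunT (peak k).
Proof.
have mp : mfunT half_exp by exact: measurable_expN.
apply: measurable_funM => //; apply: measurable_funX; apply: measurable_funM.
 exact: measurable_funM.
exact: measurable_funB.
Qed.

Lemma integrable_expN (sig : R) : 0 < sig ->
 leb.-integrable D (EFin \o (fun y => expR (- (sig * y)))).
Proof.
move=> s0; apply/integrableP; split.
 by apply: measurable_EFinS; exact: measurable_expN.
under eq_integral do rewrite /= ger0_norm//.
by rewrite integral_expN// ltry.
Qed.

Lemma integrable_peak k : leb.-integrable D (EFin \o peak k).
Proof.
have l0 : 0 < ln 2 :> R by have /andP[c1 c2] := ln2_bounds; lra.
apply: (@integrable_dominated _ _ _ leb _ _ _ (fun y => expR (- (ln 2 * y))) 1) => //.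
- exact: measurable_funTS (measurable_peak k).
- exact: integrable_expN.
move=> y /=; rewrite in_itv/= andbT => y0; by have /andP[k0 k1] := peak_bounds k (ltW y0); rewrite ger0_norm// mul1r.
Qed.

Definition peak_mass k : R := \int[leb]_(y in D) peak k y.

(** On []1, 1 + r]] one has [p >= 1/4] and [4 p (1 - p) = 1 - (1 - 2 p)^2 >= 1 - r]. *)
Lemma peak_mass_lower k (r : R) : 0 < r <= 1 -> r / 4 * (1 - r) ^+ k <= peak_mass k.
Proof.
move=> /andP[r0 r1]; have /andP[c1 c2] := ln2_bounds.
have M0 : 0 <= 1 / 4 * (1 - r) ^+ k by rewrite mulr_ge0 ?exprn_ge0 ?subr_ge0.
rewrite -lee_fin /peak_mass /Rintegral fineK; last first.
 exact: integrable_fin_num (integrable_peak k).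
rewrite integral_halfline.
have := integral_scaled_indic (`]1, 1 + r] : interval R) M0.
rewrite lebesgue_measure_itv/= lte_fin ltrDl r0 -EFinD addrAC subrr add0r -EFinM => e.
rewrite (_ : r / 4 * _ = 1 / 4 * (1 - r) ^+ k * r); last by ring.
rewrite -e; apply: ge0_le_integral => //.
- by move=> y _; rewrite lee_fin mulr_ge0.
- by apply/measurable_EFinP; exact: measurable_scaled_indic.
- by apply/measurable_EFinP; apply: measurable_funM; [exact: measurable_peak|exact: measurable_halfline].
move=> y _; rewrite lee_fin !indicE mem_setE in_itv/=.
have [|_] := boolP (1 < y <= 1 + r); last first.
 rewrite mulr0 /halfline mem_setE in_itv/= andbT; case: ltP => y0; last by rewrite mulr0.
 by have /andP[k0 k1] := peak_bounds k (ltW y0); rewrite mulr1.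
move=> /andP[y1 yr]; have y0 : 0 < y by exact: lt_trans y1.
rewrite /halfline mem_setE in_itv/= y0 !mulr1 /peak ler_pM ?exprn_ge0 ?subr_ge0//.
 rewrite (_ : 1 / 4 = expR (- (ln 2 * 2))); last first.
  by rewrite (_ : ln 2 * 2 = ln 2 + ln 2) ?expRN ?expRD ?lnK ?posrE//; [rewrite div1r; congr (_^-1); ring|ring].
 by rewrite ler_expR lerN2 ler_wpM2l; lra.
rewrite lerXn2r ?nnegrE ?subr_ge0//.
 have /andP[p0 p1] := half_exp01 (ltW y0).
 by rewrite mulr_ge0 ?mulr_ge0 ?subr_ge0.
have -> : 4 * half_exp y * (1 - half_exp y) = 1 - (1 - 2 * half_exp y) ^+ 2 by ring.
rewrite lerB// half_expE; set u := ln 2 * (y - 1).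
have u0 : 0 <= u by rewrite mulr_ge0 ?subr_ge0 ?(ltW y1)//; lra.
have ur : u <= r.
 have : u <= 1 * (y - 1) by rewrite ler_wpM2r// subr_ge0 ltW.
 by lra.
have h1 : 1 - u <= expR (- u) := expR_ge1Dx (- u).
have h2 : expR (- u) <= 1 by rewrite expRN_le1.
apply: (@le_trans _ _ ((1 - expR (- u)) * 1)); last by lra.
by rewrite expr2 ler_wpM2l ?subr_ge0//; have := expR_ge0 (- u); lra.
Qed.

(** The difference of consecutive masses is the integral of [peak k] times [(1 - 2 p)^2], a variance
    around the peak. If it exceeded [delta] times the mass for every [k], the masses would be
    [O((1 - delta)^k)], against a lower bound of order [(1 - delta / 2)^k]. *)
Lemma peak_mass_ratio (delta : R) : 0 < delta < 1 ->
 exists k, 0 < peak_mass k /\ peak_mass k - peak_mass k.+1 <= delta * peak_mass k.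
Proof.
move=> /andP[d0 d1]; set r := delta / 2.
have r01 : 0 < r <= 1 by rewrite divr_gt0//= /r; lra.
have q0 : 0 < 1 - r by rewrite /r; lra.
have b0 k : 0 < peak_mass k.
 apply: lt_le_trans (peak_mass_lower k r01).
 by rewrite mulr_gt0 ?exprn_gt0// divr_gt0//; case/andP: r01.
have [//|/forallNP nk] := pselect (exists k, 0 < peak_mass k /\ peak_mass k - peak_mass k.+1 <= delta * peak_mass k).
have dec k : peak_mass k.+1 <= (1 - delta) * peak_mass k.
 have := nk k; have [h|h _] := leP (peak_mass k - peak_mass k.+1) (delta * peak_mass k); first by case.
 by rewrite mulrBl mul1r; lra.
have geo k : peak_mass k <= (1 - delta) ^+ k * peak_mass 0.
 elim: k => [|k IH]; first by rewrite expr0 mul1r.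
 by rewrite (le_trans (dec k))// exprS -mulrA ler_wpM2l// subr_ge0 ltW.
pose x := (1 - delta) / (1 - r).
have x0 : 0 <= x by rewrite divr_ge0 ?(ltW q0)// subr_ge0 ltW.
have x1 : `|x| < 1 by rewrite ger0_norm// ltr_pdivrMr// mul1r /r; lra.
have /cvgrPdist_lt := cvg_expr x1.
have e0 : 0 < r / 4 / peak_mass 0 by rewrite !divr_gt0//; case/andP: r01.
move=> /(_ _ e0) [n _ /(_ n (leqnn n))] /=; rewrite sub0r normrN ger0_norm ?exprn_ge0//.
rewrite ltr_pdivlMr// => h; exfalso.
have := le_trans (peak_mass_lower n r01) (geo n); apply/negP; rewrite -ltNge.
by rewrite /x expr_div_n mulrAC ltr_pdivrMr ?exprn_gt0// in h.
Qed.

Variables (w : R -> R -> R) (C : R) (L : R -> R).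
Hypothesis C_ge0 : 0 <= C.
Hypothesis w_meas : forall t, mfunT (w t).
Hypothesis w_bounded : \forall t \near +oo, forall y, 0 <= w t y <= C.
Hypothesis w_regular : forall eps, 0 < eps ->
 \forall t \near +oo, forall y, `|w t y - w t 1| <= C * `|y - 1| + eps.
Hypothesis w_transform : forall sig, 0 < sig -> forall r, 0 < r -> \forall t \near +oo,
 ((L sig - r)%:E <= \int[leb]_(y in D) (expR (- (sig * y)) * w t y)%:E <= (L sig + r)%:E)%E.

Let integrable_exp_w sig t : 0 < sig -> (forall y, 0 <= w t y <= C) ->
 leb.-integrable D (EFin \o (fun y => expR (- (sig * y)) * w t y)).
Proof.
move=> s0 wC; apply: (@integrable_dominated _ _ _ leb _ _ _ (fun y => expR (- (sig * y))) C) => //.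
- by apply: measurable_funTS; apply: measurable_funM; [exact: measurable_expN|exact: w_meas].
- exact: integrable_expN.
move=> y _; have /andP[w0 wc] := wC y.
by rewrite ger0_norm ?mulr_ge0// mulrC ler_wpM2r.
Qed.

Let peak_integral_cvg k : exists l : R, (\int[leb]_(y in D) (peak k y * w t y)) @[t --> +oo] --> l.
Proof.
have [a [N aE]] := peak_sum k.
exists (\sum_(i < N) a i * L (i.+1%:R * ln 2)).
have s0 i : 0 < i.+1%:R * ln 2 :> R.
 by rewrite mulr_gt0//; have /andP[c1 c2] := ln2_bounds; lra.
have near_eq : \forall t \near +oo, \sum_(i < N) a i * \int[leb]_(y in D) (expR (- (i.+1%:R * ln 2 * y)) * w t y)
  = \int[leb]_(y in D) (peak k y * w t y).
 near=> t; have wC : forall y, 0 <= w t y <= C by near: t.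
 have ie i : leb.-integrable D (EFin \o (fun y => a i * (expR (- (i.+1%:R * ln 2 * y)) * w t y))).
  by apply: real_integrableZ => //; exact: integrable_exp_w.
 have mD : measurable (D : set (measurableTypeR R)) by exact: measurable_itv.
 have [_ e] := real_integrable_sum mD N ie.
 transitivity (\sum_(i < N) \int[leb]_(y in D) (a i * (expR (- (i.+1%:R * ln 2 * y)) * w t y))).
  by apply: eq_bigr => i _; rewrite RintegralZl//; exact: integrable_exp_w.
 rewrite -e; apply: eq_Rintegral => y _.
 by rewrite aE mulr_suml; apply: eq_bigr => i _; rewrite mulrA.
apply: (cvg_trans (near_eq_cvg near_eq)).
apply: cvg_big; first exact: add_continuous.
move=> i _; apply: cvgM; first exact: cvg_cst.
apply/cvgrPdist_le => r r0; near=> t.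
have wC : forall y, 0 <= w t y <= C by near: t.
have : ((L (i.+1%:R * ln 2) - r)%:E <= \int[leb]_(y in D) (expR (- (i.+1%:R * ln 2 * y)) * w t y)%:E <=
  (L (i.+1%:R * ln 2) + r)%:E)%E by near: t; exact: w_transform.
rewrite -[X in (_ <= X <= _)%E]fineK; last exact: integrable_fin_num (integrable_exp_w (s0 i) wC).
by rewrite !lee_fin -ler_distl distrC.
Unshelve. all: end_near. Qed.

(** With [a = 1 - 2 p], the inequality [|a| <= eta + a^2 / eta] replaces the distance to the peak by
    the variance that [peak_mass_ratio] makes small. *)
Let peak_approx k eta eps t : 0 < eta -> 0 < eps -> (forall y, 0 <= w t y <= C) ->
 (forall y, `|w t y - w t 1| <= C * `|y - 1| + eps) ->
 `|\int[leb]_(y in D) (peak k y * w t y) - w t 1 * peak_mass k| <=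
  (4 * C * eta + eps) * peak_mass k + 4 * C / eta * (peak_mass k - peak_mass k.+1).
Proof.
move=> n0 e0 wC wR.
have mw : mfunT (w t) := w_meas t.
have mpk := measurable_peak.
have ip := integrable_peak.
have i1 : leb.-integrable D (EFin \o (fun y => peak k y * w t y)).
 apply: (@integrable_dominated _ _ _ leb _ _ _ (peak k) C) => //.
  by apply: measurable_funTS; apply: measurable_funM => //; exact: mpk.
 move=> y /=; rewrite in_itv/= andbT => y0.
 have /andP[w0 wc] := wC y; have /andP[k0 k1] := peak_bounds k (ltW y0).
 by rewrite ger0_norm; [rewrite mulrC ler_wpM2r|exact: mulr_ge0].
have iZ j a : leb.-integrable D (EFin \o (fun y => a * peak j y)) by exact: real_integrableZ.
have iB : leb.-integrable D (EFin \o (fun y => peak k y - peak k.+1 y)) by exact: real_integrableB.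
have iZ2 : leb.-integrable D (EFin \o (fun y => 4 * C / eta * (peak k y - peak k.+1 y))).
 exact: real_integrableZ.
have i2 : leb.-integrable D (EFin \o (fun y => peak k y * w t y - w t 1 * peak k y)).
 exact: real_integrableB.
rewrite -RintegralZl// -RintegralB//.
rewrite (le_trans (le_normr_Rintegral _ i2))//.
rewrite /peak_mass -RintegralB// -!RintegralZl//.
rewrite -RintegralD//; apply: le_Rintegral => //.
- exact: real_integrable_norm.
- exact: real_integrableD.
move=> y /=; rewrite in_itv/= andbT => y0.
have /andP[k0 _] := peak_bounds k (ltW y0).
rewrite (_ : _ - _ = peak k y * (w t y - w t 1)); last by ring.
rewrite peakS [leRHS](_ : _ = peak k y * (4 * C * (eta + (1 - 2 * half_exp y) ^+ 2 / eta) + eps)); last first.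
 by field; rewrite gt_eqF.
rewrite normrM (ger0_norm k0) ler_wpM2l//.
set a := 1 - 2 * half_exp y.
have am : `|a| <= eta + a ^+ 2 / eta.
 have [an|an] := leP `|a| eta; first by rewrite (le_trans an)// lerDl divr_ge0 ?sqr_ge0 ?ltW.
 rewrite (@le_trans _ _ (a ^+ 2 / eta))//; last by rewrite lerDr ltW.
 by rewrite ler_pdivlMr// -real_normK ?num_real// expr2 ler_wpM2l// ltW.
have wd : `|w t y - w t 1| <= C.
 have /andP[w0 wc] := wC y; have /andP[w0' wc'] := wC 1.
 by rewrite ler_norml; apply/andP; split; lra.
have : `|w t y - w t 1| <= 4 * C * `|a| + eps.
 have [h|h] := half_exp_gap y.
  rewrite (le_trans wd)// (le_trans (_ : _ <= C * (4 * `|a|)))//; first by rewrite ler_peMr.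
  by rewrite mulrCA mulrA lerDl ltW.
 by rewrite (le_trans (wR y))// lerD2r -mulrA mulrCA ler_wpM2l.
move=> h; rewrite (le_trans h)// lerD2r ler_wpM2l// mulr_ge0//.
Qed.

(** For each [eps] one fixed [k] keeps [w t 1] close to the convergent quantity
    [\int peak k w / peak_mass k], so [w t 1] is Cauchy. The limit is not identified here. *)
Lemma peak_convergence : cvg (w t 1 @[t --> +oo]).
Proof.
apply: cauchy_cvg; apply: cauchy_exP => eps eps0.
have eps8 : 0 < eps / 8 by rewrite divr_gt0.
pose eta := eps / (32 * (C + 1)).
have C1 : 0 < C + 1 by rewrite ltr_wpDl.
have n0 : 0 < eta by rewrite divr_gt0// mulr_gt0.
(* Chosen after [eta], so that [4 C delta / eta <= eps / 8]. *)
pose delta := Num.min (1 / 2) (eta * eps / (32 * (C + 1))).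
have d01 : 0 < delta < 1.
 apply/andP; split; first by rewrite lt_min; apply/andP; split; [lra|apply: divr_gt0; [exact: mulr_gt0|exact: mulr_gt0]].
 by rewrite /delta gt_min; apply/orP; left; lra.
have [k [b0 bk]] := peak_mass_ratio d01.
have [l hl] := peak_integral_cvg k.
exists (l / peak_mass k).
have e8b : 0 < eps / 8 * peak_mass k by rewrite mulr_gt0.
have /cvgrPdist_le/(_ _ e8b) hl' := hl.
suff : \forall t \near +oo, ball (l / peak_mass k) eps (w t 1) by [].
near=> t.
have wC : forall y, 0 <= w t y <= C by near: t.
have wR : forall y, `|w t y - w t 1| <= C * `|y - 1| + eps / 8 by near: t; exact: w_regular.
have h1 : `|l - \int[leb]_(y in D) (peak k y * w t y)| <= eps / 8 * peak_mass k by near: t.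
have h2 := peak_approx k n0 eps8 wC wR.
have CC : C / (C + 1) <= 1 by rewrite ler_pdivrMr// mul1r lerDl.
have q0 : 0 <= 4 * C / eta by rewrite divr_ge0//; [exact: mulr_ge0|exact: ltW].
have h3 : 4 * C * eta <= eps / 8.
 have -> : 4 * C * eta = C / (C + 1) * (eps / 8) by rewrite /eta; field; rewrite gt_eqF.
 by rewrite ler_piMl// ltW.
have h4 : 4 * C / eta * (peak_mass k - peak_mass k.+1) <= eps / 8 * peak_mass k.
 rewrite (le_trans (ler_wpM2l q0 bk))//.
 rewrite mulrA ler_wpM2r ?(ltW b0)//.
 apply: (@le_trans _ _ (4 * C / eta * (eta * eps / (32 * (C + 1))))).
  by rewrite ler_wpM2l// /delta ge_min lexx orbT.
 rewrite (_ : _ * _ = C / (C + 1) * (eps / 8)); last by field; rewrite !gt_eqF.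
 by rewrite ler_piMl// ltW.
rewrite /ball/= -(ltr_pM2r b0) -{2}(gtr0_norm b0) -normrM mulrBl divfK ?gt_eqF//.
set I := \int[leb]_(y in D) _ in h1 h2 *.
rewrite (_ : l - _ = (l - I) + (I - w t 1 * peak_mass k)); last by ring.
rewrite (le_lt_trans (ler_normD _ _))//.
have h5 : (4 * C * eta + eps / 8) * peak_mass k <= (eps / 4) * peak_mass k.
 by rewrite ler_wpM2r//; lra.
have : eps / 8 * peak_mass k + (eps / 4 * peak_mass k + eps / 8 * peak_mass k) < eps * peak_mass k.
 by rewrite -!mulrDl ltr_pM2r//; lra.
by move: h1 h2 h4 h5; set q1 := `|_|; set q2 := `|_|; set q3 := _ * (_ - _); lra.
Unshelve. all: end_near. Qed.

End peak_kernel.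

(** * Comparison with the transform of a power *)

Section laplace_powR.
Context {R : realType}.
Local Notation leb := (@lebesgue_measure R).
Local Notation D := (`]0%R, +oo[%classic : set R).
Variable b : R.
Hypothesis b01 : 0 < b < 1.

Definition laplace_powR (sig : R) : \bar R :=
 (\int[leb]_(y in `]0%R, +oo[) (expR (- (sig * y)) * y `^ (b - 1))%:E)%E.

Let kernel (p : R * R) : R := expR (- p.1) * \1_halfline p.1 * (expR (- (p.1 * p.2)) * p.2 `^ (b - 1) * \1_halfline p.2).

Let mkernel : mfunT (EFin \o kernel).
Proof.
have mD := @measurable_halfline R.
have mE : mfunT (fun x : R => expR (- x)) by exact: measurableT_comp.
have m12 : mfunT (fun p : R * R => p.1 * p.2).
 by apply: measurable_funM; [exact: measurable_fst|exact: measurable_snd].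
apply/measurable_EFinP; apply: measurable_funM; apply: measurable_funM.
- exact: (measurableT_comp mE measurable_fst).
- exact: (measurableT_comp mD measurable_fst).
- apply: measurable_funM; first exact: (measurableT_comp mE m12).
 exact: (measurableT_comp (measurable_powR (b - 1)) measurable_snd).
- exact: (measurableT_comp mD measurable_snd).
Qed.

Let kernel_ge0 p : (0 <= (EFin \o kernel) p)%E.
Proof. by rewrite lee_fin /kernel !mulr_ge0 ?powR_ge0. Qed.

Let mpow : mfunT (fun y : R => y `^ (b - 1)). Proof. exact: measurable_powR. Qed.

Let inner_y x : (\int[leb]_y (kernel (x, y))%:E = (expR (- x) * \1_halfline x)%:E * laplace_powR x)%E.
Proof.
rewrite /laplace_powR integral_halfline -ge0_integralZl//.
- apply/measurable_EFinP; apply: measurable_funM; last exact: measurable_halfline.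
 by apply: measurable_funM; [exact: measurable_expN|exact: mpow].
- by move=> y _; rewrite lee_fin !mulr_ge0 ?powR_ge0.
Qed.

Let inner_x y : (\int[leb]_x (kernel (x, y))%:E = (beta_kernel b y * \1_halfline y)%:E)%E.
Proof.
transitivity (\int[leb]_x ((y `^ (b - 1) * \1_halfline y)%:E * (expR (- ((1 + y) * x)) * \1_halfline x)%:E))%E.
 apply: eq_integral => x _; rewrite -EFinM; congr EFin; rewrite /kernel/=.
 rewrite mulrDl mul1r opprD expRD [y * x]mulrC; ring.
have mexp : mfunT (fun x : R => (expR (- ((1 + y) * x)) * \1_halfline x)%:E).
 by apply/measurable_EFinP; apply: measurable_funM; [exact: measurable_expN|exact: measurable_halfline].
rewrite ge0_integralZl ?lee_fin ?mulr_ge0 ?powR_ge0//.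
rewrite -integral_halfline indicE /halfline mem_setE in_itv/= andbT.
case: ltP => y0; last by rewrite !mulr0 mul0e.
by rewrite integral_expN ?ltr_wpDr ?(ltW y0)// -EFinM /beta_kernel !mulr1.
Qed.

Lemma measurable_laplace_powR :
 mfunT (fun sig : R => ((expR (- sig) * \1_halfline sig)%:E * laplace_powR sig)%E).
Proof.
rewrite (_ : (fun sig => _) = (fun x => (\int[leb]_y (EFin \o kernel) (x, y))%E)).
 exact: (@measurable_fun_fubini_tonelli_F _ _ _ _ R leb _ mkernel kernel_ge0).
by apply/funext => x; rewrite -inner_y.
Qed.

(** By Tonelli, integrating [e^(- sig (1 + y))] over [sig] produces the beta kernel, without passing
    through the value of the inner transform. *)
Lemma integral_laplace_powR :
 (\int[leb]_sig ((expR (- sig) * \1_halfline sig)%:E * laplace_powR sig) = (pi / sin (b * pi))%:E)%E.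
Proof.
rewrite -(beta_integral_reflection b01) integral_halfline.
have := @fubini_tonelli _ _ _ _ _ leb leb _ mkernel kernel_ge0; rewrite /fubini_F /fubini_G => FT.
transitivity (\int[leb]_x \int[leb]_y (EFin \o kernel) (x, y))%E.
 by apply: eq_integral => x _; rewrite -inner_y.
by rewrite FT; apply: eq_integral => y _; rewrite -inner_x.
Qed.

Lemma laplace_powR_ge0 sig : (0 <= laplace_powR sig)%E.
Proof. by apply: integral_ge0 => y _; rewrite lee_fin mulr_ge0 ?powR_ge0. Qed.

Let mgam a : mfunT (fun sig : R => (expR (- sig) * (a * sig `^ (- b)) * \1_halfline sig)%:E).
Proof.
apply/measurable_EFinP; apply: measurable_funM; last exact: measurable_halfline.
apply: measurable_funM; first exact: measurableT_comp.
by apply: measurable_funM => //; exact: measurable_powR.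
Qed.

Let integral_gamma a : 0 <= a ->
 (\int[leb]_sig (expR (- sig) * (a * sig `^ (- b)) * \1_halfline sig)%:E = (a * gamma_const b)%:E)%E.
Proof.
move=> a0; have b01' : 0 <= b < 1 by case/andP: b01 => /ltW ->.
rewrite EFinM -gamma_constE// integral_halfline -ge0_integralZl//.
- by apply: eq_integral => x _; rewrite -EFinM; congr EFin; ring.
- apply/measurable_EFinP; apply: measurable_funM; last exact: measurable_halfline.
 exact: measurable_exp_powR.
- by move=> x _; rewrite lee_fin !mulr_ge0 ?powR_ge0.
Qed.

(* Both comparisons follow by integrating against [exp (- sig)], which turns
  [laplace_powR] into the beta integral. *)
Lemma laplace_powR_lower (c a : R) : 0 <= c -> 0 <= a ->
 (forall sig, (0 < sig)%R -> (c * sig `^ (- b))%:E <= a%:E * laplace_powR sig)%E ->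
 c * gamma_const b <= a * (pi / sin (b * pi)).
Proof.
move=> c0 a0 h; rewrite -lee_fin -integral_gamma// [leRHS]EFinM -integral_laplace_powR.
rewrite -ge0_integralZl//; last 2 first.
- exact: measurable_laplace_powR.
- by move=> x _; rewrite mule_ge0 ?laplace_powR_ge0// lee_fin mulr_ge0.
apply: ge0_le_integral => //.
- by move=> x _; rewrite lee_fin !mulr_ge0 ?powR_ge0.
- exact: mgam.
- by apply: measurable_funeM; exact: measurable_laplace_powR.
move=> x _; rewrite indicE /halfline mem_setE in_itv/= andbT; case: ltP => x0; last by rewrite !mulr0 mul0e mule0.
by rewrite !mulr1 muleCA EFinM lee_wpmul2l// h.
Qed.

Lemma laplace_powR_upper (c a : R) : 0 <= c -> 0 <= a ->
 (forall sig, (0 < sig)%R -> a%:E * laplace_powR sig <= (c * sig `^ (- b))%:E)%E ->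
 a * (pi / sin (b * pi)) <= c * gamma_const b.
Proof.
move=> c0 a0 h; rewrite -lee_fin -integral_gamma// [leLHS]EFinM -integral_laplace_powR.
rewrite -ge0_integralZl//; last 2 first.
- exact: measurable_laplace_powR.
- by move=> x _; rewrite mule_ge0 ?laplace_powR_ge0// lee_fin mulr_ge0.
apply: ge0_le_integral => //.
- by move=> x _; rewrite !mule_ge0 ?laplace_powR_ge0// lee_fin mulr_ge0 ?expR_ge0.
- by apply: measurable_funeM; exact: measurable_laplace_powR.
- exact: mgam.
move=> x _; rewrite indicE /halfline mem_setE in_itv/= andbT; case: ltP => x0; last by rewrite !mulr0 mul0e mule0.
by rewrite !mulr1 muleCA EFinM lee_wpmul2l// h.
Qed.

End laplace_powR.

(** * The two bounds for the liminf *)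

Section renewal_asymptotics.
Context d (Y : measurableType d) (R : realType) (mu : probability Y R).
Variables (F : Y -> Y) (tau : Y -> R) (ell : R -> R) (beta : R) (A B : set Y).
Hypothesis F_mp : measure_preserving mu F.
Hypothesis tau_meas : mfunT tau.
Hypothesis tau_pos : forall y, 0 < tau y.
Hypothesis tau_essinf : (1 < ess_inf mu (fun y => (tau y)%:E))%E.
Hypothesis ell_sv : slowly_varying ell.
Hypothesis beta01 : 0 < beta < 1.
Hypothesis tau_tail : forall t : R, 0 < t ->
 mu [set y | t < tau y] = (ell t * t `^ (- beta))%:E.
Hypothesis mA : measurable A.
Hypothesis mB : measurable B.
Local Notation leb := (@lebesgue_measure R).
Local Notation H := (tail_fun mu tau).
Local Notation marked := (marked_mean mu F tau A B).
Local Notation trig b n := (`|marked n (fun x => cos (b * x))| + `|marked n (fun x => sin (b * x))|).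
Local Notation m t := (t * H t).
Variables (C0 c0 th r0 : R).
Hypothesis C0_gt0 : 0 < C0.
Hypothesis c0_gt0 : 0 < c0.
Hypothesis th01 : 0 < th < 1.
Hypothesis r0_gt0 : 0 < r0.
Hypothesis fourier_near : forall b n, 0 < b <= r0 ->
 trig b n <=
  C0 * (expR (- c0 * (n%:R * H b^-1)) + th ^+ n).
Hypothesis fourier_far : forall d' L : R, 0 < d' -> d' <= L -> exists M q : R,
 [/\ 0 <= M, 0 < q < 1 & forall b n, d' <= b <= L ->
  trig b n <= M * q ^+ n].
Hypothesis laplace_near : forall e, 0 < e -> exists2 r, 0 < r & forall s n, 0 < s <= r ->
 `|laplace_mean mu F tau A B n s -
   fine (mu A) * fine (mu B) * (1 - laplace_defect mu tau s) ^+ n| <=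
  e * ((1 + n%:R * H s^-1) * expR (- c0 * (n%:R * H s^-1))) + C0 * th ^+ n.
Variable h : R.
Hypothesis h_gt0 : 0 < h.
Local Notation win n x := (marked n (window_indicator h x)).
Local Notation full := (full_window mu F tau A B h).
Local Notation g := (gamma_const beta).
Local Notation Lam := (renewal_laplace mu beta A B).
Local Notation c := (fine (mu A) * fine (mu B)).

Definition renewal_window x : R := \sum_(n < window_bound h x) win n x.

Let H0 t : 0 < H t. Proof. exact: (tail_gt0 tau_meas ell_sv tau_tail). Qed.

Let win_ge0 n x : 0 <= win n x. Proof. exact: marked_window_ge0. Qed.

Lemma renewal_window_ge0 x : 0 <= renewal_window x.
Proof. exact: sumr_ge0. Qed.

Lemma full_window1 t x : full 0 0 0 t x = m t * renewal_window x.
Proof.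
rewrite /full_window /weighted_window /weighted_mean mulr_sumr; apply: eq_bigr => n _.
by rewrite /renewal_weight /damped_weight expr0 mul0r oppr0 expR0 !mulr1.
Qed.

Let damped_mono k (z e y z' e' y' : R) : 0 <= z * y -> z * y <= z' * y' -> e' * y' <= e * y ->
 damped_weight k z e y <= damped_weight k z' e' y'.
Proof.
move=> zy0 zy ey; have zy0' := le_trans zy0 zy.
have e1 (x : R) : 0 <= x -> 0 <= 1 - expR (- x) by move=> x0; rewrite subr_ge0 expRN_le1.
rewrite /damped_weight ler_pM ?exprn_ge0 ?e1//; last by rewrite ler_expR lerN2.
by rewrite lerXn2r ?nnegrE ?e1// lerB// ler_expR lerN2.
Qed.

Lemma full_window_le k (z e t x : R) : 0 <= t -> 0 <= z -> 0 <= e -> full k z e t x <= m t * renewal_window x.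
Proof.
move=> t0 z0 e0; rewrite mulr_sumr; apply: ler_sum => n _.
rewrite ler_wpM2r// /renewal_weight ler_piMr ?mulr_ge0 ?(ltW (H0 _))//.
have nH : 0 <= n%:R * H t by rewrite mulr_ge0 ?(ltW (H0 _)).
by rewrite (le_trans (damped_weight_le_exp k e z0 nH))// expRN_le1 mulr_ge0.
Qed.

(** At position [t y] the weight belongs to the scale [t]. It is compared with a weight of scale
    [t y], for which convergence on the diagonal is available, by adjusting [z] and [e] to the ratio
    of the tails. *)
Let full_window_rescale k (z e z' e' t y : R) : 0 < t -> 0 < y -> 0 <= z ->
 z * H t <= z' * H (t * y) -> e' * H (t * y) <= e * H t ->
 full k z e t (t * y) <= m t / m (t * y) * full k z' e' (t * y) (t * y).
Proof.
move=> t0 y0 z0 hz he; rewrite mulr_sumr; apply: ler_sum => n _.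
rewrite mulrA ler_wpM2r// /renewal_weight.
rewrite [leRHS](_ : _ = m t * damped_weight k z' e' (n%:R * H (t * y))); last by field; rewrite !gt_eqF.
rewrite ler_wpM2l ?mulr_ge0 ?(ltW t0) ?(ltW (H0 _))//.
apply: damped_mono; first by rewrite !mulr_ge0 ?(ltW (H0 _)).
- by rewrite mulrCA [leRHS]mulrCA ler_wpM2l.
- by rewrite mulrCA [leRHS]mulrCA ler_wpM2l.
Qed.

Let mass_ratio (y : R) : 0 < y -> (m t / m (t * y)) @[t --> +oo] --> y `^ (beta - 1).
Proof.
move=> y0; have yn : y `^ (- beta) != 0 by rewrite gt_eqF// powR_gt0.
have r : (H (y * t) / H t)^-1 @[t --> +oo] --> (y `^ (- beta))^-1.
 by apply: cvgV => //; exact: (tail_ratio tau_meas ell_sv tau_tail y0).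
have -> : y `^ (beta - 1) = y^-1 * (y `^ (- beta))^-1.
 by rewrite -powRN opprK powRB ?(gt_eqF y0) ?implybT// powRr1 ?(ltW y0)// mulrC.
have prod : (y^-1 * (H (y * t) / H t)^-1) @[t --> +oo] --> y^-1 * (y `^ (- beta))^-1.
 by apply: cvgM => //; exact: cvg_cst.
have E : \forall t \near +oo, y^-1 * (H (y * t) / H t)^-1 = m t / m (t * y).
 near=> t; have t0 : 0 < t by [].
 rewrite [t * y]mulrC; field.
 by rewrite !gt_eqF.
exact: (cvg_trans (near_eq_cvg E)).
Unshelve. all: end_near. Qed.

Let mulr_cvgy (y : R) : 0 < y -> (t * y) @[t --> +oo] --> +oo.
Proof.
move=> y0; apply/cvgryPge => M; near=> t; have tM : M / y <= t by [].
by rewrite -ler_pdivrMr.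
Unshelve. all: end_near. Qed.

Section damped.
Variables (k : nat).
Hypothesis k_large : 4 <= k.+1%:R * (beta / 2).

Let regular (z e : R) : 0 < z -> 0 < e -> exists C t0, [/\ 0 < C, 1 <= t0,
 (forall t x, t0 <= t -> 0 <= full k z e t x <= C) &
 forall eps, 0 < eps -> exists t1, forall t x x', t1 <= t ->
  `|full k z e t x - full k z e t x'| <= C * `|x - x'| / t + eps].
Proof.
move=> z0 e0.
have [C [t0 [C1 t01 hb hr]]] := weighted_window_regular F_mp tau_meas ell_sv beta01 tau_tail
 mA mB C0_gt0 c0_gt0 th01 r0_gt0 fourier_near fourier_far z0 e0 k_large h_gt0.
exists C, t0; split => // [t x tt|eps eps0].
 rewrite hb// andbT; apply: (weighted_window_ge0 F_mp tau_meas ell_sv tau_tail mA mB) => //.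
  exact: ltW.
 by rewrite (le_trans _ tt)// (le_trans ler01).
have [t1 ht1] := hr _ eps0; exists t1 => t x x' tt.
have E x1 x2 : full k z e t x1 = weighted_window mu F tau A B k z e h (maxn (window_bound h x1) x2) t x1.
 by rewrite (weighted_window_full F_mp tau_meas tau_essinf mA mB)// leq_maxl.
by rewrite (E x (window_bound h x')) (E x' (window_bound h x)) maxnC ht1.
Qed.

Let transform (z e sig r : R) : 0 <= z -> 0 <= e -> 0 < sig -> 0 < r -> \forall t \near +oo,
 ((h * Lam k z e sig - r)%:E <=
  \int[leb]_(y in `]0%R, +oo[) (expR (- (sig * y)) * full k z e t (t * y))%:E <=
  (h * Lam k z e sig + r)%:E)%E.
Proof.
move=> z0 e0 s0; apply: (full_window_transform F_mp tau_meas tau_pos tau_essinf ell_sv beta01 tau_tail mA mB h_gt0 z0 e0 s0).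
exact: (laplace_limit_damped tau_meas tau_pos ell_sv beta01 tau_tail C0_gt0 c0_gt0 th01 laplace_near).
Qed.

Let mfull z e t s : mfunT (fun y : R => full k z e t (s * y)).
Proof. exact: (measurable_full_window F_mp tau_meas tau_essinf mA mB). Qed.

Lemma full_window_converges (z e : R) : 0 < z -> 0 < e -> cvg (full k z e t t @[t --> +oo]).
Proof.
move=> z0 e0; have [C [t0 [C1 t01 hb hr]]] := regular z0 e0.
rewrite (_ : (fun t => full k z e t t) = (fun t => full k z e t (t * 1))); last first.
 by apply/funext => t; rewrite mulr1.
apply: (@peak_convergence R (fun t y => full k z e t (t * y)) C (fun sig => h * Lam k z e sig)
 (ltW C1) (fun t => mfull z e t t)).
- near=> t => y; apply: hb; near: t; apply: nbhs_pinfty_ge; exact: num_real.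
- move=> eps eps0; have [t1 h1] := hr _ eps0; near=> t => y.
 have tt : t1 <= t by [].
 rewrite mulr1 (le_trans (h1 t _ _ tt))//.
 rewrite lerD2r -[X in _ * `|_ - X|]mulr1 -mulrBr normrM gtr0_norm// mulrCA mulrAC divff ?gt_eqF// mul1r//.
by move=> sig s0 r r1; apply: transform => //; exact: ltW.
Unshelve. all: end_near. Qed.

Variable a : R.
Hypothesis a_often : forall T, exists2 s, T <= s & m s * renewal_window s <= a.

(** [a] is an upper bound only along some sequence of [s]. Since the damped sums converge, it bounds
    their limit all the same; boundedness alone would not do. *)
Let window_lim_le (z e l : R) : 0 < z -> 0 < e -> full k z e t t @[t --> +oo] --> l -> l <= a.
Proof.
move=> z0 e0 fl; rewrite leNgt; apply/negP => al.
have /cvgrPdist_lt := fl; rewrite -subr_gt0 in al; move=> /(_ _ al) [M [_ hM]].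
have [s sM sa] := a_often (Num.max 1 (M + 1)).
have s1 : 1 <= s by rewrite (le_trans _ sM)// le_max lexx.
have Ms : M < s by rewrite (lt_le_trans _ sM)// lt_max ltrDl ltr01 orbT.
have fa : full k z e s s <= a.
 by rewrite (le_trans _ sa)// full_window_le ?(ltW z0) ?(ltW e0)// (le_trans ler01).
have := hM _ Ms; rewrite ltr_norml => /andP[_]; lra.
Qed.

Let a_ge0 : 0 <= a.
Proof.
have [s s0 sa] := a_often 0; rewrite (le_trans _ sa)//.
by rewrite mulr_ge0 ?renewal_window_ge0// mulr_ge0 ?(ltW (H0 _)).
Qed.

(** The factors 2 in [z'] and [e'] leave room for [H (t y) / H t] to differ from its limit
    [y^-beta]. *)
Let window_upper (z e y eps : R) : 0 < z -> 0 < e -> 0 < y -> 0 < eps ->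
 \forall t \near +oo, full k z e t (t * y) <= a * y `^ (beta - 1) + eps.
Proof.
move=> z0 e0 y0 eps0; have yb : 0 < y `^ (- beta) by exact: powR_gt0.
pose z' := 2 * z / y `^ (- beta); pose e' := e / (2 * y `^ (- beta)).
have z'0 : 0 < z' by rewrite divr_gt0// mulr_gt0.
have e'0 : 0 < e' by rewrite divr_gt0// mulr_gt0.
have /cvg_ex [l hl] := full_window_converges z'0 e'0.
have la := window_lim_le z'0 e'0 hl.
have prod : (m t / m (t * y) * full k z' e' (t * y) (t * y)) @[t --> +oo] --> y `^ (beta - 1) * l.
 by apply: cvgM; [exact: mass_ratio|exact: (cvg_comp _ _ (mulr_cvgy y0) hl)].
have lim_lt : y `^ (beta - 1) * l < a * y `^ (beta - 1) + eps.
 by rewrite (@le_lt_trans _ _ (a * y `^ (beta - 1))) ?ltrDl// mulrC ler_wpM2r ?powR_ge0.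
have h1 : \forall t \near +oo, m t / m (t * y) * full k z' e' (t * y) (t * y) <= a * y `^ (beta - 1) + eps.
 exact: (cvgr_le _ prod _ lim_lt).
have rat := tail_ratio tau_meas ell_sv tau_tail y0.
have up : y `^ (- beta) < 2 * y `^ (- beta) by lra.
have lo : y `^ (- beta) / 2 < y `^ (- beta) by lra.
have h2 : \forall t \near +oo, H (y * t) / H t <= 2 * y `^ (- beta) by exact: (cvgr_le _ rat _ up).
have h3 : \forall t \near +oo, y `^ (- beta) / 2 <= H (y * t) / H t by exact: (cvgr_ge _ rat _ lo).
near=> t; have t0 : 0 < t by [].
have q1 : H (y * t) / H t <= 2 * y `^ (- beta) by near: t.
have q2 : y `^ (- beta) / 2 <= H (y * t) / H t by near: t.
have q3 : m t / m (t * y) * full k z' e' (t * y) (t * y) <= a * y `^ (beta - 1) + eps by near: t.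
apply: le_trans q3; apply: full_window_rescale => //; first exact: ltW.
- move: q2; rewrite ler_pdivlMr// [y * t]mulrC => q2.
 have -> : z * H t = z' * (y `^ (- beta) / 2 * H t) by rewrite /z'; field; rewrite gt_eqF.
 by rewrite ler_wpM2l// ltW.
- move: q1; rewrite ler_pdivrMr// [y * t]mulrC => q1.
 have -> : e * H t = e' * (2 * y `^ (- beta) * H t) by rewrite /e'; field; rewrite gt_eqF.
 by rewrite ler_wpM2l// ltW.
Unshelve. all: end_near. Qed.

(** The pointwise bound [window_upper] passes to the transform through the positive part of
    [f n - G], which tends to 0 and is dominated by an exponential. *)
Let laplace_le (z e sig : R) : 0 < z -> 0 < e -> 0 < sig ->
 ((h * Lam k z e sig)%:E <= a%:E * laplace_powR beta sig)%E.
Proof.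
move=> z0 e0 s0; have [C [t0 [C1 t01 hb _]]] := regular z0 e0.
have C_ge0 := ltW C1.
pose T n : R := t0 + n%:R.
have Ty : T n @[n --> \oo] --> +oo.
 apply/cvgryPge => M; near=> n; rewrite (@le_trans _ _ n%:R)//; last by rewrite lerDr (le_trans ler01).
 by near: n; apply: nbhs_infty_ger; exact: num_real.
pose f n y := expR (- (sig * y)) * full k z e (T n) (T n * y).
pose G y := a * (expR (- (sig * y)) * y `^ (beta - 1)).
pose p n y := Num.max (f n y - G y) 0.
have tT n : t0 <= T n by rewrite lerDl.
have mE := measurable_expN sig.
have mf n : mfunT (f n) by apply: measurable_funM => //; exact: mfull.
have mP : mfunT (fun y : R => expR (- (sig * y)) * y `^ (beta - 1)).
 by apply: measurable_funM => //; exact: measurable_powR.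
have mG : mfunT G by exact: measurable_funM.
have mp n : mfunT (p n).
 by apply: measurable_maxr => //; exact: measurable_funB.
have G0 y : 0 <= G y by rewrite /G mulr_ge0// mulr_ge0 ?powR_ge0.
have fC n y : 0 <= f n y <= C * expR (- (sig * y)).
 have /andP[v0 vC] := hb (T n) (T n * y) (tT n).
 by rewrite /f mulr_ge0 ?expR_ge0//= mulrC ler_wpM2r ?expR_ge0.
have p0 n y : 0 <= p n y by rewrite le_max lexx orbT.
have pC n y : p n y <= C * expR (- (sig * y)).
 have /andP[v0 vC] := fC n y.
 by rewrite ge_max mulr_ge0 ?expR_ge0// andbT (le_trans _ vC)// gerBl.
have [| | |_ pcvg] := @dominated_cvg _ _ R leb (`]0, +oo[%classic : set R) p (cst 0) (fun y => C * expR (- (sig * y)))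
 (measurable_itv _) (fun n => measurable_funTS (mp n)).
- move=> y /=; rewrite in_itv/= andbT => y0; apply/cvgrPdist_le => eps eps0.
 have h1 := Ty _ (window_upper z0 e0 y0 eps0).
 near=> n; rewrite sub0r normrN ger0_norm// ge_max (ltW eps0) andbT lerBlDr.
 have hn : full k z e (T n) (T n * y) <= a * y `^ (beta - 1) + eps by near: n.
 rewrite /f (le_trans (ler_wpM2l (expR_ge0 _) hn))// mulrDr addrC /G mulrCA lerD2r.
 by rewrite ler_piMl ?(ltW eps0)// expRN_le1 mulr_ge0// ltW.
- by apply: real_integrableZ => //; exact: integrable_expN.
- by move=> n y _; rewrite ger0_norm.
rewrite integral0 in pcvg.
have GE : (a%:E * laplace_powR beta sig = \int[leb]_(y in `]0%R, +oo[) (G y)%:E)%E.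
 rewrite /laplace_powR -ge0_integralZl//.
 - exact: measurable_EFinS.
 - by move=> y _; rewrite lee_fin mulr_ge0 ?expR_ge0 ?powR_ge0.
rewrite GE; apply/lee_addgt0Pr => eps eps0.
have e2 : 0 < eps / 2 by rewrite divr_gt0.
have h1 := Ty _ (transform (ltW z0) (ltW e0) s0 e2).
have h2 : \forall n \near \oo, (\int[leb]_(y in `]0%R, +oo[) (p n y)%:E <= (eps / 2)%:E)%E.
 have /fine_cvgP[pf /cvgrPdist_le/(_ _ e2) pd] := pcvg.
 near=> n; have fn : (\int[leb]_(y in `]0%R, +oo[) (p n y)%:E)%E \is a fin_num by near: n.
 rewrite -(fineK fn) lee_fin (le_trans (ler_norm _))// -normrN -sub0r.
 by near: n.
near \oo => n.
have i1 : ((h * Lam k z e sig - eps / 2)%:E <=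
  \int[leb]_(y in `]0%R, +oo[) (f n y)%:E)%E.
 have /andP[] : ((h * Lam k z e sig - eps / 2)%:E <=
  \int[leb]_(y in `]0%R, +oo[) (f n y)%:E <= (h * Lam k z e sig + eps / 2)%:E)%E by near: n.
 by [].
have i2 : (\int[leb]_(y in `]0%R, +oo[) (p n y)%:E <= (eps / 2)%:E)%E by near: n.
have i3 : (\int[leb]_(y in `]0%R, +oo[) (f n y)%:E <=
  \int[leb]_(y in `]0%R, +oo[) (G y)%:E + \int[leb]_(y in `]0%R, +oo[) (p n y)%:E)%E.
 rewrite -ge0_integralD//.
 - apply: ge0_le_integral => //.
  + by move=> y _; rewrite lee_fin; case/andP: (fC n y).
  + by apply: measurable_EFinS; exact: mf.
  + by apply: measurable_EFinS; apply: measurable_funD => //; exact: mp.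
  + move=> y _; rewrite lee_fin addrC -lerBlDr /p le_max lexx//.
 - by move=> y _; rewrite lee_fin.
 - exact: measurable_EFinS.
 - by move=> y _; rewrite lee_fin.
 - by apply: measurable_EFinS; exact: mp.
rewrite (_ : h * _ = h * Lam k z e sig - eps / 2 + eps / 2); last by ring.
rewrite (_ : eps%:E = (eps / 2)%:E + (eps / 2)%:E)%E; last by rewrite -EFinD; congr EFin; lra.
by rewrite EFinD addeA leeD2r// (le_trans i1)// (le_trans i3)// leeD2l.
Unshelve. all: end_near. Qed.

Let g_gt0 : 0 < g. Proof. exact: (gamma_const_gt0 tau_meas tau_pos ell_sv beta01 tau_tail). Qed.

(** With [z = n + 1] and [e = 1 / (n + 1)] every term [j >= 1] of the binomial sum is [O(1 / n)],
    and the term [j = 0] tends to the undamped value. *)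
Let renewal_laplace_cvg (sig : R) : 0 < sig ->
 Lam k n.+1%:R n.+1%:R^-1 sig @[n --> \oo] --> c / (g * sig `^ beta).
Proof.
move=> s0; have gs : 0 < g * sig `^ beta by rewrite mulr_gt0// powR_gt0.
have inv0 : (n.+1%:R^-1 : R) @[n --> \oo] --> (0 : R) by exact: cvg_harmonic.
rewrite /renewal_laplace.
have E : c / (g * sig `^ beta) = \sum_(j < k.+1) (if j == 0%N :> nat then c / (g * sig `^ beta) else 0).
 by rewrite big_ord_recl/= big1 ?addr0.
rewrite E; apply: cvg_big; first exact: add_continuous.
case=> [[|j] jk] _ /=.
 under eq_fun do rewrite expr0 bin0 !mul1r mul0r add0r.
 apply: cvgM; first exact: cvg_cst.
 apply: cvgV; first by rewrite gt_eqF.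
 rewrite -[X in _ --> X]add0r; apply: cvgD => //; exact: cvg_cst.
rewrite -[X in _ --> X](mulr0 ((-1) ^+ j.+1 * 'C(k, j.+1)%:R)); apply: cvgM; first exact: cvg_cst.
apply/cvgr0Pnorm_le => eps eps0; have c_ge0 : 0 <= c by rewrite mulr_ge0 ?fine_ge0.
near=> n; have n0 : 0 < n.+1%:R :> R by rewrite ltr0n.
have den : n.+1%:R <= j.+1%:R * n.+1%:R + n.+1%:R^-1 + g * sig `^ beta.
 rewrite -addrA (@le_trans _ _ (j.+1%:R * n.+1%:R))//; first by rewrite ler_peMl// ler1n.
 by rewrite lerDl addr_ge0 ?(ltW n0)// ltW.
rewrite ger0_norm; last by rewrite divr_ge0// (le_trans (ltW n0)).
rewrite ler_pdivrMr ?(lt_le_trans n0)// (@le_trans _ _ (eps * n.+1%:R))//; last by rewrite ler_wpM2l// ltW.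
rewrite [leRHS]mulrC -ler_pdivrMr//.
by near: n; move/cvgryPge: (@natS_cvgy R) => /(_ (c / eps)).
Unshelve. all: end_near. Qed.

(** Letting the damping disappear in [laplace_le] bounds [(h c / g) sig^-beta] by [a] times the
    transform of [y^(beta - 1)]; after integration against [e^(- sig)] the constant [g] cancels. *)
Lemma renewal_liminf_lower : d_const beta * c * h <= a.
Proof.
have c_ge0 : 0 <= c by rewrite mulr_ge0 ?fine_ge0.
have hcg : 0 <= h * c / g by rewrite divr_ge0 ?(ltW g_gt0)// mulr_ge0// ltW.
have sp : 0 < sin (beta * pi) :> R.
 have /andP[b0 b1] := beta01; have p0 := pi_gt0 R.
 by rewrite sin_gt0_pi// mulr_gt0//= gtr_pMl.
have := @laplace_powR_lower R beta beta01 (h * c / g) a hcg a_ge0.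
rewrite divfK ?gt_eqF// => /(_ _) ub.
have p0 := pi_gt0 R.
rewrite /d_const (_ : _ * c * h = h * c * (sin (beta * pi) / pi)); last by ring.
rewrite -ler_pdivlMr ?divr_gt0// invf_div; apply: ub => sig s0.
have -> : h * c / g * sig `^ (- beta) = h * (c / (g * sig `^ beta)).
 by rewrite powRN; field; rewrite !gt_eqF// powR_gt0.
have hc : (h * Lam k n.+1%:R n.+1%:R^-1 sig)%:E @[n --> \oo] -->
  (h * (c / (g * sig `^ beta)))%:E.
 apply: cvg_EFin; first exact: nearW.
 by apply: cvgM; [exact: cvg_cst|exact: renewal_laplace_cvg].
rewrite -(cvg_lim _ hc)//; apply: lime_le; first by apply/cvg_ex; eexists; exact: hc.
by near=> n; apply: laplace_le; rewrite ?ltr0n.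
Unshelve. all: end_near. Qed.

End damped.

(** The undamped sums at position [t y] are asymptotically at least [a y^(beta - 1)], and Fatou's
    lemma compares the transforms. With [k = z = e = 0] the weight is constantly 1, because
    [0 ^+ 0 = 1]. *)
Lemma renewal_liminf_upper (a T0 : R) : 0 <= a ->
 (forall s, T0 <= s -> a <= m s * renewal_window s) -> a <= d_const beta * c * h.
Proof.
move=> a0 often.
have c_ge0 : 0 <= c by rewrite mulr_ge0 ?fine_ge0.
have g_gt0 : 0 < g by exact: (gamma_const_gt0 tau_meas tau_pos ell_sv beta01 tau_tail).
have hcg : 0 <= h * c / g by rewrite divr_ge0 ?(ltW g_gt0)// mulr_ge0// ltW.
have p0 := pi_gt0 R.
have sp : 0 < sin (beta * pi) :> R.
 have /andP[b0 b1] := beta01.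
 by rewrite sin_gt0_pi// mulr_gt0//= gtr_pMl.
have := @laplace_powR_upper R beta beta01 (h * c / g) a hcg a0.
rewrite divfK ?gt_eqF// => /(_ _) ub.
rewrite /d_const (_ : _ * c * h = h * c * (sin (beta * pi) / pi)); last by ring.
rewrite -ler_pdivrMr ?divr_gt0// invf_div; apply: ub => sig s0.
have -> : h * c / g * sig `^ (- beta) = h * Lam 0 0 0 sig.
 rewrite /renewal_laplace big_ord1 expr0 bin0 !mul1r mul0r !add0r powRN.
 by field; rewrite !gt_eqF// powR_gt0.
apply/lee_addgt0Pr => eps eps0.
have lap := full_window_transform F_mp tau_meas tau_pos tau_essinf ell_sv beta01 tau_tail mA mB h_gt0
 (lexx 0) (lexx 0) s0 (laplace_limit_damped tau_meas tau_pos ell_sv beta01 tau_tail C0_gt0 c0_gt0 th01 laplace_near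
 0 (lexx 0) (lexx 0) s0) eps0.
pose f n y := expR (- (sig * y)) * full 0 0 0 n%:R (n%:R * y).
have mf n : mfunT (f n).
 by apply: measurable_funM; [exact: measurable_expN|exact: (measurable_full_window F_mp tau_meas tau_essinf mA mB)].
have f0 n y : 0 <= f n y.
 rewrite /f full_window1 mulr_ge0//; apply: mulr_ge0 (renewal_window_ge0 _).
 by rewrite mulr_ge0 ?(ltW (H0 _)).
pose G y := a * (expR (- (sig * y)) * y `^ (beta - 1)).
have G0 y : 0 <= G y by rewrite /G mulr_ge0// mulr_ge0 ?expR_ge0 ?powR_ge0.
have mP : mfunT (fun y : R => expR (- (sig * y)) * y `^ (beta - 1)).
 by apply: measurable_funM; [exact: measurable_expN|exact: measurable_powR].
have mG : mfunT G by exact: measurable_funM.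
have ny : (n%:R : R) @[n --> \oo] --> +oo.
 by apply/cvgryPge => M; apply: nbhs_infty_ger; exact: num_real.
have lower y : 0 < y -> ((G y)%:E <= limn_einf (fun n => (f n y)%:E))%E.
 move=> y0; apply/lee_addgt0Pr => q q0; rewrite -leeBlDr// limn_einf_lim -EFinB.
 apply: lime_ge; first exact: is_cvg_einfs.
 have mr : (a * expR (- (sig * y)) * (m t / m (t * y))) @[t --> +oo] --> a * expR (- (sig * y)) * y `^ (beta - 1).
  by apply: cvgM; [exact: cvg_cst|exact: mass_ratio].
 have lt : G y - q < a * expR (- (sig * y)) * y `^ (beta - 1) by rewrite /G mulrA gtrBl.
 have h1 : \forall t \near +oo, G y - q <= a * expR (- (sig * y)) * (m t / m (t * y)) by exact: (cvgr_ge _ mr _ lt).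
 have h2 : \forall t \near +oo, G y - q <= expR (- (sig * y)) * full 0 0 0 t (t * y).
  near=> t; have t0 : 0 < t by [].
  have q1 : G y - q <= a * expR (- (sig * y)) * (m t / m (t * y)) by near: t.
  rewrite (le_trans q1)// full_window1 mulrAC mulrC ler_wpM2l ?expR_ge0//.
  have tT : T0 / y <= t by [].
  rewrite ler_pdivrMr// in tT.
  have mty : 0 < m (t * y) by rewrite !mulr_gt0.
  by rewrite mulrCA ler_wpM2l ?mulr_ge0 ?(ltW t0) ?(ltW (H0 _))// ler_pdivrMr// mulrC often.
 have [N _ hN] := ny _ h2.
 near=> n; apply: le_ereal_inf_tmp => _ [j /= nj <-]; rewrite lee_fin; apply: hN => /=.
 by rewrite (leq_trans _ nj)//; near: n; exact: nbhs_infty_ge.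
have mfE n : measurable_fun (`]0, +oo[%classic : set R) (fun y : R => (f n y)%:E).
 by apply: measurable_EFinS; exact: mf.
have fE0 n (y : R) : (`]0, +oo[%classic : set R) y -> (0 <= (f n y)%:E)%E by move=> _; rewrite lee_fin.
have fat := @fatou _ _ R leb (`]0, +oo[%classic : set R) (measurable_itv _) (fun n y => (f n y)%:E) mfE fE0.
have GE : (a%:E * laplace_powR beta sig = \int[leb]_(y in `]0%R, +oo[) (G y)%:E)%E.
 rewrite /laplace_powR -ge0_integralZl//.
 - exact: measurable_EFinS.
 - by move=> y _; rewrite lee_fin mulr_ge0 ?expR_ge0 ?powR_ge0.
rewrite GE -EFinD; apply: (@le_trans _ _ (\int[leb]_(y in `]0%R, +oo[) limn_einf (fun n => (f n y)%:E))%E).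
 apply: ge0_le_integral => //.
 - by move=> y _; rewrite lee_fin.
 - exact: measurable_EFinS.
 - apply: measurableT_comp => //; apply: measurable_fun_limn_esup => n.
  by apply: measurableT_comp => //; exact: mfE.
 - by move=> y /=; rewrite in_itv/= andbT => y0; exact: lower.
apply: le_trans fat _; rewrite limn_einf_lim; apply: lime_le; first exact: is_cvg_einfs.
near=> n; apply: ge_ereal_inf => /=; exists (\int[leb]_(y in `]0%R, +oo[) (f n y)%:E)%E; first by exists n => //=.
have /andP[//] : ((h * Lam 0 0 0 sig - eps)%:E <=
  \int[leb]_(y in `]0%R, +oo[) (f n y)%:E <= (h * Lam 0 0 0 sig + eps)%:E)%E.
near: n; exact: (ny _ lap).
Unshelve. all: end_near. Qed.

End renewal_asymptotics.

(** * The renewal function as a finite sum *)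

Section renewal_function.
Context d (Y : measurableType d) (R : realType) (mu : probability Y R).
Variables (F : Y -> Y) (tau : Y -> R) (A B : set Y).
Hypothesis F_mp : measure_preserving mu F.
Hypothesis tau_meas : mfunT tau.
Hypothesis tau_essinf : (1 < ess_inf mu (fun y => (tau y)%:E))%E.
Hypothesis mA : measurable A.
Hypothesis mB : measurable B.
Local Notation marked := (marked_mean mu F tau A B).
Local Notation S := (birkhoff_sum F tau).

Let bounded_indic (i : interval R) : bounded_meas (\1_([set` i])).
Proof.
split; first by apply: measurable_indic; exact: measurable_itv.
by exists 1 => x; rewrite indicE; case: (_ \in _); rewrite ?normr1 ?normr0.
Qed.

Lemma renewal_termE n (i : interval R) :
 mu (A `&` iter n F @^-1` B `&` [set y | S n y \in i]) = (marked n (\1_([set` i])))%:E.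
Proof.
have mE : measurable (A `&` iter n F @^-1` B `&` [set y | S n y \in i]).
 apply: measurableI; first exact: (measurable_visit F_mp mA mB).
 have := measurable_birkhoff F_mp tau_meas n measurableT (measurable_itv i).
 by rewrite setTI.
rewrite /marked_mean /Rintegral.
transitivity (\int[mu]_y (\1_(A `&` iter n F @^-1` B `&` [set y | S n y \in i]) y)%:E)%E.
 by rewrite integral_indic// setIT.
rewrite fineK; last first.
 exact: integrable_fin_num (rintegrable_marked F_mp tau_meas mA mB n (bounded_indic i)).
by apply: eq_integral => y _; rewrite indicI/= /visit; congr (_ * _)%:E.
Qed.

(** [tau_n >= n] almost everywhere makes the series finite, so that the increment of the renewal
    function is a genuine difference of reals. *)
Lemma renewal_functionE x N : (x < N%:R) ->
 renewal_function mu F tau A B x = (\sum_(n < N) marked n (\1_(`[0, x]%classic)))%:E.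
Proof.
move=> xN; have zero n : (N <= n)%N -> marked n (\1_(`[0, x]%classic)) = 0.
 move=> Nn; have <- : marked n (fun=> 0) = 0.
  by rewrite /marked_mean; under eq_Rintegral do rewrite mulr0; rewrite Rintegral_cst// mul0r.
 apply: (marked_mean_eq_ge F_mp tau_meas tau_essinf mA mB) => //.
  by split => //; exists 0 => u; rewrite normr0.
 move=> u nu; rewrite indicE mem_setE in_itv/= [u <= x]leNgt (lt_le_trans xN) ?andbF//.
 by rewrite (le_trans _ nu)// ler_nat.
rewrite /renewal_function /renewal_measure; apply: lim_near_cst => //.
near=> m; have Nm : (N <= m)%N by near: m; exact: nbhs_infty_ge.
rewrite (eq_bigr (fun n => (marked n (\1_(`[0, x]%classic)))%:E)); last by move=> n _; exact: renewal_termE.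
have tail0 : \sum_(N <= n < m) marked n (\1_(`[0, x]%classic)) = 0.
 by rewrite big_nat_cond big1// => n /andP[/andP[Nn _] _]; exact: zero.
by rewrite sumEFin; congr EFin; rewrite (big_cat_nat (n := N))//= tail0 addr0 big_mkord.
Unshelve. all: end_near. Qed.

Lemma renewal_function_window t h : 0 < t -> 0 < h ->
 (renewal_function mu F tau A B (t + h) - renewal_function mu F tau A B t =
  (renewal_window mu F tau A B h t)%:E)%E.
Proof.
move=> t0 h0; have tN : t + h < (window_bound h t)%:R by exact: truncnS_gt.
have tN' : t < (window_bound h t)%:R by rewrite (le_lt_trans _ tN)// lerDl ltW.
rewrite (renewal_functionE tN) (renewal_functionE tN') -EFinB; congr EFin.
rewrite /renewal_window -sumrB; apply: eq_bigr => n _.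
apply/eqP; rewrite subr_eq; apply/eqP.
rewrite -(marked_meanD F_mp tau_meas mA mB)//; last exact: bounded_indic.
congr marked_mean; apply/funext => u; rewrite /window_indicator !indicE !mem_setE !in_itv/= -natrD.
congr (_%:R); have [ut|ut] := leP u t.
 have -> : u <= t + h by rewrite (le_trans ut)// lerDl ltW.
 by rewrite !andbT.
by rewrite andbF addn0 (ltW (lt_trans t0 ut)).
Qed.

End renewal_function.

(** This puts the liminf in the form of the two comparisons established above: with a constant
    undershot at arbitrarily large times, and with an eventual lower bound. *)
Lemma limf_einf_pinfty_eq (R : realType) (f : R -> \bar R) (v : R -> R) (L : R) :
 (\forall t \near +oo, f t = (v t)%:E) ->
 (forall a, (forall T, exists2 s, T <= s & v s <= a) -> L <= a) ->
 (forall a T, (forall s, T <= s -> a <= v s) -> a <= L) ->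
 limf_einf f (pinfty_nbhs R) = L%:E.
Proof.
move=> [T0 [_ fv]] lower upper; rewrite limf_einfE; apply/eqP; rewrite eq_le; apply/andP; split.
 apply: ge_ereal_sup => _ [V [M [_ MV]] <-]; rewrite leNgt; apply/negP => Lx.
 have [a La ax] : exists2 a, L < a & (a%:E <= ereal_inf (f @` V))%E.
  case: (ereal_inf _) Lx => [x| |]//=; rewrite ?lte_fin => Lx; first by exists x.
  by exists (L + 1); rewrite ?ltrDl ?leey.
 have := upper a (Num.max M T0 + 1) => /(_ _)/wrap[].
  move=> s sM; have [Ms Ts] : M < s /\ T0 < s.
   by split; rewrite (lt_le_trans _ sM)// (@le_lt_trans _ _ (Num.max M T0)) ?ltrDl// le_max lexx ?orbT.
  rewrite -lee_fin -fv// (le_trans ax)//; apply: ereal_inf_lbound; exists s => //; exact: MV.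
 by rewrite leNgt La.
apply/lee_subgt0Pr => e e0; rewrite -EFinB.
have [T hT] : exists T, forall s, T <= s -> L - e < v s.
 apply: contrapT => /forallNP nT.
 have : L <= L - e.
  apply: lower => T; have /existsNP [s /not_implyP [Ts /negP]] := nT T.
  by rewrite -leNgt => vs; exists s.
 by move: e0; lra.
apply: (@le_trans _ _ (ereal_inf (f @` [set s | Num.max T T0 < s]))).
 apply: le_ereal_inf_tmp => _ [s /= sM <-].
 by move: sM; rewrite gt_max => /andP[sT sT0]; rewrite fv// lee_fin ltW// hT// ltW.
apply: ereal_sup_ubound; exists [set s | Num.max T T0 < s] => //.
by exists (Num.max T T0); split => //; exact: num_real.
Qed.

Theorem theorem2p4 (R : realType) (d : measure_display) (Y : measurableType d)
    (mu : probability Y R) (F : Y -> Y) (tau : Y -> R) (ell : R -> R) (beta : R)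
    (P : (Y -> R[i]) -> (Y -> R[i]))
    (p0 : R) (BB : R -> R -> R -> banach_fun_space mu) (A B : set Y) (h : R)
    (F_mp : measure_preserving mu F)
    (F_ergodic : ergodic mu F)
    (F_mixing : mixing mu F)
    (tau_meas : measurable_fun setT tau)
    (tau_pos : forall y, 0 < tau y)
    (tau_nonint : ~ mu.-integrable setT (fun y => (tau y)%:E))
    (tau_essinf : (1 < ess_inf mu (fun y => (tau y)%:E))%E)
    (ell_sv : slowly_varying ell)
    (beta01 : 0 < beta < 1)
    (tail : forall t : R, 0 < t ->
      mu [set y | t < tau y] = (ell t * t `^ (- beta))%:E)
    (P_transfer : transfer_operator mu F P)
    (p0_ge1 : 1 <= p0)
    (H : forall p gamma L : R, p0 < p -> 0 < gamma < beta -> 0 < L ->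
      hypothesis_H P tau p gamma L (BB p gamma L))
    (Sii : forall p gamma L : R, p0 < p -> 0 < gamma < beta -> 0 < L ->
      hypothesis_Sii P tau L (BB p gamma L))
    (mA : measurable A) (mB : measurable B)
    (A_in_BB : forall p gamma L : R, p0 < p -> 0 < gamma < beta -> 0 < L ->
      in_space (BB p gamma L) (fun y => (\1_A y : R)%:C%C))
    (h_gt0 : 0 < h) :
  limf_einf
    (fun t : R => (m_fun ell beta t)%:E *
      (renewal_function mu F tau A B (t + h) - renewal_function mu F tau A B t))%E
    (pinfty_nbhs R)
  = ((d_const beta)%:E * mu A * mu B * h%:E)%E.
Proof.
have /andP[beta0 beta1] := beta01.
(* [3 beta / 4] is the exponent furnished by [tail_gamma]. *)
have gamma_beta : 0 < 3 * beta / 4 < beta by apply/andP; split; lra.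
have [C1 [b1 [C1_ge1 b1_gt0 mass]]] := laplace_kernel_bound tau_meas tau_pos ell_sv beta01 tail.
have [C2 [b2 [C2_ge1 b2_gt0 gam]]] := tail_gamma tau_meas ell_sv beta01 tail.
have [c3 [b3 [c3_gt0 b3_gt0 cosl]]] := cos_defect_lower tau_meas ell_sv beta01 tail.
have expl := exp_defect_lower mu tau_meas tau_pos.
have c4_gt0 : 0 < 1 - expR (- 1) :> R by rewrite subr_gt0 -[ltRHS]expR0 ltr_expR ltrN10.
pose Hf b := tail_fun mu tau b^-1.
have Hf_gt0 b : 0 < Hf b by exact: (tail_gt0 tau_meas ell_sv tail).
pose b0 := Num.min b1 (Num.min b2 b3); pose C0 := Num.max C1 C2; pose c0 := Num.min c3 (1 - expR (- 1)).
have b0_gt0 : 0 < b0 by rewrite /b0 !lt_min b1_gt0 b2_gt0 b3_gt0.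
have c0_gt0 : 0 < c0 by rewrite /c0 lt_min c3_gt0.
have C0_ge1 : 1 <= C0 by rewrite /C0 le_max C1_ge1.
have le_b0 b : 0 < b <= b0 -> [/\ 0 < b <= b1, 0 < b <= b2 & 0 < b <= b3].
 by rewrite /b0 !le_min => /and4P[-> -> -> ->].
have h01 b : 0 < b <= b0 -> 0 < Hf b <= 1 by move=> _; rewrite Hf_gt0 tail_le1.
have h_mass b : 0 < b <= b0 -> \int[mu]_y Num.min 2 (3 * b * tau y) <= C0 * Hf b.
 by move=> /le_b0[hb _ _]; rewrite (le_trans (mass _ hb))// ler_wpM2r ?(ltW (Hf_gt0 _))// /C0 le_max lexx.
have h_gamma b : 0 < b <= b0 -> b `^ (3 * beta / 4) <= C0 * Hf b `^ 2^-1.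
 by move=> /le_b0[_ hb _]; rewrite (le_trans (gam _ hb))// ler_wpM2r ?powR_ge0// /C0 le_max lexx orbT.
have h_cos b : 0 < b <= b0 -> c0 * Hf b <= \int[mu]_y (1 - cos (b * tau y)).
 by move=> /le_b0[_ _ hb]; rewrite (le_trans _ (cosl _ hb))// ler_wpM2r ?(ltW (Hf_gt0 _))// /c0 ge_min lexx.
have h_exp b : 0 < b <= b0 -> c0 * Hf b <= \int[mu]_y (1 - expR (- (b * tau y))).
 by move=> /andP[hb _]; rewrite (le_trans _ (expl _ hb))// ler_wpM2r ?(ltW (Hf_gt0 _))// /c0 ge_min lexx orbT.
have [C [c [th [C_gt0 c_gt0 th01 [r r_gt0 near0] lap]]]] :=
 fourier_laplace_small F_mp F_mixing tau_meas tau_pos P_transfer p0_ge1 beta1 gamma_beta H mA mB A_in_BB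
  b0_gt0 c0_gt0 C0_ge1 h01 (tail_small tau_meas ell_sv beta01 tail) h_mass h_gamma h_cos h_exp.
have far := fourier_decay F_mp tau_meas tau_pos P_transfer p0_ge1 gamma_beta H Sii mA mB A_in_BB.
(* [k + 1 > 8 / beta] is the order of vanishing that yields Fourier decay of order 4. *)
pose k := Num.truncn (8 / beta).
have k_large : 4 <= k.+1%:R * (beta / 2).
 have := ltW (truncnS_gt (8 / beta)); rewrite ler_pdivrMr// -/k => hk.
 by rewrite mulrA ler_pdivlMr//; lra.
rewrite -[mu A]fineK ?fin_num_measure// -[mu B]fineK ?fin_num_measure// -!EFinM.
pose v t := t * tail_fun mu tau t * renewal_window mu F tau A B h t.
have L0 : 0 <= d_const beta * fine (mu A) * fine (mu B) * h.
 have p_gt0 := pi_gt0 R.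
 have dc0 : 0 <= d_const beta.
  rewrite /d_const divr_ge0 ?(ltW p_gt0)// sin_ge0_pi// mulr_ge0 ?(ltW beta0) ?(ltW p_gt0)//=.
  by rewrite ger_pMl// ltW.
 exact: mulr_ge0 (mulr_ge0 (mulr_ge0 dc0 (fine_ge0 _)) (fine_ge0 _)) (ltW h_gt0).
apply: (@limf_einf_pinfty_eq R _ v).
- near=> t; have t0 : 0 < t by [].
 rewrite (renewal_function_window F_mp tau_meas tau_essinf mA mB t0 h_gt0) -EFinM.
 by rewrite (m_funE tail t0).
- move=> a often; rewrite -[_ * _ * fine (mu B)]mulrA.
 exact: (renewal_liminf_lower F_mp tau_meas tau_pos tau_essinf ell_sv beta01 tail mA mB
  C_gt0 c_gt0 th01 r_gt0 near0 far lap h_gt0 k_large often).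
(* A negative [a] lies below the nonnegative limit; the Laplace comparison is applied to
   [0 <= a]. *)
move=> a T above; have [a0|a0] := leP 0 a; last exact: le_trans (ltW a0) L0.
rewrite -[_ * _ * fine (mu B)]mulrA.
exact: (renewal_liminf_upper F_mp tau_meas tau_pos tau_essinf ell_sv beta01 tail mA mB
  C_gt0 c_gt0 th01 lap h_gt0 a0 above).
Unshelve. all: end_near. Qed.
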